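(* Let $A(x)=(a_{ij}(x))_{ij}$ be a uniformly positive definite matrix-valued function on $\Omega$ with entries $a_{ij}\in C^1(\overline\Omega)$. For every $\varepsilon>0$ there exists a matrix-valued function $B=(b_{ij})_{ij}$ with entries in $C^1(\overline\Omega)$ and $\|B\|_{C^1}<\varepsilon$ such that all the eigenvalues $\lambda$ of the problem $$\partial_i\big((a_{ij}+b_{ij})\partial_j u\big)=0\ \text{ in }\Omega,\qquad \partial_\nu u+u=\lambda\, d\, u\ \text{ on }\partial\Omega$$ (summation over repeated indices, $\partial_\nu$ being the conormal derivative associated with $A+B$) are simple.
   Context: $\Omega\subset\mathbb{R}^n$ is an open bounded domain whose boundary $\partial\Omega$ is of class $C^{1,1}$ and is composed of two connected parts, $\partial\Omega=S\cup W$, with nonempty (relative) interiors $S^{\mathrm{o}}$, $W^{\mathrm{o}}$ satisfying $S^{\mathrm{o}}\cap W^{\mathrm{o}}=\emptyset$. The function $d=\mathbbm{1}_S$ on $\partial\Omega$ equals $1$ on $S$ and $0$ on $W$. Coefficient matrices ($A$ and $B$) are symmetric. Eigenvalues are understood weakly: $\lambda$ is an eigenvalue with eigenfunction $0\neq e\in H^1(\Omega)$ if $\int_\Omega\sum_{i,j}(a_{ij}+b_{ij})\,\partial_i e\,\partial_j\varphi\,dx+\int_{\partial\Omega}e\varphi\,d\sigma=\lambda\int_{\partial\Omega}d\,e\varphi\,d\sigma$ for all $\varphi\in H^1(\Omega)$. An eigenvalue is simple if its eigenspace is one-dimensional. *)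

(* Defs.v *)
From HB Require Import structures.
From mathcomp Require Import all_boot all_order all_algebra.
From mathcomp Require Import all_classical all_reals all_analysis.

Set Implicit Arguments.
Unset Strict Implicit.
Unset Printing Implicit Defensive.
Import Order.TTheory GRing.Theory Num.Theory.
Import numFieldNormedType.Exports.

Local Open Scope classical_set_scope.
Local Open Scope ring_scope.

(* Points of R^d are row vectors; domains live in R^(n+1), which loses nothing
   since no set in R^0 has a nonempty boundary. The library norm on 'rV[R]_d is
   the sup norm: it only serves for topology and boundedness, and the Euclidean
   norm [enorm] is used elsewhere. *)

Definition enorm (R : realType) (d : nat) (x : 'rV[R]_d) : R :=
  Num.sqrt (\sum_(i < d) x 0 i ^+ 2).

(* A copy of T in which every set is measurable, so that [mu_ext] (infimum over
   countable covers by measurable sets) ranges over arbitrary covers. *)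
Definition any_set_type (T : Type) : Type := T.
HB.instance Definition _ (T : pointedType) := Pointed.on (any_set_type T).
HB.instance Definition _ (T : pointedType) :=
  @isMeasurable.Build default_measure_display (any_set_type T) setT
    I (fun _ _ => I) (fun _ _ => I).

(* Volume of the smallest closed box containing A; +oo if A is unbounded. *)
Definition box_gauge (R : realType) (n : nat) (A : set 'rV[R]_n.+1) : \bar R :=
  ereal_inf [set (\prod_(i < n.+1) (z.2 0 i - z.1 0 i))%:E
            | z in [set z : 'rV[R]_n.+1 * 'rV[R]_n.+1 |
                (forall i, z.1 0 i <= z.2 0 i) /\
                A `<=` [set x | forall i, z.1 0 i <= x 0 i <= z.2 0 i]]].

Lemma box_gauge_ge0 (R : realType) (n : nat) (A : set 'rV[R]_n.+1) :
  (0 <= box_gauge A)%E.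
Proof.
apply: le_ereal_inf_tmp => _ [z [zle _] <-]; rewrite lee_fin.
by apply: prodr_ge0 => i _; rewrite subr_ge0.
Qed.

Lemma box_gauge0 (R : realType) (n : nat) : box_gauge (@set0 'rV[R]_n.+1) = 0%E.
Proof.
apply/eqP; rewrite eq_le box_gauge_ge0 andbT; apply: ereal_inf_lbound.
exists (0, 0) => /=; first by split=> [i|]; [exact: lexx | exact: sub0set].
by rewrite big_ord_recl mxE subrr mul0r.
Qed.

Definition lebesgue_outer (R : realType) (n : nat) :
    {outer_measure set 'rV[R]_n.+1 -> \bar R} :=
  let T := any_set_type 'rV[R]_n.+1 in
  HB.pack_for {outer_measure set 'rV[R]_n.+1 -> \bar R}
    (@mu_ext _ T R (@box_gauge R n))
    (isOuterMeasure.Build R 'rV[R]_n.+1 (@mu_ext _ T R (@box_gauge R n))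
      (@mu_ext0 _ T R _ (@box_gauge0 R n) (@box_gauge_ge0 R n))
      (@mu_ext_ge0 _ T R _ (@box_gauge_ge0 R n))
      (@le_mu_ext _ T R (@box_gauge R n))
      (@mu_ext_sigma_subadditive _ T R _ (@box_gauge_ge0 R n))).

(* The sets measurable in the sense of Caratheodory for the outer measure are
   the Lebesgue-measurable sets (a complete sigma-algebra). *)
Notation lebesgue_space R n := (caratheodory_type (@lebesgue_outer R n)).

Definition lebesgue (R : realType) (n : nat) :
    {measure set (lebesgue_space R n) -> \bar R} :=
  [the {measure set (lebesgue_space R n) -> \bar R} of
     (@lebesgue_outer R n : set (lebesgue_space R n) -> \bar R)].

(* Volume of the Euclidean unit ball of R^s, by omega_s = 2 pi / s omega_(s-2).
   With this normalization the Hausdorff measure is the usual surface area. *)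
Fixpoint unit_ball_volume (R : realType) (s : nat) : R :=
  match s with
  | 0 => 1
  | 1 => 2
  | k.+2 => 2 * pi / k.+2%:R * unit_ball_volume R k
  end.

Definition diam (R : realType) (d : nat) (C : set 'rV[R]_d) : \bar R :=
  ereal_sup [set (enorm (z.1 - z.2))%:E | z in C `*` C].

Definition hausdorff_gauge (R : realType) (d s : nat) (delta : R)
    (C : set 'rV[R]_d) : \bar R :=
  if C == set0 then 0%E
  else if (diam C <= delta%:E)%E
       then (unit_ball_volume R s * (fine (diam C) / 2) ^+ s)%:E
       else +oo%E.

Definition hausdorff_content (R : realType) (d s : nat) (delta : R)
    (A : set 'rV[R]_d) : \bar R :=
  @mu_ext _ (any_set_type 'rV[R]_d) R (@hausdorff_gauge R d s delta) A.

Definition hausdorff_pre (R : realType) (d s : nat) (A : set 'rV[R]_d) : \bar R :=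
  ereal_sup [set @hausdorff_content R d s delta A | delta in [set delta : R | 0 < delta]].

Lemma unit_ball_volume_ge0 (R : realType) (s : nat) : 0 <= unit_ball_volume R s.
Proof.
suff: 0 <= unit_ball_volume R s /\ 0 <= unit_ball_volume R s.+1 by case.
elim: s => [|s [h0 h1]]; first by split; rewrite /= ?ler01 ?ler0n.
split=> //; rewrite [unit_ball_volume _ _.+2]/=.
by rewrite !mulr_ge0 ?invr_ge0 ?ler0n ?pi_ge0.
Qed.

Lemma diam_ge0 (R : realType) (d : nat) (C : set 'rV[R]_d) :
  C !=set0 -> (0 <= diam C)%E.
Proof.
move=> [x Cx]; apply: (@le_trans _ _ (enorm (x - x))%:E).
  by rewrite lee_fin sqrtr_ge0.
by apply: ereal_sup_ubound; exists (x, x).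
Qed.

Lemma hausdorff_gauge_ge0 (R : realType) (d s : nat) (delta : R)
    (C : set 'rV[R]_d) : (0 <= hausdorff_gauge s delta C)%E.
Proof.
rewrite /hausdorff_gauge; case: ifPn => // /set0P C0; case: ifPn => // _.
rewrite lee_fin mulr_ge0 ?unit_ball_volume_ge0// exprn_ge0// divr_ge0//.
exact/fine_ge0/diam_ge0.
Qed.

Lemma hausdorff_gauge0 (R : realType) (d s : nat) (delta : R) :
  hausdorff_gauge s delta (@set0 'rV[R]_d) = 0%E.
Proof. by rewrite /hausdorff_gauge eqxx. Qed.

Lemma hausdorff_content_le (R : realType) (d s : nat) (delta : R)
    (A : set 'rV[R]_d) :
  0 < delta -> (hausdorff_content s delta A <= hausdorff_pre s A)%E.
Proof. by move=> d0; apply: ereal_sup_ubound; exists delta. Qed.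

Lemma hausdorff_pre_ge0 (R : realType) (d s : nat) (A : set 'rV[R]_d) :
  (0 <= hausdorff_pre s A)%E.
Proof.
apply: le_trans (@hausdorff_content_le R d s 1 A ltr01).
exact: (@mu_ext_ge0 _ (any_set_type 'rV[R]_d) R _ (@hausdorff_gauge_ge0 R d s 1)).
Qed.

Lemma hausdorff_pre0 (R : realType) (d s : nat) :
  hausdorff_pre s (@set0 'rV[R]_d) = 0%E.
Proof.
apply/eqP; rewrite eq_le hausdorff_pre_ge0 andbT.
apply: ge_ereal_sup => _ [delta _ <-].
by rewrite /hausdorff_content (@mu_ext0 _ (any_set_type 'rV[R]_d) R _
  (@hausdorff_gauge0 R d s delta) (@hausdorff_gauge_ge0 R d s delta)).
Qed.

Lemma le_hausdorff_pre (R : realType) (d s : nat) :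
  {homo @hausdorff_pre R d s : A B / A `<=` B >-> (A <= B)%E}.
Proof.
move=> A B AB; apply: ge_ereal_sup => _ [delta d0 <-].
apply: le_trans (@hausdorff_content_le R d s delta B d0).
exact: (@le_mu_ext _ (any_set_type 'rV[R]_d) R).
Qed.

Lemma hausdorff_pre_sigma_subadditive (R : realType) (d s : nat) :
  sigma_subadditive (@hausdorff_pre R d s).
Proof.
move=> F; apply: ge_ereal_sup => _ [delta d0 <-].
apply: le_trans (@mu_ext_sigma_subadditive _ (any_set_type 'rV[R]_d) R _
  (@hausdorff_gauge_ge0 R d s delta) F) _.
apply: lee_nneseries => i *; last exact: hausdorff_content_le.
exact: (@mu_ext_ge0 _ (any_set_type 'rV[R]_d) R _ (@hausdorff_gauge_ge0 R d s delta)).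
Qed.

Definition hausdorff_outer (R : realType) (d s : nat) :
    {outer_measure set 'rV[R]_d -> \bar R} :=
  HB.pack_for {outer_measure set 'rV[R]_d -> \bar R} (@hausdorff_pre R d s)
    (isOuterMeasure.Build R 'rV[R]_d (@hausdorff_pre R d s)
      (@hausdorff_pre0 R d s) (@hausdorff_pre_ge0 R d s)
      (@le_hausdorff_pre R d s) (@hausdorff_pre_sigma_subadditive R d s)).

Notation surface_space R n := (caratheodory_type (@hausdorff_outer R n.+1 n)).

(* n-dimensional Hausdorff measure on R^(n+1): the surface measure d sigma *)
Definition surface (R : realType) (n : nat) :
    {measure set (surface_space R n) -> \bar R} :=
  [the {measure set (surface_space R n) -> \bar R} of
     (@hausdorff_outer R n.+1 n : set (surface_space R n) -> \bar R)].

Definition basis_vec (R : realType) (d : nat) (i : 'I_d) : 'rV[R]_d := delta_mx 0 i.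

Definition partial (R : realType) (d : nat) (i : 'I_d) (f : 'rV[R]_d -> R) :
    'rV[R]_d -> R := fun x => 'D_(basis_vec R i) f x.

Definition iter_partial (R : realType) (d : nat) (s : seq 'I_d)
    (f : 'rV[R]_d -> R) : 'rV[R]_d -> R :=
  foldr (@partial R d) f s.

Definition smooth (R : realType) (d : nat) (f : 'rV[R]_d -> R) : Prop :=
  forall s : seq 'I_d, continuous (iter_partial s f) /\
    forall i x, derivable (iter_partial s f) x (basis_vec R i).

Definition test_function (R : realType) (d : nat) (Omega : set 'rV[R]_d)
    (phi : 'rV[R]_d -> R) : Prop :=
  smooth phi /\ exists K : set 'rV[R]_d,
    [/\ compact K, K `<=` Omega & forall x, ~ K x -> phi x = 0].

Definition extends_to_closure (R : realType) (d : nat) (Omega : set 'rV[R]_d)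
    (f : 'rV[R]_d -> R) : Prop :=
  exists g : 'rV[R]_d -> R, {within closure Omega, continuous g} /\
    forall x, Omega x -> g x = f x.

(* f belongs to C^1 of the closure of Omega; only the restriction of f to the
   open set Omega matters. *)
Definition C1_closure (R : realType) (d : nat) (Omega : set 'rV[R]_d)
    (f : 'rV[R]_d -> R) : Prop :=
  [/\ forall i x, Omega x -> derivable f x (basis_vec R i),
      extends_to_closure Omega f
    & forall i, extends_to_closure Omega (partial i f)].

Definition sup_norm (R : realType) (d : nat) (Omega : set 'rV[R]_d)
    (f : 'rV[R]_d -> R) : \bar R :=
  ereal_sup [set `|f x|%:E | x in Omega].

Definition C1_norm (R : realType) (d : nat) (Omega : set 'rV[R]_d)
    (f : 'rV[R]_d -> R) : \bar R :=
  (sup_norm Omega f + \sum_(i < d) sup_norm Omega (partial i f))%E.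

Definition entry (R : realType) (d : nat) (M : 'rV[R]_d -> 'M[R]_d)
    (i j : 'I_d) : 'rV[R]_d -> R := fun x => M x i j.

Definition C1_closure_mx (R : realType) (d : nat) (Omega : set 'rV[R]_d)
    (M : 'rV[R]_d -> 'M[R]_d) : Prop :=
  forall i j, C1_closure Omega (entry M i j).

Definition C1_norm_mx (R : realType) (d : nat) (Omega : set 'rV[R]_d)
    (M : 'rV[R]_d -> 'M[R]_d) : \bar R :=
  (\sum_(i < d) \sum_(j < d) C1_norm Omega (entry M i j))%E.

Definition symmetric_on (R : realType) (d : nat) (Omega : set 'rV[R]_d)
    (M : 'rV[R]_d -> 'M[R]_d) : Prop :=
  forall x, Omega x -> (M x)^T = M x.

Definition uniformly_posdef (R : realType) (d : nat) (Omega : set 'rV[R]_d)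
    (M : 'rV[R]_d -> 'M[R]_d) : Prop :=
  exists2 alpha : R, 0 < alpha & forall x (xi : 'rV[R]_d), Omega x ->
    alpha * enorm xi ^+ 2 <= \sum_(i < d) \sum_(j < d) M x i j * xi 0 i * xi 0 j.

Definition boundary (T : topologicalType) (A : set T) : set T :=
  closure A `\` interior A.

Definition relative_interior (T : topologicalType) (B A : set T) : set T :=
  [set x | B x /\ exists U : set T, [/\ open U, U x & U `&` B `<=` A]].

Definition C11 (R : realType) (d : nat) (f : 'rV[R]_d -> R) : Prop :=
  (forall x, differentiable f x) /\
  exists L : R, forall i x y,
    `|partial i f x - partial i f y| <= L * enorm (x - y).

Definition first_coords (R : realType) (n : nat) (x : 'rV[R]_n.+1) : 'rV[R]_n :=
  \row_(i < n) x 0 (lift ord_max i).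

(* Near each boundary point, Omega is the strict epigraph of a C^{1,1} function
   in orthonormal coordinates; the translation is absorbed by the function. *)
Definition C11_boundary (R : realType) (n : nat) (Omega : set 'rV[R]_n.+1) : Prop :=
  forall x0, boundary Omega x0 ->
  exists (r : R) (Q : 'M[R]_n.+1) (gamma : 'rV[R]_n -> R),
    [/\ 0 < r, Q *m Q^T = 1%:M, C11 gamma
      & forall x, enorm (x - x0) < r ->
          (Omega x <-> gamma (first_coords (x *m Q)) < (x *m Q) 0 ord_max)].

Definition square_integrable (R : realType) (disp : measure_display)
    (T : measurableType disp) (mu : {measure set T -> \bar R}) (D : set T)
    (f : T -> R) : Prop :=
  measurable_fun D f /\ mu.-integrable D (fun x => (f x ^+ 2)%:E).

Definition is_weak_partial (R : realType) (n : nat) (Omega : set 'rV[R]_n.+1)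
    (u : 'rV[R]_n.+1 -> R) (i : 'I_n.+1) (v : 'rV[R]_n.+1 -> R) : Prop :=
  forall phi, test_function Omega phi ->
    \int[lebesgue R n]_(x in Omega) (u x * partial i phi x) =
    - \int[lebesgue R n]_(x in Omega) (v x * phi x).

Definition H1 (R : realType) (n : nat) (Omega : set 'rV[R]_n.+1)
    (u : 'rV[R]_n.+1 -> R) : Prop :=
  square_integrable (lebesgue R n) Omega u /\
  forall i, exists v : 'rV[R]_n.+1 -> R,
    square_integrable (lebesgue R n) Omega v /\ is_weak_partial Omega u i v.

(* A representative of the weak i-th partial derivative of u in H^1(Omega),
   which is unique up to a Lebesgue-null subset of Omega; 0 if there is none. *)
Definition weak_partial (R : realType) (n : nat) (Omega : set 'rV[R]_n.+1)
    (u : 'rV[R]_n.+1 -> R) (i : 'I_n.+1) : 'rV[R]_n.+1 -> R :=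
  xget (fun=> 0) [set v : 'rV[R]_n.+1 -> R |
    square_integrable (lebesgue R n) Omega v /\ is_weak_partial Omega u i v].

(* g in L^2 of the boundary is the limit there of smooth functions on R^(n+1)
   converging to u in H^1(Omega). *)
Definition is_trace (R : realType) (n : nat) (Omega : set 'rV[R]_n.+1)
    (u g : 'rV[R]_n.+1 -> R) : Prop :=
  square_integrable (surface R n) (boundary Omega) g /\
  exists v : nat -> 'rV[R]_n.+1 -> R,
  [/\ forall k, smooth (v k),
      (\int[lebesgue R n]_(x in Omega) ((v k x - u x) ^+ 2)%:E)%E
        @[k --> \oo] --> 0%E,
      forall i, (\int[lebesgue R n]_(x in Omega)
          ((partial i (v k) x - weak_partial Omega u i x) ^+ 2)%:E)%E
        @[k --> \oo] --> 0%E
    & (\int[surface R n]_(x in boundary Omega) ((v k x - g x) ^+ 2)%:E)%E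
        @[k --> \oo] --> 0%E].

(* A representative of the boundary trace of u in H^1(Omega), which for C^{1,1}
   domains exists and is unique up to a surface-null set. *)
Definition trace (R : realType) (n : nat) (Omega : set 'rV[R]_n.+1)
    (u : 'rV[R]_n.+1 -> R) : 'rV[R]_n.+1 -> R :=
  xget (fun=> 0) [set g | is_trace Omega u g].

(* e lies in the eigenspace of lambda (0 included): weak form of
   d_i (m_ij d_j e) = 0 in Omega, d_nu e + e = lambda 1_S e on the boundary. *)
Definition eigenspace_mem (R : realType) (n : nat) (Omega S : set 'rV[R]_n.+1)
    (M : 'rV[R]_n.+1 -> 'M[R]_n.+1) (lambda : R) (e : 'rV[R]_n.+1 -> R) : Prop :=
  H1 Omega e /\
  forall phi, H1 Omega phi ->
    \int[lebesgue R n]_(x in Omega) (\sum_(i < n.+1) \sum_(j < n.+1)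
        M x i j * weak_partial Omega e i x * weak_partial Omega phi j x)
    + \int[surface R n]_(x in boundary Omega)
        (trace Omega e x * trace Omega phi x)
    = lambda * \int[surface R n]_(x in boundary Omega)
        (\1_S x * trace Omega e x * trace Omega phi x).

Definition nonzero_on (R : realType) (n : nat) (Omega : set 'rV[R]_n.+1)
    (e : 'rV[R]_n.+1 -> R) : Prop :=
  ~ {ae lebesgue R n, forall x, Omega x -> e x = 0}.

Definition is_eigenvalue (R : realType) (n : nat) (Omega S : set 'rV[R]_n.+1)
    (M : 'rV[R]_n.+1 -> 'M[R]_n.+1) (lambda : R) : Prop :=
  exists e, eigenspace_mem Omega S M lambda e /\ nonzero_on Omega e.

(* The eigenspace is one-dimensional in H^1(Omega), i.e. modulo null sets. *)
Definition simple_eigenvalue (R : realType) (n : nat) (Omega S : set 'rV[R]_n.+1)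
    (M : 'rV[R]_n.+1 -> 'M[R]_n.+1) (lambda : R) : Prop :=
  exists e, [/\ eigenspace_mem Omega S M lambda e, nonzero_on Omega e
    & forall e', eigenspace_mem Omega S M lambda e' ->
        exists c : R, {ae lebesgue R n, forall x, Omega x -> e' x = c * e x}].

(* Main.v *)
From HB Require Import structures.
Require Import Defs.
From mathcomp Require Import all_boot all_order all_algebra.
From mathcomp Require Import all_classical all_reals all_analysis.
From mathcomp Require Import measurable_realfun.
From mathcomp Require Import ring lra zify.
Import Order.TTheory GRing.Theory Num.Theory.
Import numFieldNormedType.Exports.
Local Open Scope classical_set_scope.
Local Open Scope ring_scope.

(** Write [q_M u v] for the integral of [M grad u . grad v] over [Omega] plus the
    boundary integral of [tr u * tr v], and [s u v] for the integral of
    [tr u * tr v] over [S]. An eigenfunction of the problem with coefficients [M] is a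
    vector [e] of H^1 with [q_M e v = lambda * s e v] for all [v], so the theorem is a
    statement about a family of quadratic forms on a Hilbert space which depends
    linearly on [M].

    The abstract part rests on two facts about forms [q >= alpha h], where [h] is a
    complete form and [s] is compact relative to [h]. Openness ([no_family_open]): if [q]
    has no [m] independent eigenvectors for a common eigenvalue [lambda <= N], the same
    holds for the forms near [q], because eigenvectors of nearby forms have convergent
    subsequences. Density ([simple_dense]): among the small perturbations choose one for
    which the largest multiplicity below [N] is minimal, say [m >= 2]. If every
    direction [B] preserved this multiplicity, then, to first order, [B] would act as a
    scalar on some eigenspace of dimension [m] ([persistent_scalar]). Only finitely many
    eigenvalues lie below [N], and being a scalar on one of these eigenspaces is a linear
    condition on [B], so a single [B] violates all of them as soon as each can be
    violated separately. Openness and density are combined as in the proof of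
    Baire's theorem ([generic_simplicity]): one chooses corrections [C 0, C 1, ...] such
    that the [N]-th one makes the eigenvalues below [N] simple and the later ones are
    too small to undo this; the sum of the series is the required [B].

    The corrections are symmetric matrices of functions from an explicit algebra of bump
    functions. That they separate any two [s]-orthonormal vectors [e], [f]
    ([separating_perturbation]) is seen on [psi E_ii] with [psi] a bump function. If none
    of these separates [e] and [f], then [d_i e * d_i f = 0] and
    [(d_i e)^2 = (d_i f)^2] almost everywhere, so both gradients vanish, [e] and [f] are
    constants on the connected set [Omega], and orthonormality fails.

    The analytic part provides the Hilbert space. Locally the boundary is a Lipschitz
    graph, and sliding the surface measure into [Omega] along the vertical direction
    produces a measure dominated by Lebesgue measure ([boundary_collar]). Integrating
    along these segments gives the trace inequality ([trace_inequality]) and an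
    estimate in thin boundary strips ([strip_estimate]); together with the Poincare
    inequality on small cubes the latter gives a compactness inequality of Rellich type
    ([rellich]). The trace and the Rellich inequality carry over to H^1 by approximation
    with smooth functions, H^1 is complete by the Riesz-Fischer theorem, functions with vanishing weak gradient are
    constant ([weakly_constant]), and a compactness argument makes the Robin form coercive
    ([robin_coercive]).

    This argument applies when every function of H^1 has a trace and the boundary is not
    null for the surface measure. Otherwise the weak equation, tested with functions
    whose boundary terms vanish, shows that every eigenfunction has zero gradient
    ([simple_null_boundary], [simple_without_trace]); eigenfunctions are then constants
    and [B = 0] serves. *)

Set Implicit Arguments.
Unset Strict Implicit.
Unset Printing Implicit Defensive.

(** * Measurable sets of the Lebesgue and Hausdorff measures *)

(** Intersecting every set of a cover of [A `|` B] with [P] and with [Q] yields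
    covers of [A] and of [B]. *)
Lemma mu_ext_split (T : pointedType) (R : realType)
    (g : set (any_set_type T) -> \bar R) (P Q A B : set T) :
    (forall C, 0 <= g C)%E ->
    (forall C, (g (C `&` P) + g (C `&` Q) <= g C)%E) ->
    A `<=` P -> B `<=` Q ->
  (@mu_ext _ (any_set_type T) R g A + @mu_ext _ (any_set_type T) R g B <=
   @mu_ext _ (any_set_type T) R g (A `|` B))%E.
Proof.
move=> g0 gPQ AP BQ; apply: le_ereal_inf_tmp => _ [F [mF FAB] <-].
apply: (@le_trans _ _ (\sum_(k <oo) (g (F k `&` P) + g (F k `&` Q)))%E); last first.
  by apply: lee_nneseries => // k _ _; rewrite adde_ge0.
rewrite nneseriesD//; apply: leeD; apply: ereal_inf_lbound.
- exists (fun k => F k `&` P) => //; split => // x Ax.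
  by have [k _ Fx] := FAB x (or_introl Ax); exists k => //; split => //; exact: AP.
- exists (fun k => F k `&` Q) => //; split => // x Bx.
  by have [k _ Fx] := FAB x (or_intror Bx); exists k => //; split => //; exact: BQ.
Qed.

Lemma mu_ext_le (T : pointedType) (R : realType)
    (g : set (any_set_type T) -> \bar R) (A : set T) :
  g set0 = 0%E -> (forall C, 0 <= g C)%E ->
  (@mu_ext _ (any_set_type T) R g A <= g A)%E.
Proof.
move=> g00 g0; apply: ereal_inf_lbound.
exists (fun k => if k is 0 then A else set0).
  by split => // x Ax; exists 0.
rewrite nneseries_recl//=.
by rewrite eseries_cond/= eseries0 ?adde0// => -[|].
Qed.

(** A hyperplane cuts a box into two boxes whose volumes add up; [m] is the height
    of the cut clipped to the box. *)
Lemma box_gauge_half (R : realType) (n : nat) (i : 'I_n.+1) (c : R)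
    (C : set 'rV[R]_n.+1) :
  (box_gauge (C `&` [set x | (x 0 i < c)%R]) +
   box_gauge (C `&` [set x | (c <= x 0 i)%R]) <= box_gauge C)%E.
Proof.
apply: le_ereal_inf_tmp => _ [[a b] /= [ab Cab] <-].
pose m := Num.min (b 0 i) (Num.max (a 0 i) c).
pose b' : 'rV[R]_n.+1 := \row_j (if j == i then m else b 0 j).
pose a' : 'rV[R]_n.+1 := \row_j (if j == i then m else a 0 j).
have am : a 0 i <= m by rewrite le_min ab le_max lexx.
have mb : m <= b 0 i by rewrite ge_min lexx.
have H1 : (box_gauge (C `&` [set x | (x 0 i < c)%R]) <=
           (\prod_(j < n.+1) (b' 0 j - a 0 j))%:E)%E.
  apply: ereal_inf_lbound; exists (a, b') => //=; split=> [j|x [/Cab xab /= xc] j].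
    by rewrite mxE; case: eqP => [->|].
  rewrite mxE; have /andP[xa xb] := xab j; rewrite xa; case: eqP => [ji|_ //].
  by move: xb; rewrite ji => xb; rewrite le_min xb le_max (ltW xc) orbT.
have H2 : (box_gauge (C `&` [set x | (c <= x 0 i)%R]) <=
           (\prod_(j < n.+1) (b 0 j - a' 0 j))%:E)%E.
  apply: ereal_inf_lbound; exists (a', b) => //=; split=> [j|x [/Cab xab /= xc] j].
    by rewrite mxE; case: eqP => [->|].
  rewrite mxE; have /andP[xa xb] := xab j; rewrite xb andbT; case: eqP => [ji|_ //].
  by move: xa; rewrite ji => xa; rewrite ge_min ge_max xa xc orbT.
apply: le_trans (leeD H1 H2) _; rewrite -EFinD lee_fin.
rewrite !(bigD1 (P := xpredT) i isT)/= !mxE eqxx.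
have e1 : \prod_(j < n.+1 | j != i) (b' 0 j - a 0 j) =
          \prod_(j < n.+1 | j != i) (b 0 j - a 0 j).
  by apply: eq_bigr => j /negbTE ji; rewrite mxE ji.
have e2 : \prod_(j < n.+1 | j != i) (b 0 j - a' 0 j) =
          \prod_(j < n.+1 | j != i) (b 0 j - a 0 j).
  by apply: eq_bigr => j /negbTE ji; rewrite mxE ji.
by rewrite e1 e2 -mulrDl [X in X * _ <= _](_ : _ = b 0 i - a 0 i)//; ring.
Qed.

Lemma lebesgue_half_measurable (R : realType) (n : nat) (i : 'I_n.+1) (c : R) :
  measurable ([set x | x 0 i < c] : set (lebesgue_space R n)).
Proof.
apply: le_caratheodory_measurable => X.
rewrite -[leRHS](_ : lebesgue_outer R n
  ((X `&` [set x | x 0 i < c]) `|` (X `&` ~` [set x | x 0 i < c])) = _); last first.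
  by rewrite -setIUr setUCr setIT.
apply: (@mu_ext_split _ R (@box_gauge R n) [set x | (x 0 i < c)%R] [set x | (c <= x 0 i)%R]).
- exact: box_gauge_ge0.
- exact: box_gauge_half.
- by move=> x [].
- by move=> x [_ /= /negP]; rewrite -leNgt.
Qed.

Lemma coord_le_enorm (R : realType) (d : nat) (x : 'rV[R]_d) i : `|x 0 i| <= enorm x.
Proof.
rewrite -sqrtr_sqr ler_sqrt ?sumr_ge0// => [|j _]; last exact: sqr_ge0.
by rewrite (bigD1 i)//= lerDl sumr_ge0// => j _; exact: sqr_ge0.
Qed.

Lemma diam_ub (R : realType) (d : nat) (C : set 'rV[R]_d) x y :
  C x -> C y -> ((enorm (x - y))%:E <= diam C)%E.
Proof. by move=> Cx Cy; apply: ereal_sup_ubound; exists (x, y). Qed.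

Lemma le_diam (R : realType) (d : nat) (A B : set 'rV[R]_d) :
  A `<=` B -> (diam A <= diam B)%E.
Proof.
move=> AB; apply: ge_ereal_sup => _ [[x y] /= [Ax Ay] <-].
by apply: diam_ub; exact: AB.
Qed.

Lemma le_hausdorff_gauge (R : realType) (d s : nat) (delta : R) (A B : set 'rV[R]_d) :
  A `<=` B -> (hausdorff_gauge s delta A <= hausdorff_gauge s delta B)%E.
Proof.
move=> AB; rewrite /hausdorff_gauge; case: ifPn => A0.
  by have := hausdorff_gauge_ge0 s delta B; rewrite /hausdorff_gauge.
have [B0|B0] := eqVneq B set0; first by move: A0 AB; rewrite B0 subset0 => /eqP.
case: (leP (diam B) delta%:E) => Bd; last by rewrite leey.
rewrite (le_trans (le_diam AB) Bd) lee_fin ler_wpM2l ?unit_ball_volume_ge0//.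
move: A0 => /set0P[x Ax].
have Afin : diam A \is a fin_num.
  rewrite ge0_fin_numE; last by apply: diam_ge0; exists x.
  by rewrite (le_lt_trans (le_diam AB))// (le_lt_trans Bd)// ltry.
have Bfin : diam B \is a fin_num.
  rewrite ge0_fin_numE; last by apply: diam_ge0; exists x; exact: AB.
  by rewrite (le_lt_trans Bd)// ltry.
have [dA dB] : 0 <= fine (diam A) /\ 0 <= fine (diam B).
  by split; apply/fine_ge0/diam_ge0; exists x => //; exact: AB.
rewrite lerXn2r ?nnegrE ?divr_ge0//.
by rewrite ler_wpM2r ?invr_ge0// fine_le// le_diam.
Qed.

Lemma hausdorff_content_anti (R : realType) (d s : nat) (e e' : R) (A : set 'rV[R]_d) :
  e <= e' -> (hausdorff_content s e' A <= hausdorff_content s e A)%E.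
Proof.
move=> ee'; apply: le_ereal_inf_tmp => _ [F mF <-].
apply: (@le_trans _ _ (\sum_(k <oo) hausdorff_gauge s e' (F k))%E).
  by apply: ereal_inf_lbound; exists F.
apply: lee_nneseries => k *; first exact: hausdorff_gauge_ge0.
rewrite /hausdorff_gauge; case: ifP => // _.
case: (leP (diam (F k)) e%:E) => Fe; last by rewrite leey.
by rewrite (le_trans Fe) ?lee_fin.
Qed.

(** For covers by sets of diameter less than the gap [t' - t] no set meets both
    pieces, so additivity holds for the contents at small scale. *)
Lemma surface_sep (R : realType) (d s : nat) (i : 'I_d.+1) (t t' : R) (A B : set 'rV[R]_d.+1) :
  t < t' -> A `<=` [set x | x 0 i < t] -> B `<=` [set x | t' <= x 0 i] ->
  (hausdorff_pre s A + hausdorff_pre s B <= hausdorff_pre s (A `|` B))%E.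
Proof.
move=> tt' At Bt.
have key e e' : 0 < e -> 0 < e' ->
    (hausdorff_content s e A + hausdorff_content s e' B <= hausdorff_pre s (A `|` B))%E.
  move=> e0 e'0; pose m := Num.min ((t' - t) / 2) (Num.min e e').
  have m0 : 0 < m by rewrite !lt_min e0 e'0 divr_gt0 ?subr_gt0.
  apply: le_trans (hausdorff_content_le _ _ m0).
  apply: (@le_trans _ _ (hausdorff_content s m A + hausdorff_content s m B)%E).
    apply: leeD; apply: hausdorff_content_anti; rewrite !ge_min lexx ?orbT//.
  apply: (@mu_ext_split _ R (hausdorff_gauge s m) [set x | (x 0 i < t)%R]
             [set x | (t' <= x 0 i)%R]) => // [C|C]; first exact: hausdorff_gauge_ge0.
  have [->|/eqP CA0] := eqVneq (C `&` [set x | (x 0 i < t)%R]) set0.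
    by rewrite hausdorff_gauge0 add0e le_hausdorff_gauge// => x [].
  have [->|/eqP CB0] := eqVneq (C `&` [set x | (t' <= x 0 i)%R]) set0.
    by rewrite hausdorff_gauge0 adde0 le_hausdorff_gauge// => x [].
  move/eqP/set0P: CA0 => [x [Cx /= xt]]; move/eqP/set0P: CB0 => [y [Cy /= yt]].
  rewrite [leRHS]/hausdorff_gauge ifN; last by apply/set0P; exists x.
  rewrite ifN ?leey// -ltNge; apply: lt_le_trans (diam_ub Cy Cx).
  rewrite lte_fin; apply: (@lt_le_trans _ _ (t' - t)).
    by rewrite /m gt_min ltr_pdivrMr// ltr_pMr ?subr_gt0// ltr1n.
  apply: le_trans (coord_le_enorm _ i); rewrite !mxE (le_trans _ (ler_norm _))//.
  by rewrite lerB// ltW.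
have [Boo|Bfin] := eqVneq (hausdorff_pre s B) +oo%E.
  have -> : (hausdorff_pre s (A `|` B) = +oo)%E; last exact: leey.
  apply/eqP; rewrite -leye_eq -Boo; apply: le_hausdorff_pre; exact: subsetUr.
have Bf : hausdorff_pre s B \is a fin_num.
  by rewrite ge0_fin_numE ?hausdorff_pre_ge0// lt_neqAle Bfin leey.
rewrite -leeBrDr//; apply: ge_ereal_sup => _ [e e0 <-]; rewrite leeBrDr//.
have [->|Cfin] := eqVneq (hausdorff_pre s (A `|` B)) +oo%E; first exact: leey.
have cA : hausdorff_content s e A \is a fin_num.
  have h0 : (0 <= hausdorff_content s e A)%E.
    exact: (@mu_ext_ge0 _ (any_set_type 'rV[R]_d.+1) R _ (@hausdorff_gauge_ge0 R _ s e)).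
  rewrite ge0_fin_numE//; apply: (@le_lt_trans _ _ (hausdorff_pre s (A `|` B))).
    apply: le_trans (hausdorff_content_le _ _ e0) _; apply: le_hausdorff_pre.
    exact: subsetUl.
  by rewrite lt_neqAle Cfin leey.
rewrite addeC -leeBrDr//; apply: ge_ereal_sup => _ [e' e'0 <-]; rewrite leeBrDr//.
by rewrite addeC key.
Qed.

(** Caratheodory's criterion for a half-space. The part of [X] below the hyperplane
    is exhausted by pieces [Ak k] at positive distance from it, for which
    [surface_sep] gives additivity; the layers [L k] between consecutive pieces have
    summable measure, because every second one is separated, so their tails do not
    matter. *)
Lemma surface_half (R : realType) (d s : nat) (i : 'I_d.+1) (c : R) :
  (@hausdorff_outer R d.+1 s).-caratheodory [set x | x 0 i < c].
Proof.
apply: le_caratheodory_measurable => X.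
set A := X `&` _; set B := X `&` _.
pose mu := @hausdorff_outer R d.+1 s.
have [Xoo|Xfin] := eqVneq (mu X) +oo%E; first by rewrite -/mu Xoo leey.
have fin Y : Y `<=` X -> mu Y \is a fin_num.
  move=> YX; rewrite ge0_fin_numE ?outer_measure_ge0//.
  by rewrite (le_lt_trans (le_outer_measure mu _ _ YX))// lt_neqAle Xfin leey.
pose t k : R := c - k.+1%:R^-1.
have t_lt k : t k < t k.+1.
  by rewrite ltrD2l ltrN2 ltf_pV2 ?posrE// ltr_nat.
have t_mono m n : (m <= n)%N -> t m <= t n.
  by move=> mn; rewrite lerD2l lerN2 lef_pV2 ?posrE// ler_nat.
have tc k : t k < c by rewrite /t gtrBl invr_gt0.
pose Ak k := X `&` [set x : 'rV[R]_d.+1 | x 0 i < t k].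
pose L k := X `&` [set x : 'rV[R]_d.+1 | t k <= x 0 i < t k.+1].
pose a k := fine (mu (Ak k)).
have Ea k : mu (Ak k) = (a k)%:E by rewrite fineK// fin// => x [].
have El k : mu (L k) = (fine (mu (L k)))%:E by rewrite fineK// fin// => x [].
have EB : mu B = (fine (mu B))%:E by rewrite fineK// fin// => x [].
have EX : mu X = (fine (mu X))%:E by rewrite fineK// fin.
have aB k : a k + fine (mu B) <= fine (mu X).
  rewrite -lee_fin EFinD -Ea -EB -EX.
  apply: le_trans (surface_sep (i := i) s (tc k) _ _) _.
  - by move=> x [].
  - by move=> x [_ /= /negP]; rewrite -leNgt.
  - by apply: (le_outer_measure mu) => x [] [].
have al k : fine (mu (L k.+1)) <= a k.+2 - a k.
  rewrite lerBrDl -lee_fin EFinD -!Ea -El.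
  apply: le_trans (surface_sep (i := i) s (t_lt k) _ _) _.
  - by move=> x [].
  - by move=> x [_ /= /andP[]].
  - apply: (le_outer_measure mu) => x [] [xX /=]; split => //=.
      exact: lt_trans (lt_trans b (t_lt _)) (t_lt _).
    by case/andP: b.
have a_ndS k : a k <= a k.+1.
  rewrite -lee_fin -!Ea; apply: (le_outer_measure mu) => x [xX /= xt]; split => //=.
  exact: lt_trans (t_lt _).
have hs : has_sup (range a).
  split; first by exists (a 0); exists 0.
  exists (fine (mu X) - fine (mu B)) => _ [k _ <-]; rewrite lerBrDr; exact: aB.
pose l := sup (range a).
have al_le k : a k <= l by apply: sup_ubound; [exact: hs.2|exists k].
have lB : l + fine (mu B) <= fine (mu X).
  rewrite -lerBrDr; apply: ge_sup; first exact: hs.1.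
  by move=> _ [k _ <-]; rewrite lerBrDr; exact: aB.
have lay K : (\sum_(K.+1 <= j <oo) mu (L j) <= (2 * (l - a K))%:E)%E.
  apply: lime_le; first by apply: is_cvg_nneseries => *; exact: outer_measure_ge0.
  apply: nearW => M.
  have -> : (\sum_(K.+1 <= j < M) mu (L j) =
      (\sum_(K.+1 <= j < M) fine (mu (L j)))%:E)%E.
    by rewrite -sumEFin; apply: eq_bigr => j _; rewrite -El.
  rewrite lee_fin; case: (leqP M K.+1) => MK.
    by rewrite big_geq// mulr_ge0// subr_ge0.
  have step m : \sum_(K.+1 <= j < K.+1 + m) fine (mu (L j)) <=
      a (K + m).+1 + a (K + m)%N - a K.+1 - a K.
    elim: m => [|m IH].
      by rewrite (addn0 K.+1) big_geq// !addn0; lra.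
    rewrite !addnS big_nat_recr/= ?leq_addr//.
    have := al (K + m)%N; move: IH; rewrite !addSn; lra.
  have := step (M - K.+1)%N; rewrite subnKC; last exact: ltnW.
  have := al_le (K + (M - K.+1)).+1; have := al_le (K + (M - K.+1))%N; have := a_ndS K.
  by lra.
have Al : (mu A <= l%:E)%E.
  apply/lee_addgt0Pr => e e0.
  have [_ [K _ <-] Ke] := sup_adherent (divr_gt0 e0 (ltr0n R 2)) hs.
  have sub : A `<=` Ak K.+1 `|` \bigcup_(j in ~` `I_K.+1) L j.
    move=> x [xX /= xc]; case: (ltP (x 0 i) (t K.+1)) => xt; first by left.
    right.
    have ex : exists k, (x 0 i < t k).
      have cx : 0 < c - x 0 i by rewrite subr_gt0.
      exists (Num.truncn (c - x 0 i)^-1); rewrite /t ltrBrDr -ltrBrDl.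
      rewrite invf_plt ?posrE//; exact: truncnS_gt.
    case: (ex_minnP ex) => k xk kmin.
    case: k xk kmin => [|k] xk kmin.
      by move: (le_lt_trans xt xk); rewrite ltNge t_mono.
    exists k => /=.
      by move/t_mono/(lt_le_trans xk); rewrite ltNge xt.
    split => //=; rewrite xk andbT leNgt; apply/negP => /kmin; rewrite ltnn//.
  apply: (le_trans (le_outer_measure mu _ _ sub)).
  apply: (le_trans (outer_measureU2 _ _ _)).
  apply: (@le_trans _ _ ((a K.+1)%:E + (2 * (l - a K))%:E)%E).
    rewrite Ea; apply: leeD => //.
    exact: le_trans (outer_measure_sigma_subadditive_tail _ _ _) (lay K).
  rewrite -!EFinD lee_fin; have := al_le K.+1; move: Ke; rewrite -/l; lra.
rewrite -/mu (_ : mu B = (fine (mu B))%:E)// EX.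
by apply: le_trans (leeD Al (lexx _)) _; rewrite -EFinD lee_fin.
Qed.

Lemma rV_ballE (R : realType) (n : nat) (x : 'rV[R]_n) (r : R) (y : 'rV[R]_n) : 0 < r ->
  ball x r y <-> forall i, `|x 0 i - y 0 i| < r.
Proof.
move=> r0; split=> [[_ h] i|h]; first exact: h.
by split=> // i j; rewrite ord1; exact: h.
Qed.

(** An open set is a countable union of balls of the sup norm with rational centres,
    and each ball is a countable combination of half-spaces. *)
Lemma open_halfspaces_measurable (R : realType) (n : nat) (disp : measure_display)
    (T : measurableType disp) (f : T -> 'rV[R]_n.+1) :
  (forall i c, measurable (f @^-1` [set x | x 0 i < c])) ->
  forall U, open U -> measurable (f @^-1` U).
Proof.
move=> half U oU.
pose q2r (q : 'rV[rat]_n.+1) : 'rV[R]_n.+1 := map_mx ratr q.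
pose rad k : R := k.+1%:R^-1.
pose J := [set p : 'rV[rat]_n.+1 * nat | ball (q2r p.1) (rad p.2) `<=` U].
have -> : U = \bigcup_(p in J) ball (q2r p.1) (rad p.2).
  apply/seteqP; split=> [x Ux|x [p pI]]; last exact: pI.
  have /nbhs_ballP[e /= e0 eU] : nbhs x U by apply: open_nbhs_nbhs.
  pose k := Num.truncn (2 / e).
  have k2 : rad k < e / 2.
    by rewrite /rad -[e / 2]invrK ltf_pV2 ?posrE ?invr_gt0 ?divr_gt0// invf_div truncnS_gt.
  have /choice[q qP] : forall i, exists q : rat, `|ratr q - x 0 i| < rad k.
    move=> i; have [|q] := @rat_in_itvoo R (x 0 i - rad k) (x 0 i + rad k).
      by rewrite ltrD2l gt0_cp// invr_gt0.
    rewrite in_itv/= => /andP[q1 q2]; exists q.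
    by rewrite ltr_norml; apply/andP; split; lra.
  have radk0 : 0 < rad k by rewrite invr_gt0.
  exists (\row_i q i, k) => /=; last by apply/(rV_ballE _ _ radk0) => i; rewrite !mxE.
  move=> y /(rV_ballE _ _ radk0) yq; apply: eU; apply/rV_ballE => // i.
  have := yq i; rewrite !mxE => h1; have h2 := qP i.
  rewrite distrC in h2.
  have := ler_distD (ratr (q i)) (x 0 i) (y 0 i).
  by move=> /le_lt_trans; apply; lra.
rewrite preimage_bigcup bigcup_mkcond; apply: countable_bigcupT_measurable => // p.
case: ifPn => // _.
have rp : 0 < rad p.2 by rewrite invr_gt0.
have -> : f @^-1` ball (q2r p.1) (rad p.2) = ~` \bigcup_(i : 'I_n.+1)
   ~` ((f @^-1` [set x | x 0 i < q2r p.1 0 i + rad p.2]) `&`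
    \bigcup_k ~` (f @^-1` [set x | x 0 i < q2r p.1 0 i - rad p.2 + k.+1%:R^-1])).
  rewrite setC_bigcup; under eq_bigcapr do rewrite setCK; apply/seteqP; split=> [x /= /(rV_ballE _ _ rp) h i _|x /= h].
    have := h i; rewrite ltr_norml => /andP[h1 h2]; split => /=; first by lra.
    exists (Num.truncn (f x 0 i - (q2r p.1 0 i - rad p.2))^-1) => //=.
    apply/negP; rewrite -leNgt -lerBrDl.
    rewrite -[leRHS]invrK lef_pV2 ?posrE// ?invr_gt0; first exact/ltW/truncnS_gt.
    by lra.
  apply/rV_ballE => // i; have [/= h1 [k _ /negP /=]] := h i I.
  rewrite -leNgt => h2; have k0 : 0 < (k.+1%:R^-1 : R) by rewrite invr_gt0.
  rewrite ltr_norml; move: h1 h2 k0.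
  by move: (k.+1%:R^-1) (q2r p.1 0 i) (f x 0 i) (rad p.2) => *; apply/andP; split; lra.
apply: measurableC; apply: countable_bigcupT_measurable => // i.
apply: measurableC; apply: measurableI; first exact: half.
by apply: bigcup_measurable => k _; apply: measurableC; exact: half.
Qed.

Section RnMeasurability.
Context (R : realType) (n : nat) (disp : measure_display) (T : measurableType disp).
Implicit Type f : T -> 'rV[R]_n.+1.

Lemma preimage_open_measurable f (U : set 'rV[R]_n.+1) :
  (forall i, measurable_fun setT (fun x => f x 0 i)) -> open U -> measurable (f @^-1` U).
Proof.
move=> mf; apply: open_halfspaces_measurable => i c.
have -> : f @^-1` [set x | x 0 i < c] = [set: T] `&` (fun x => f x 0 i) @^-1` `]-oo, c[%classic.
  by apply/seteqP; split=> x /=; rewrite in_itv/= => // -[].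
exact: mf.
Qed.

Lemma continuous_comp_measurable f (g : 'rV[R]_n.+1 -> R) :
  (forall i, measurable_fun setT (fun x => f x 0 i)) -> continuous g ->
  measurable_fun setT (g \o f).
Proof.
move=> mf cg; apply: (measurability _ (RGenOpens.measurableE R)) => _ [_ [a [b ->] <-]].
rewrite setTI comp_preimage; apply: preimage_open_measurable => //.
by move/continuousP : cg; apply; exact: interval_open.
Qed.
End RnMeasurability.

(** * Translations and iterated integrals *)

Section MeasurePreserving.
Local Open Scope ereal_scope.
Context (R : realType) d (T : measurableType d) (mu : {measure set T -> \bar R}).
Variables (phi : T -> T) (mphi : measurable_fun setT phi).
Hypothesis phi_mu : forall A, measurable A -> mu (phi @^-1` A) = mu A.

(** The pushforward of [mu] by [phi] is [mu] itself, so this is the change of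
    variables for pushforwards. *)
Lemma ge0_integral_preserving (D : set T) (f : T -> \bar R) :
  measurable D -> measurable_fun D f -> (forall x, D x -> 0 <= f x) ->
  \int[mu]_(x in phi @^-1` D) f (phi x) = \int[mu]_(x in D) f x.
Proof.
move=> mD mf f0; rewrite -(ge0_integral_pushforward mphi mu mD mf) => [|y /set_mem/f0//].
by apply: eq_measure_integral => A mA _; exact: phi_mu.
Qed.

End MeasurePreserving.

Section CaratheodorySpaces.
Context (R : realType) (n : nat).

Lemma lebesgue_coord i : measurable_fun setT (fun x : lebesgue_space R n => (x : 'rV[R]_n.+1) 0 i).
Proof.
apply: (measurability _ (RGenInftyO.measurableE R)) => _ [_ [c ->] <-].
rewrite setTI [X in measurable X](_ : _ = [set x : 'rV[R]_n.+1 | x 0 i < c]); last first.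
  by apply/seteqP; split=> x /=; rewrite in_itv.
exact: lebesgue_half_measurable.
Qed.

Lemma surface_coord i : measurable_fun setT (fun x : surface_space R n => (x : 'rV[R]_n.+1) 0 i).
Proof.
apply: (measurability _ (RGenInftyO.measurableE R)) => _ [_ [c ->] <-].
rewrite setTI [X in measurable X](_ : _ = [set x : 'rV[R]_n.+1 | x 0 i < c]); last first.
  by apply/seteqP; split=> x /=; rewrite in_itv.
exact: surface_half.
Qed.

Lemma lebesgue_open (U : set 'rV[R]_n.+1) : open U -> measurable (U : set (lebesgue_space R n)).
Proof. exact: (@preimage_open_measurable R n _ (lebesgue_space R n) id U lebesgue_coord). Qed.

Lemma surface_open (U : set 'rV[R]_n.+1) : open U -> measurable (U : set (surface_space R n)).
Proof. exact: (@preimage_open_measurable R n _ (surface_space R n) id U surface_coord). Qed.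

Lemma lebesgue_closed (U : set 'rV[R]_n.+1) : closed U -> measurable (U : set (lebesgue_space R n)).
Proof. by move=> /closed_openC/lebesgue_open/measurableC; rewrite setCK. Qed.

Lemma surface_closed (U : set 'rV[R]_n.+1) : closed U -> measurable (U : set (surface_space R n)).
Proof. by move=> /closed_openC/surface_open/measurableC; rewrite setCK. Qed.

Lemma lebesgue_continuous (g : 'rV[R]_n.+1 -> R) (D : set (lebesgue_space R n)) :
  continuous g -> measurable_fun D (g : lebesgue_space R n -> R).
Proof.
by move=> cg; apply: measurable_funTS; exact: (@continuous_comp_measurable R n _ (lebesgue_space R n) id g lebesgue_coord).
Qed.

Lemma surface_continuous (g : 'rV[R]_n.+1 -> R) (D : set (surface_space R n)) :
  continuous g -> measurable_fun D (g : surface_space R n -> R).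
Proof.
by move=> cg; apply: measurable_funTS; exact: (@continuous_comp_measurable R n _ (surface_space R n) id g surface_coord).
Qed.

Lemma box_gauge_shift (w : 'rV[R]_n.+1) (A : set 'rV[R]_n.+1) :
  (box_gauge ((fun x => (x + w)%R) @^-1` A) <= box_gauge A)%E.
Proof.
apply: le_ereal_inf_tmp => _ [[a b] /= [ab Aab] <-].
apply: ereal_inf_lbound; exists (a - w, b - w) => /=.
  split=> [i|x /= /Aab h i]; first by rewrite !mxE lerB.
  by have := h i; rewrite !mxE; lra.
by congr EFin; apply: eq_bigr => i _; rewrite !mxE opprB addrA subrK.
Qed.

Lemma lebesgue_outer_shift (w : 'rV[R]_n.+1) (A : set 'rV[R]_n.+1) :
  lebesgue_outer R n ((fun x => x + w) @^-1` A) = lebesgue_outer R n A.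
Proof.
have le v (B : set 'rV[R]_n.+1) :
    (lebesgue_outer R n ((fun x => x + v)%R @^-1` B) <= lebesgue_outer R n B)%E.
  apply: le_ereal_inf_tmp => _ [F [mF FB] <-].
  apply: (@le_trans _ _ (\sum_(k <oo) box_gauge ((fun x => x + v)%R @^-1` F k))%E).
    apply: ereal_inf_lbound; exists (fun k => (fun x => x + v) @^-1` F k) => //.
    by split => // x /= /FB [k _ Fk]; exists k.
  by apply: lee_nneseries => k *; [exact: box_gauge_ge0|exact: box_gauge_shift].
apply/eqP; rewrite eq_le le/=.
have := le (- w) ((fun x => x + w) @^-1` A).
rewrite -comp_preimage (_ : _ \o _ = id) ?preimage_id//.
by apply/funext => x /=; rewrite subrK.
Qed.

Lemma shift_measurable (w : 'rV[R]_n.+1) :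
  measurable_fun setT (fun x : lebesgue_space R n => (x + w : 'rV[R]_n.+1) : lebesgue_space R n).
Proof.
move=> _ A mA; rewrite setTI.
have {}mA : (lebesgue_outer R n).-caratheodory A by [].
suff : (lebesgue_outer R n).-caratheodory ((fun x : 'rV[R]_n.+1 => x + w) @^-1` A) by [].
move=> X.
pose Y := (fun x : 'rV[R]_n.+1 => x - w) @^-1` X.
have XY : X = (fun x => x + w) @^-1` Y.
  by rewrite /Y -comp_preimage (_ : _ \o _ = id) ?preimage_id//; apply/funext => x /=; rewrite addrK.
have -> : lebesgue_outer R n X = lebesgue_outer R n Y by rewrite XY lebesgue_outer_shift.
rewrite (mA Y); congr (_ + _)%E.
  by rewrite -(lebesgue_outer_shift w) XY.
by rewrite -(lebesgue_outer_shift w) XY.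
Qed.

Lemma lebesgue_shift (w : 'rV[R]_n.+1) (A : set 'rV[R]_n.+1) :
  lebesgue R n ((fun x => x + w) @^-1` A) = lebesgue R n A.
Proof. exact: lebesgue_outer_shift. Qed.

Lemma ge0_integral_shift (w : 'rV[R]_n.+1) (D : set (lebesgue_space R n))
    (f : lebesgue_space R n -> \bar R) :
  measurable D -> measurable_fun D f -> (forall x, D x -> 0 <= f x)%E ->
  (\int[lebesgue R n]_(x in (fun x => (x + w)%R) @^-1` D) f (x + w)%R =
   \int[lebesgue R n]_(x in D) f x)%E.
Proof. by move=> *; apply: (ge0_integral_preserving (shift_measurable w)) => // A mA; exact: lebesgue_shift.
Qed.

Lemma lebesgue_box_le (a b : 'rV[R]_n.+1) (A : set 'rV[R]_n.+1) :
  (forall i, a 0 i <= b 0 i) ->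
  A `<=` [set x | forall i, a 0 i <= x 0 i <= b 0 i] ->
  (lebesgue R n A <= (\prod_(i < n.+1) (b 0 i - a 0 i))%:E)%E.
Proof.
move=> ab Aab; apply: le_trans (mu_ext_le _ _ _) _; first exact: box_gauge0.
  exact: box_gauge_ge0.
by apply: ereal_inf_lbound; exists (a, b).
Qed.

Lemma bounded_box (A : set 'rV[R]_n.+1) : bounded_set A ->
  exists2 M, 0 < M & forall x i, A x -> `|x 0 i| <= M.
Proof.
move=> [M0 [M0r hM]]; exists (Num.max 1 (M0 + 1)); first by rewrite lt_max ltr01.
move=> x i Ax; have /= := hM (Num.max 1 (M0 + 1)); rewrite lt_max ltrDl ltr01 orbT => /(_ isT x Ax).
apply: le_trans; rewrite [leRHS]mx_normrE.
apply: (le_trans _ (le_bigmax_cond _ (fun i => `|x i.1 i.2|) (j := (0, i)) isT)) => //.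
Qed.

Lemma lebesgue_bounded_lty (A : set 'rV[R]_n.+1) : bounded_set A -> (lebesgue R n A < +oo)%E.
Proof.
move=> /bounded_box[M M0 hM].
apply: le_lt_trans (@lebesgue_box_le (const_mx (- M)) (const_mx M) _ _ _) _; last exact: ltry.
  by move=> i; rewrite !mxE; lra.
by move=> x Ax i; rewrite !mxE -ler_norml; exact: hM.
Qed.

End CaratheodorySpaces.

Section Tonelli.
Local Open Scope ereal_scope.
Context (R : realType) d1 d2 (T1 : measurableType d1) (T2 : measurableType d2).
Variables (m1 : {measure set T1 -> \bar R}) (m2 : {measure set T2 -> \bar R}).

Lemma integral_mfrestr d (T : measurableType d) (m : {measure set T -> \bar R})
    (D : set T) (mD : measurable D) (Doo : m D < +oo) (f : T -> \bar R) :
  measurable_fun setT f -> (forall x, 0 <= f x) ->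
  \int[mfrestr mD Doo]_x f x = \int[m]_(x in D) f x.
Proof.
move=> mf f0.
have mDc : measurable (~` D) by exact: measurableC.
rewrite -(setvU D) ge0_integral_setU//; last first.
- by rewrite /disj_set setICl.
- exact: measurable_funTS.
rewrite [X in X + _](_ : _ = 0) ?add0e; last first.
  apply: (@null_set_integral _ _ _ (mfrestr mD Doo)) => //; last by rewrite /= /mfrestr /mrestr setICl.
  exact: measurable_funTS.
 apply: eq_measure_integral => A mA AD.
by rewrite /= /mfrestr /mrestr setIidl.
Qed.

(** Restricting both measures to sets of finite measure makes them finite, which
    brings the situation back to the sigma-finite Tonelli theorem. *)
Lemma tonelli_finite (D1 : set T1) (D2 : set T2) (f : T1 * T2 -> \bar R) :
  measurable D1 -> measurable D2 -> m1 D1 < +oo -> m2 D2 < +oo ->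
  measurable_fun setT f -> (forall x, 0 <= f x) ->
  \int[m1]_(x in D1) \int[m2]_(y in D2) f (x, y) =
  \int[m2]_(y in D2) \int[m1]_(x in D1) f (x, y).
Proof.
move=> mD1 mD2 D1oo D2oo mf f0.
have mfx x : measurable_fun setT (fun y => f (x, y)) by exact: measurableT_comp.
have mfy y : measurable_fun setT (fun x => f (x, y)) by exact: measurableT_comp.
have := @fubini_tonelli _ _ _ _ _ (mfrestr mD1 D1oo) (mfrestr mD2 D2oo) f mf f0.
under [X in X = _ -> _]eq_integral do rewrite integral_mfrestr//.
under [X in _ = X -> _]eq_integral do rewrite integral_mfrestr//.
have mF := @measurable_fun_fubini_tonelli_F _ _ _ _ _ (mfrestr mD2 D2oo) f mf f0.
have mG := @measurable_fun_fubini_tonelli_G _ _ _ _ _ (mfrestr mD1 D1oo) f mf f0.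
rewrite !integral_mfrestr//.
- by move: mG; apply: eq_measurable_fun => x _; rewrite /= /fubini_G integral_mfrestr.
- by move=> x; exact: integral_ge0.
- by move: mF; apply: eq_measurable_fun => x _; rewrite /= /fubini_F integral_mfrestr.
- by move=> x; exact: integral_ge0.
Qed.

End Tonelli.

(** * Differential calculus along lines *)

Lemma sum_continuous (R : realType) (T : topologicalType) I (r : seq I) (P : pred I)
    (F : I -> T -> R) : (forall i, continuous (F i)) ->
  continuous (fun x => \sum_(i <- r | P i) F i x).
Proof.
move=> cF; elim: r => [|i r IH] x.
  by under eq_fun do rewrite big_nil; exact: cvg_cst.
under eq_fun do rewrite big_cons; case: ifPn => _; last exact: IH.
by apply: cvgD; [exact: cF|exact: IH].
Qed.

Lemma contM (R : realType) (T : topologicalType) (f g : T -> R) :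
  continuous f -> continuous g -> continuous (fun x => f x * g x).
Proof. by move=> cf cg x; apply: continuousM; [exact: cf|exact: cg]. Qed.

Lemma contD (R : realType) (T : topologicalType) (f g : T -> R) :
  continuous f -> continuous g -> continuous (fun x => f x + g x).
Proof. by move=> cf cg x; apply: continuousD; [exact: cf|exact: cg]. Qed.

Lemma contB (R : realType) (T : topologicalType) (f g : T -> R) :
  continuous f -> continuous g -> continuous (fun x => f x - g x).
Proof. by move=> cf cg x; apply: continuousB; [exact: cf|exact: cg]. Qed.

Lemma cont_sqr (R : realType) (T : topologicalType) (f : T -> R) :
  continuous f -> continuous (fun x => f x ^+ 2).
Proof. by move=> cf; exact: contM. Qed.

Lemma cont_comp (T U V : topologicalType) (f : T -> U) (g : U -> V) :
  continuous f -> continuous g -> continuous (fun x => g (f x)).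
Proof. by move=> cf cg x; apply: continuous_comp; [exact: cf|exact: cg]. Qed.

Section LineDerivatives.
Context (R : realType) (V : normedModType R).
Implicit Types (f : V -> R) (u w x y : V).

Lemma line_quotient f u y (s : R) :
  (fun h : R => h^-1 *: (((fun t : R => f (t *: u + y)) \o shift s) (h *: (1 : R)) - f (s *: u + y))) =
  (fun h : R => h^-1 *: ((f \o shift (s *: u + y)) (h *: u) - f (s *: u + y))).
Proof. by apply/funext => h /=; rewrite scaler1 scalerDl addrA. Qed.

Lemma line_is_derive f u y (s d : R) : is_derive (s *: u + y) u f d ->
  is_derive s 1 (fun t : R => f (t *: u + y)) d.
Proof.
case=> df Ef; split; first by rewrite /derivable line_quotient.
by rewrite /derive line_quotient.
Qed.

Lemma is_derive_line f u y (s d : R) : is_derive s 1 (fun t : R => f (t *: u + y)) d ->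
  is_derive (s *: u + y) u f d.
Proof.
case=> df Ef; split; first by move: df; rewrite /derivable line_quotient.
by move: Ef; rewrite /derive line_quotient.
Qed.

Lemma is_derive_dirZ f u y (h d : R) : is_derive y u f d -> is_derive y (h *: u) f (h * d).
Proof.
move=> dfy.
have d0 : is_derive (h * 0) 1 (fun t : R => f (t *: u + y)) d.
  by apply: line_is_derive; rewrite mulr0 scale0r add0r.
have dh : is_derive (0 : R) 1 ( *%R h) h.
  have := @is_deriveZ R R R id h 0 1 1 (is_derive_id _ _).
  by rewrite /GRing.scale /= mulr1.
have := is_derive1_comp (f := fun t : R => f (t *: u + y)) d0 dh.
rewrite mulrC => H; have := @is_derive_line f (h *: u) y 0 (h * d).
rewrite scale0r add0r; apply.
by move: H; congr is_derive; apply/funext => t /=; rewrite scalerA mulrC.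
Qed.

(** Moving along [w + u] is moving along [w] and then along [u]; the second step is
    controlled by the mean value theorem and the continuity of the derivative along
    [u]. *)
Lemma is_derive_dirD f u w x (d : R) : (forall y, derivable f y u) ->
  {for x, continuous (fun y => 'D_u f y)} -> is_derive x w f d ->
  is_derive x (w + u) f (d + 'D_u f x).
Proof.
move=> du cu [dw Ew].
have mvt z (h : R) : exists2 t : R, `|t| <= `|h| & f (h *: u + z) - f z = h * 'D_u f (t *: u + z).
  have lined (s : R) : is_derive s (1 : R) (fun t : R => f (t *: (h *: u) + z))
      (h * 'D_u f (s *: (h *: u) + z)).
    exact: line_is_derive (is_derive_dirZ h (derivableP (du _))).
  have [|c] := @MVT_segment R (fun t => f (t *: (h *: u) + z))
      (fun s => h * 'D_u f (s *: (h *: u) + z)) 0 1 ler01 (fun s _ => lined s).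
    by apply: derivable_within_continuous => s _; case: (lined s).
  rewrite in_itv/= subr0 mulr1 scale1r scale0r add0r => /andP[c0 c1] ->.
  exists (c * h); last by rewrite scalerA.
  by rewrite normrM (ger0_norm c0) ler_piMl.
have q0 : (fun h : R => h^-1 *: (f (h *: u + (h *: w + x)) - f (h *: w + x))) @ 0^' -->
    'D_u f x.
  apply/cvgrPdist_lt => e e0.
  have /cvgrPdist_lt/(_ e e0)/nbhs_ballP[r /= r0 hr] := cu.
  have K0 : 0 < `|w| + `|u| + 1 by rewrite ltr_wpDl// addr_ge0.
  near=> h.
  have h0 : h != 0 by near: h; exact: nbhs_dnbhs_neq.
  have [t th ->] := mvt (h *: w + x) h.
  rewrite [X in _ - X](_ : _ = 'D_u f (t *: u + (h *: w + x))); last first.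
    by rewrite [LHS]mulrA mulVf// mul1r.
  apply: hr; rewrite -ball_normE /= addrA opprD [x + _]addrC subrK normrN.
  apply: le_lt_trans (ler_normD _ _) _; rewrite !normrZ.
  apply: (@le_lt_trans _ _ (`|h| * (`|w| + `|u| + 1))).
    have := ler_wpM2r (normr_ge0 u) th; have := normr_ge0 h; nra.
  rewrite -ltr_pdivlMr//; near: h; apply: dnbhs0_lt.
  by rewrite divr_gt0.
have EE : (fun h : R => h^-1 *: ((f \o shift x) (h *: (w + u)) - f x)) =
    (fun h : R => h^-1 *: ((f \o shift x) (h *: w) - f x) +
       h^-1 *: (f (h *: u + (h *: w + x)) - f (h *: w + x))).
  apply/funext => h /=; rewrite -scalerDr; congr (_ *: _).
  have -> : h *: (w + u) + x = h *: u + (h *: w + x).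
    by rewrite scalerDr addrA [h *: w + _]addrC.
  by rewrite [RHS]addrC subrKA.
have lim : (fun h : R => h^-1 *: ((f \o shift x) (h *: (w + u)) - f x)) @ 0^' --> d + 'D_u f x.
  by rewrite EE; apply: cvgD q0; rewrite -Ew; exact: dw.
by split; [apply/cvg_ex; exists (d + 'D_u f x)|exact: cvg_lim].
Unshelve. all: by end_near. Qed.

End LineDerivatives.

Section C1functions.
Context (R : realType) (n : nat).
Implicit Types (v : 'rV[R]_n.+1 -> R) (w x : 'rV[R]_n.+1).

Definition dirder v w x : R := \sum_(i < n.+1) w 0 i * partial i v x.

(** The partial derivatives are added one coordinate at a time with
    [is_derive_dirD]. *)
Lemma C1_is_derive v w x : (forall i y, derivable v y (basis_vec R i)) ->
  (forall i, continuous (partial i v)) -> is_derive x w v (dirder v w x).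
Proof.
move=> dv cv; rewrite /dirder.
have Ew : w = \sum_(i < n.+1) w 0 i *: basis_vec R i.
  rewrite {1}[w]row_sum_delta; apply: eq_bigr => i _; by [].
rewrite {1}Ew; elim/big_rec2: _ => [|i y1 y2 _ IH]; first exact: is_derive0.
rewrite [X in is_derive _ X _ _]addrC [X in is_derive _ _ _ X]addrC.
have E y : 'D_(w 0 i *: basis_vec R i) v y = w 0 i * partial i v y.
  have : is_derive y (w 0 i *: basis_vec R i) v (w 0 i * partial i v y).
    by apply: is_derive_dirZ; exact: derivableP.
  by case.
rewrite -E; apply: is_derive_dirD => //.
  by move=> y; have [] : is_derive y (w 0 i *: basis_vec R i) v (w 0 i * partial i v y)
    by apply: is_derive_dirZ; exact: derivableP.
rewrite (_ : (fun y => _) = (fun y => w 0 i * partial i v y)); last exact/funext.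
by apply: contM; [exact: cst_continuous|exact: cv].
Qed.

Lemma dirder_continuous v w : (forall i, continuous (partial i v)) ->
  continuous (dirder v w).
Proof.
by move=> cv; apply: sum_continuous => i; apply: contM; [exact: cst_continuous|exact: cv].
Qed.

End C1functions.

Section Increment.
Context (R : realType).
Local Notation mu := (@lebesgue_measure R).

(** Integrate [2 c g' - c^2 <= g'^2], where [c] is the mean slope of [g]. *)
Lemma increment_sqr_le (g g' : R -> R) (h : R) : 0 < h ->
  (forall t : R, is_derive t (1 : R) g (g' t)) -> continuous g' ->
  (((g h - g 0) ^+ 2)%:E <= h%:E * \int[mu]_(t in `[0%R, h]) (g' t ^+ 2)%:E)%E.
Proof.
move=> h0 dg cg'.
have cg'W D : {within D, continuous g'} by exact: continuous_subspaceT.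
have cg : continuous g by move=> x; apply/differentiable_continuous/derivable1_diffP; case: (dg x).
have ftc : (\int[mu]_(t in `[0%R, h]) (g' t)%:E = (g h - g 0)%:E)%E.
  rewrite EFinB; apply: continuous_FTC2 => //.
    split; first by move=> x _; case: (dg x).
      exact/cvg_at_right_filter/cg.
    exact/cvg_at_left_filter/cg.
  by move=> x _; rewrite derive1E; case: (dg x).
have int_cont (k : R -> R) : continuous k -> mu.-integrable `[0, h] (EFin \o k).
  move=> ck; apply: continuous_compact_integrable; first exact: segment_compact.
  exact: continuous_subspaceT.
have i1 := int_cont _ cg'.
pose c := (g h - g 0) / h.
have csq : continuous (fun t => g' t ^+ 2) by apply: (@contM _ _ g' g').
have i2 := int_cont _ csq.
have i3 : mu.-integrable `[0, h] (EFin \o (fun t => 2 * c * g' t - c ^+ 2)).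
  apply: int_cont; apply: contB; last exact: cst_continuous.
  by apply: contM; [exact: cst_continuous|exact: cg'].
have Lh : (mu `[0%R, h] = h%:E)%E by rewrite lebesgue_measure_itv/= lte_fin h0 oppr0 adde0.
have lhs : (\int[mu]_(t in `[0%R, h]) (2 * c * g' t - c ^+ 2)%:E =
    (2 * c * (g h - g 0) - c ^+ 2 * h)%:E)%E.
  under eq_integral do rewrite EFinB EFinM.
  rewrite integralB_EFin//; last 2 first.
  - by apply: int_cont; apply: contM; [exact: cst_continuous|exact: cg'].
  - by apply: int_cont; exact: cst_continuous.
  under eq_integral do rewrite EFinM.
  by rewrite integralZl// ftc integral_cst//= Lh -!EFinM -EFinB.
have le : ((2 * c * (g h - g 0) - c ^+ 2 * h)%:E <=
    \int[mu]_(t in `[0%R, h]) (g' t ^+ 2)%:E)%E.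
  rewrite -lhs; apply: le_integral => // t _; rewrite lee_fin -subr_ge0.
  by rewrite (_ : _ - _ = (g' t - c) ^+ 2) ?sqr_ge0//; ring.
apply: le_trans (lee_wpmul2l _ le); last by rewrite lee_fin ltW.
rewrite -EFinM lee_fin /c le_eqVlt; apply/orP; left; apply/eqP; field.
exact: lt0r_neq0.
Qed.

End Increment.

(** * Measures dominated by Lebesgue measure *)

Lemma bigsetU_subadditive (R : realType) (T : Type) (nu : set T -> \bar R) (m : set (set T))
    I (r : seq I) (P : pred I) (F : I -> set T) :
  m set0 -> (forall A B, m A -> m B -> m (A `|` B)) -> nu set0 = 0%E ->
  (forall A B, m A -> m B -> (nu (A `|` B) <= nu A + nu B)%E) ->
  (forall i, P i -> m (F i)) ->
  (nu (\big[setU/set0]_(i <- r | P i) F i) <= \sum_(i <- r | P i) nu (F i))%E.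
Proof.
move=> m0 mU nu0 nuU mF.
suff [] : (nu (\big[setU/set0]_(i <- r | P i) F i) <= \sum_(i <- r | P i) nu (F i))%E /\
  m (\big[setU/set0]_(i <- r | P i) F i) by [].
elim: r => [|i r [IH1 IH2]]; first by rewrite !big_nil nu0.
rewrite !big_cons; case: ifPn => // Pi; split; last by apply: mU => //; exact: mF.
by apply: le_trans (nuU _ _ (mF _ Pi) IH2) _; exact: leeD.
Qed.

Section IntegralMeasureMonotone.
Local Open Scope ereal_scope.
Context (R : realType) d (T : measurableType d) (mu nu : {measure set T -> \bar R}).
Import HBNNSimple.

Lemma ge0_integral_le_measure (f : T -> \bar R) :
  (forall A, measurable A -> mu A <= nu A) -> (forall x, 0 <= f x) ->
  \int[mu]_x f x <= \int[nu]_x f x.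
Proof.
move=> munu f0; rewrite !ge0_integralTE//; apply: ge_ereal_sup => _ [h /= hf <-].
apply: (@le_trans _ _ (sintegral nu h)); last by apply: ereal_sup_ubound; exists h.
rewrite !sintegralE; apply: lee_fsum => // x [y _ <-].
by apply: lee_wpmul2l; [rewrite lee_fin|exact: munu].
Qed.
End IntegralMeasureMonotone.

(** The Borel sigma-algebra, on which measures coming from the Lebesgue and from the
    Hausdorff measure can be compared. *)
Notation borelRn R n := (g_sigma_algebraType (@open 'rV[R]_n.+1)).

Lemma prod_continuous (R : realType) (T : topologicalType) I (r : seq I) (P : pred I)
    (F : I -> T -> R) : (forall i, continuous (F i)) ->
  continuous (fun x => \prod_(i <- r | P i) F i x).
Proof.
move=> cF; elim: r => [|i r IH] x.
  by under eq_fun do rewrite big_nil; exact: cvg_cst.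
under eq_fun do rewrite big_cons; case: ifPn => _; last exact: IH.
exact: (contM (cF i) IH).
Qed.

Section LebesgueDomination.
Context (R : realType) (n : nat).
Local Notation E := 'rV[R]_n.+1.

Definition box (a b : E) : set E := [set x | forall i, a 0 i <= x 0 i <= b 0 i].

Definition cube (c : E) (rho : R) : set E := [set x | forall i, c 0 i <= x 0 i <= c 0 i + rho].

Lemma borel_open (U : set E) : open U -> measurable (U : set (borelRn R n)).
Proof. by move=> oU; exact: sub_sigma_algebra. Qed.

Lemma borel_coord i : measurable_fun setT (fun x : borelRn R n => (x : E) 0 i).
Proof.
apply: (measurability _ (RGenOpens.measurableE R)) => _ [_ [a [b ->] <-]].
rewrite setTI; apply: borel_open.
have /continuousP := @coord_continuous R 1 n.+1 0 i; apply; exact: interval_open.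
Qed.

Lemma box_closed (a b : E) : closed (box a b).
Proof.
rewrite (_ : box a b = \bigcap_(i in [set: 'I_n.+1])
   ((fun x : E => x 0 i) @^-1` `[a 0 i, b 0 i]%classic)); last first.
  apply/seteqP; split=> x /= h i; first by move=> _ /=; rewrite in_itv/=; exact: h.
  by have := h i I; rewrite /= in_itv.
apply: closed_bigI => i _; apply: closed_comp; last exact: itv_closed.
by move=> x _; exact: coord_continuous.
Qed.

Lemma borel_closed (U : set E) : closed U -> measurable (U : set (borelRn R n)).
Proof. by move=> /closed_openC/borel_open/measurableC; rewrite setCK. Qed.

Lemma borel_measurable_fun_id : measurable_fun setT (fun x : lebesgue_space R n => (x : E) : borelRn R n).
Proof.
apply: (@measurability _ _ (lebesgue_space R n) (borelRn R n) setT (fun x => x) (@open E) erefl).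
move=> _ [U oU <-].
by rewrite setTI; exact: lebesgue_open.
Qed.

Context (nu : {measure set (borelRn R n) -> \bar R}) (C : R).
Hypothesis C0 : 0 <= C.
Hypothesis nu_cube : forall c rho, 0 < rho -> (nu (cube c rho) <= (C * rho ^+ n.+1)%:E)%E.

(** Cover the box by a grid of cubes of side [rho]; the extra [rho] in each factor
    accounts for the last, partial cube. *)
Lemma box_sub_cubes (a b : E) (rho : R) : (forall i, a 0 i <= b 0 i) -> 0 < rho ->
  (nu (box a b) <= (C * \prod_(i < n.+1) (b 0 i - a 0 i + rho))%:E)%E.
Proof.
move=> ab rho0.
pose N (i : 'I_n.+1) := (Num.truncn ((b 0 i - a 0 i) / rho)).+1.
pose M := (\max_i N i)%N.
have NM i : (N i <= M)%N by exact: leq_bigmax.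
pose Q (i : 'I_n.+1) : pred 'I_M := fun k => (k < N i)%N.
pose cub (z : {ffun 'I_n.+1 -> 'I_M}) := cube (\row_i (a 0 i + (z i)%:R * rho)) rho.
have sub : box a b `<=` \big[setU/set0]_(z in family Q) cub z.
  move=> x /= xab.
  have kN (i : 'I_n.+1) : (Num.truncn ((x 0%R i - a 0%R i)%R / rho)%R < N i)%N.
    rewrite ltnS; apply: le_truncn; rewrite ler_pM2r ?invr_gt0// lerD2r.
    by case/andP: (xab i).
  pose z := [ffun i => Ordinal (leq_trans (kN i) (NM i))].
  rewrite -bigcup_pred; exists z => /=.
    by apply/familyP => i; rewrite ffunE; exact: kN.
  move=> i; rewrite mxE ffunE /=; have /andP[xa xb] := xab i.
  have x0 : 0 <= (x 0 i - a 0 i) / rho by rewrite divr_ge0 ?subr_ge0// ltW.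
  have /andP[h1 h2] := truncn_itv x0.
  by move: h1 h2; rewrite ler_pdivlMr// ltr_pdivrMr// -natr1; nra.
have mc z : measurable (cub z : set (borelRn R n)).
  apply: borel_closed.
  rewrite (_ : cub z = box (\row_i (a 0 i + (z i)%:R * rho)) (\row_i (a 0 i + (z i)%:R * rho + rho))).
    exact: box_closed.
  by apply/seteqP; split => x h i; have := h i; rewrite !mxE.
apply: le_trans (le_measure nu _ _ sub) _.
- by rewrite inE; apply: borel_closed; exact: box_closed.
- by rewrite inE; exact: bigsetU_measurable.
have sa : (nu (\big[setU/set0]_(z in family Q) cub z) <= \sum_(z in family Q) nu (cub z))%E.
  apply: (@bigsetU_subadditive R _ nu (@measurable _ (borelRn R n))) => //.
  - exact: measurableU.
  - by move=> A B mA mB; exact: measureU2.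
apply: le_trans sa _.
apply: (@le_trans _ _ (\sum_(z in family Q) (C * rho ^+ n.+1)%:E)%E).
  by apply: lee_sum => z _; exact: nu_cube.
rewrite sumEFin lee_fin -big_distrr/=; apply: ler_wpM2l => //.
rewrite (eq_bigr (fun z : {ffun 'I_n.+1 -> 'I_M} => \prod_(i < n.+1) rho)); last first.
  by move=> z _; rewrite prodr_const card_ord.
rewrite -(bigA_distr_big_dep _ (fun i (_ : 'I_M) => rho)).
apply: ler_prod => i _; rewrite sumr_ge0 => [/=|? _]; last exact: ltW.
rewrite sumr_const -(mulr_natr rho) (_ : #|_| = N i); last first.
  by rewrite -sum1_card (eq_bigl (fun k : 'I_M => (k < N i)%N))// (big_ord_narrow (NM i)) sum1_card card_ord.
rewrite -natr1 mulrDr mulr1 lerD2r mulrC -ler_pdivlMr//.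
have : 0 <= (b 0 i - a 0 i) / rho by rewrite divr_ge0 ?subr_ge0// ltW.
by move=> /truncn_itv/andP[].
Qed.

Lemma box_dominated (a b : E) : (forall i, a 0 i <= b 0 i) ->
  (nu (box a b) <= (C * \prod_(i < n.+1) (b 0 i - a 0 i))%:E)%E.
Proof.
move=> ab.
have fin : nu (box a b) \is a fin_num.
  rewrite ge0_fin_numE//; apply: le_lt_trans (box_sub_cubes ab ltr01) _; exact: ltry.
rewrite -(fineK fin) lee_fin.
have cv : (C * \prod_(i < n.+1) (b 0 i - a 0 i + rho)) @[rho --> 0^'+] -->
    C * \prod_(i < n.+1) (b 0 i - a 0 i + 0).
  apply: (@cvg_at_right_filter _ _ (fun rho : R => C * \prod_(i < n.+1) (b 0 i - a 0 i + rho)) 0).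
  apply: continuousM; first exact: cst_continuous.
  apply: prod_continuous => i.
  by apply: contD; [exact: cst_continuous|move=> z].
rewrite [leRHS](_ : _ = C * \prod_(i < n.+1) (b 0 i - a 0 i + 0)); last first.
  by congr (_ * _); apply: eq_bigr => i _; rewrite addr0.
apply: (cvgr_to_ge cv).
near=> rho.
have r0 : 0 < rho by near: rho; exact: nbhs_right_gt.
by have := box_sub_cubes ab r0; rewrite -{1}(fineK fin) lee_fin.
Unshelve. all: by end_near. Qed.

(** A bound on cubes passes to boxes by letting the mesh of the grid tend to zero,
    and then to all Borel sets because Lebesgue measure is an infimum over covers by
    boxes. *)
Lemma lebesgue_dominates (A : set E) : 0 < C -> measurable (A : set (borelRn R n)) ->
  (nu A <= C%:E * lebesgue R n A)%E.
Proof.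
move=> Cp mA; rewrite -lee_pdivrMl//; apply: le_ereal_inf_tmp => _ [F [mF FA] <-].
have g0 k : (0 <= box_gauge (F k))%E by exact: box_gauge_ge0.
have [Foo|Ffin] := pselect (exists k, box_gauge (F k) = +oo%E).
  by case: Foo => k Fk; rewrite (eseries_pinfty _ _ Fk) ?leey// => i _; rewrite -ltNye (lt_le_trans _ (g0 i)).
apply/lee_addgt0Pr => e e0.
have /choice[p hp] : forall k, exists p : E * E, [/\ (forall i, p.1 0 i <= p.2 0 i),
    F k `<=` box p.1 p.2 &
    ((\prod_(i < n.+1) (p.2 0 i - p.1 0 i))%:E <= box_gauge (F k) + (e / (2 ^ k.+1)%:R)%:E)%E].
  move=> k; have ek : (0 < e / (2 ^ k.+1)%:R)%R by rewrite divr_gt0// ltr0n expn_gt0.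
  have fin : box_gauge (F k) \is a fin_num.
    by rewrite ge0_fin_numE// ltey; apply/eqP => h; apply: Ffin; exists k.
  have [_ [[a b] /= [ab Fab] <-] h] := lb_ereal_inf_adherent ek fin.
  by exists (a, b); split => //; exact: ltW.
apply: (@le_trans _ _ (C^-1%:E * \sum_(k <oo) nu (box (p k).1 (p k).2))%E).
  apply: lee_wpmul2l; first by rewrite lee_fin invr_ge0.
  have mB k : measurable (box (p k).1 (p k).2 : set (borelRn R n)).
    by apply: borel_closed; exact: box_closed.
  apply: (measure_sigma_subadditive nu mB mA).
  by move=> x /FA [k _ Fk]; exists k => //; have [_ /(_ x Fk)] := hp k.
apply: (@le_trans _ _ (\sum_(k <oo) (box_gauge (F k) + (e / (2 ^ k.+1)%:R)%:E))%E).
  rewrite -nneseriesZl//.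
  apply: lee_nneseries => k *; first by rewrite mule_ge0// lee_fin invr_ge0.
  have [pab _ h] := hp k; apply: le_trans h; rewrite lee_pdivrMl// -EFinM.
  exact: box_dominated.
by apply: le_trans (epsilon_trick _ _ (ltW e0)) _ => // k.
Qed.

End LebesgueDomination.

(** * Euclidean norm and Hausdorff measure of Lipschitz graphs *)

Section EuclideanNorm.
Context (R : realType).

Lemma enorm_ge0 d (x : 'rV[R]_d) : 0 <= enorm x.
Proof. exact: sqrtr_ge0. Qed.

Lemma enorm_sqr d (x : 'rV[R]_d) : enorm x ^+ 2 = \sum_(i < d) x 0 i ^+ 2.
Proof. by rewrite sqr_sqrtr// sumr_ge0// => i _; exact: sqr_ge0. Qed.

Lemma enorm_lt d (x : 'rV[R]_d) (r : R) : 0 <= r -> (enorm x < r) = (\sum_(i < d) x 0 i ^+ 2 < r ^+ 2).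
Proof. by move=> r0; rewrite -enorm_sqr ltr_pXn2r// nnegrE ?enorm_ge0. Qed.

Lemma enorm_le d (x : 'rV[R]_d) (r : R) : 0 <= r -> (enorm x <= r) = (\sum_(i < d) x 0 i ^+ 2 <= r ^+ 2).
Proof. by move=> r0; rewrite -enorm_sqr ler_pXn2r// nnegrE ?enorm_ge0. Qed.

Lemma enorm_le_sum d (x : 'rV[R]_d) : enorm x <= \sum_(i < d) `|x 0 i|.
Proof.
have s0 m (y : 'I_m -> R) : 0 <= \sum_(i < m) `|y i| by apply: sumr_ge0.
rewrite enorm_le; last exact: s0.
have key m (y : 'I_m -> R) : \sum_(i < m) y i ^+ 2 <= (\sum_(i < m) `|y i|) ^+ 2.
  elim: m y => [|m IH] y; first by rewrite !big_ord0.
  rewrite !big_ord_recr/=; set S := \sum_(i < m) _ in IH *.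
  have := IH (fun i => y (widen_ord (leqnSn m) i)).
  have := s0 _ (fun i => y (widen_ord (leqnSn m) i)).
  move=> a0 h; rewrite sqrrD (real_normK (num_real _)) lerD2r.
  by apply: le_trans h _; rewrite lerDl mulrn_wge0// mulr_ge0.
exact: key.
Qed.

Lemma enormD_sqr d (x y : 'rV[R]_d) : enorm (x + y) ^+ 2 <= 2 * enorm x ^+ 2 + 2 * enorm y ^+ 2.
Proof.
rewrite !enorm_sqr !mulr_sumr -big_split/=; apply: ler_sum => i _; rewrite mxE.
by have := sqr_ge0 (x 0 i - y 0 i); nra.
Qed.

Lemma enorm_orthogonal d (Q : 'M[R]_d) (x : 'rV[R]_d) : Q *m Q^T = 1%:M ->
  enorm (x *m Q) = enorm x.
Proof.
have E (y : 'rV[R]_d) : \sum_(i < d) y 0 i ^+ 2 = (y *m y^T) 0 0.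
  by rewrite mxE; apply: eq_bigr => i _; rewrite mxE expr2.
move=> QQ; rewrite /enorm; congr Num.sqrt.
by rewrite !E trmx_mul mulmxA -(mulmxA x) QQ mulmx1.
Qed.

Lemma enormZ d (a : R) (x : 'rV[R]_d) : enorm (a *: x) ^+ 2 = a ^+ 2 * enorm x ^+ 2.
Proof.
by rewrite !enorm_sqr mulr_sumr; apply: eq_bigr => i _; rewrite mxE exprMn.
Qed.

Lemma lift_max_widen n (i : 'I_n) : lift ord_max i = widen_ord (leqnSn n) i.
Proof. by apply: val_inj => /=; rewrite /bump leqNgt ltn_ord. Qed.

Lemma rV_continuous (T : topologicalType) d (f : T -> 'rV[R]_d) :
  (forall i, continuous (fun x => f x 0 i)) -> continuous f.
Proof.
move=> cf x; apply/cvg_ballP => e e0.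
have H : \forall y \near x, forall i, `|f x 0 i - f y 0 i| < e.
  by apply: filter_forall => i; have /cvgrPdist_lt/(_ e e0) := cf i x.
by apply: filterS H => y hy; apply/rV_ballE.
Qed.

Lemma mulmx_row_continuous d m (Q : 'M[R]_(d, m)) : continuous (fun x : 'rV[R]_d => x *m Q).
Proof.
apply: rV_continuous => j.
rewrite (_ : (fun x => _) = fun x : 'rV[R]_d => \sum_(i < d) x 0 i * Q i j); last first.
  by apply/funext => x; rewrite mxE.
apply: sum_continuous => i; apply: contM; last exact: cst_continuous.
exact: coord_continuous.
Qed.

Lemma enorm_ball_open d (x0 : 'rV[R]_d) (r : R) : 0 <= r -> open [set x | enorm (x - x0) < r].
Proof.
move=> r0; have -> : [set x | enorm (x - x0) < r] =
    (fun x : 'rV[R]_d => \sum_(i < d) (x 0 i - x0 0 i) ^+ 2) @^-1` [set t | t < r ^+ 2].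
  have Es (x : 'rV[R]_d) : \sum_(i < d) (x - x0) 0 i ^+ 2 = \sum_(i < d) (x 0 i - x0 0 i) ^+ 2.
    by apply: eq_bigr => i _; rewrite !mxE.
  by apply/seteqP; split => x /=; rewrite enorm_lt// Es.
apply: open_comp; last exact: open_lt.
move=> x _; apply: sum_continuous => i; apply: cont_sqr; apply: contB; last exact: cst_continuous.
exact: coord_continuous.
Qed.

End EuclideanNorm.

Section Lipschitz.
Context (R : realType) (n : nat) (gamma : 'rV[R]_n -> R).

(** The partial derivatives are Lipschitz, hence bounded on the cube; the mean value
    theorem is applied along the segment from [z'] to [z]. *)
Lemma C11_lipschitz (z0 : 'rV[R]_n) (r : R) : C11 gamma -> 0 <= r ->
  exists2 M, 0 <= M & forall z z' : 'rV[R]_n,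
    (forall i, `|z 0 i - z0 0 i| <= r) -> (forall i, `|z' 0 i - z0 0 i| <= r) ->
    `|gamma z - gamma z'| <= M * \sum_(i < n) `|z 0 i - z' 0 i|.
Proof.
move=> [dg [L Lg]] r0.
pose M := \sum_(i < n) `|partial i gamma z0| + `|L| * (n%:R * r).
have nr : 0 <= n%:R * r by rewrite mulr_ge0.
exists M; first by rewrite addr_ge0 ?sumr_ge0// mulr_ge0.
move=> z z' hz hz'.
pose w := z - z'.
have dline (s : R) : is_derive s (1 : R) (fun t : R => gamma (t *: w + z'))
    (\sum_(i < n) w 0 i * partial i gamma (s *: w + z')).
  apply: line_is_derive; split; first exact: diff_derivable.
  move: (s *: w + z') => p; rewrite deriveE// {1}[w]row_sum_delta linear_sum; apply: eq_bigr => i _.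
  by rewrite linearZ /partial deriveE.
have [|s] := @MVT_segment R (fun t : R => gamma (t *: w + z')) _ 0 1 ler01 (fun s _ => dline s).
  by apply: derivable_within_continuous => s _; case: (dline s).
rewrite in_itv/= => /andP[s0 s1]; rewrite subr0 mulr1 scale1r scale0r add0r subrK => ->.
apply: le_trans (ler_norm_sum _ _ _) _; rewrite mulr_sumr; apply: ler_sum => i _.
rewrite normrM !mxE mulrC; apply: ler_wpM2r => //.
set p := s *: w + z'.
have pz : enorm (p - z0) <= n%:R * r.
  apply: le_trans (enorm_le_sum _) _.
  rewrite -[n in n%:R](card_ord n) -sumr_const mulr_suml.
  apply: ler_sum => j _; rewrite mul1r !mxE.
  have := hz j; have := hz' j; rewrite !ler_norml => /andP[a1 a2] /andP[b1 b2].
  by apply/andP; split; nra.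
have := Lg i p z0; rewrite -/p => h.
have h2 : L * enorm (p - z0) <= `|L| * (n%:R * r).
  apply: le_trans (ler_norm _) _; rewrite normrM; apply: ler_wpM2l => //.
  by rewrite ger0_norm// enorm_ge0.
have h3 : `|partial i gamma z0| <= \sum_(i < n) `|partial i gamma z0|.
  by rewrite (bigD1 i)//= lerDl sumr_ge0.
have h4 := ler_normB (partial i gamma p - partial i gamma z0) (- partial i gamma z0).
by rewrite opprK subrK normrN in h4; rewrite /M; lra.
Qed.

End Lipschitz.

Section HausdorffOfPieces.
Context (R : realType) (d s : nat) (delta : R).

Definition content_outer : {outer_measure set 'rV[R]_d -> \bar R} :=
  HB.pack_for {outer_measure set 'rV[R]_d -> \bar R} (hausdorff_content s delta)
    (isOuterMeasure.Build R 'rV[R]_d (hausdorff_content s delta)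
      (@mu_ext0 _ (any_set_type 'rV[R]_d) R _ (@hausdorff_gauge0 R d s delta) (@hausdorff_gauge_ge0 R d s delta))
      (@mu_ext_ge0 _ (any_set_type 'rV[R]_d) R _ (@hausdorff_gauge_ge0 R d s delta))
      (@le_mu_ext _ (any_set_type 'rV[R]_d) R (@hausdorff_gauge R d s delta))
      (@mu_ext_sigma_subadditive _ (any_set_type 'rV[R]_d) R _ (@hausdorff_gauge_ge0 R d s delta))).

Lemma content_piece (A : set 'rV[R]_d) (l : R) : 0 <= l -> l <= delta ->
  (forall x y, A x -> A y -> enorm (x - y) <= l) ->
  (content_outer A <= (unit_ball_volume R s * (l / 2) ^+ s)%:E)%E.
Proof.
move=> l0 ld Al.
have cA : (content_outer A <= hausdorff_gauge s delta A)%E.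
  by apply: mu_ext_le; [exact: hausdorff_gauge0|exact: hausdorff_gauge_ge0].
apply: le_trans cA _; rewrite /hausdorff_gauge; case: ifPn => [_|/set0P A0].
  by rewrite lee_fin mulr_ge0 ?unit_ball_volume_ge0// exprn_ge0// divr_ge0.
have dl : (diam A <= l%:E)%E.
  by apply: ge_ereal_sup => _ [[x y] /= [Ax Ay] <-]; rewrite lee_fin; exact: Al.
rewrite ifT; last by apply: le_trans dl _; rewrite lee_fin.
have d0 := diam_ge0 A0.
have dfin : diam A \is a fin_num by rewrite ge0_fin_numE// (le_lt_trans dl)// ltry.
rewrite lee_fin; apply: ler_wpM2l; first exact: unit_ball_volume_ge0.
rewrite lerXn2r ?nnegrE ?divr_ge0 ?fine_ge0//.
by rewrite ler_wpM2r// -lee_fin fineK.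
Qed.

(** Covering [A] by [#|I|] pieces of diameter at most [l] bounds its content by
    [#|I|] times the gauge of one piece. *)
Lemma content_pieces (I : finType) (F : I -> set 'rV[R]_d) (A : set 'rV[R]_d) (l : R) :
  0 <= l -> l <= delta -> A `<=` \bigcup_i F i ->
  (forall i x y, F i x -> F i y -> enorm (x - y) <= l) ->
  (hausdorff_content s delta A <= (#|I|%:R * (unit_ball_volume R s * (l / 2) ^+ s))%:E)%E.
Proof.
move=> l0 ld AF Fl.
apply: (@le_trans _ _ (content_outer (\big[setU/set0]_(i : I) F i))).
  apply: (le_outer_measure content_outer) => x /AF [i _ Fi].
  by rewrite -(@bigcup_pred I _ predT F); exists i.
apply: (@le_trans _ _ (\sum_(i : I) content_outer (F i))%E).
  apply: (@bigsetU_subadditive R _ content_outer setT) => // A' B _ _; exact: outer_measureU2.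
apply: (@le_trans _ _ (\sum_(i : I) (unit_ball_volume R s * (l / 2) ^+ s)%:E)%E).
  by apply: lee_sum => i _; apply: content_piece => //; exact: Fl.
by rewrite sumEFin sumr_const mulr_natl; exact: lexx.
Qed.

End HausdorffOfPieces.

(** * Collars of the boundary *)

Definition image_measure d d' (T1 : measurableType d) (T2 : measurableType d') (R : realType)
    (m : {measure set T1 -> \bar R}) (f : T1 -> T2) (mf : measurable_fun setT f) :
    {measure set T2 -> \bar R} :=
  measure_function_pushforward__canonical__measure_function_Measure m mf.

Lemma ge0_integral_image_measure d d' (T1 : measurableType d) (T2 : measurableType d')
    (R : realType) (m : {measure set T1 -> \bar R}) (f : T1 -> T2) (mf : measurable_fun setT f)
    (g : T2 -> \bar R) : measurable_fun setT g -> (forall x, 0 <= g x)%E ->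
  (\int[image_measure m mf]_y g y = \int[m]_x g (f x))%E.
Proof. by move=> mg g0; have := ge0_integral_pushforward mf m measurableT mg (in1W g0). Qed.

(** Sliding the measure [m] in the direction [e]. If the points of [Gam] which can
    be slid to distance [rho] of a given point have mass O(rho^n), then the slid
    measure of a cube of side [rho] is O(rho^(n+1)), since the sliding time spent in
    the cube is O(rho); so the slid measure is dominated by Lebesgue measure. *)
Section Slide.
Context (R : realType) (n : nat) (disp : measure_display) (T : measurableType disp).
Local Notation E := 'rV[R]_n.+1.
Variables (m : {measure set T -> \bar R}) (Gam : set T) (p : T -> E) (e : E) (C1 : R).
Hypotheses (Gam_measurable : measurable Gam) (Gam_finite : (m Gam < +oo)%E).
Hypotheses (p_measurable : forall i, measurable_fun setT (fun y => p y 0 i)).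
Hypotheses (enorm_e : enorm e = 1) (C10 : 0 < C1).
Hypothesis near_e : forall (q : E) (rho : R), 0 < rho -> exists Y : set T,
  [/\ measurable Y, (m Y <= (C1 * rho ^+ n)%:E)%E, Y `<=` Gam &
      forall y t, Gam y -> enorm (p y + t *: e - q) <= rho -> Y y].
Variables (h : R) (h0 : 0 < h).

Let I01 : set R := `]0%R, h]%classic.
Let mI : measurable (I01 : set (measurableTypeR R)). Proof. exact: measurable_itv. Qed.
Let Ifin : (@lebesgue_measure R I01 < +oo)%E.
Proof. by rewrite /I01 lebesgue_measure_itv/= lte_fin h0 -EFinB ltry. Qed.

Let m1 : {finite_measure set T -> \bar R} := mfrestr Gam_measurable Gam_finite.
Let m2 : {finite_measure set (measurableTypeR R) -> \bar R} := mfrestr mI Ifin.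
Let Phi (z : T * measurableTypeR R) : borelRn R n := (p z.1 + z.2 *: e).

Let Phi_coord i : measurable_fun setT (fun z => (Phi z : E) 0 i).
Proof.
rewrite (_ : (fun z => _) = (fun z : T * measurableTypeR R =>
   p z.1 0 i + z.2 * e 0 i)); last by apply/funext => z; rewrite !mxE.
apply: measurable_funD.
  exact: (measurableT_comp (p_measurable i)).
by apply: measurable_funM.
Qed.

Let Phi_measurable : measurable_fun setT Phi.
Proof.
apply: (@measurability _ _ _ (borelRn R n) setT Phi (@open E) erefl).
move=> _ [V oV <-]; rewrite setTI.
exact: (preimage_open_measurable Phi_coord).
Qed.

Let nu : {measure set (borelRn R n) -> \bar R} := image_measure (m1 \x m2)%E Phi_measurable.

Lemma cube_measurable (c : E) rho : measurable (cube c rho : set (borelRn R n)).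
Proof.
apply: borel_closed; rewrite (_ : cube c rho = box c (\row_i (c 0 i + rho))).
  exact: box_closed.
by apply/seteqP; split => x hx i; have := hx i; rewrite !mxE.
Qed.

Let Cs : R := 2 * n.+1%:R * (C1 * n.+1%:R ^+ n).
Let Cs0 : 0 < Cs. Proof. by rewrite !mulr_gt0// exprn_gt0. Qed.

Let slide_cube_le c rho : 0 < rho -> (nu (cube c rho) <= (Cs * rho ^+ n.+1)%:E)%E.
Proof.
pose D : R := n.+1%:R.
have D0 : 0 < D by [].
move=> rho0.
have cube_diff (q q' : E) : cube c rho q -> cube c rho q' -> enorm (q - q') <= D * rho.
  move=> hp hq; apply: le_trans (enorm_le_sum _) _.
  rewrite mulr_natl -[n.+1 in leRHS](card_ord n.+1) -sumr_const; apply: ler_sum => i _.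
  by rewrite !mxE ler_norml; have := hp i; have := hq i; lra.
have cc : cube c rho c by move=> i; rewrite lexx lerDl ltW.
have Drho : 0 < D * rho by rewrite mulr_gt0.
have [Y [mY Yle YG HY]] := near_e c Drho.
have sec (y : T) : Gam y -> (m2 (xsection (Phi @^-1` cube c rho) y) <=
    (2 * (D * rho))%:E * (\1_Y y)%:E)%E.
  move=> Gy; have [->|/set0P[t0]] := eqVneq (xsection (Phi @^-1` cube c rho) y) set0.
    by rewrite measure0 -EFinM lee_fin !mulr_ge0// ltW.
  rewrite /xsection /= inE /= => ht0.
  have Yy : Y y by apply: (HY y t0 Gy); exact: cube_diff ht0 cc.
  rewrite indicE mem_set// mule1.
  apply: (@le_trans _ _ (@lebesgue_measure R `[t0 - D * rho, t0 + D * rho])).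
    rewrite /m2 /= /mfrestr /mrestr; apply: le_measure; rewrite ?inE//.
    - apply: measurableI => //; apply: measurable_xsection.
      rewrite -[X in measurable X]setTI; apply: Phi_measurable => //.
      exact: cube_measurable.
    move=> t [+ _]; rewrite /xsection /= inE /= in_itv/= => ht.
    have := cube_diff _ _ ht ht0; rewrite /Phi /= opprD addrACA subrr add0r -scalerBl.
    rewrite -(ler_pXn2r (n := 2))// ?nnegrE ?enorm_ge0 ?(ltW Drho)//.
    rewrite enormZ enorm_e expr1n mulr1 => H.
    have : `|t - t0| <= D * rho.
      by rewrite -(ler_pXn2r (n := 2))// ?nnegrE ?(ltW Drho)// real_normK ?num_real.
    by rewrite ler_norml; lra.
  rewrite lebesgue_measure_itv/= lte_fin ifT; last by lra.
  by rewrite -EFinB lee_fin; lra.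
rewrite /nu /= /image_measure /= /pushforward /= /product_measure1.
have mP : measurable (Phi @^-1` cube c rho).
  rewrite -[X in measurable X]setTI; apply: Phi_measurable => //.
  exact: cube_measurable.
rewrite /m1 integral_mfrestr; last 2 first.
- exact: measurable_fun_xsection.
- by [].
apply: (@le_trans _ _ (\int[m]_(y in Gam) ((2 * (D * rho))%:E * (\1_Y y)%:E))%E).
  apply: ge0_le_integral => //.
  - exact: measurable_funTS (measurable_fun_xsection _ mP).
  - by apply: measurable_funeM; apply/measurable_EFinP; exact: measurable_indic.
rewrite ge0_integralZl_EFin//; last 2 first.
- by apply/measurable_EFinP; exact: measurable_indic.
- by rewrite mulr_ge0// ltW.
rewrite integral_indic// (setIidl YG).
apply: le_trans (lee_wpmul2l _ Yle) _; first by rewrite lee_fin mulr_ge0// ltW.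
rewrite -EFinM lee_fin exprMn exprS le_eqVlt; apply/orP; left; apply/eqP.
by rewrite /Cs -/D; ring.
Qed.

Let Lb : {measure set (borelRn R n) -> \bar R} :=
  image_measure (lebesgue R n) (@borel_measurable_fun_id R n).

Lemma integral_borel_lebesgue (f : borelRn R n -> \bar R) :
  measurable_fun setT f -> (forall x, 0 <= f x)%E ->
  (\int[Lb]_x f x = \int[lebesgue R n]_x f x)%E.
Proof.
move=> mf f0.
exact: ge0_integral_image_measure.
Qed.

(** The left-hand side is the integral of [g] against the slid measure, which lives
    on [Omega] and is dominated by a multiple of Lebesgue measure. *)
Lemma slide_dominated (Omega : set E) (g : E -> R) : open Omega ->
  (forall y t, Gam y -> 0 < t -> t <= h -> Omega (p y + t *: e)) ->
  continuous g -> (forall x, 0 <= g x) ->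
    (\int[m]_(y in Gam) \int[@lebesgue_measure R]_(t in I01) (g (p y + t *: e))%:E <=
     Cs%:E * \int[lebesgue R n]_(x in Omega) (g x)%:E)%E.
Proof.
move=> oO GO cg g0.
pose g' (x : borelRn R n) : \bar R := (((EFin \o g) : E -> \bar R) \_ Omega) x.
have mg : measurable_fun setT ((EFin \o g) : borelRn R n -> \bar R).
  apply/measurable_EFinP.
  exact: (@continuous_comp_measurable R n _ (borelRn R n) id g (@borel_coord R n)).
have mO : measurable (Omega : set (borelRn R n)) by exact: borel_open.
have mg' : measurable_fun setT g'.
  by apply/(measurable_restrictT _ mO)/measurable_funTS.
have g'0 x : (0 <= g' x)%E by rewrite /g' patchE; case: ifPn => // _; rewrite lee_fin.
have mgP : measurable_fun setT (g' \o Phi) by exact: measurableT_comp.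
have E1 : (\int[m]_(y in Gam) \int[@lebesgue_measure R]_(t in I01) (g (p y + t *: e))%:E =
  \int[nu]_x g' x)%E.
  transitivity (\int[m]_(y in Gam) \int[@lebesgue_measure R]_(t in I01) (g' \o Phi) (y, t))%E.
    apply: eq_integral => y /set_mem Gy; apply: eq_integral => t /set_mem.
    rewrite /I01 /= in_itv/= => /andP[t0 th].
    by rewrite /g' /Phi /= patchE ifT//; apply/mem_set; exact: GO.
  rewrite /nu ge0_integral_image_measure//.
  rewrite (@fubini_tonelli1 _ _ _ _ _ _ _ (g' \o Phi))//; last by move=> z; exact: g'0.
  transitivity (\int[m]_(y in Gam) fubini_F m2 (g' \o Phi) y)%E; last first.
    apply/esym/integral_mfrestr.
      exact: (@measurable_fun_fubini_tonelli_F _ _ _ _ _ m2 _ mgP (fun z => g'0 (Phi z))).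
    by move=> y; apply: integral_ge0 => t _; exact: g'0.
  apply: eq_integral => y _; apply/esym/integral_mfrestr.
    exact: (measurableT_comp mgP (pair1_measurable y)).
  by move=> t; exact: g'0.
rewrite E1.
have dom A : measurable A -> (nu A <= mscale (NngNum (ltW Cs0)) Lb A)%E.
  by move=> mA; have := @lebesgue_dominates R n nu Cs (ltW Cs0) slide_cube_le A Cs0 mA.
apply: le_trans (ge0_integral_le_measure dom g'0) _.
have E2 : (\int[Lb]_x g' x = \int[lebesgue R n]_(x in Omega) (g x)%:E)%E.
  by rewrite integral_borel_lebesgue// [RHS]integral_mkcond.
by rewrite ge0_integral_mscale// E2.
Qed.

End Slide.

(** A piece of the boundary without reference to its chart: in the open set [U] the
    direction [e] points into [Omega], [ht] measures the height above the boundary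
    along [e], and sliding the surface measure along [e] is dominated by Lebesgue
    measure. *)
Record collar (R : realType) (n : nat) (Omega U : set 'rV[R]_n.+1) (e : 'rV[R]_n.+1)
    (ht : 'rV[R]_n.+1 -> R) (width C : R) : Prop := Collar {
  collar_open : open U;
  collar_width_gt0 : 0 < width;
  collar_const_gt0 : 0 < C;
  collar_dir : enorm e = 1;
  collar_height_continuous : continuous ht;
  collar_height_shift : forall x t, ht (x + t *: e) = ht x + t;
  collar_inside : forall x t, U x -> 0 <= t -> t < width -> 0 < ht x + t -> Omega (x + t *: e);
  collar_height_gt0 : forall x, U x -> Omega x -> 0 < ht x;
  collar_height_boundary : forall x, U x -> boundary Omega x -> ht x = 0;
  collar_finite : (surface R n (boundary Omega `&` U) < +oo)%E;
  collar_slide : forall (h : R) (g : 'rV[R]_n.+1 -> R), 0 < h -> h < width ->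
    continuous g -> (forall x, 0 <= g x) ->
    (\int[surface R n]_(y in boundary Omega `&` U)
        \int[@lebesgue_measure R]_(t in `]0%R, h]) (g (y + t *: e))%:E <=
     C%:E * \int[lebesgue R n]_(x in Omega) (g x)%:E)%E }.

Section Charts.
Context (R : realType) (n : nat).
Local Notation E := 'rV[R]_n.+1.
Variables (Omega : set E) (x0 : E) (r : R) (Q : 'M[R]_n.+1) (gamma : 'rV[R]_n -> R).
Hypotheses (Omega_open : open Omega) (r0 : 0 < r) (QQ : Q *m Q^T = 1%:M) (Hgamma : C11 gamma).
Hypothesis (epi : forall x, enorm (x - x0) < r ->
          (Omega x <-> gamma (first_coords (x *m Q)) < (x *m Q) 0 ord_max)).

Let e : E := delta_mx 0 ord_max *m Q^T.
Let ht (x : E) := (x *m Q) 0 ord_max - gamma (first_coords (x *m Q)).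
Let U := [set x | enorm (x - x0) < r / 2].
Let Gam := boundary Omega `&` U.

Let QTQ : Q^T *m Q = 1%:M. Proof. exact: mulmx1C. Qed.

Let eQ : e *m Q = delta_mx 0 ord_max.
Proof. by rewrite -mulmxA QTQ mulmx1. Qed.

Let enorm_e : enorm e = 1.
Proof.
rewrite -(enorm_orthogonal e QQ) eQ /enorm (bigD1 ord_max)//= !mxE !eqxx expr1n big1 ?addr0 ?sqrtr1//.
by move=> i /negbTE ni; rewrite !mxE ni andbF expr0n.
Qed.

Let fcD (x y : E) : first_coords (x + y) = first_coords x + first_coords y.
Proof. by apply/rowP => i; rewrite !mxE. Qed.

Let fc_e : first_coords (delta_mx 0 ord_max : E) = 0.
Proof. by apply/rowP => i; rewrite !mxE [lift _ _ == _]eq_sym (negbTE (neq_lift ord_max i)) andbF. Qed.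

Let fcZ a (x : E) : first_coords (a *: x) = a *: first_coords x.
Proof. by apply/rowP => i; rewrite !mxE. Qed.

Let fc_slide x t : first_coords ((x + t *: e) *m Q) = first_coords (x *m Q).
Proof. by rewrite mulmxDl -scalemxAl eQ fcD fcZ fc_e scaler0 addr0. Qed.

Let ht_shift x t : ht (x + t *: e) = ht x + t.
Proof.
rewrite /ht fc_slide mulmxDl -scalemxAl eQ !mxE !eqxx mulr1; ring.
Qed.

Let fc_continuous : continuous (fun x : E => first_coords (x *m Q)).
Proof.
apply: rV_continuous => i.
rewrite (_ : (fun x => _) = (fun x : E => (x *m Q) 0 (lift ord_max i))); last first.
  by apply/funext => x; rewrite mxE.
apply: (@cont_comp _ _ _ (fun x : E => x *m Q) (fun y : E => y 0 (lift ord_max i))).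
  exact: mulmx_row_continuous.
exact: coord_continuous.
Qed.

Let ht_continuous : continuous ht.
Proof.
apply: contB.
  apply: (@cont_comp _ _ _ (fun x : E => x *m Q) (fun y : E => y 0 ord_max)).
    exact: mulmx_row_continuous.
  exact: coord_continuous.
apply: (@cont_comp _ _ _ (fun x : E => first_coords (x *m Q)) gamma).
  exact: fc_continuous.
by move=> z; apply: differentiable_continuous; case: Hgamma.
Qed.

Let U_open : open U. Proof. by apply: enorm_ball_open; rewrite divr_ge0// ltW. Qed.

Let U_ball x : U x -> enorm (x - x0) < r.
Proof. by move=> h; apply: lt_trans h _; rewrite ltr_pdivrMr// ltr_pMr// ltr1n. Qed.

Let slide_ball x t : U x -> 0 <= t -> t < r / 2 -> enorm (x + t *: e - x0) < r.
Proof.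
move=> Ux t0 tr; rewrite addrAC.
rewrite -(ltr_pXn2r (n := 2))// ?nnegrE ?enorm_ge0 ?(ltW r0)//.
apply: le_lt_trans (enormD_sqr _ _) _; rewrite enormZ enorm_e expr1n mulr1.
have : enorm (x - x0) < r / 2 by [].
by have := enorm_ge0 (x - x0); nra.
Qed.

Let slide_inside x t : U x -> 0 <= t -> t < r / 2 -> 0 < ht x + t -> Omega (x + t *: e).
Proof.
move=> Ux t0 tr h; apply/(epi (slide_ball Ux t0 tr)).
by rewrite -subr_gt0 -/(ht _) ht_shift.
Qed.

Let height_gt0 x : U x -> Omega x -> 0 < ht x.
Proof. by move=> /U_ball/epi H /H; rewrite subr_gt0. Qed.

Let boundaryE x : boundary Omega x <-> closure Omega x /\ ~ Omega x.
Proof. by rewrite /boundary ((interior_id _).1 Omega_open); split => -[]. Qed.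

Let height_boundary x : U x -> boundary Omega x -> ht x = 0.
Proof.
move=> Ux /boundaryE[cx nx]; apply/eqP; rewrite eq_le; apply/andP; split.
  rewrite leNgt; apply/negP => h; apply: nx; apply/(epi (U_ball Ux)).
  by rewrite -subr_gt0.
rewrite leNgt; apply/negP => h.
have : nbhs x (U `&` ht @^-1` [set t | t < 0]).
  apply: open_nbhs_nbhs; split; last by split.
  apply: openI => //; apply: open_comp; last exact: open_lt.
  by move=> y _; exact: ht_continuous.
move=> /cx[y [Oy [Uy /= hy]]].
by have := height_gt0 Uy Oy; rewrite ltNge (ltW hy).
Qed.

Let fc_enorm (x y : E) i :
  `|first_coords (x *m Q) 0 i - first_coords (y *m Q) 0 i| <= enorm (x - y).
Proof.
rewrite -(enorm_orthogonal (x - y) QQ) mulmxBl; apply: le_trans (coord_le_enorm _ (lift ord_max i)).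
by rewrite !mxE.
Qed.

Let Y (c : 'rV[R]_n) (tau : R) : set E :=
  Gam `&` [set y | forall i, `|first_coords (y *m Q) 0 i - c 0 i| <= tau].

(** At every scale [delta] the part of the graph over a cube of side [2 tau] is cut
    into about [(tau / l)^n] pieces of diameter O(l) with [l <= delta], because
    [gamma] is Lipschitz. *)
Lemma chart_surface_le : exists2 C1, 0 < C1 & forall c tau, 0 < tau ->
  (surface R n (Y c tau) <= (C1 * tau ^+ n)%:E)%E.
Proof.
have [M M0 lipM] := C11_lipschitz (first_coords (x0 *m Q)) Hgamma (ltW r0).
pose Lam := (1 + M) * n%:R.
have L0 : 0 <= Lam by rewrite mulr_ge0// addr_ge0.
pose w := unit_ball_volume R n.
have w0 : 0 <= w by exact: unit_ball_volume_ge0.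
exists (w * (2 * Lam) ^+ n + 1).
  by rewrite ltr_wpDl// mulr_ge0// exprn_ge0// mulr_ge0.
move=> c tau tau0; apply: ge_ereal_sup => _ [delta delta0 <-].
pose N := (Num.truncn (Lam * (2 * tau) / delta)).+1.
have N0 : 0 < N%:R :> R by [].
pose l := 2 * tau / N%:R.
have l0 : 0 < l by rewrite divr_gt0// mulr_gt0.
have lN : l * N%:R = 2 * tau by rewrite /l divfK// gt_eqF.
have Ll : Lam * l <= delta.
  rewrite /l mulrA ler_pdivrMr//.
  have : Lam * (2 * tau) / delta < N%:R by exact: truncnS_gt.
  by rewrite ltr_pdivrMr// => /ltW; lra.
pose F (z : {ffun 'I_n -> 'I_N.+1}) : set E :=
  Gam `&` [set y | forall i, c 0 i - tau + (z i)%:R * l <= first_coords (y *m Q) 0 i <=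
                             c 0 i - tau + (z i)%:R * l + l].
apply: (@le_trans _ _ ((#|{ffun 'I_n -> 'I_N.+1}|%:R * (w * (Lam * l / 2) ^+ n))%:E)%E).
  apply: (@content_pieces _ _ _ _ _ F) => //; first by rewrite mulr_ge0// ltW.
    move=> y [Gy /= hy].
    have qN (i : 'I_n) : (Num.truncn ((first_coords (y *m Q) 0%R i - (c 0%R i - tau))%R / l)%R < N.+1)%N.
      rewrite truncn_lt_nat; last first.
        by rewrite divr_ge0 ?(ltW l0)//; have := hy i; rewrite ler_norml; lra.
      rewrite ltr_pdivrMr// -natr1 [(_ + 1) * l]mulrDl mul1r [_ * l]mulrC lN.
      by have := hy i; rewrite ler_norml; lra.
    exists [ffun i => Ordinal (qN i)] => //; split => // i; rewrite ffunE /=.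
    have q0 : 0 <= (first_coords (y *m Q) 0 i - (c 0 i - tau)) / l.
      by rewrite divr_ge0 ?(ltW l0)//; have := hy i; rewrite ler_norml; lra.
    have /andP[h1 h2] := truncn_itv q0.
    by move: h1 h2; rewrite ler_pdivlMr// ltr_pdivrMr// -natr1 [(_ + 1) * l]mulrDl mul1r; lra.
  move=> z x y [[bx Ux] /= hx] [[by_ Uy] /= hy].
  have hd i : `|first_coords (x *m Q) 0 i - first_coords (y *m Q) 0 i| <= l.
    by rewrite ler_norml; have := hx i; have := hy i; lra.
  rewrite -(enorm_orthogonal (x - y) QQ) mulmxBl.
  apply: le_trans (enorm_le_sum _) _; rewrite big_ord_recr/= /Lam mulrDl mul1r mulrDl.
  apply: lerD.
    rewrite mulr_natl -[n in leRHS](card_ord n) -sumr_const; apply: ler_sum => i _.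
    by have := hd i; rewrite !mxE lift_max_widen.
  have := height_boundary Ux bx; have := height_boundary Uy by_; rewrite /ht => /eqP.
  rewrite subr_eq0 => /eqP hy' /eqP; rewrite subr_eq0 => /eqP hx'.
  rewrite [X in `|X|](_ : _ = (x *m Q) 0 ord_max - (y *m Q) 0 ord_max); last by rewrite !mxE.
  rewrite hx' hy'; apply: le_trans (lipM _ _ _ _) _.
  - by move=> i; apply: le_trans (fc_enorm _ _ i) (ltW (U_ball Ux)).
  - by move=> i; apply: le_trans (fc_enorm _ _ i) (ltW (U_ball Uy)).
  rewrite -mulrA; apply: ler_wpM2l => //.
  by rewrite mulr_natl -[n in leRHS](card_ord n) -sumr_const; apply: ler_sum => i _.
rewrite lee_fin card_ffun !card_ord natrX.
have -> : N.+1%:R ^+ n * (w * (Lam * l / 2) ^+ n) = w * (N.+1%:R * (Lam * l / 2)) ^+ n.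
  by rewrite mulrCA -exprMn.
rewrite [leRHS]mulrDl mul1r ler_wpDr ?exprn_ge0 ?(ltW tau0)//.
rewrite -[leRHS]mulrA -exprMn; apply: ler_wpM2l => //.
have NN : N.+1%:R <= 2 * N%:R :> R by rewrite -natrM ler_nat mul2n -addnn addnS ltnS leq_addr.
have NE : N%:R * (Lam * l / 2) = Lam * tau.
  by rewrite mulrA [N%:R * _]mulrCA [N%:R * l]mulrC lN -mulrA [2 * tau]mulrC mulfK.
have x0' : 0 <= Lam * l / 2 by rewrite divr_ge0// mulr_ge0// ltW.
have N1 : 0 <= N.+1%:R :> R by exact: ler0n.
have f1 := mulr_ge0 N1 x0'.
have f2 : 0 <= 2 * Lam * tau by apply: mulr_ge0; [apply: mulr_ge0|exact: ltW].
apply: lerXn2r => //.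
by apply: le_trans (ler_wpM2r x0' NN) _; rewrite -[2 * N%:R * _]mulrA NE mulrA.
Qed.

Let boundary_closed : closed (boundary Omega).
Proof.
rewrite (_ : boundary Omega = closure Omega `&` ~` Omega); last first.
  by apply/seteqP; split=> x /boundaryE.
by apply: closedI; [exact: closed_closure|exact: open_closedC].
Qed.

Let Gam_measurable : measurable (Gam : set (surface_space R n)).
Proof. by apply: measurableI; [exact: surface_closed|exact: surface_open]. Qed.

Let Y_measurable c tau : measurable (Y c tau : set (surface_space R n)).
Proof.
apply: measurableI; first exact: Gam_measurable.
apply: surface_closed.
rewrite (_ : [set y | _] = \bigcap_(i in [set: 'I_n])
   ((fun y : E => first_coords (y *m Q) 0 i) @^-1` `[c 0 i - tau, c 0 i + tau]%classic)); last first.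
  apply/seteqP; split=> x /= h i.
    by move=> _ /=; rewrite in_itv/=; have := h i; rewrite ler_norml; lra.
  by have := h i I; rewrite /= in_itv/= ler_norml; lra.
apply: closed_bigI => i _; apply: closed_comp; last exact: itv_closed.
move=> x _; apply: (@cont_comp _ _ _ (fun x : E => first_coords (x *m Q)) (fun y : 'rV[R]_n => y 0 i)).
  exact: fc_continuous.
exact: coord_continuous.
Qed.

Let Gam_finite : (surface R n Gam < +oo)%E.
Proof.
have [C1 C10 HC] := chart_surface_le.
have := HC (first_coords (x0 *m Q)) r r0; set YY := Y _ _ => hY.
apply: (@le_lt_trans _ _ (surface R n YY)); last by apply: le_lt_trans hY _; exact: ltry.
apply: (le_outer_measure (@hausdorff_outer R n.+1 n)).
move=> y [by_ Uy]; split => // i /=.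
exact: le_trans (fc_enorm _ _ i) (ltW (U_ball Uy)).
Qed.

(** The direction [e] is the vertical axis of the chart and [ht] is the height above
    the graph; [chart_surface_le] supplies the mass bound that [slide_dominated]
    asks for. *)
Lemma chart_collar : exists C, collar Omega U e ht (r / 2) C.
Proof.
have [C1 C10 HC] := chart_surface_le.
have r20 : 0 < r / 2 by rewrite divr_gt0.
exists (2 * n.+1%:R * (C1 * n.+1%:R ^+ n)); split => //.
- by rewrite !mulr_gt0// exprn_gt0.
- move=> h g h0 hr cg g0.
  have near_e (q : E) (rho : R) : 0 < rho -> exists Y : set (surface_space R n),
    [/\ measurable Y, (surface R n Y <= (C1 * rho ^+ n)%:E)%E, Y `<=` Gam &
      forall (y : surface_space R n) t, Gam y -> enorm ((y : E) + t *: e - q) <= rho -> Y y].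
    move=> rho0; exists (Y (first_coords (q *m Q)) rho); split => //.
    - exact: HC.
    - by move=> y [].
    - move=> y t Gy hy; split => // i /=; rewrite -(fc_slide y t).
      exact: le_trans (fc_enorm _ _ i) hy.
  apply: (@slide_dominated R n _ (surface_space R n) (surface R n) Gam id e C1
    Gam_measurable Gam_finite (@surface_coord R n) enorm_e C10 near_e h h0 Omega g) => //.
  move=> y t [by_ Uy] t0 th.
  apply: (slide_inside Uy (ltW t0) (le_lt_trans th hr)).
  by rewrite (height_boundary Uy by_) add0r.
Qed.

End Charts.

Lemma boundary_collar (R : realType) (n : nat) (Omega : set 'rV[R]_n.+1) :
  open Omega -> C11_boundary Omega -> forall x0, boundary Omega x0 ->
  exists U e ht width C, U x0 /\ collar Omega U e ht width C.
Proof.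
move=> oO cO x0 /cO[r [Q [gamma [r0 QQ Cg epi]]]].
have [C HC] := chart_collar oO r0 QQ Cg epi.
exists [set x | enorm (x - x0) < r / 2], (delta_mx 0 ord_max *m Q^T),
  (fun x => (x *m Q) 0 ord_max - gamma (first_coords (x *m Q))), (r / 2), C; split => //.
rewrite /= subrr /enorm big1 ?sqrtr0 ?divr_gt0// => i _.
by rewrite mxE expr0n.
Qed.

(** * Quadratic forms and energy estimates for smooth functions *)

Section Forms.
Context (R : realType) (V : lmodType R).

(** Eigenvectors are handled for symmetric bilinear forms on a module without a
    norm: the forms in play are only semidefinite on functions, as functions equal
    almost everywhere are not identified. *)
Record symform (b : V -> V -> R) : Prop := SymForm {
  formC : forall u v, b u v = b v u;
  form_lin : forall a u v w, b (a *: u + v) w = a * b u w + b v w }.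

Definition psd (b : V -> V -> R) := forall u, 0 <= b u u.

Variable b : V -> V -> R.
Hypothesis sb : symform b.

Lemma formDl u v w : b (u + v) w = b u w + b v w.
Proof. by have := form_lin sb 1 u v w; rewrite scale1r mul1r. Qed.
Lemma form0l w : b 0 w = 0.
Proof. by have := formDl 0 0 w; rewrite addr0; lra. Qed.
Lemma formZl a u w : b (a *: u) w = a * b u w.
Proof. by have := form_lin sb a u 0 w; rewrite addr0 form0l addr0. Qed.
Lemma formNl u w : b (- u) w = - b u w.
Proof. by rewrite -scaleN1r formZl mulN1r. Qed.
Lemma formBl u v w : b (u - v) w = b u w - b v w.
Proof. by rewrite formDl formNl. Qed.
Lemma formDr u v w : b u (v + w) = b u v + b u w.
Proof. by rewrite formC// formDl ![b _ u]formC. Qed.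
Lemma form0r w : b w 0 = 0. Proof. by rewrite formC// form0l. Qed.
Lemma formZr a u w : b u (a *: w) = a * b u w.
Proof. by rewrite formC// formZl formC. Qed.
Lemma formNr u w : b u (- w) = - b u w.
Proof. by rewrite formC// formNl formC. Qed.
Lemma formBr u v w : b u (v - w) = b u v - b u w.
Proof. by rewrite formDr formNr. Qed.
Lemma form_suml I (r : seq I) (P : pred I) (F : I -> V) w :
  b (\sum_(i <- r | P i) F i) w = \sum_(i <- r | P i) b (F i) w.
Proof. by apply: (big_morph (b^~ w)) => [u v|]; [exact: formDl|exact: form0l]. Qed.
Lemma form_sumr I (r : seq I) (P : pred I) (F : I -> V) w :
  b w (\sum_(i <- r | P i) F i) = \sum_(i <- r | P i) b w (F i).
Proof. by apply: (big_morph (b w)) => [u v|]; [exact: formDr|exact: form0r]. Qed.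

Lemma form_sqrD u v : b (u + v) (u + v) = b u u + 2 * b u v + b v v.
Proof. by rewrite formDl !formDr [b v u]formC//; ring. Qed.
Lemma form_sqrB u v : b (u - v) (u - v) = b u u - 2 * b u v + b v v.
Proof. by rewrite formBl !formBr [b v u]formC//; ring. Qed.
Lemma form_sqrZ a u : b (a *: u) (a *: u) = a ^+ 2 * b u u.
Proof. by rewrite formZl formZr mulrA. Qed.

Hypothesis pb : psd b.

Lemma form_CS u v : b u v ^+ 2 <= b u u * b v v.
Proof.
have H a : 0 <= b u u - 2 * a * b u v + a ^+ 2 * b v v.
  by have := pb (u - a *: v); rewrite form_sqrB form_sqrZ formZr mulrA.
have [v0|v0] := eqVneq (b v v) 0.
  have [uv|uv] := eqVneq (b u v) 0; first by rewrite uv v0 expr0n mulr0.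
  have := H ((b u u + 1) / (2 * b u v)); rewrite v0 mulr0 addr0.
  have -> : 2 * ((b u u + 1) / (2 * b u v)) * b u v = b u u + 1 by field.
  by lra.
have vp : 0 < b v v by rewrite lt_neqAle eq_sym v0 pb.
have := H (b u v / b v v).
have -> : b u u - 2 * (b u v / b v v) * b u v + (b u v / b v v) ^+ 2 * b v v =
  (b u u * b v v - b u v ^+ 2) / b v v by field.
by rewrite pmulr_lge0 ?invr_gt0// subr_ge0.
Qed.

Lemma form_sqrB_le u v : b (u - v) (u - v) <= 2 * b u u + 2 * b v v.
Proof. by have := pb (u + v); rewrite form_sqrB form_sqrD; lra. Qed.

(** In a semidefinite form the isotropic vectors form the kernel, by the Cauchy-
    Schwarz inequality. *)
Lemma form_null u v : b u u = 0 -> b u v = 0.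
Proof.
move=> u0; have := form_CS u v; rewrite u0 mul0r => h.
by apply/eqP; rewrite -sqrf_eq0 eq_le h sqr_ge0.
Qed.

End Forms.

Lemma sum_CS (R : realType) d (a c : 'I_d -> R) :
  (\sum_(i < d) a i * c i) ^+ 2 <= (\sum_(i < d) a i ^+ 2) * \sum_(i < d) c i ^+ 2.
Proof.
pose dot (u v : 'rV[R]_d) := \sum_(i < d) u 0 i * v 0 i.
have sd : symform dot.
  split=> [u v|k u v w]; first by apply: eq_bigr => i _; rewrite mulrC.
  by rewrite mulr_sumr -big_split; apply: eq_bigr => i _ /=; rewrite !mxE mulrDl mulrA.
have pd : psd dot by move=> u; apply: sumr_ge0 => i _; rewrite -expr2 sqr_ge0.
have := form_CS sd pd (\row_i a i) (\row_i c i); rewrite /dot.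
by under eq_bigr do rewrite !mxE; under [X in _ <= X * _]eq_bigr do rewrite !mxE -expr2;
   under [X in _ <= _ * X]eq_bigr do rewrite !mxE -expr2.
Qed.

Section NonnegIntegral.
Local Open Scope ereal_scope.
Context (R : realType) d (T : measurableType d) (mu : {measure set T -> \bar R}).
Import HBNNSimple.

(** The integral of a nonnegative function is a supremum over the simple functions
    below it. *)
Lemma ge0_integral_mono (D : set T) (f g : T -> \bar R) : (forall x, D x -> 0 <= f x) ->
  (forall x, D x -> f x <= g x) -> \int[mu]_(x in D) f x <= \int[mu]_(x in D) g x.
Proof.
move=> f0 fg; rewrite !ge0_integralE//; last by move=> x Dx; exact: le_trans (f0 x Dx) (fg x Dx).
apply: ge_ereal_sup => _ [h /= hf <-]; apply: ereal_sup_ubound; exists h => //= x.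
apply: le_trans (hf x) _; rewrite !patchE; case: ifPn => // /set_mem; exact: fg.
Qed.

End NonnegIntegral.

Section ConstantFactor.
Local Open Scope ereal_scope.
Context (R : realType) d (T : measurableType d) (mu : {measure set T -> \bar R}).

Lemma ge0_integral_scale (D : set T) (c : R) (f : T -> R) : measurable D ->
  measurable_fun D f -> (0 <= c)%R -> (forall x, D x -> 0 <= f x)%R ->
  \int[mu]_(x in D) (c * f x)%:E = c%:E * \int[mu]_(x in D) (f x)%:E.
Proof.
move=> mD mf c0 f0; under eq_integral do rewrite EFinM.
by rewrite ge0_integralZl_EFin//; exact/measurable_EFinP.
Qed.

End ConstantFactor.

Lemma itv_lebesgue_lty (R : realType) (a b : R) :
  (@lebesgue_measure R (`]a, b]%classic : set R) < +oo)%E.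
Proof. by rewrite lebesgue_measure_itv/=; case: ifPn => _; rewrite ?ltry// -EFinB ltry. Qed.

Lemma line_continuous (R : realType) (n : nat) (x w : 'rV[R]_n.+1) (g : 'rV[R]_n.+1 -> R) :
  continuous g -> continuous (fun t : R => g (x + t *: w)).
Proof.
move=> cg t; apply: (@continuous_comp _ _ _ (fun t : R => x + t *: w) g); last exact: cg.
apply: cvgD; first exact: cvg_cst.
by apply: cvgZr_tmp; exact: cvg_id.
Qed.

Lemma addr_continuous (R : realType) (V : normedModType R) (w : V) :
  continuous (fun x : V => x + w).
Proof. by move=> t; apply: cvgD; [exact: cvg_id|exact: cvg_cst]. Qed.

Section SmoothFunctions.
Context (R : realType) (n : nat).
Local Notation E := 'rV[R]_n.+1.
Implicit Types v : E -> R.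

Lemma smooth_continuous v : smooth v -> continuous v.
Proof. by move=> /(_ [::])[]. Qed.

Lemma smooth_partial_continuous v i : smooth v -> continuous (partial i v).
Proof. by move=> /(_ [:: i])[]. Qed.

Lemma smooth_derivable v i x : smooth v -> derivable v x (basis_vec R i).
Proof. by move=> /(_ [::])[_]; apply. Qed.

Definition gradsq v (x : E) : R := \sum_(i < n.+1) partial i v x ^+ 2.

Lemma gradsq_ge0 v x : 0 <= gradsq v x.
Proof. by apply: sumr_ge0 => i _; exact: sqr_ge0. Qed.

Lemma gradsq_continuous v : smooth v -> continuous (gradsq v).
Proof. by move=> sv; apply: sum_continuous => i; apply: cont_sqr; exact: smooth_partial_continuous. Qed.

(** [increment_sqr_le] along a segment, with the derivative along [w] bounded by the
    gradient. *)
Lemma smooth_increment_sqr v (x w : E) (h : R) : smooth v -> 0 < h ->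
  (((v (x + h *: w) - v x) ^+ 2)%:E <=
   (h * enorm w ^+ 2)%:E * \int[@lebesgue_measure R]_(t in `]0%R, h]) (gradsq v (x + t *: w))%:E)%E.
Proof.
move=> sv h0.
have cl : continuous (fun t : R => t *: w + x).
  move=> t; apply: cvgD; last exact: cvg_cst.
  by apply: cvgZr_tmp; exact: cvg_id.
have dg (t : R) : is_derive t (1 : R) (fun t => v (t *: w + x)) (dirder v w (t *: w + x)).
  by apply/line_is_derive/C1_is_derive => *; [exact: smooth_derivable|exact: smooth_partial_continuous].
have cg : continuous (fun t : R => dirder v w (t *: w + x)).
  apply: (cont_comp cl); apply: dirder_continuous => i; exact: smooth_partial_continuous.
have := increment_sqr_le h0 dg cg.
rewrite scale0r add0r [h *: w + x]addrC => /le_trans; apply.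
rewrite EFinM -muleA; apply: lee_wpmul2l; first by rewrite lee_fin ltW.
have cG : continuous (fun t : R => gradsq v (x + t *: w)).
  exact/line_continuous/gradsq_continuous.
have mG : measurable_fun `]0%R, h] (fun t : R => (gradsq v (x + t *: w))%:E).
  by apply/measurable_EFinP/measurable_funTS; exact: continuous_measurable_fun.
rewrite -integral_itv_obnd_cbnd; last first.
  apply/measurable_EFinP/measurable_funTS.
  exact: (continuous_measurable_fun (cont_sqr cg)).
rewrite -(@ge0_integral_scale R _ _ (@lebesgue_measure R) `]0%R, h]%classic (enorm w ^+ 2)
  (fun t => gradsq v (x + t *: w))); last 4 first.
- exact: measurable_itv.
- exact/measurable_EFinP.
- exact: sqr_ge0.
- by move=> t _; exact: gradsq_ge0.
apply: ge0_integral_mono => t _; first by rewrite lee_fin sqr_ge0.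
rewrite lee_fin enorm_sqr /gradsq [x + _]addrC; exact: sum_CS.
Qed.

End SmoothFunctions.

Section Translation.
Context (R : realType) (n : nat).
Local Notation E := 'rV[R]_n.+1.
Local Notation L := (lebesgue R n).

Lemma lebesgue_add_coord disp (T : measurableType disp) (p : T -> E) (w : E) :
  (forall i, measurable_fun setT (fun y => p y 0 i)) ->
  forall i, measurable_fun setT (fun z : T * measurableTypeR R => (p z.1 + z.2 *: w) 0 i).
Proof.
move=> mp i.
rewrite (_ : (fun z => _) = (fun z : T * measurableTypeR R =>
   p z.1 0 i + z.2 * w 0 i)); last by apply/funext => z; rewrite !mxE.
apply: measurable_funD; first exact: (measurableT_comp (mp i)).
by apply: measurable_funM.
Qed.

(** The integrand is jointly measurable in the starting point and the time, because
    [g] is continuous and the position depends measurably on both. *)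
Lemma segment_tonelli disp (T : measurableType disp) (m : {measure set T -> \bar R})
    (p : T -> E) (D : set T) (w : E) (g : E -> R) (h : R) :
  (forall i, measurable_fun setT (fun y => p y 0 i)) -> measurable D -> (m D < +oo)%E ->
  continuous g -> (forall x, 0 <= g x) ->
  (\int[m]_(x in D) \int[@lebesgue_measure R]_(t in `]0%R, h]) (g (p x + t *: w))%:E =
   \int[@lebesgue_measure R]_(t in `]0%R, h]) \int[m]_(x in D) (g (p x + t *: w))%:E)%E.
Proof.
move=> mp mD Doo cg g0.
apply: (@tonelli_finite R _ _ T (measurableTypeR R) m (@lebesgue_measure R) D `]0%R, h]%classic
  (fun z => (g (p z.1 + z.2 *: w))%:E)) => //.
- exact: itv_lebesgue_lty.
- apply/measurable_EFinP.
  exact: (continuous_comp_measurable (lebesgue_add_coord w mp)).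
- by move=> z; rewrite lee_fin.
Qed.

Lemma slide_increment disp (T : measurableType disp) (m : {measure set T -> \bar R})
    (p : T -> E) (D : set T) (w : E) (v : E -> R) (h : R) :
  (forall i, measurable_fun setT (fun y => p y 0 i)) -> measurable D -> (m D < +oo)%E ->
  smooth v -> 0 < h ->
  (\int[m]_(x in D) ((v (p x + h *: w) - v (p x)) ^+ 2)%:E <=
   \int[@lebesgue_measure R]_(t in `]0%R, h]) \int[m]_(x in D)
     (h * enorm w ^+ 2 * gradsq v (p x + t *: w))%:E)%E.
Proof.
move=> mp mD Doo sv h0; have cG := gradsq_continuous sv.
have c0 : 0 <= h * enorm w ^+ 2 by rewrite mulr_ge0 ?exprn_ge0 ?enorm_ge0// ltW.
rewrite -(@segment_tonelli _ T m p D w (fun x => h * enorm w ^+ 2 * gradsq v x) h)//; last 2 first.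
- by apply: contM => //; exact: cst_continuous.
- by move=> x; rewrite mulr_ge0// gradsq_ge0.
apply: ge0_integral_mono => x _; first by rewrite lee_fin sqr_ge0.
apply: le_trans (smooth_increment_sqr (p x) w sv h0) _.
rewrite ge0_integral_scale//; last by move=> t _; exact: gradsq_ge0.
have cl : continuous (fun t : R => gradsq v (p x + t *: w)) by exact: line_continuous.
by apply/measurable_funTS; exact: continuous_measurable_fun.
Qed.

Lemma ge0_integral_translate_le (D D' : set E) (w : E) (g : E -> R) :
  measurable (D : set (lebesgue_space R n)) -> measurable (D' : set (lebesgue_space R n)) ->
  continuous g -> (forall x, 0 <= g x) -> (forall x, D x -> D' (x + w)) ->
  (\int[L]_(x in D) (g (x + w))%:E <= \int[L]_(x in D') (g x)%:E)%E.
Proof.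
move=> mD mD' cg g0 DD'.
have mg A : measurable_fun (A : set (lebesgue_space R n)) (fun x => (g x)%:E).
  by apply/measurable_EFinP; exact: lebesgue_continuous.
rewrite -(@ge0_integral_shift R n w D' (fun x => (g x)%:E) mD' (mg _)); last first.
  by move=> x _; rewrite lee_fin.
apply: ge0_subset_integral.
- exact: mD.
- by rewrite -[X in measurable X]setTI; exact: shift_measurable.
- apply/measurable_EFinP; apply: (@lebesgue_continuous R n (fun x => g (x + w))).
  exact: (cont_comp (@addr_continuous R _ w) cg).
- by move=> x _; rewrite lee_fin.
- exact: DD'.
Qed.

(** Bound the increment by the energy along the segment, exchange the integrals, and
    use the translation invariance of Lebesgue measure at every time. *)
Lemma translation_estimate (v : E -> R) (D D' : set E) (w : E) : smooth v ->
  measurable (D : set (lebesgue_space R n)) -> measurable (D' : set (lebesgue_space R n)) ->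
  (L D < +oo)%E -> (forall x t, D x -> 0 < t -> t <= 1 -> D' (x + t *: w)) ->
  (\int[L]_(x in D) ((v (x + w) - v x) ^+ 2)%:E <=
   (enorm w ^+ 2)%:E * \int[L]_(x in D') (gradsq v x)%:E)%E.
Proof.
move=> sv mD mD' Doo DD'.
have cG := gradsq_continuous sv.
have w2 : 0 <= enorm w ^+ 2 by rewrite exprn_ge0// enorm_ge0.
have := slide_increment w (@lebesgue_coord R n) mD Doo sv ltr01.
rewrite mul1r; under eq_integral do rewrite scale1r; move/le_trans; apply.
rewrite -(@ge0_integral_scale _ _ _ L D' (enorm w ^+ 2) (gradsq v) mD'); last 3 first.
- exact: lebesgue_continuous.
- exact: w2.
- by move=> x _; exact: gradsq_ge0.
apply: (@le_trans _ _ (\int[@lebesgue_measure R]_(t in `]0%R, 1%R]) \int[L]_(x in D') (enorm w ^+ 2 * gradsq v x)%:E)%E).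
  apply: ge0_integral_mono => t.
    by move=> _; apply: integral_ge0 => x _; rewrite lee_fin mulr_ge0// gradsq_ge0.
  rewrite /= in_itv/= => /andP[t0 t1].
  apply: (@ge0_integral_translate_le D D' (t *: w) (fun x => enorm w ^+ 2 * gradsq v x)) => //.
  - by apply: contM => //; exact: cst_continuous.
  - by move=> x; rewrite mulr_ge0// gradsq_ge0.
  - by move=> x Dx; exact: DD'.
rewrite integral_cst//= lebesgue_measure_itv/= lte_fin ltr01 -EFinB subr0 mule1.
exact: lexx.
Qed.
End Translation.

(** * Poincare inequality on cubes *)

Section AbstractIntegrals.
Local Open Scope ereal_scope.
Context (R : realType) d (T : measurableType d) (mu : {measure set T -> \bar R}).

Lemma ge0_integral_mono2 (D D' : set T) (f g : T -> \bar R) : (forall x, D x -> 0 <= f x) ->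
  (forall x, D' x -> 0 <= g x) -> (forall x, D x -> D' x /\ f x <= g x) ->
  \int[mu]_(x in D) f x <= \int[mu]_(x in D') g x.
Proof.
move=> f0 g0 fg; rewrite integral_mkcond [leRHS]integral_mkcond.
apply: ge0_integral_mono => x _; rewrite !patchE; first by case: ifPn => // /set_mem/f0.
case: ifPn => [/set_mem Dx|_].
  by have [D'x le] := fg x Dx; rewrite mem_set.
by case: ifPn => // /set_mem/g0.
Qed.

Lemma integrable_Rintegral (D : set T) (f : T -> R) : measurable D ->
  mu.-integrable D (EFin \o f) ->
  \int[mu]_(x in D) (f x)%:E = (\int[mu]_(x in D) f x)%R%:E.
Proof. by move=> mD fi; rewrite /Rintegral fineK//; exact: integrable_fin_num. Qed.

(** Expanding the square turns the double integral of the increments into the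
    variance; this is how a bound on increments becomes a Poincare inequality. *)
Lemma variance_identity (D : set T) (v : T -> R) : measurable D -> mu D < +oo ->
  mu.-integrable D (EFin \o v) -> mu.-integrable D (EFin \o (fun x => v x ^+ 2)%R) ->
  \int[mu]_(x in D) \int[mu]_(y in D) (((v y - v x) ^+ 2)%R)%:E =
  (2 * (fine (mu D) * (\int[mu]_(x in D) (v x ^+ 2)) - (\int[mu]_(x in D) v x) ^+ 2))%R%:E.
Proof.
move=> mD Doo iv iv2.
set S := (\int[mu]_(x in D) (v x ^+ 2))%R; set M := (\int[mu]_(x in D) v x)%R.
set l := fine (mu D).
have lE : mu D = l%:E by rewrite fineK// ge0_fin_numE.
have icst (a : R) : mu.-integrable D (EFin \o cst a).
  apply: (measurable_bounded_integrable mD Doo) => //.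
  by exists `|a|%R; split => [|N aN x Dx]; [exact: num_real|exact: ltW].
have iZ (a : R) (f : T -> R) : mu.-integrable D (EFin \o f) ->
    mu.-integrable D (EFin \o (fun x => a * f x)%R).
  by move=> fi; have := integrableZl mD a fi; apply: eq_integrable.
have iD (f g : T -> R) : mu.-integrable D (EFin \o f) -> mu.-integrable D (EFin \o g) ->
    mu.-integrable D (EFin \o (fun x => f x + g x)%R).
  by move=> fi gi; have := integrableD mD fi gi; apply: eq_integrable.
have intZ (a : R) (f : T -> R) : mu.-integrable D (EFin \o f) ->
    (\int[mu]_(x in D) (a * f x) = a * \int[mu]_(x in D) f x)%R.
  by move=> fi; rewrite RintegralZl.
have intD (f g : T -> R) : mu.-integrable D (EFin \o f) -> mu.-integrable D (EFin \o g) ->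
    (\int[mu]_(x in D) (f x + g x) = \int[mu]_(x in D) f x + \int[mu]_(x in D) g x)%R.
  by move=> fi gi; rewrite RintegralD.
have intC (a : R) : (\int[mu]_(x in D) (cst a x) = a * l)%R by rewrite Rintegral_cst.
have inner x : \int[mu]_(y in D) (((v y - v x) ^+ 2)%R)%:E =
    (S + ((- 2 * M) * v x + l * v x ^+ 2))%R%:E.
  transitivity (\int[mu]_(y in D) ((v y ^+ 2 + ((- 2 * v x) * v y + cst (v x ^+ 2) y))%R)%:E).
    by apply: eq_integral => y _; congr EFin; rewrite /cst; ring.
  rewrite integrable_Rintegral//; last first.
    by apply: (iD (fun y => v y ^+ 2)%R) => //; apply: (iD (fun y => (- 2 * v x) * v y)%R) => //; exact: iZ.
  rewrite (intD (fun y => v y ^+ 2)%R)//; last first.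
    by apply: (iD (fun y => (- 2 * v x) * v y)%R) => //; exact: iZ.
  rewrite (intD (fun y => (- 2 * v x) * v y)%R)//; last exact: iZ.
  rewrite intZ// intC; congr EFin; rewrite -/S -/M; ring.
under eq_integral do rewrite inner.
rewrite (integrable_Rintegral (f := fun x => S + ((- 2 * M) * v x + l * v x ^+ 2))%R)//; last first.
  apply: (iD (cst S)) => //; apply: (iD (fun y => (- 2 * M) * v y)%R); first exact: iZ.
  exact: (iZ l (fun y => v y ^+ 2)%R).
rewrite (intD (cst S))//; last first.
  apply: (iD (fun y => (- 2 * M) * v y)%R); first exact: iZ.
  exact: (iZ l (fun y => v y ^+ 2)%R).
rewrite (intD (fun y => (- 2 * M) * v y)%R); last 2 first.
- exact: iZ.
- exact: (iZ l (fun y => v y ^+ 2)%R).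
rewrite intC intZ// (intZ l (fun y => v y ^+ 2)%R)//.
congr EFin; rewrite -/S -/M; ring.
Qed.

Lemma measurable_forall (J : countType) (F : J -> set T) : (forall i, measurable (F i)) ->
  measurable [set x | forall i, F i x].
Proof.
move=> mF; rewrite (_ : [set x | _] = ~` \bigcup_(i in [set: J]) ~` F i); last first.
  rewrite setC_bigcup; apply/seteqP; split => x /= h i; first by move=> _; rewrite setCK; exact: h.
  by have := h i I; rewrite setCK.
by apply/measurableC/countable_bigcupT_measurable => // i; exact: measurableC.
Qed.

End AbstractIntegrals.

Section Poincare.
Context (R : realType) (n : nat).
Local Notation E := 'rV[R]_n.+1.
Local Notation L := (lebesgue R n).

Definition hcube (c : E) (s : R) : set E := [set x | forall i, c 0 i <= x 0 i < c 0 i + s].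

Lemma hcube_preimage disp (T : measurableType disp) (f : T -> E) c s :
  (forall i, measurable_fun setT (fun x => f x 0 i)) -> measurable (f @^-1` hcube c s).
Proof.
move=> mf; apply: (@measurable_forall _ T 'I_n.+1 (fun i => [set x | c 0 i <= f x 0 i < c 0 i + s])) => i.
rewrite (_ : [set x | _] = setT `&` (fun x => f x 0 i) @^-1` `[c 0 i, c 0 i + s[%classic).
  by apply: mf.
by apply/seteqP; split => x /=; rewrite in_itv/= => // -[].
Qed.

Lemma hcube_measurable c s : measurable (hcube c s : set (lebesgue_space R n)).
Proof. exact: (@hcube_preimage _ (lebesgue_space R n) id c s (@lebesgue_coord R n)). Qed.

Lemma hcube_bounded c s : bounded_set (hcube c s).
Proof.
apply: (@sub_boundedr _ _ _ _ (globally (cube c s))) => [|].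
  by move=> P h x hx; apply: h => i; have /andP[-> /ltW] := hx i.
have : compact (cube c s).
  rewrite (_ : cube c s = [set x : E | forall i, `[c 0 i, c 0 i + s]%classic (x 0 i)]).
    apply: (@rV_compact R n.+1 (fun i => `[c 0 i, c 0 i + s]%classic)) => i.
    exact: segment_compact.
  by apply/seteqP; split => x h i; have := h i; rewrite /= in_itv.
exact: compact_bounded.
Qed.

Lemma hcube_lty c s : (L (hcube c s) < +oo)%E.
Proof. exact/lebesgue_bounded_lty/hcube_bounded. Qed.

Lemma hcube_translate c s : L (hcube c s) = L (hcube 0 s).
Proof.
rewrite -(lebesgue_shift (- c) (hcube 0 s)); congr (L _).
apply/seteqP; split => x h i; have := h i; rewrite /= !mxE; lra.
Qed.

(** The cube of differences is the union of the [2^(n+1)] translates of [hcube 0 s]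
    given by the signs of the coordinates. *)
Lemma double_cube_le (s : R) : 0 < s ->
  (L [set w : E | forall i, (- s < w 0%R i < s)%R] <= (2 ^+ n.+1)%:E * L (hcube 0 s))%E.
Proof.
move=> s0.
pose F (z : {ffun 'I_n.+1 -> bool}) := hcube (\row_i (if z i then - s else 0)) s.
have sub : [set w : E | forall i, - s < w 0%R i < s] `<=` \big[setU/set0]_(z : {ffun 'I_n.+1 -> bool}) F z.
  move=> w /= hw; rewrite -(@bigcup_pred _ _ predT F).
  exists [ffun i => w 0 i < 0] => // i; rewrite mxE ffunE.
  by have /andP[h1 h2] := hw i; case: ltP => h; apply/andP; split; lra.
apply: le_trans (le_outer_measure (lebesgue_outer R n) _ _ sub) _.
have : (lebesgue_outer R n (\big[setU/set0]_(z : {ffun 'I_n.+1 -> bool}) F z) <=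
    \sum_(z : {ffun 'I_n.+1 -> bool}) lebesgue_outer R n (F z))%E.
  apply: (@bigsetU_subadditive R _ (lebesgue_outer R n) setT) => // A B _ _.
  exact: outer_measureU2.
move/le_trans; apply.
have -> : (\sum_(z : {ffun 'I_n.+1 -> bool}) lebesgue_outer R n (F z) =
    \sum_(z : {ffun 'I_n.+1 -> bool}) L (hcube 0 s))%E.
  by apply: eq_bigr => z _; rewrite -(hcube_translate (\row_i (if z i then - s else 0)) s).
have fin : L (hcube 0 s) \is a fin_num.
  rewrite ge0_fin_numE; [exact: hcube_lty|exact: measure_ge0].
rewrite -(fineK fin) sumEFin sumr_const card_ffun card_bool card_ord -EFinM lee_fin.
by rewrite -[leLHS]mulr_natl natrX.
Qed.

Lemma continuous_bounded_on (D : set E) (v : E -> R) : bounded_set D -> continuous v ->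
  exists M, forall x, D x -> `|v x| <= M.
Proof.
move=> /bounded_box[M M0 hM] cv.
pose K := [set x : E | forall i, `[- M, M]%classic (x 0 i)].
have cK : compact K.
  apply: (@rV_compact R n.+1 (fun i => `[- M, M]%classic)) => i; exact: segment_compact.
have [N [Nr hN]] : bounded_set (v @` K).
  by apply: compact_bounded; apply: continuous_compact => //; exact: continuous_subspaceT.
exists (N + 1) => x Dx; apply: hN; first by rewrite ltrDl.
by exists x => // i /=; rewrite in_itv/= -ler_norml; exact: hM.
Qed.

Lemma continuous_integrable (D : set E) (v : E -> R) :
  measurable (D : set (lebesgue_space R n)) -> bounded_set D -> continuous v ->
  L.-integrable D (EFin \o v).
Proof.
move=> mD bD cv.
have [M hM] := continuous_bounded_on bD cv.
apply: (measurable_bounded_integrable mD (lebesgue_bounded_lty bD)).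
- exact: lebesgue_continuous.
- exists M; split; first exact: num_real.
  by move=> N MN x Dx; exact: le_trans (hM x Dx) (ltW MN).
Qed.

Lemma addr_coord (i : 'I_n.+1) :
  measurable_fun setT (fun z : lebesgue_space R n * lebesgue_space R n => ((z.1 : E) + (z.2 : E)) 0 i).
Proof.
rewrite (_ : (fun z => _) = (fun z : lebesgue_space R n * lebesgue_space R n =>
   (z.1 : E) 0 i + (z.2 : E) 0 i)); last by apply/funext => z; rewrite mxE.
apply: measurable_funD.
  exact: (measurableT_comp (lebesgue_coord i) measurable_fst).
exact: (measurableT_comp (lebesgue_coord i) measurable_snd).
Qed.

(** Substitute [y = x + w]: for each [w] in the cube of differences,
    [translation_estimate] bounds the increments, the segment staying in the convex
    cube. *)
Lemma double_integral_le (v : E -> R) (c : E) (s : R) : smooth v -> 0 < s ->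
  (\int[L]_(x in hcube c s) \int[L]_(y in hcube c s) ((v y - v x) ^+ 2)%:E <=
   (n.+1%:R * s ^+ 2)%:E * (\int[L]_(x in hcube c s) (gradsq v x)%:E) *
   ((2 ^+ n.+1)%:E * L (hcube c s)))%E.
Proof.
move=> sv s0.
set q := hcube c s; set G := (\int[L]_(x in q) (gradsq v x)%:E)%E.
have mq := hcube_measurable c s; have qoo := hcube_lty c s.
pose B := [set w : E | forall i, - s < w 0 i < s].
have mB : measurable (B : set (lebesgue_space R n)).
  apply: (@measurable_forall _ (lebesgue_space R n) 'I_n.+1
     (fun i => [set w | - s < w 0 i < s])) => i.
  suff -> : (fun x : lebesgue_space R n => [set w : E | - s < w 0 i < s] x) =
      (fun w : E => w 0 i) @^-1` `]- s, s[%classic.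
    apply: lebesgue_open.
    by apply: open_comp; [move=> x _; exact: coord_continuous|exact: interval_open].
  by apply/seteqP; split => x /=; rewrite in_itv.
have Bq : (L B <= (2 ^+ n.+1)%:E * L q)%E.
  by rewrite /q hcube_translate; exact: double_cube_le.
have Boo : (L B < +oo)%E.
  apply: le_lt_trans Bq _; apply: lte_mul_pinfty => //.
have G0 : (0 <= G)%E by apply: integral_ge0 => x _; rewrite lee_fin gradsq_ge0.
have cv := smooth_continuous sv.
pose f (z : lebesgue_space R n * lebesgue_space R n) : R :=
  \1_((fun z : lebesgue_space R n * lebesgue_space R n => (z.1 : E) + (z.2 : E)) @^-1` q) z *
  (v ((z.1 : E) + (z.2 : E)) - v z.1) ^+ 2.
have f0 z : 0 <= f z by rewrite mulr_ge0 ?sqr_ge0.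
have mf : measurable_fun setT f.
  apply: measurable_funM.
    by apply: measurable_indic; exact: (hcube_preimage c s addr_coord).
  apply: measurable_funX; apply: measurable_funB.
    exact: (continuous_comp_measurable addr_coord cv).
  exact: (measurableT_comp (lebesgue_continuous cv) measurable_fst).
apply: (@le_trans _ _ (\int[L]_(x in q) \int[L]_(w in B) (f (x, w))%:E)%E).
  apply: ge0_integral_mono => x qx.
    by apply: integral_ge0 => y _; rewrite lee_fin sqr_ge0.
  rewrite -(@ge0_integral_shift R n x q (fun y => ((v y - v x) ^+ 2)%:E) mq); last 2 first.
  - apply/measurable_EFinP; apply: (@lebesgue_continuous R n (fun y => (v y - v x) ^+ 2)).
    by apply: cont_sqr; apply: contB => //; exact: cst_continuous.
  - by move=> y _; rewrite lee_fin sqr_ge0.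
  apply: ge0_integral_mono2.
  - by move=> w _; rewrite lee_fin sqr_ge0.
  - by move=> w _; rewrite lee_fin.
  move=> w qw; split.
    move=> i; have := qx i; have := qw i; rewrite mxE; lra.
  rewrite /f lee_fin indicE mem_set/=; last by rewrite addrC.
  by rewrite mul1r [x + w]addrC.
rewrite (tonelli_finite (f := fun z => (f z)%:E) mq mB qoo Boo); last 2 first.
- exact/measurable_EFinP.
- by move=> z; rewrite lee_fin.
apply: (@le_trans _ _ (\int[L]_(w in B) ((n.+1%:R * s ^+ 2)%:E * G))%E).
  apply: ge0_integral_mono => w Bw; first by apply: integral_ge0 => x _; rewrite lee_fin.
  pose D := q `&` (fun x => x + w) @^-1` q.
  have mD : measurable (D : set (lebesgue_space R n)).
    by apply: measurableI => //; rewrite -[X in measurable X]setTI; exact: shift_measurable.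
  apply: (@le_trans _ _ (\int[L]_(x in D) ((v (x + w) - v x) ^+ 2)%:E)%E).
    rewrite integral_mkcond [leRHS]integral_mkcond.
    apply: ge0_integral_mono => x _; rewrite !patchE; first by case: ifPn => // _; rewrite lee_fin.
    case: ifPn => [/set_mem qx|_]; last first.
      by case: ifPn => // _; rewrite lee_fin sqr_ge0.
    have -> : f (x, w) = (x + w \in q)%:R * (v (x + w) - v x) ^+ 2 by rewrite /f indicE.
    have [xw|xw] := boolP (x + w \in q).
      have /mem_set xD : D x by split => //=; exact/set_mem.
      by rewrite mul1r; case: ifPn => //; rewrite xD.
    by rewrite mul0r; case: ifPn => // _; rewrite lee_fin sqr_ge0.
  apply: (@le_trans _ _ ((enorm w ^+ 2)%:E * G)%E).
    apply: translation_estimate => //.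
    - apply: le_lt_trans qoo; apply: (le_outer_measure (lebesgue_outer R n)); by move=> x [].
    - move=> x t [qx qxw] t0 t1 i; have := qx i; have := qxw i; rewrite /= !mxE.
      by move=> /andP[a1 a2] /andP[b1 b2]; apply/andP; split; nra.
  apply: lee_wpmul2r => //; rewrite lee_fin enorm_sqr.
  rewrite -[n.+1 in leRHS](card_ord n.+1) mulr_natl -sumr_const.
  apply: ler_sum => i _; have /andP[w1 w2] := Bw i; nra.
rewrite integral_cst//; apply: lee_wpmul2l => //.
by apply: mule_ge0 => //; rewrite lee_fin mulr_ge0// sqr_ge0.
Qed.

Definition Rint (D : set E) (v : E -> R) : R := \int[L]_(x in D) v x.

(** By [variance_identity] the mass minus the contribution of the mean is the double
    integral of the increments divided by twice the volume; [double_integral_le]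
    bounds it. *)
Lemma poincare_cube (v : E -> R) (c : E) (s : R) : smooth v -> 0 < s ->
  Rint (hcube c s) (fun x => v x ^+ 2) <=
    2 ^+ n * n.+1%:R * s ^+ 2 * Rint (hcube c s) (gradsq v) +
    (fine (L (hcube c s)))^-1 * Rint (hcube c s) v ^+ 2.
Proof.
move=> sv s0; have := double_integral_le c sv s0.
set q := hcube c s.
have mq := hcube_measurable c s; have qoo := hcube_lty c s; have bq := hcube_bounded c s.
have cv := smooth_continuous sv.
have iv := continuous_integrable mq bq cv.
have iv2 := continuous_integrable mq bq (cont_sqr cv).
have iG := continuous_integrable mq bq (gradsq_continuous sv).
rewrite variance_identity// (integrable_Rintegral mq iG).
have lE : L q = (fine (L q))%:E.
  rewrite fineK// ge0_fin_numE; [exact: qoo|exact: measure_ge0].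
rewrite {2}lE -!EFinM lee_fin -/(Rint q _) -/(Rint q _) -/(Rint q _).
set l := fine _; set S := Rint _ (fun x => v x ^+ 2); set G := Rint _ (gradsq v).
set M := Rint q v => h.
have l0 : 0 <= l by apply: fine_ge0; exact: measure_ge0.
have [l00|l00] := eqVneq l 0.
  have z (g : E -> R) : continuous g -> Rint q g = 0.
    move=> cg; rewrite /Rint /Rintegral null_set_integral; [by []|exact: mq| |].
    - by apply/measurable_EFinP; exact: lebesgue_continuous.
    - by rewrite lE -/l l00.
  rewrite /S /G /M !z//; [by rewrite expr0n/= !mulr0 addr0|exact: gradsq_continuous|exact: cont_sqr].
have lp : 0 < l by rewrite lt_neqAle eq_sym l00.
rewrite -(ler_pM2l lp) mulrDr mulrA mulVKf//.
by move: h; rewrite [2 ^+ n.+1]exprS; lra.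
Qed.

End Poincare.

(** * Mass in boundary strips *)

Section SumsOfIntegrals.
Local Open Scope ereal_scope.
Context (R : realType) d (T : measurableType d) (mu : {measure set T -> \bar R}).

Lemma disjoint_integrals_le (J : finType) (P : pred J) (F : J -> set T) (D : set T) (f : T -> \bar R) :
  (forall j, measurable (F j)) -> measurable D -> measurable_fun D f ->
  (forall x, D x -> 0 <= f x) -> (forall j, P j -> F j `<=` D) ->
  (forall i j x, P i -> P j -> F i x -> F j x -> i = j) ->
  \sum_(j | P j) \int[mu]_(x in F j) f x <= \int[mu]_(x in D) f x.
Proof.
move=> mF mD mf f0 FD dF.
have sub : \big[setU/set0]_(j <- [seq j <- index_enum J | P j]) F j `<=` D.
  by rewrite big_filter => x; rewrite -(@bigcup_pred _ _ P F) => -[j /= Pj]; exact: FD.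
rewrite -big_filter -(@ge0_integral_bigsetU _ T R mu J F f [seq j <- index_enum J | P j]).
- apply: ge0_subset_integral => //; exact: bigsetU_measurable.
- exact: mF.
- by rewrite filter_uniq// index_enum_uniq.
- apply/trivIsetP => i j /=; rewrite !mem_filter => /andP[Pi _] /andP[Pj _] ij.
  by apply/seteqP; split => // x [Fi Fj]; move: ij; rewrite (dF i j x)// eqxx.
- by apply: measurable_funS mf.
- by move=> x /sub; exact: f0.
Qed.

Lemma integral_cover_le (J : finType) (P : pred J) (F : J -> set T) (D : set T) (f : T -> \bar R) :
  (forall j, measurable (F j)) -> measurable_fun setT f -> (forall x, 0 <= f x) ->
  (forall x, D x -> exists2 j, P j & F j x) ->
  \int[mu]_(x in D) f x <= \sum_(j | P j) \int[mu]_(x in F j) f x.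
Proof.
move=> mF mf f0 cov.
rewrite integral_mkcond; under eq_bigr do rewrite integral_mkcond.
rewrite -big_filter -ge0_integral_sum//; last 2 first.
- by move=> j; apply/(measurable_restrictT f (mF j)); exact: measurable_funS mf.
- by move=> j x _; rewrite patchE; case: ifP.
apply: ge0_integral_mono => x _; rewrite patchE; first by case: ifP.
case: ifPn => [/set_mem Dx|_]; last by apply: sume_ge0 => j _; rewrite patchE; case: ifP.
have [j Pj Fj] := cov x Dx.
rewrite big_filter (bigD1 j)//= patchE ifT ?inE// leeDl//.
by apply: sume_ge0 => i _; rewrite patchE; case: ifP.
Qed.

End SumsOfIntegrals.

Lemma sqr_split (R : realType) (y z : R) : z ^+ 2 <= 2 * y ^+ 2 + 2 * (y - z) ^+ 2.
Proof. have := sqr_ge0 (2 * y - z); nra. Qed.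

(** Summing [K] inequalities with different right-hand sides: the strip is compared
    with [K] disjoint layers, and the average over the layers gains a factor [1/K]. *)
Lemma average_le (R : realType) (K : nat) (x c T : R) (y : 'I_K -> R) :
  (forall k, x <= 2 * y k + c) -> \sum_(k < K) y k <= T -> K%:R * x <= 2 * T + K%:R * c.
Proof.
move=> h hT; have := ler_sum (index_enum 'I_K) (fun k (_ : true) => h k).
rewrite sumr_const card_ord big_split/= sumr_const card_ord -mulr_sumr -(mulr_natl x) -(mulr_natl c) => le.
by apply: le_trans le _; rewrite lerD2r ler_wpM2l.
Qed.

Section Strip.
Context (R : realType) (n : nat).
Local Notation E := 'rV[R]_n.+1.
Local Notation L := (lebesgue R n).
Local Notation Lm := (lebesgue_space R n).

Lemma bounded_sub (A B : set E) : A `<=` B -> bounded_set B -> bounded_set A.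
Proof. by move=> AB [M [Mr h]]; exists M; split => // x Mx y /AB; exact: h. Qed.

Lemma Rint_EFin (D : set E) (f : E -> R) : measurable (D : set Lm) -> bounded_set D ->
  continuous f -> (\int[L]_(x in D) (f x)%:E = (Rint D f)%:E)%E.
Proof. move=> mD bD cf; apply: (@integrable_Rintegral R _ Lm L D f mD).
exact: continuous_integrable. Qed.

Lemma Rint_ge0 (D : set E) (f : E -> R) : (forall x, 0 <= f x) -> 0 <= Rint D f.
Proof. by move=> f0; apply/fine_ge0/integral_ge0 => x _; rewrite lee_fin. Qed.

(** The strip of height [a] is translated along [e] to the [K] layers above it,
    which are disjoint in [Omega]. Each translation costs the energy along segments
    of length at most [K * a], and averaging over the layers shows that the strip
    carries at most about [2/K] of the mass. *)
Lemma strip_estimate (Omega U : set E) e ht width C (K : nat) (a : R) (v : E -> R) :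
  open Omega -> bounded_set Omega -> collar Omega U e ht width C ->
  0 < a -> K%:R * a < width -> smooth v ->
  K%:R * Rint (Omega `&` (U `&` [set x | ht x < a])) (fun x => v x ^+ 2) <=
  2 * Rint Omega (fun x => v x ^+ 2) + 2 * K%:R * (K%:R * a) ^+ 2 * Rint Omega (gradsq v).
Proof.
move=> oO bO col a0 Ka sv; set S := Omega `&` _.
have cv := smooth_continuous sv; have cv2 := cont_sqr cv; have cG := gradsq_continuous sv.
have oS : open S.
  apply: openI => //; apply: openI; first exact: collar_open col.
  rewrite (_ : [set x | _] = ht @^-1` `]-oo, a[%classic).
    apply: open_comp => [x _|]; first exact: (collar_height_continuous col).
    exact: interval_open.
  by apply/seteqP; split => x /=; rewrite in_itv.
have mO := @lebesgue_open R n _ oO; have mS := @lebesgue_open R n _ oS.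
have SO : S `<=` Omega by move=> x [].
have bS : bounded_set S by apply: bounded_sub bO.
pose F (k : 'I_K) := [set x : E | S (x - (k%:R * a) *: e)].
have kK (k : 'I_K) : k%:R * a <= K%:R * a by rewrite ler_pM2r// ler_nat ltnW.
have mF k : measurable (F k : set Lm).
  apply: lebesgue_open; apply: (open_comp (f := fun x : E => x - (k%:R * a) *: e)) => // x _.
  exact: addr_continuous.
have FO k : F k `<=` Omega.
  move=> x Sx; rewrite -(subrK ((k%:R * a) *: e) x); case: Sx => Ox [Ux hx].
  apply: (collar_inside col) => //; first by rewrite mulr_ge0 ?ler0n// ltW.
    exact: le_lt_trans (kK k) Ka.
  rewrite ltr_wpDr//; first by rewrite mulr_ge0 ?ler0n// ltW.
  exact: (collar_height_gt0 col).
have bF k : bounded_set (F k) by apply: bounded_sub bO; exact: FO.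
have Fht k x : F k x -> k%:R * a < ht x < k.+1%:R * a.
  move=> [Ox [Ux]]; have := collar_height_gt0 col Ux Ox.
  by rewrite /= -scaleNr (collar_height_shift col) -natr1 mulrDl mul1r => h1 h2; apply/andP; split; lra.
have dF (i j : 'I_K) x : F i x -> F j x -> i = j.
  move=> /Fht/andP[i1 i2] /Fht/andP[j1 j2]; apply/val_inj/eqP; rewrite eqn_leq.
  have := lt_trans i1 j2; have := lt_trans j1 i2.
  by rewrite !ltr_pM2r// !ltr_nat !ltnS => -> ->.
have sumF : \sum_(k < K) Rint (F k) (fun x => v x ^+ 2) <= Rint Omega (fun x => v x ^+ 2).
  rewrite -lee_fin -sumEFin -(Rint_EFin mO bO cv2).
  under eq_bigr do rewrite -(Rint_EFin (mF _) (bF _) cv2).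
  apply: (@disjoint_integrals_le _ _ Lm L _ xpredT F Omega (fun x => (v x ^+ 2)%:E) mF mO
    _ _ (fun k _ => @FO k) _).
  - by apply/measurable_EFinP; exact: lebesgue_continuous.
  - by move=> x _; rewrite lee_fin sqr_ge0.
  - by move=> i j x _ _; exact: dF.
have each k : Rint S (fun x => v x ^+ 2) <= 2 * Rint (F k) (fun x => v x ^+ 2) +
    2 * (K%:R * a) ^+ 2 * Rint Omega (gradsq v).
  pose w := (k%:R * a) *: e.
  pose g x := v (x + w) ^+ 2; pose h x := (v (x + w) - v x) ^+ 2.
  have cg : continuous g by apply: cont_sqr; apply: cont_comp cv; exact: addr_continuous.
  have ch : continuous h by apply: cont_sqr; apply: contB => //; apply: cont_comp cv; exact: addr_continuous.
  have hle : Rint S h <= (K%:R * a) ^+ 2 * Rint Omega (gradsq v).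
    rewrite -lee_fin EFinM -(Rint_EFin mO bO cG) -(Rint_EFin mS bS ch).
    apply: le_trans (_ : (enorm w ^+ 2)%:E * _ <= _)%E.
      apply: (@translation_estimate R n v S Omega w sv mS mO (lebesgue_bounded_lty bS)).
      move=> x t [Ox [Ux hx]] t0 t1; rewrite /w scalerA.
      have tw : 0 <= t * (k%:R * a) by rewrite !mulr_ge0 ?ler0n// ltW.
      apply: (collar_inside col) => //.
        apply: le_lt_trans Ka; apply: le_trans (kK k); rewrite -[leRHS]mul1r ler_wpM2r//.
        by rewrite mulr_ge0 ?ler0n// ltW.
      by rewrite ltr_wpDr//; exact: (collar_height_gt0 col).
    apply: lee_wpmul2r; first by apply: integral_ge0 => x _; rewrite lee_fin gradsq_ge0.
    rewrite lee_fin enormZ (collar_dir col) expr1n mulr1 lerXn2r ?nnegrE//.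
    - by rewrite mulr_ge0 ?ler0n// ltW.
    - by rewrite mulr_ge0 ?ler0n// ltW.
  have gle : Rint S g <= Rint (F k) (fun x => v x ^+ 2).
    rewrite -lee_fin -(Rint_EFin mS bS cg) -(Rint_EFin (mF k) (bF k) cv2).
    apply: (ge0_integral_translate_le mS (mF k) cv2); first by move=> x; rewrite sqr_ge0.
    by move=> x Sx; rewrite /F /= addrK.
  have ghle : Rint S (fun x => v x ^+ 2) <= 2 * Rint S g + 2 * Rint S h.
    have cG2 : continuous (fun x => 2 * g x) by apply: contM => //; exact: cst_continuous.
    have cH2 : continuous (fun x => 2 * h x) by apply: contM => //; exact: cst_continuous.
    rewrite /Rint -!RintegralZl//; [|exact: continuous_integrable|exact: continuous_integrable].
    rewrite -RintegralD//; [|exact: continuous_integrable|exact: continuous_integrable].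
    apply: le_Rintegral => //; [exact: continuous_integrable|apply: continuous_integrable => //; exact: contD|].
    by move=> x _; exact: sqr_split.
  by move: hle gle ghle; nra.
apply: le_trans (average_le each sumF) _.
by rewrite le_eqVlt; apply/orP; left; apply/eqP; ring.
Qed.

End Strip.

(** * The Rellich inequality *)

Section Covers.
Context (R : realType) (n : nat).
Local Notation E := 'rV[R]_n.+1.

Lemma compact_finite_cover (K : set E) (U : E -> set E) : compact K ->
  (forall x, K x -> open (U x) /\ U x x) ->
  exists s : seq E, (forall x, x \in s -> K x) /\
    forall y, K y -> exists2 x, x \in s & U x y.
Proof.
rewrite compact_cover => cK hU.
have [|x Kx|s sK sU] := cK E K U; first by move=> x /hU[].
  by exists x => //; have [] := hU x Kx.
exists (finmap.enum_fset s); split => [x xs|y /sU[x /= xs Uxy]].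
  by have := sK x xs; rewrite inE.
by exists x.
Qed.

Lemma closure_compact (Omega : set E) : bounded_set Omega -> compact (closure Omega).
Proof.
move=> /bounded_box[M M0 hM].
pose K := [set x : E | forall i, `[- M, M]%classic (x 0 i)].
have cK : compact K.
  apply: (@rV_compact R n.+1 (fun i => `[- M, M]%classic)) => i; exact: segment_compact.
apply: (subclosed_compact _ cK); first exact: closed_closure.
rewrite [X in _ `<=` X](closure_id _).1; last by apply: compact_closed => //; exact: norm_hausdorff.
apply: closure_subset => z Oz i /=.
by rewrite in_itv/= -ler_norml; exact: hM.
Qed.

Lemma boundary_compact (Omega : set E) : bounded_set Omega -> compact (boundary Omega).
Proof.
move=> bO; apply: subclosed_compact (closure_compact bO) _; last by move=> x [].
rewrite /boundary setDE; apply: closedI; first exact: closed_closure.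
by rewrite closedC; exact: open_interior.
Qed.

(** Finitely many collars cover the compact boundary. *)
Lemma boundary_collars (Omega : set E) : open Omega -> bounded_set Omega -> C11_boundary Omega ->
  exists (J : finType) (U : J -> set E) (e : J -> E) (ht : J -> E -> R) (w C : J -> R),
    (forall j, collar Omega (U j) (e j) (ht j) (w j) (C j)) /\
    forall y, boundary Omega y -> exists j, U j y.
Proof.
move=> oO bO cO.
have /choice[f hf] : forall x, exists z : set E * E * (E -> R) * R * R, boundary Omega x ->
    z.1.1.1.1 x /\ collar Omega z.1.1.1.1 z.1.1.1.2 z.1.1.2 z.1.2 z.2.
  move=> x; have [bx|nbx] := pselect (boundary Omega x); last first.
    by exists (set0, 0, (fun=> 0), 0, 0).
  have [U [e [ht [w [C [Ux col]]]]]] := boundary_collar oO cO bx.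
  by exists (U, e, ht, w, C).
have [|s [sb sc]] := @compact_finite_cover _ (fun x => (f x).1.1.1.1) (boundary_compact bO).
  by move=> x /hf[Ux col]; split => //; exact: collar_open col.
exists (seq_sub s), (fun j => (f (val j)).1.1.1.1), (fun j => (f (val j)).1.1.1.2),
  (fun j => (f (val j)).1.1.2), (fun j => (f (val j)).1.2), (fun j => (f (val j)).2).
split => [j|y /sc[x xs Uy]].
  by have [] := hf (val j) (sb _ (valP j)).
by exists (SeqSub xs).
Qed.

Lemma Lebesgue_radius (K Omega : set E) : compact K -> open Omega -> K `<=` Omega ->
  exists2 r, 0 < r & forall x, K x -> ball x r `<=` Omega.
Proof.
move=> /compact_near_coveringP cK oO KO.
have near1 : forall x, K x -> \forall x' \near x & i \near (0 : R)^'+, ball x' i `<=` Omega.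
  move=> x /KO Ox; have /nbhs_ballP[r /= r0 hr] : nbhs x Omega by exact: open_nbhs_nbhs.
  exists (ball x (r / 2), [set i | i < r / 2]) => /=.
    split; first by apply: nbhsx_ballx; rewrite divr_gt0.
    by apply: nbhs_right_lt; rewrite divr_gt0.
  move=> [x' i] /= [bx' ir] z bz; apply: hr.
  rewrite [r]splitr; apply: (@ball_triangle _ _ x' x z (r / 2) (r / 2)) => //.
  by apply: le_ball bz; exact: ltW.
have h := cK R (0 : R)^'+ (fun r x => ball x r `<=` Omega) (at_right_proper_filter 0) near1.
have [r [r0 hr]] : exists r : R, 0 < r /\ K `<=` (fun x => ball x r `<=` Omega).
  near (0 : R)^'+ => r; exists r; split; first by near: r; exact: nbhs_right_gt.
  by near: r.
by exists r.
Unshelve. all: by end_near. Qed.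

(** The cells of a fine grid which meet the compact set [K]: their size is below the
    distance from [K] to the complement of [Omega]. *)
Lemma interior_cells (K Omega : set E) (s0 : R) : compact K -> open Omega -> K `<=` Omega -> 0 < s0 ->
  exists s, [/\ 0 < s, s <= s0 & exists (J : finType) (P : pred J) (c : J -> E),
    [/\ forall j, P j -> hcube (c j) s `<=` Omega,
        forall i j x, hcube (c i) s x -> hcube (c j) s x -> i = j
      & forall x, K x -> exists2 j, P j & hcube (c j) s x]].
Proof.
move=> cK oO KO s00.
have [r r0 hr] := Lebesgue_radius cK oO KO.
have [M M0 hM] := bounded_box (compact_bounded cK).
pose s := Num.min s0 (r / 2).
have sp : 0 < s by rewrite lt_min s00 divr_gt0.
have sr : s < r by rewrite gt_min (_ : r / 2 < r) ?orbT//; lra.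
exists s; split => //; first by rewrite ge_min lexx.
pose N := (Num.truncn (2 * M / s)).+1.
pose c (z : {ffun 'I_n.+1 -> 'I_N}) : E := \row_i (- M + s * (z i)%:R).
exists {ffun 'I_n.+1 -> 'I_N}, (fun z => `[< hcube (c z) s `<=` Omega >]), c; split.
- by move=> j /asboolP.
- move=> i j x hi hj; apply/ffunP => k; apply/val_inj/eqP; rewrite eqn_leq.
  have /andP[i1 i2] := hi k; have /andP[j1 j2] := hj k; move: i1 i2 j1 j2; rewrite !mxE => i1 i2 j1 j2.
  have a1 : s * (i k)%:R < s * (j k).+1%:R by rewrite -natr1 mulrDr mulr1; lra.
  have a2 : s * (j k)%:R < s * (i k).+1%:R by rewrite -natr1 mulrDr mulr1; lra.
  by move: a1 a2; rewrite !ltr_pM2l// !ltr_nat !ltnS => -> ->.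
- move=> x Kx.
  have xM i : 0 <= (x 0 i + M) / s.
    by rewrite divr_ge0 ?(ltW sp)//; have := hM x i Kx; rewrite ler_norml => /andP[]; lra.
  have zN i : (Num.truncn ((x 0 i + M) / s)%R < N)%N.
    rewrite ltnS; apply: le_truncn; rewrite ler_pM2r ?invr_gt0//.
    by have := hM x i Kx; rewrite ler_norml => /andP[]; lra.
  pose z : {ffun 'I_n.+1 -> 'I_N} := [ffun i => Ordinal (zN i)].
  have xz : hcube (c z) s x.
    move=> i; rewrite !mxE ffunE /=; have /andP[] := truncn_itv (xM i).
    rewrite ler_pdivlMr// ltr_pdivrMr// -natr1; set t := _%:R => h1 h2.
    by apply/andP; split; nra.
  exists z => //; apply/asboolP => y yz; apply: (hr x Kx); apply/rV_ballE => // i.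
  have := xz i; have := yz i; rewrite ltr_norml => /andP[? ?] /andP[? ?]; apply/andP; split; lra.
Qed.

Lemma finite_lower (J : finType) (f : J -> R) (b : R) : 0 < b -> (forall j, 0 < f j) ->
  exists2 eta, 0 < eta <= b & forall j, eta < f j.
Proof.
move=> b0 f0; pose m := \big[Num.min/b]_j f j.
have m0 : 0 < m by rewrite /m; elim/big_ind: _ => // x y x0 y0; rewrite lt_min x0.
have mb : m <= b by exact: bigmin_le_id.
exists (m / 2); first by rewrite divr_gt0//; lra.
by move=> j; apply: (@lt_le_trans _ _ m); [lra|exact: bigmin_le].
Qed.

End Covers.

Section Rellich.
Context (R : realType) (n : nat).
Local Notation E := 'rV[R]_n.+1.
Local Notation L := (lebesgue R n).
Local Notation Lm := (lebesgue_space R n).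

Lemma sum_constr_le (J : finType) (P : pred J) (f : J -> R) (c : R) :
  0 <= c -> (forall j, P j -> f j <= c) -> \sum_(j | P j) f j <= #|J|%:R * c.
Proof.
move=> c0 fc; apply: (@le_trans _ _ (\sum_(j : J) c)).
  rewrite [leRHS](bigID P)/= -[leLHS]addr0; apply: lerD; first exact: ler_sum.
  exact: sumr_ge0.
by rewrite sumr_const mulr_natl.
Qed.

(** The mass near the boundary is small by [strip_estimate] with [K] large; the rest
    of [Omega] is covered by small cubes inside [Omega], on which the mass is
    controlled by the energy and the mean value ([poincare_cube]). Compactness of
    the embedding of H^1 in L^2 is thus expressed through finitely many means. *)
Lemma rellich (Omega : set E) (eps : R) : open Omega -> bounded_set Omega -> C11_boundary Omega ->
  0 < eps -> exists (J : finType) (P : pred J) (q : J -> set E) (K : R),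
  [/\ forall j, measurable (q j : set Lm), forall j, P j -> q j `<=` Omega, 0 <= K &
   forall v, smooth v -> Rint Omega (fun x => v x ^+ 2) <=
     eps * (Rint Omega (fun x => v x ^+ 2) + Rint Omega (gradsq v)) +
     K * \sum_(j | P j) Rint (q j) v ^+ 2].
Proof.
move=> oO bO cO e0.
have [J0 [U [e [ht [w [C [col cov]]]]]]] := boundary_collars oO bO cO.
set N0 : R := #|J0|%:R.
have N00 : 0 <= N0 by rewrite ler0n.
(* By [strip_estimate] the strips of the [N0] collars carry about [2 * N0 / K] of the mass. *)
pose K := (Num.truncn (2 * N0 / eps)).+1.
have K0 : 0 < K%:R :> R by rewrite ltr0n.
have hK : 2 * N0 / K%:R <= eps.
  rewrite ler_pdivrMr// -ler_pdivrMl// mulrC.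
  by apply/ltW; have /andP[] := truncn_itv (divr_ge0 (mulr_ge0 (ler0n R 2) N00) (ltW e0)).
have [eta /andP[eta0 etab] etaw] : exists2 eta, 0 < eta <= Num.min 1 (eps / (4 * (N0 + 1))) & forall j, eta < w j.
  apply: finite_lower; last by move=> j; exact: collar_width_gt0 (col j).
  by rewrite lt_min ltr01 divr_gt0// mulr_gt0// ltr_wpDl.
have eta1 : eta <= 1 by apply: le_trans etab _; rewrite ge_min lexx.
have eta2 : 4 * N0 * eta ^+ 2 <= eps.
  have : eta <= eps / (4 * (N0 + 1)) by apply: le_trans etab _; rewrite ge_min lexx orbT.
  rewrite ler_pdivlMr; last by rewrite mulr_gt0// ltr_wpDl.
  have h1 : N0 * eta * eta <= N0 * eta by rewrite ler_piMr ?mulr_ge0// ltW.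
  rewrite expr2; nra.
pose a := eta / K%:R.
have a0 : 0 < a by rewrite divr_gt0.
have Ka : K%:R * a = eta by rewrite /a mulrC divfK// gt_eqF.
pose V j := U j `&` [set x | ht j x < a].
have oV j : open (V j).
  apply: openI; first exact: collar_open (col j).
  rewrite (_ : [set x | _] = ht j @^-1` `]-oo, a[%classic).
    apply: open_comp => [x _|]; first exact: (collar_height_continuous (col j)).
    exact: interval_open.
  by apply/seteqP; split => x /=; rewrite in_itv.
pose K1 := closure Omega `\` \bigcup_j V j.
have cK1 : compact K1.
  apply: (subclosed_compact _ (closure_compact bO)); last by move=> x [].
  rewrite /K1 setDE; apply: closedI; first exact: closed_closure.
  by apply: open_closedC; apply: bigcup_open => j _; exact: oV.
have K1O : K1 `<=` Omega.
  move=> x [clx nV]; apply: contrapT => nOx; apply: nV.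
  have bx : boundary Omega x by split => // /interior_subset.
  have [j Ujx] := cov x bx; exists j => //; split => //=.
  by rewrite (collar_height_boundary (col j)).
pose s0 := Num.min 1 (eps / (4 * (2 ^+ n * n.+1%:R))).
have d0 : 0 < 2 ^+ n * n.+1%:R :> R by rewrite mulr_gt0 ?exprn_gt0.
have s00 : 0 < s0 by rewrite lt_min ltr01 divr_gt0// mulr_gt0.
have [s [sp ss0 [J [P [c [cO1 dc cc]]]]]] := interior_cells cK1 oO K1O s00.
have hs : 2 ^+ n * n.+1%:R * s ^+ 2 <= eps / 4.
  have s1 : s <= 1 by apply: le_trans ss0 _; rewrite ge_min lexx.
  have : s <= eps / (4 * (2 ^+ n * n.+1%:R)) by apply: le_trans ss0 _; rewrite ge_min lexx orbT.
  rewrite ler_pdivlMr; last by rewrite mulr_gt0.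
  move: d0; set D := _ * n.+1%:R => d0 h.
  have h1 : D * s * s <= D * s by rewrite ler_piMr// mulr_ge0// ltW.
  rewrite expr2; nra.
pose l := fine (L (hcube 0 s)).
have l0 : 0 <= l by apply: fine_ge0; exact: measure_ge0.
exists J, P, (fun j => hcube (c j) s), l^-1; split => [j|j|//|v sv].
- exact: hcube_measurable.
- exact: cO1.
- by rewrite invr_ge0.
have cv := smooth_continuous sv; have cv2 := cont_sqr cv; have cG := gradsq_continuous sv.
have mO := @lebesgue_open R n _ oO.
set m := Rint Omega (fun x => v x ^+ 2); set g := Rint Omega (gradsq v).
have m0 : 0 <= m by apply: Rint_ge0 => x; exact: sqr_ge0.
have g0 : 0 <= g by apply: Rint_ge0 => x; exact: gradsq_ge0.
have mS j : measurable (Omega `&` V j : set Lm) by apply: lebesgue_open; exact: openI.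
have bS j : bounded_set (Omega `&` V j) by apply: bounded_sub bO => x [].
have cellsG : \sum_(j | P j) Rint (hcube (c j) s) (gradsq v) <= g.
  rewrite -lee_fin -sumEFin -(Rint_EFin mO bO cG).
  under eq_bigr do rewrite -(Rint_EFin (hcube_measurable _ _) (@hcube_bounded _ _ _ _) cG).
  apply: (@disjoint_integrals_le _ _ Lm L _ P (fun j => hcube (c j) s) Omega (fun x => (gradsq v x)%:E)
    (fun j => hcube_measurable _ _) mO _ _ cO1 _).
  - by apply/measurable_EFinP; exact: lebesgue_continuous.
  - by move=> x _; rewrite lee_fin gradsq_ge0.
  - by move=> i j x _ _; exact: dc.
have cells : \sum_(j | P j) Rint (hcube (c j) s) (fun x => v x ^+ 2) <=
    eps / 4 * g + l^-1 * \sum_(j | P j) Rint (hcube (c j) s) v ^+ 2.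
  apply: (@le_trans _ _ (\sum_(j | P j) (eps / 4 * Rint (hcube (c j) s) (gradsq v) +
      l^-1 * Rint (hcube (c j) s) v ^+ 2))).
    apply: ler_sum => j _; apply: le_trans (poincare_cube _ sv sp) _.
    rewrite hcube_translate lerD2r ler_wpM2r//.
    by apply: Rint_ge0 => x; exact: gradsq_ge0.
  by rewrite big_split/= -!mulr_sumr lerD2r ler_wpM2l// divr_ge0// ltW.
have strips : \sum_(j : J0) Rint (Omega `&` V j) (fun x => v x ^+ 2) <= eps * m + eps / 2 * g.
  apply: (@le_trans _ _ (N0 * (2 / K%:R * m + 2 * eta ^+ 2 * g))).
    apply: sum_constr_le => [|j _].
      apply: addr_ge0; apply: mulr_ge0 => //.
      by rewrite mulr_ge0 ?sqr_ge0.
    have := strip_estimate (v := v) (K := K) oO bO (col j) a0 _ sv.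
    rewrite Ka => /(_ (etaw j)) h.
    rewrite -(ler_pM2l K0); apply: le_trans h _; rewrite -/m -/g.
    rewrite le_eqVlt; apply/orP; left; apply/eqP; field.
    by rewrite gt_eqF.
  rewrite mulrDr; apply: lerD.
    by rewrite mulrA ler_wpM2r// mulrA [N0 * 2]mulrC.
  by rewrite mulrA ler_wpM2r//; move: eta2; lra.
have tot : m <= \sum_(j : J0) Rint (Omega `&` V j) (fun x => v x ^+ 2) +
    \sum_(j | P j) Rint (hcube (c j) s) (fun x => v x ^+ 2).
  pose F (z : J0 + J) : set E := match z with inl j => Omega `&` V j | inr j => hcube (c j) s end.
  pose Q (z : J0 + J) := match z with inl _ => true | inr j => P j end.
  have mF z : measurable (F z : set Lm) by case: z => j; [exact: mS|exact: hcube_measurable].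
  have bF z : bounded_set (F z) by case: z => j; [exact: bS|exact: hcube_bounded].
  have := @integral_cover_le _ _ Lm L _ Q F Omega (fun x => (v x ^+ 2)%:E) mF.
  rewrite (Rint_EFin mO bO cv2).
  under eq_bigr do rewrite (Rint_EFin (mF _) (bF _) cv2).
  rewrite sumEFin lee_fin big_sumType/=; apply.
  - by apply/measurable_EFinP; exact: lebesgue_continuous.
  - by move=> x; rewrite lee_fin sqr_ge0.
  - move=> x Ox; have [[j _ Vj]|nV] := pselect ((\bigcup_j V j) x); first by exists (inl j).
    have [|j Pj cj] := cc x; last by exists (inr j).
    by split => //; exact: subset_closure.
move: tot strips cells; nra.
Qed.

End Rellich.

(** * The trace inequality *)

Section TraceInequality.
Context (R : realType) (n : nat).
Local Notation E := 'rV[R]_n.+1.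
Local Notation sg := (surface R n).
Implicit Types v : E -> R.

Lemma Rint_comb (D : set E) (f g : E -> R) (a b : R) :
  measurable (D : set (lebesgue_space R n)) -> bounded_set D -> continuous f -> continuous g ->
  Rint D (fun x => a * f x + b * g x) = a * Rint D f + b * Rint D g.
Proof.
move=> mD bD cf cg.
have i1 := continuous_integrable mD bD cf; have i2 := continuous_integrable mD bD cg.
have ca : continuous (fun x => a * f x) by apply: contM => //; exact: cst_continuous.
have cb : continuous (fun x => b * g x) by apply: contM => //; exact: cst_continuous.
rewrite /Rint -(RintegralZl a mD i1) -(RintegralZl b mD i2) RintegralD//; exact: continuous_integrable.
Qed.

(** Compare the value at the boundary point [y] with the values along the ray and
    average over a length [h]. *)
Lemma ray_estimate v (y e : E) (h : R) : smooth v -> enorm e = 1 -> 0 < h ->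
  (h%:E * (v y ^+ 2)%:E <= \int[@lebesgue_measure R]_(t in `]0%R, h])
     (2 * v (y + t *: e) ^+ 2 + 2 * h ^+ 2 * gradsq v (y + t *: e))%:E)%E.
Proof.
move=> sv e1 h0.
have cv := smooth_continuous sv; have cv2 := cont_sqr cv; have cG := gradsq_continuous sv.
pose I := (`]0%R, h]%classic : set R).
have mI : measurable I by exact: measurable_itv.
have muI : (@lebesgue_measure R I = h%:E)%E.
  by rewrite /I lebesgue_measure_itv/= lte_fin h0 -EFinD subr0.
have mline (g : E -> R) : continuous g -> measurable_fun I (fun t : R => g (y + t *: e)).
  move=> cg; apply: (@measurable_funS _ _ _ _ setT) => //; apply: continuous_measurable_fun.
  exact: line_continuous.
set G := (\int[@lebesgue_measure R]_(t in I) (gradsq v (y + t *: e))%:E)%E.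
have G0 : (0 <= G)%E by apply: integral_ge0 => t _; rewrite lee_fin gradsq_ge0.
apply: (@le_trans _ _ (\int[@lebesgue_measure R]_(t in I)
   ((2 * v (y + t *: e) ^+ 2)%:E + (2 * h)%:E * G))%E).
  rewrite [leLHS]muleC -muI -integral_cst//.
  apply: ge0_integral_mono => t; first by rewrite lee_fin sqr_ge0.
  rewrite /I /= in_itv/= => /andP[t0 th].
  apply: (@le_trans _ _ ((2 * v (y + t *: e) ^+ 2)%:E + 2%:E * ((v (y + t *: e) - v y) ^+ 2)%:E)%E).
    by rewrite -EFinM -EFinD lee_fin; exact: sqr_split.
  rewrite leeD2l// [(2 * h)%:E]EFinM -muleA; apply: lee_wpmul2l; first by rewrite lee_fin.
  apply: le_trans (smooth_increment_sqr y e sv t0) _.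
  rewrite e1 expr1n mulr1; apply: lee_pmul.
  - by rewrite lee_fin ltW.
  - by apply: integral_ge0 => s _; rewrite lee_fin gradsq_ge0.
  - by rewrite lee_fin.
  - apply: ge0_integral_mono2 => s; [by rewrite lee_fin gradsq_ge0|by rewrite lee_fin gradsq_ge0|].
    by rewrite /I /= !in_itv/= => /andP[s0 st]; split; rewrite // s0 (le_trans st).
rewrite ge0_integralD//; last 3 first.
- by move=> t _; rewrite lee_fin mulr_ge0// sqr_ge0.
- by apply/measurable_EFinP; apply: measurable_funM; [exact: measurable_cst|exact: (mline _ cv2)].
- by move=> t _; apply: mule_ge0 => //; rewrite lee_fin mulr_ge0// ltW.
under [leRHS]eq_integral do rewrite EFinD.
rewrite [leRHS]ge0_integralD//; last 4 first.
- by move=> t _; rewrite lee_fin mulr_ge0// sqr_ge0.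
- by apply/measurable_EFinP; apply: measurable_funM; [exact: measurable_cst|exact: (mline _ cv2)].
- move=> t _; rewrite lee_fin; apply: mulr_ge0; last exact: gradsq_ge0.
  by rewrite mulr_ge0 ?sqr_ge0.
- by apply/measurable_EFinP; apply: measurable_funM; [exact: measurable_cst|exact: (mline _ cG)].
apply: leeD2l.
rewrite (@ge0_integral_scale R _ _ (@lebesgue_measure R) I (2 * h ^+ 2) (fun t => gradsq v (y + t *: e)))//; last 3 first.
- exact: mline.
- by rewrite mulr_ge0 ?sqr_ge0.
- by move=> t _; exact: gradsq_ge0.
have e2 : (\int[@lebesgue_measure R]_(t in I) ((2 * h)%:E * G) = (2 * h)%:E * G * h%:E)%E.
  have := integral_cst (@lebesgue_measure R) mI ((2 * h)%:E * G)%E.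
  by rewrite /cst => ->; congr (_ * _)%E.
rewrite [leLHS]e2 muleAC -EFinM.
by rewrite (_ : 2 * h * h = 2 * h ^+ 2)//; ring.
Qed.

(** Integrate [ray_estimate] over the boundary piece; [collar_slide] turns the
    integral along the rays into an integral over [Omega]. *)
Lemma collar_trace (Omega U : set E) e ht w C v (h : R) : open Omega -> bounded_set Omega ->
  collar Omega U e ht w C -> smooth v -> 0 < h -> h < w ->
  (\int[sg]_(y in boundary Omega `&` U) (v y ^+ 2)%:E <=
   (C * (2 / h * Rint Omega (fun x => v x ^+ 2) + 2 * h * Rint Omega (gradsq v)))%:E)%E.
Proof.
move=> oO bO col sv h0 hw.
have cv := smooth_continuous sv; have cv2 := cont_sqr cv; have cG := gradsq_continuous sv.
have mO := @lebesgue_open R n _ oO.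
pose g x := 2 * v x ^+ 2 + 2 * h ^+ 2 * gradsq v x.
have c1 : continuous (fun x => 2 * v x ^+ 2) by apply: contM cv2; exact: cst_continuous.
have c2 : continuous (fun x => 2 * h ^+ 2 * gradsq v x) by apply: contM cG; exact: cst_continuous.
have cg : continuous g by exact: contD.
have g0 x : 0 <= g x by rewrite /g; have := mulr_ge0 (sqr_ge0 h) (gradsq_ge0 v x); have := sqr_ge0 (v x); nra.
have mD : measurable (boundary Omega `&` U : set (surface_space R n)).
  apply: measurableI; last by apply: surface_open; exact: collar_open col.
  by apply: surface_closed; apply: compact_closed; [exact: norm_hausdorff|exact: boundary_compact].
have := collar_slide col h0 hw cg g0.
rewrite (Rint_EFin mO bO cg) => le.
have gE : Rint Omega g = 2 * Rint Omega (fun x => v x ^+ 2) + 2 * h ^+ 2 * Rint Omega (gradsq v).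
  by rewrite -Rint_comb.
rewrite -(@lee_pmul2l _ h%:E)// -EFinM.
rewrite -(@ge0_integral_scale R _ _ sg _ h (fun y => v y ^+ 2) mD); last 3 first.
- exact: surface_continuous.
- exact: ltW.
- by move=> y _; rewrite sqr_ge0.
apply: le_trans (_ : _ <= (C * Rint Omega g)%:E)%E _; last first.
  rewrite gE lee_fin le_eqVlt; apply/orP; left; apply/eqP; field; exact: lt0r_neq0.
apply: le_trans le; apply: ge0_integral_mono => y _; first by rewrite lee_fin mulr_ge0 ?sqr_ge0 ?ltW.
by rewrite EFinM; apply: ray_estimate => //; exact: collar_dir col.
Qed.

Lemma boundary_surface_lty (Omega : set E) : open Omega -> bounded_set Omega -> C11_boundary Omega ->
  (sg (boundary Omega) < +oo)%E.
Proof.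
move=> oO bO cO; have [J [U [e [ht [w [C [col cov]]]]]]] := boundary_collars oO bO cO.
have sub : boundary Omega `<=` \big[setU/set0]_(j : J) (boundary Omega `&` U j).
  move=> y by_; rewrite -(@bigcup_pred _ _ predT); have [j Uj] := cov y by_; by exists j.
apply: le_lt_trans (le_outer_measure (hausdorff_outer R n.+1 n) _ _ sub) _.
apply: (@le_lt_trans _ _ (\sum_(j : J) hausdorff_outer R n.+1 n (boundary Omega `&` U j))%E).
  apply: (@bigsetU_subadditive R _ (hausdorff_outer R n.+1 n) setT) => // A B _ _.
  exact: outer_measureU2.
by apply: lte_sum_pinfty => j _; exact: collar_finite (col j).
Qed.

(** Sum [collar_trace] over finitely many collars. The energy appears with a factor
    O(h), so it can be made small at the expense of the constant of the mass: this
    is what makes the trace compact. *)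
Lemma trace_inequality (Omega : set E) (eps : R) :
  open Omega -> bounded_set Omega -> C11_boundary Omega -> 0 < eps -> exists2 K, 0 <= K &
  forall v, smooth v -> (\int[sg]_(y in boundary Omega) (v y ^+ 2)%:E <=
    (eps * Rint Omega (gradsq v) + K * Rint Omega (fun x => v x ^+ 2))%:E)%E.
Proof.
move=> oO bO cO e0; have [J [U [e [ht [w [C [col cov]]]]]]] := boundary_collars oO bO cO.
pose CC := \sum_j C j.
have C0 j : 0 <= C j by apply: ltW; exact: collar_const_gt0 (col j).
have CC0 : 0 <= CC by exact: sumr_ge0.
have [h /andP[h0 hb] hw] : exists2 h, 0 < h <= eps / (2 * (CC + 1)) & forall j, h < w j.
  apply: finite_lower; last by move=> j; exact: collar_width_gt0 (col j).
  by rewrite divr_gt0// mulr_gt0// ltr_wpDl.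
exists (CC * (2 / h)) => [|v sv]; first by rewrite mulr_ge0// divr_ge0// ltW.
have cv2 := cont_sqr (smooth_continuous sv).
set g := Rint Omega (gradsq v); set m := Rint Omega (fun x => _).
have g0 : 0 <= g by apply: Rint_ge0 => x; exact: gradsq_ge0.
apply: (@le_trans _ _ (\sum_(j : J) (C j * (2 / h * m + 2 * h * g))%:E)%E); last first.
  rewrite sumEFin lee_fin -mulr_suml -/CC.
  have : CC * (2 * h) <= eps.
    move: hb; rewrite ler_pdivlMr; last by rewrite mulr_gt0// ltr_wpDl.
    by move=> hb; move: h0; nra.
  move=> hC; rewrite mulrDr addrC mulrA [CC * (2 / h * m)]mulrA lerD2r.
  by rewrite ler_wpM2r.
apply: (@le_trans _ _ (\sum_(j : J) \int[sg]_(y in boundary Omega `&` U j) (v y ^+ 2)%:E)%E).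
  apply: (@integral_cover_le _ _ (surface_space R n) sg _ xpredT (fun j => boundary Omega `&` U j)).
  - move=> j; apply: measurableI; last by apply: surface_open; exact: collar_open (col j).
    by apply: surface_closed; apply: compact_closed; [exact: norm_hausdorff|exact: boundary_compact].
  - by apply/measurable_EFinP; exact: surface_continuous.
  - by move=> x; rewrite lee_fin sqr_ge0.
  - by move=> y by_; have [j Uj] := cov y by_; exists j.
by apply: lee_sum => j _; apply: collar_trace (col j) sv h0 (hw j).
Qed.

End TraceInequality.

(** * Functions with zero integral over cubes *)

Lemma half_series_lty (R : realType) : (\sum_(0 <= k <oo) ((2 : R) ^- k)%:E < +oo)%E.
Proof.
have h : (\sum_(0 <= k < N) ((2 : R) ^- k)%:E)%E @[N --> \oo] --> (2%:E : \bar R).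
  apply/fine_cvgP; split; first by apply: nearW => N; rewrite sumEFin.
  have := @cvg_geometric_series_half R 2 0; rewrite expr0 divr1; apply: cvg_trans.
  apply: near_eq_cvg; apply: nearW => N /=; rewrite sumEFin /=; rewrite /series /=.
  by apply: eq_bigr => i _; rewrite addn1 natrX exprS invfM mulrA divff// mul1r.
by move/cvg_lim : h => ->//; rewrite ltry.
Qed.

Section LimitSets.
Local Open Scope ereal_scope.
Context (R : realType) d (T : measurableType d) (mu : {measure set T -> \bar R}).

(** Dominated convergence for the indicators of [U N]. *)
Lemma limit_set_integral (D V : set T) (U : nat -> set T) (g : T -> R) :
  measurable D -> mu.-integrable D (EFin \o g) ->
  (forall N, measurable (U N)) -> measurable V ->
  {ae mu, forall x, D x -> (V x -> \forall N \near \oo, U N x) /\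
                           (~ V x -> \forall N \near \oo, ~ U N x)} ->
  (forall N, \int[mu]_(x in D `&` U N) (g x)%:E = 0) ->
  \int[mu]_(x in D `&` V) (g x)%:E = 0.
Proof.
move=> mD gi mU mV h z.
have mg : measurable_fun D (EFin \o g) by exact: measurable_int gi.
have mr (W : set T) : measurable W -> measurable_fun D ((EFin \o g) \_ W).
  move=> mW; apply/(measurable_restrict _ mW mD).
  by apply: measurable_funS mg.
have [|||||_ _] := @dominated_convergence _ _ _ mu D mD
    (fun N => (EFin \o g) \_ (U N)) ((EFin \o g) \_ V) (fun x => `|(g x)%:E|).
- by move=> N; exact: mr.
- exact: mr.
- apply: filterS h => x hx Dx; have [h1 h2] := hx Dx.
  rewrite patchE; case: ifPn => [/set_mem Vx|/negP nVx].
    apply: cvg_near_cst; apply: filterS (h1 Vx) => N UN.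
    by rewrite patchE mem_set.
  apply: cvg_near_cst; have {}nVx : ~ V x by move=> Vx; apply: nVx; exact: mem_set.
  apply: filterS (h2 nVx) => N UN.
  by rewrite patchE memNset.
- exact: integrable_abse gi.
- apply: aeW => x N Dx; rewrite patchE; case: ifP => // _; by rewrite [leLHS]abse0.
move=> cv; rewrite integral_mkcondr.
apply/esym; apply: (cvg_unique _ _ cv) => //=.
rewrite (_ : (fun n => _) = fun=> 0); first exact: cvg_cst.
by apply/funext => N /=; rewrite -integral_mkcondr z.
Qed.

(** Borel-Cantelli. *)
Lemma summable_fading (U : nat -> set T) (A : set T) : measurable A -> (forall N, measurable (U N)) ->
  (forall N, mu (U N `\` A) <= ((2 ^- N)%R)%:E) ->
  {ae mu, forall x, ~ A x -> \forall N \near \oo, ~ U N x}.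
Proof.
move=> mA mU UA; pose F N := U N `\` A.
have mF N : measurable (F N) by exact: measurableD.
have z : mu (lim_sup_set F) = 0.
  apply: lim_sup_set_cvg0 => //.
  apply: le_lt_trans (half_series_lty R).
  by apply: lee_nneseries => k _ //; exact: UA.
exists (lim_sup_set F); split => //.
  by apply: bigcap_measurable => // k _; exact: bigcup_measurable.
move=> x nx; apply: contrapT => nlim; apply: nx => nAx.
have /existsNP[N hN] : ~ forall N, (\bigcup_(j >= N) F j) x by move=> h'; apply: nlim => N _; exact: h'.
by exists N => // j /= Nj Uj; apply: hN; exists j.
Qed.

End LimitSets.

Section Hull.
Context (R : realType) (n : nat).
Local Notation E := 'rV[R]_n.+1.
Local Notation L := (lebesgue R n).

(** A cover of [A] by closed boxes which is optimal up to [eps], as the Lebesgue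
    measure of [A] is the infimum over such covers. *)
Lemma box_hull (A : set E) (eps : R) : (L A < +oo)%E -> 0 < eps ->
  exists F : nat -> set E, [/\ forall k, closed (F k), A `<=` \bigcup_k F k &
    (L (\bigcup_k F k) <= L A + eps%:E)%E].
Proof.
move=> Aoo e0.
have Af : L A \is a fin_num by rewrite ge0_fin_numE//; exact: (outer_measure_ge0 (lebesgue_outer R n)).
have e2 : 0 < eps / 2 by rewrite divr_gt0.
have [x [G [_ AG] <-] Gle0] := lb_ereal_inf_adherent e2 Af.
have Gle : (\sum_(0 <= k <oo) box_gauge (G k : set E) < L A + (eps / 2)%:E)%E by exact: Gle0.
have Goo k : (box_gauge (G k : set E) < +oo)%E.
  apply: le_lt_trans (lt_trans Gle _); last by rewrite -(fineK Af) -EFinD ltry.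
  apply: le_trans (_ : (_ <= \sum_(0 <= i < k.+1) box_gauge (G i : set E))%E) _.
    by rewrite big_nat_recr//= leeDr// sume_ge0// => *; exact: box_gauge_ge0.
  by apply: nneseries_lim_ge => *; exact: box_gauge_ge0.
have /choice[z hz] : forall k, exists z : E * E, [/\ forall i, z.1 0 i <= z.2 0 i,
    G k `<=` box z.1 z.2 &
    ((\prod_(i < n.+1) (z.2 0 i - z.1 0 i))%:E <= box_gauge (G k) + (eps / 2 / (2 ^ k.+1)%:R)%:E)%E].
  move=> k; have kf : box_gauge (G k : set E) \is a fin_num by rewrite ge0_fin_numE// box_gauge_ge0.
  have ek : 0 < eps / 2 / (2 ^ k.+1)%:R by rewrite divr_gt0// ltr0n expn_gt0.
  have [_ [z [z1 z2] <-] zle] := lb_ereal_inf_adherent ek kf.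
  by exists z; split => //; exact: ltW.
exists (fun k => box (z k).1 (z k).2); split => [k|x0 Ax|].
- exact: box_closed.
- have [k _ Gx] := AG x0 Ax; exists k => //; have [_ + _] := hz k; exact.
apply: le_trans (outer_measure_sigma_subadditive (lebesgue_outer R n) _) _.
apply: (@le_trans _ _ (\sum_(0 <= k <oo) (box_gauge (G k : set E) + (eps / 2 / (2 ^ k.+1)%:R)%:E))%E).
  apply: lee_nneseries => [k _ _|k _]; first exact: (outer_measure_ge0 (lebesgue_outer R n)).
  have [z1 z2 zle] := hz k; apply: le_trans zle.
  exact: (@lebesgue_box_le R n (z k).1 (z k).2).
apply: le_trans (epsilon_trick xpredT (fun k => @box_gauge_ge0 R n (G k)) (ltW e2)) _.
rewrite [in leRHS](splitr eps) EFinD addeA leeD2r//; exact: ltW.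
Qed.

End Hull.

Section NullFromGrids.
Context (R : realType) (n : nat).
Local Notation E := 'rV[R]_n.+1.
Local Notation L := (lebesgue R n).
Local Notation Lm := (lebesgue_space R n).

(** The cell with index [z] of the partition of the cube [hcube c s] into
    [(N+1)^(n+1)] congruent half-open cubes. *)
Definition gcube (c : E) (s : R) (N : nat) (z : {ffun 'I_n.+1 -> 'I_N.+1}) : set E :=
  hcube (\row_i (c 0 i + s / N.+1%:R * (z i)%:R)) (s / N.+1%:R).

Lemma gcube_disjoint c s N (z z' : {ffun 'I_n.+1 -> 'I_N.+1}) x : 0 < s ->
  gcube c s z x -> gcube c s z' x -> z = z'.
Proof.
move=> s0 hi hj; apply/ffunP => k; apply/val_inj/eqP; rewrite eqn_leq.
have sN : 0 < s / N.+1%:R by rewrite divr_gt0.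
have := hi k; have := hj k; rewrite !mxE; set t := s / _ => /andP[j1 j2] /andP[i1 i2].
have a1 : t * (z k)%:R < t * (z' k).+1%:R by rewrite -natr1 mulrDr mulr1; lra.
have a2 : t * (z' k)%:R < t * (z k).+1%:R by rewrite -natr1 mulrDr mulr1; lra.
by move: a1 a2; rewrite !ltr_pM2l// !ltr_nat !ltnS => -> ->.
Qed.

Lemma gcube_sub c s N (z : {ffun 'I_n.+1 -> 'I_N.+1}) : 0 < s -> gcube c s z `<=` hcube c s.
Proof.
move=> s0 x hx i; have := hx i; rewrite !mxE.
have sN : s = s / N.+1%:R * N.+1%:R by rewrite divfK.
set t := s / _; have t0 : 0 < t by rewrite divr_gt0.
have z0 : 0 <= t * (z i)%:R by rewrite mulr_ge0// ltW.
have z1 : t * (z i)%:R + t <= t * N.+1%:R.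
  by rewrite -[X in _ + X]mulr1 -mulrDr ler_pM2l// natr1 ler_nat ltn_ord.
have : s = t * N.+1%:R by [].
by move=> sE /andP[h1 h2]; apply/andP; split; lra.
Qed.

Lemma gcube_cover c s N x : 0 < s -> hcube c s x ->
  exists z : {ffun 'I_n.+1 -> 'I_N.+1}, gcube c s z x.
Proof.
move=> s0 hx; set t := s / N.+1%:R; have t0 : 0 < t by rewrite divr_gt0.
have sN : s = N.+1%:R * t by rewrite mulrC divfK.
have x0 i : 0 <= (x 0 i - c 0 i) / t.
  by rewrite divr_ge0 ?(ltW t0)// subr_ge0; have /andP[] := hx i.
have zN i : (Num.truncn ((x 0 i - c 0 i) / t)%R < N.+1)%N.
  rewrite -(ltr_nat R); apply: le_lt_trans (_ : _ <= (x 0 i - c 0 i) / t) _.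
    by have /andP[] := truncn_itv (x0 i).
  rewrite ltr_pdivrMr// -sN ltrBlDl; by have /andP[] := hx i.
exists [ffun i => Ordinal (zN i)] => i; rewrite !mxE ffunE /= -/t.
have /andP[] := truncn_itv (x0 i).
by rewrite ler_pdivlMr// ltr_pdivrMr// -natr1; set m := _%:R => h1 h2; apply/andP; split; nra.
Qed.

Lemma near_small (s r : R) : 0 < r -> 0 < s -> \forall N \near \oo, s / N.+1%:R < r.
Proof.
move=> r0 s0; exists (Num.truncn (s / r)) => // N /= hN.
rewrite ltr_pdivrMr// mulrC -ltr_pdivrMr//.
apply: lt_le_trans (_ : (Num.truncn (s / r)).+1%:R <= _); last by rewrite ler_nat.
by have /andP[] := truncn_itv (divr_ge0 (ltW s0) (ltW r0)).
Qed.

Variables (c : E) (s : R) (g : E -> R).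
Local Notation Q := (hcube c s).
Hypothesis s0 : 0 < s.
Hypothesis gi : L.-integrable Q (EFin \o g).
Hypothesis gz : forall N (z : {ffun 'I_n.+1 -> 'I_N.+1}), (\int[L]_(x in gcube c s z) (g x)%:E = 0)%E.

Let mQ : measurable (Q : set Lm) := hcube_measurable c s.
Let mg : measurable_fun (Q : set Lm) (EFin \o g) := measurable_int L gi.

Let grid_open (U : set E) : open U -> (\int[L]_(x in Q `&` U) (g x)%:E = 0)%E.
Proof.
move=> oU.
pose r N := [seq z <- index_enum {ffun 'I_n.+1 -> 'I_N.+1} | `[< gcube c s z `<=` U >]].
pose W N : set E := \big[setU/set0]_(z <- r N) gcube c s z.
have WE N x : W N x <-> exists2 z : {ffun 'I_n.+1 -> 'I_N.+1}, gcube c s z `<=` U & gcube c s z x.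
  rewrite /W /r big_filter -(@bigcup_pred _ _ (fun z => `[< _ `<=` _ >])).
  by split => [[z /asboolP]|[z zU zx]]; [exists z|exists z => //; exact/asboolP].
have mgc N (z : {ffun 'I_n.+1 -> 'I_N.+1}) : measurable (gcube c s z : set Lm) by exact: hcube_measurable.
have mW N : measurable (W N : set Lm) by exact: bigsetU_measurable.
apply: (@limit_set_integral _ _ Lm L Q U W g mQ gi mW (lebesgue_open oU)).
  apply: aeW => x Qx; split => [Ux|nUx].
    have /nbhs_ballP[e /= e0 eU] : nbhs x U by exact: open_nbhs_nbhs.
    apply: filterS (near_small e0 s0) => N sN; apply/WE.
    have [z zx] := gcube_cover N s0 Qx; exists z => // y zy; apply: eU; apply/rV_ballE => // i.
    have := zx i; have := zy i; set t := s / _ in sN *; rewrite !mxE => /andP[? ?] /andP[? ?].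
    by rewrite ltr_norml; apply/andP; split; lra.
  by apply: nearW => N /WE[z zU /zU].
move=> N; rewrite setIidr; last by move=> x /WE[z _]; exact: gcube_sub.
rewrite (@integral_bigsetU_EFin _ Lm R L _ _ g (r N)).
- by rewrite big1// => z _; exact: gz.
- exact: mgc.
- by rewrite filter_uniq// index_enum_uniq.
- apply/trivIsetP => z z' _ _ /= zz'; apply/seteqP; split => // x [zx z'x].
  by move: zz'; rewrite (gcube_disjoint s0 zx z'x) eqxx.
- apply: (measurable_funS mQ) mg => x; rewrite -/(W N) => /WE[z _]; exact: gcube_sub.
Qed.

Let grid_closed (F : set E) : closed F -> (\int[L]_(x in Q `&` F) (g x)%:E = 0)%E.
Proof.
move=> cF.
have mF := @lebesgue_closed R n _ cF.
have mC : measurable (~` F : set Lm) by apply: lebesgue_open; exact: closed_openC.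
have := grid_open openT; rewrite setIT.
rewrite -{1}[Q]setIT -(setUv F) setIUr integral_setU.
- by rewrite (grid_open (closed_openC cF)) adde0.
- exact: measurableI.
- exact: measurableI.
- by rewrite -setIUr setUv setIT.
- apply/disj_setPRL => x [Qx Fx] [_]; exact.
Qed.

Let grid_Fsigma (F : nat -> set E) : (forall k, closed (F k)) ->
  (\int[L]_(x in Q `&` \bigcup_k F k) (g x)%:E = 0)%E.
Proof.
move=> cF; pose W N := \big[setU/set0]_(k < N) F k.
have cW N : closed (W N) by apply: closed_bigsetU => k _; exact: cF.
apply: (@limit_set_integral _ _ Lm L Q _ W g mQ gi).
- by move=> N; apply: lebesgue_closed.
- by apply: bigcup_measurable => k _; apply: lebesgue_closed; exact: cF.
- apply: aeW => x Qx; split => [[k _ Fx]|nF].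
    by exists k.+1 => // N /= kN; rewrite /W -bigcup_mkord; exists k.
  by apply: nearW => N; rewrite /W -bigcup_mkord => -[k _ Fx]; apply: nF; exists k.
- by move=> N; exact: grid_closed.
Qed.

(** The integral of [g] vanishes over open sets, which are limits of unions of
    cells, then over closed sets and countable unions of closed sets; an arbitrary
    measurable set is up to a null set a limit of such unions by [box_hull], so [g]
    has zero integral over every measurable subset of the cube. *)
Lemma null_of_grid : {ae L, forall x, Q x -> g x = 0}.
Proof.
suff h : ae_eq L Q (EFin \o g) (cst 0%E).
  by apply: filterS h => x hx Qx; have [] := hx Qx.
apply: integral_ae_eq => // A AQ mA; rewrite integral_cst// mul0e.
have Aoo : (L A < +oo)%E.
  by apply: le_lt_trans (hcube_lty c s); exact: (le_outer_measure (lebesgue_outer R n)).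
have /choice[F hF] : forall N, exists F : nat -> set E, [/\ forall k, closed (F k), A `<=` \bigcup_k F k &
    (L (\bigcup_k F k) <= L A + (2 ^- N)%:E)%E].
  by move=> N; apply: box_hull => //; rewrite invr_gt0 exprn_gt0.
pose V N := \bigcup_k F N k.
have mV N : measurable (V N : set Lm).
  by apply: bigcup_measurable => k _; apply: lebesgue_closed; have [h _ _] := hF N.
rewrite -(setIidr AQ).
apply: (@limit_set_integral _ _ Lm L Q A V g mQ gi mV mA).
  have VA N : (L (V N `\` A) <= (2 ^- N)%:E)%E.
    have [_ AV] := hF N; rewrite -/(V N) [X in (X <= _)%E -> _](measureDI L (mV N) mA).
    rewrite setIidr// addeC leeD2lE// ge0_fin_numE//; exact: measure_ge0.
  have := @summable_fading _ _ Lm L V A mA mV VA.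
  apply: filterS => x hx Qx; split => // Ax; apply: nearW => N.
  by have [_ + _] := hF N; apply.
by move=> N; apply: grid_Fsigma; have [] := hF N.
Qed.

End NullFromGrids.

Section LocalToGlobal.
Context (R : realType) (n : nat).
Local Notation E := 'rV[R]_n.+1.
Local Notation L := (lebesgue R n).

(** Countably many rational cubes suffice to cover [Omega]. *)
Lemma ae_local (Omega : set E) (P : E -> Prop) :
  (forall x, Omega x -> exists2 r, 0 < r & forall c s, 0 < s -> s < r -> hcube c s x ->
     {ae L, forall y, hcube c s y -> P y}) ->
  {ae L, forall y, Omega y -> P y}.
Proof.
move=> h.
pose T := (nat * {ffun 'I_n.+1 -> int})%type.
pose q (z : T) : set E := hcube (\row_i (z.1.+1%:R^-1 * (z.2 i)%:~R)) z.1.+1%:R^-1.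
pose F k : set E := if unpickle k is Some z then
   (if `[< {ae L, forall y, q z y -> P y} >] then [set y | q z y /\ ~ P y] else set0) else set0.
have FN k : L.-negligible (F k).
  rewrite /F; case: unpickle => [z|]; last exact: negligible_set0.
  case: asboolP => [qz|_]; last exact: negligible_set0.
  apply: negligibleS qz => y [qy nP] /=; by move=> /(_ qy).
apply: negligibleS (negligible_bigcup FN) => x /= /not_implyP[Ox nPx].
have [r r0 hr] := h x Ox.
have [k _ /(_ k (leqnn k)) kr] := near_small r0 (@ltr01 R).
rewrite /= div1r in kr.
have k0 : 0 < k.+1%:R^-1 :> R by rewrite invr_gt0.
pose z : T := (k, [ffun i => Num.floor (x 0 i / k.+1%:R^-1)]).
have qx : q z x.
  move=> i; rewrite !mxE ffunE /=.
  have /andP[] := floor_itv (x 0 i / k.+1%:R^-1).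
  rewrite ler_pdivlMr// ltr_pdivrMr// intrD mulrDl mul1r [_ * (_)^-1]mulrC => h1 h2.
  by apply/andP; split.
exists (pickle z) => //; rewrite /F pickleK.
by rewrite asboolT//; apply: hr.
Qed.

End LocalToGlobal.

(** * An algebra of bump functions *)

Section Flat.
Context (R : realType).

(** The family is closed under derivatives in the sense of [flat_derive]: for [t >
    0] the derivative of [t^-m exp(-1/t)] is [- m t^-(m+1) exp(-1/t) + t^-(m+2)
    exp(-1/t)]. *)
Definition flat (m : nat) (t : R) : R := if 0 < t then t^-1 ^+ m * expR (- t^-1) else 0.

Lemma flat_ge0 m t : 0 <= flat m t.
Proof. by rewrite /flat; case: ifP => // t0; rewrite mulr_ge0 ?expR_ge0// exprn_ge0// invr_ge0 ltW. Qed.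

Lemma expr_le_expR m (u : R) : 0 <= u -> u ^+ m <= m.+1%:R ^+ m * expR u.
Proof.
move=> u0.
have m0 : 0 < m.+1%:R :> R by [].
have h : (u / m.+1%:R) ^+ m <= expR u.
  apply: (@le_trans _ _ (expR (u / m.+1%:R) ^+ m)).
    rewrite lerXn2r ?nnegrE ?expR_ge0 ?divr_ge0//.
    by apply: le_trans (expR_ge1Dx _); rewrite lerDr.
  by rewrite -expRM_natl ler_expR mulrCA ler_piMr// ler_pdivrMr// mul1r ler_nat.
by rewrite mulrC -ler_pdivrMr ?exprn_gt0// -exprVn -exprMn.
Qed.

Lemma flat_bounded m t : flat m t <= m.+1%:R ^+ m.
Proof.
rewrite /flat; case: ifP => t0; last by rewrite exprn_ge0.
rewrite expRN ler_pdivrMr ?expR_gt0//; apply: expr_le_expR.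
by rewrite invr_ge0 ltW.
Qed.

Lemma flat_small m t : 0 < t -> flat m t <= m.+2%:R ^+ m.+1 * t.
Proof.
move=> t0; have := flat_bounded m.+1 t; rewrite /flat t0 exprS -mulrA => h.
by rewrite -ler_pdivrMr// mulrC.
Qed.

Lemma flat_pos_derive m (t : R) : 0 < t ->
  is_derive t (1 : R) (fun t : R => t^-1 ^+ m * expR (- t^-1)) (- m%:R * flat m.+1 t + flat m.+2 t).
Proof.
move=> t0; have tn0 : t != 0 by rewrite gt_eqF.
have iV : is_derive t (1 : R) (fun y : R => y^-1) (- t ^- 2 *: (1 : R)).
  exact: (@is_deriveV R id t 1 1 tn0 (is_derive_id _ _)).
have iX := is_deriveX m iV.
have iE := is_derive1_comp (is_derive_expR _) (is_deriveN iV).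
have := is_deriveM iX iE; rewrite /flat t0 => h.
have fE : (fun s : R => s^-1 ^+ m * expR (- s^-1)) =
    ((fun y : R => y^-1) ^+ m * (expR \o - (fun y : R => y^-1))).
  by apply/funext => y; rewrite !fctE.
rewrite fE; apply: (is_derive_eq h); rewrite !fctE /GRing.scale/= !mulr1.
case: m {iX h fE} => [|m]; first by rewrite !expr0 mulr0n !mul0r mulr0 addr0 oppr0 mul0r add0r mul1r opprK -exprVn mulrC.
by rewrite [_.+1.-1]/= -!exprVn !exprS; ring.
Qed.

(** At the origin the difference quotient is [flat m.+1 t] for [t > 0], and it tends
    to zero by [flat_small]. *)
Lemma flat_derive m (t : R) : is_derive t (1 : R) (flat m) (- m%:R * flat m.+1 t + flat m.+2 t).
Proof.
have [t0|t0|<-] := ltgtP 0 t.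
- apply: near_eq_is_derive (flat_pos_derive m t0).
  by near=> s; rewrite /flat ifT//; near: s; exact: lt_nbhsr.
- rewrite {2 3}/flat !(lt_gtF t0) mulr0 addr0.
  apply: near_eq_is_derive (is_derive_cst (0 : R) t 1).
  by near=> s; rewrite /flat ifF//; apply/lt_gtF; near: s; exact: lt_nbhsl.
- rewrite {2 3}/flat ltxx mulr0 addr0.
  have cv : h^-1 *: ((flat m \o shift 0) (h *: (1 : R)) - flat m 0) @[h --> (0 : R)^'] --> (0 : R).
    pose C : R := m.+3%:R ^+ m.+2.
    have C0 : 0 < C by rewrite exprn_gt0.
    apply/cvgrPdist_le => e e0; near=> h; rewrite sub0r normrN /= addr0 {2}/flat ltxx subr0.
    rewrite /GRing.scale/= mulr1 /flat; case: ifP => h0; last by rewrite mulr0 normr0 ltW.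
    rewrite mulrA -exprS ger0_norm; last by rewrite mulr_ge0 ?expR_ge0// exprn_ge0// invr_ge0 ltW.
    have := flat_small m.+1 h0; rewrite {1}/flat h0 => /le_trans; apply.
    rewrite -/C mulrC -ler_pdivlMr//.
    apply: le_trans (ler_norm _) _; near: h; apply: dnbhs0_le; exact: divr_gt0.
  split; first by apply/cvg_ex; exists 0.
  exact: cvg_lim cv.
Unshelve. all: by end_near. Qed.

Lemma flat_continuous m : continuous (flat m).
Proof.
move=> t; apply: differentiable_continuous; apply/derivable1_diffP.
by have [] := flat_derive m t.
Qed.

End Flat.

Section BumpAlgebra.
Context (R : realType) (n : nat).
Local Notation E := 'rV[R]_n.+1.

(** The algebra generated by the functions [flat m (a * x_i + b)]. All its elements
    are smooth, bounded and have partial derivatives in the same algebra, so one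
    inductive predicate supplies the test functions, the perturbations and all the
    bounds that they need. *)
Inductive bump_alg : (E -> R) -> Prop :=
| bump_cst c : bump_alg (fun=> c)
| bump_gen m a b i : bump_alg (fun x => flat m (a * x 0 i + b))
| bump_add f g : bump_alg f -> bump_alg g -> bump_alg (fun x => f x + g x)
| bump_mul f g : bump_alg f -> bump_alg g -> bump_alg (fun x => f x * g x).

Lemma bump_continuous f : bump_alg f -> continuous f.
Proof.
elim=> [c|m a b i|{}f g _ cf _ cg|{}f g _ cf _ cg]; last 2 first.
- exact: contD.
- exact: contM.
- exact: cst_continuous.
- apply: (cont_comp (f := fun x : E => a * x 0 i + b)); last exact: flat_continuous.
  apply: contD; last exact: cst_continuous.
  apply: contM; [exact: cst_continuous|exact: coord_continuous].
Qed.

Lemma bump_bounded f : bump_alg f -> exists2 M, 0 <= M & forall x, `|f x| <= M.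
Proof.
elim=> [c|m a b i|{}f g _ [M M0 hM] _ [N N0 hN]|{}f g _ [M M0 hM] _ [N N0 hN]].
- by exists `|c|.
- exists (m.+1%:R ^+ m) => [|x]; first by rewrite exprn_ge0.
  by rewrite ger0_norm ?flat_ge0// flat_bounded.
- exists (M + N) => [|x]; first exact: addr_ge0.
  by apply: le_trans (ler_normD _ _) _; exact: lerD.
- exists (M * N) => [|x]; first exact: mulr_ge0.
  by rewrite normrM ler_pM.
Qed.

Lemma flat_affine_derive m (p q : R) : is_derive (0 : R) 1 (fun t : R => flat m (p * t + q))
  (p * (- m%:R * flat m.+1 q + flat m.+2 q)).
Proof.
have i1 : is_derive (0 : R) (1 : R) (fun t : R => p * t + q) p.
  have := is_deriveD (is_deriveZ p (is_derive_id (0 : R) (1 : R))) (is_derive_cst q (0 : R) (1 : R)).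
  by move/is_derive_eq; apply; rewrite addr0 /GRing.scale/= mulr1.
have := @is_derive1_comp R (flat m) (fun t : R => p * t + q) 0 _ _ (flat_derive m _) i1.
by rewrite mulr0 add0r mulrC.
Qed.

Lemma bump_derive f j : bump_alg f ->
  exists2 f', bump_alg f' & forall x, is_derive x (basis_vec R j) f (f' x).
Proof.
elim=> [c|m a b i|{}f g Af [f' Af' df] Ag [g' Ag' dg]|{}f g Af [f' Af' df] Ag [g' Ag' dg]].
- by exists (fun=> 0); [exact: bump_cst|move=> x; exact: is_derive_cst].
- pose p : R := a * (i == j)%:R.
  exists (fun x => p * (- m%:R * flat m.+1 (a * x 0 i + b) + flat m.+2 (a * x 0 i + b))).
    apply: bump_mul; first exact: bump_cst.
    apply: bump_add; last exact: bump_gen.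
    by apply: bump_mul; [exact: bump_cst|exact: bump_gen].
  move=> x; have := @is_derive_line R E (fun x => flat m (a * x 0 i + b)) (basis_vec R j) x 0.
  rewrite scale0r add0r; apply.
  rewrite (_ : (fun t : R => _) = (fun t => flat m (p * t + (a * x 0 i + b)))); last first.
    by apply/funext => t; rewrite !mxE eqxx /p; congr flat; ring.
  exact: flat_affine_derive.
- exists (fun x => f' x + g' x); first exact: bump_add.
  by move=> x; exact: is_deriveD (df x) (dg x).
- exists (fun x => f x * g' x + g x * f' x).
    by apply: bump_add; apply: bump_mul.
  by move=> x; exact: is_deriveM (df x) (dg x).
Qed.

Lemma bump_partial f i : bump_alg f -> bump_alg (partial i f).
Proof.
move=> /(bump_derive i)[f' Af' df].
rewrite (_ : partial i f = f')//; apply/funext => x.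
by have [_] := df x.
Qed.

Lemma bump_derivable f i x : bump_alg f -> derivable f x (basis_vec R i).
Proof. by move=> /(bump_derive i)[f' _ /(_ x)][]. Qed.

(** Coinduction for smoothness: a class of continuous, differentiable functions
    which is stable under partial derivatives consists of smooth functions. *)
Lemma smooth_of_class (P : (E -> R) -> Prop) : (forall f, P f -> continuous f) ->
  (forall f i x, P f -> derivable f x (basis_vec R i)) -> (forall f i, P f -> P (partial i f)) ->
  forall f, P f -> smooth f.
Proof.
move=> Pc Pd Pp f Pf s; suff Ps : P (iter_partial s f) by split; [exact: Pc|move=> i x; exact: Pd].
by elim: s => [|i s IH] //=; exact: Pp.
Qed.

Lemma bump_smooth f : bump_alg f -> smooth f.
Proof.
apply: smooth_of_class; [exact: bump_continuous|move=> g i x; exact: bump_derivable|].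
move=> g i; exact: bump_partial.
Qed.

Lemma smooth_comb (a b : R) (f g : E -> R) : smooth f -> smooth g ->
  smooth (fun x => a * f x + b * g x).
Proof.
move=> sf sg.
pose P (h : E -> R) := exists f g : E -> R, [/\ smooth f, smooth g & h = fun x => a * f x + b * g x].
have dP (f1 g1 : E -> R) i x : smooth f1 -> smooth g1 -> is_derive x (basis_vec R i)
    (fun x => a * f1 x + b * g1 x) (a * partial i f1 x + b * partial i g1 x).
  move=> s1 s2; 
  have d1 : derivable f1 x (basis_vec R i) by exact: smooth_derivable.
  have d2 : derivable g1 x (basis_vec R i) by exact: smooth_derivable.
  apply: is_deriveD.
    exact: (is_deriveZ a (derivableP d1)).
  exact: (is_deriveZ b (derivableP d2)).
have sp (f1 : E -> R) i : smooth f1 -> smooth (partial i f1).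
  by move=> s1 s; have := s1 (rcons s i); rewrite /iter_partial foldr_rcons.
apply: (@smooth_of_class P); last by exists f, g.
- move=> _ [f1 [g1 [s1 s2 ->]]]; apply: contD; apply: contM; try exact: cst_continuous.
    exact: smooth_continuous.
  exact: smooth_continuous.
- by move=> _ i x [f1 [g1 [s1 s2 ->]]]; have [] := dP f1 g1 i x s1 s2.
- move=> _ i [f1 [g1 [s1 s2 ->]]]; exists (partial i f1), (partial i g1); split; try exact: sp.
  by apply/funext => x; have [_] := dP f1 g1 i x s1 s2.
Qed.

Lemma partial_comb (a b : R) (f g : E -> R) i x : smooth f -> smooth g ->
  partial i (fun x => a * f x + b * g x) x = a * partial i f x + b * partial i g x.
Proof.
move=> s1 s2; 
  have d1 : derivable f x (basis_vec R i) by exact: smooth_derivable.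
  have d2 : derivable g x (basis_vec R i) by exact: smooth_derivable.
have dd : is_derive x (basis_vec R i) (fun x => a * f x + b * g x)
    (a * partial i f x + b * partial i g x).
  by apply: is_deriveD; [exact: (is_deriveZ a (derivableP d1))|exact: (is_deriveZ b (derivableP d2))].
by case: dd.
Qed.

End BumpAlgebra.

(** * The fundamental lemma and weakly constant functions *)

Section AlmostEverywhere.
Context (R : realType) d (T : measurableType d) (mu : {measure set T -> \bar R}).

Lemma ae_imp (P Q : T -> Prop) : (forall x, P x -> Q x) ->
  {ae mu, forall x, P x} -> {ae mu, forall x, Q x}.
Proof. by move=> PQ; apply: filterS. Qed.

Lemma ae_imp2 (P P' Q : T -> Prop) : (forall x, P x -> P' x -> Q x) ->
  {ae mu, forall x, P x} -> {ae mu, forall x, P' x} -> {ae mu, forall x, Q x}.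
Proof. by move=> PQ; apply: filterS2. Qed.

Lemma ae_null (D : set T) (P : T -> Prop) : measurable D -> mu D = 0%E ->
  {ae mu, forall x, D x -> P x}.
Proof. by move=> mD D0; exists D; split => // x /= /not_implyP[]. Qed.

Lemma ae_false (D : set T) : measurable D -> {ae mu, forall x, ~ D x} -> mu D = 0%E.
Proof.
move=> mD [N [mN N0 DN]]; apply/eqP; rewrite eq_le measure_ge0 andbT -N0.
by apply: le_measure; rewrite ?inE// => x Dx; apply: DN => /=; apply.
Qed.

End AlmostEverywhere.

Section Cutoff.
Context (R : realType) (n : nat).
Local Notation E := 'rV[R]_n.+1.
Implicit Types (c w x : E) (s r : R).

(** An element of the algebra of bump functions which approximates the indicator of
    the half-open cube of corner [c] and side [s]. The slope [k^2] beats the offset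
    [k], so that in the limit the left faces are included and the right faces are
    excluded. *)
Definition cutoff (k : nat) c s x : R :=
  \prod_(i < n.+1) (flat 0 (k.+1%:R ^+ 2 * x 0 i + (k.+1%:R - k.+1%:R ^+ 2 * c 0 i)) *
    flat 0 (- k.+1%:R ^+ 2 * x 0 i + (k.+1%:R ^+ 2 * (c 0 i + s) - k.+1%:R))).

Lemma flat0_le1 (t : R) : flat 0 t <= 1.
Proof. by apply: le_trans (flat_bounded 0 t) _; rewrite expr0. Qed.

Lemma cutoff_bump k c s : bump_alg (cutoff k c s).
Proof.
rewrite /cutoff; elim: (index_enum _) => [|i l IH].
  rewrite (_ : (fun x => _) = fun=> 1); first exact: bump_cst.
  by apply/funext => x; rewrite big_nil.
rewrite (_ : (fun x => _) = fun x : E => (flat 0 (k.+1%:R ^+ 2 * x 0 i + (k.+1%:R - k.+1%:R ^+ 2 * c 0 i)) *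
    flat 0 (- k.+1%:R ^+ 2 * x 0 i + (k.+1%:R ^+ 2 * (c 0 i + s) - k.+1%:R))) *
   \prod_(i <- l) (flat 0 (k.+1%:R ^+ 2 * x 0 i + (k.+1%:R - k.+1%:R ^+ 2 * c 0 i)) *
    flat 0 (- k.+1%:R ^+ 2 * x 0 i + (k.+1%:R ^+ 2 * (c 0 i + s) - k.+1%:R)))).
  by apply: bump_mul => //; apply: bump_mul; exact: bump_gen.
by apply/funext => x; rewrite big_cons.
Qed.

Lemma cutoff_itv k c s x : 0 <= cutoff k c s x <= 1.
Proof.
rewrite prodr_ge0/=; last by move=> i _; rewrite mulr_ge0// flat_ge0.
by apply: prodr_ile1 => i _; rewrite mulr_ge0 ?flat_ge0//= mulr_ile1 ?flat_ge0 ?flat0_le1.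
Qed.

Lemma cutoff_translate k c s w x : cutoff k c s (x + w) = cutoff k (c - w) s x.
Proof. by apply: eq_bigr => i _; rewrite !mxE; congr (flat 0 _ * flat 0 _); ring. Qed.

Lemma cutoff_support k c s r x : k.+1%:R^-1 <= r ->
  ~ (forall i, c 0 i - r <= x 0 i < c 0 i + s) -> cutoff k c s x = 0.
Proof.
move=> kr /existsNP[i /negP]; rewrite negb_and -ltNge -leNgt => h.
rewrite /cutoff (bigD1 i)//=; have k0 : 0 < k.+1%:R :> R by [].
suff : flat 0 (k.+1%:R ^+ 2 * x 0 i + (k.+1%:R - k.+1%:R ^+ 2 * c 0 i)) *
    flat 0 (- k.+1%:R ^+ 2 * x 0 i + (k.+1%:R ^+ 2 * (c 0 i + s) - k.+1%:R)) = 0.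
  by move=> ->; rewrite mul0r.
case/orP: h => h.
  rewrite {1}/flat ifF ?mul0r//; apply/negbTE; rewrite -leNgt.
  have : k.+1%:R * (c 0 i - x 0 i) >= 1.
    by rewrite -ler_pdivrMl// mulr1; apply: le_trans kr _; move: h; lra.
  nra.
rewrite [X in _ * X]/flat ifF ?mulr0//; apply/negbTE; rewrite -leNgt.
have : 0 <= k.+1%:R ^+ 2 * (x 0 i - (c 0 i + s)) by rewrite mulr_ge0 ?exprn_ge0// subr_ge0.
lra.
Qed.

Lemma flat0_cvg (u : nat -> R) : (forall A : R, \forall k \near \oo, A <= u k) ->
  flat 0 (u k) @[k --> \oo] --> (1 : R).
Proof.
move=> hu; apply/cvgrPdist_le => e e0; near=> k.
have uk : e^-1 <= u k by near: k; exact: hu.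
have u0 : 0 < u k by apply: lt_le_trans uk; rewrite invr_gt0.
rewrite ger0_norm ?subr_ge0 ?flat0_le1// /flat u0 expr0 mul1r.
have := expR_ge1Dx (- (u k)^-1).
have : (u k)^-1 <= e by rewrite -[leRHS]invrK lef_pV2 ?posrE ?invr_gt0.
lra.
Unshelve. all: by end_near. Qed.

Lemma prod_cvg1 (I : Type) (l : seq I) (F : I -> nat -> R) :
  (forall i, F i k @[k --> \oo] --> (1 : R)) -> \prod_(i <- l) F i k @[k --> \oo] --> (1 : R).
Proof.
move=> hF; elim: l => [|i l IH].
  by rewrite (_ : (fun k => _) = fun=> 1); [exact: cvg_cst|apply/funext => k; rewrite big_nil].
rewrite (_ : (fun k => _) = fun k => F i k * \prod_(i <- l) F i k); last first.
  by apply/funext => k; rewrite big_cons.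
by rewrite -[X in _ --> X]mulr1; apply: cvgM.
Qed.

Lemma near_natr (A : R) : \forall k \near \oo, A <= k.+1%:R.
Proof.
exists (Num.truncn `|A|) => // k /= hk; apply: le_trans (ler_norm _) _; apply: ltW.
by apply: lt_le_trans (_ : (Num.truncn `|A|).+1%:R <= _); [have /andP[] := truncn_itv (normr_ge0 A)|rewrite ler_nat].
Qed.

(** In the cube both arguments of [flat 0] tend to infinity, where [flat 0] tends to
    [1]; outside one of them is eventually negative. *)
Lemma cutoff_cvg c s x : cutoff k c s x @[k --> \oo] --> (\1_(hcube c s) x : R).
Proof.
have [hx|nx] := pselect (hcube c s x).
  rewrite indicE mem_set//; apply: prod_cvg1 => i; have /andP[h1 h2] := hx i.
  rewrite -[X in _ --> X]mulr1; apply: cvgM; apply: flat0_cvg => A.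
    apply: filterS (near_natr A) => k Ak.
    have : 0 <= k.+1%:R ^+ 2 * (x 0 i - c 0 i) by rewrite mulr_ge0 ?exprn_ge0// subr_ge0.
    by move: Ak; lra.
  have p0 : 0 < c 0 i + s - x 0 i by rewrite subr_gt0.
  near=> k.
  have k1 : `|A| + 1 <= k.+1%:R by near: k; exact: near_natr.
  have k2 : 2 <= k.+1%:R * (c 0 i + s - x 0 i).
    by rewrite -ler_pdivrMr//; near: k; exact: near_natr.
  have := ler_norm A; move: k1 k2; nra.
rewrite indicE memNset//; apply: cvg_near_cst.
have /existsNP[i /negP] := nx; rewrite negb_and -ltNge -leNgt => /orP[h|h].
  have r0 : 0 < (c 0 i - x 0 i) / 2 by rewrite divr_gt0// subr_gt0.
  near=> k; apply: (@cutoff_support _ _ _ ((c 0 i - x 0 i) / 2)).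
    rewrite -[leRHS]invrK lef_pV2 ?posrE ?invr_gt0//; near: k; exact: near_natr.
  by move=> /(_ i)/andP[]; move: h; lra.
apply: nearW => k; apply: (@cutoff_support _ _ _ k.+1%:R^-1) => // /(_ i)/andP[_].
by rewrite ltNge h.
Unshelve. all: by end_near. Qed.

Lemma cutoff_test (Omega : set E) k c s r : k.+1%:R^-1 <= r ->
  (forall x, (forall i, c 0 i - r <= x 0 i <= c 0 i + s) -> Omega x) ->
  test_function Omega (cutoff k c s).
Proof.
move=> kr h; split; first exact/bump_smooth/cutoff_bump.
exists [set x : E | forall i, `[c 0 i - r, c 0 i + s]%classic (x 0 i)]; split.
- apply: (@rV_compact R n.+1 (fun i => `[c 0 i - r, c 0 i + s]%classic)) => i; exact: segment_compact.
- by move=> x hx; apply: h => i; have := hx i; rewrite /= in_itv.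
- move=> x hx; apply: (cutoff_support kr) => h'; apply: hx => i.
  by rewrite /= in_itv/=; have /andP[-> /ltW] := h' i.
Qed.

End Cutoff.

Section FundamentalLemma.
Context (R : realType) (n : nat).
Local Notation E := 'rV[R]_n.+1.
Local Notation L := (lebesgue R n).
Local Notation Lm := (lebesgue_space R n).
Implicit Types (c w : E) (s r rho : R).

Lemma gcorner_bounds c s N (z : {ffun 'I_n.+1 -> 'I_N.+1}) i : 0 < s ->
  c 0 i <= c 0 i + s / N.+1%:R * (z i)%:R /\
  c 0 i + s / N.+1%:R * (z i)%:R + s / N.+1%:R <= c 0 i + s.
Proof.
move=> s0; have sN : 0 < s / N.+1%:R by rewrite divr_gt0.
split; first by rewrite lerDl mulr_ge0// ltW.
rewrite -addrA lerD2l -[X in _ + X]mulr1 -mulrDr natr1 mulrAC ler_pdivrMr// ler_pM2l//.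
by rewrite ler_nat ltn_ord.
Qed.

Variables (Omega : set E) (f : E -> R).
Hypothesis oO : open Omega.
Hypothesis fi : L.-integrable Omega (EFin \o f).
Let mO := @lebesgue_open R n _ oO.

Lemma integrable_bump (psi : E -> R) : bump_alg psi ->
  L.-integrable Omega (EFin \o (fun x => f x * psi x)).
Proof.
move=> ap; have [M M0 hM] := bump_bounded ap.
have mf : measurable_fun (Omega : set Lm) f by apply/measurable_EFinP; exact: measurable_int fi.
have mp : measurable_fun (Omega : set Lm) psi by apply: lebesgue_continuous; exact: bump_continuous.
apply: (le_integrable mO (g := fun x => M%:E * (EFin \o f) x)%E).
- by apply/measurable_EFinP; exact: measurable_funM.
- by move=> x _ /=; rewrite lee_fin normrM normrM mulrC (ger0_norm M0) ler_wpM2r.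
- exact: (integrableZl mO M fi).
Qed.

(** Dominated convergence. *)
Lemma cutoff_integral_cvg c s : hcube c s `<=` Omega ->
  \int[L]_(x in Omega) (f x * cutoff k c s x) @[k --> \oo] --> \int[L]_(x in hcube c s) f x.
Proof.
move=> sub; have mq := hcube_measurable c s.
have mf : measurable_fun (Omega : set Lm) (EFin \o f) := measurable_int L fi.
have cv : (\int[L]_(x in Omega) (f x * cutoff k c s x)%:E @[k --> \oo] -->
    \int[L]_(x in Omega) (f x * \1_(hcube c s) x)%:E)%E.
  apply: (@dominated_cvg _ Lm R L Omega mO _ _ (fun x => `|(f x)%:E|)%E).
  - by move=> k; exact: measurable_int (integrable_bump (cutoff_bump k c s)).
  - move=> x Ox; apply/fine_cvgP; split; first by apply: nearW.
    by apply: cvgM; [exact: cvg_cst|exact: cutoff_cvg].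
  - by [].
  - exact: integrable_abse fi.
  - move=> k x _ /=; rewrite lee_fin normrM ler_piMr//.
    by have /andP[c0 c1] := cutoff_itv k c s x; rewrite ger0_norm.
have E1 : (\int[L]_(x in Omega) (f x * \1_(hcube c s) x)%:E = \int[L]_(x in hcube c s) (f x)%:E)%E.
  rewrite -[in RHS](setIidr sub) integral_mkcondr; apply: eq_integral => x _.
  by rewrite patchE indicE; case: ifP => _; rewrite ?mulr1 ?mulr0.
rewrite E1 in cv; apply: fine_cvg.
rewrite /Rintegral fineK; first exact: cv.
apply: (@integrable_fin_num _ Lm R L _ mq).
exact: (integrableS mO mq sub fi).
Qed.

Lemma hcube_integral0 c s r : 0 < r -> (forall x : E, (forall i, c 0 i - r <= x 0 i <= c 0 i + s) -> Omega x) ->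
  (forall phi, bump_alg phi -> test_function Omega phi -> \int[L]_(x in Omega) (f x * phi x) = 0) ->
  (\int[L]_(x in hcube c s) (f x)%:E = 0)%E.
Proof.
move=> r0 hr hz.
have sub : hcube c s `<=` Omega.
  by move=> x hx; apply: hr => i; have /andP[] := hx i; move: r0; lra.
have mq := hcube_measurable c s.
rewrite (@integrable_Rintegral R _ Lm L _ f mq); last exact: (integrableS mO mq sub fi).
congr EFin; apply/esym; apply: (cvg_unique _ _ (cutoff_integral_cvg sub)) => //.
apply: cvg_near_cst; near=> k; apply: hz; first exact: cutoff_bump.
apply: cutoff_test hr.
rewrite -[leRHS]invrK lef_pV2 ?posrE ?invr_gt0//; near: k; exact: near_natr.
Unshelve. all: by end_near. Qed.

Lemma small_cube_margin (x : E) rho : ball x rho `<=` Omega -> forall c s, 0 < s -> s < rho / 2 ->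
  hcube c s x -> forall y : E, (forall i, c 0 i - rho / 2 <= y 0 i <= c 0 i + s) -> Omega y.
Proof.
move=> hb c s s0 sr hx y hy; apply: hb.
have rho0 : 0 < rho by lra.
apply/rV_ballE => // i; have /andP[? ?] := hx i; have /andP[? ?] := hy i.
by rewrite ltr_norml; apply/andP; split; lra.
Qed.

(** The fundamental lemma of the calculus of variations: testing with [cutoff] shows
    that the integral of [f] over every small cube vanishes, and [null_of_grid]
    concludes. *)
Lemma null_of_test_integrals :
  (forall phi, bump_alg phi -> test_function Omega phi -> \int[L]_(x in Omega) (f x * phi x) = 0) ->
  {ae L, forall x, Omega x -> f x = 0}.
Proof.
move=> hz; apply: ae_local => x Ox.
have /nbhs_ballP[rho /= rho0 hb] : nbhs x Omega by exact: open_nbhs_nbhs.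
exists (rho / 2) => [|c s s0 sr hx]; first by rewrite divr_gt0.
have marg := small_cube_margin hb s0 sr hx.
have r2 : 0 < rho / 2 by rewrite divr_gt0.
have sub : hcube c s `<=` Omega.
  by move=> y hy; apply: marg => i; have /andP[] := hy i; lra.
apply: null_of_grid => //; first exact: (integrableS mO (hcube_measurable c s) sub fi).
move=> N z; apply: (hcube_integral0 r2) hz => y hy.
apply: marg => i; have := hy i; have [g1 g2] := gcorner_bounds c z i s0.
rewrite !mxE => /andP[h1 h2]; apply/andP; split.
  by apply: le_trans h1; rewrite lerD2r.
exact: le_trans h2 g2.
Qed.

End FundamentalLemma.

Section Constancy.
Context (R : realType) (n : nat).
Local Notation E := 'rV[R]_n.+1.
Local Notation L := (lebesgue R n).
Local Notation Lm := (lebesgue_space R n).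
Implicit Types (c w : E) (s r : R).

Lemma bump_dirder w (psi : E -> R) : bump_alg psi -> bump_alg (dirder psi w).
Proof.
move=> ap; rewrite /dirder; elim: (index_enum _) => [|i l IH].
  by rewrite (_ : (fun x => _) = fun=> 0); [exact: bump_cst|apply/funext => x; rewrite big_nil].
rewrite (_ : (fun x => _) = fun x => w 0 i * partial i psi x + \sum_(i <- l) w 0 i * partial i psi x).
  by apply: bump_add => //; apply: bump_mul; [exact: bump_cst|exact: bump_partial].
by apply/funext => x; rewrite big_cons.
Qed.

Lemma bump_line w (psi : E -> R) x (t : R) : bump_alg psi ->
  is_derive t (1 : R) (fun t : R => psi (t *: w + x)) (dirder psi w (t *: w + x)).
Proof.
move=> ap; apply: line_is_derive; apply: C1_is_derive.
  by move=> i y; exact: bump_derivable.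
by move=> i; apply: bump_continuous; exact: bump_partial.
Qed.

Lemma bump_increment w (psi : E -> R) x (t : R) : bump_alg psi -> 0 < t ->
  exists2 u : R, 0 < u < t & psi (t *: w + x) - psi x = t * dirder psi w (u *: w + x).
Proof.
move=> ap t0.
have [||u] := @MVT R (fun t : R => psi (t *: w + x)) (fun t => dirder psi w (t *: w + x)) 0 t t0.
- by move=> v _; exact: bump_line.
- apply: derivable_within_continuous => v _; by have [] := bump_line w x v ap.
by rewrite in_itv/= => u0; rewrite scale0r add0r subr0 mulrC; exists u.
Qed.

Lemma bump_taylor w (psi : E -> R) : bump_alg psi -> exists2 M, 0 <= M & forall x (t : R), 0 < t ->
  `|psi (t *: w + x) - psi x - t * dirder psi w x| <= M * t ^+ 2.
Proof.
move=> ap; have ad := bump_dirder w ap.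
have [M M0 hM] := bump_bounded (bump_dirder w ad).
exists M => // x t t0.
have [u /andP[u0 ut] ->] := bump_increment w x ap t0.
have [u' _ eu] := bump_increment w x ad u0.
rewrite -mulrBr eu !normrM (gtr0_norm t0) (gtr0_norm u0).
have : t * (u * `|dirder (dirder psi w) w (u' *: w + x)|) <= t * (t * M).
  by rewrite ler_pM2l//; apply: ler_pM => //; exact: ltW.
by rewrite expr2 [M * _]mulrC -mulrA.
Qed.

(** Splitting the unit interval into [N] steps bounds the total variation by [C /
    N]. *)
Lemma telescope_const (G : R -> R) (C : R) : 0 <= C ->
  (forall t h, 0 <= t -> 0 < h -> t + h <= 1 -> `|G (t + h) - G t| <= C * h ^+ 2) -> G 1 = G 0.
Proof.
move=> C0 hG; apply/eqP; rewrite -subr_eq0 -normr_eq0 eq_le normr_ge0 andbT.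
apply/ler_addgt0Pr => e e0; rewrite add0r.
pose N := (Num.truncn (C / e)).+1.
have N0 : 0 < N%:R :> R by [].
have tel : G 1 - G 0 = \sum_(j < N) (G (j%:R / N%:R + N%:R^-1) - G (j%:R / N%:R)).
  rewrite (eq_bigr (fun j : 'I_N => (fun j => G (j%:R / N%:R)) j.+1 - G (j%:R / N%:R))); last first.
    by move=> j _; rewrite -{2}[N%:R^-1]mul1r -mulrDl natr1.
  rewrite -(big_mkord xpredT (fun j => G (j.+1%:R / N%:R) - G (j%:R / N%:R))).
  by rewrite telescope_sumr// divff ?gt_eqF// mul0r.
rewrite tel; apply: le_trans (ler_norm_sum _ _ _) _.
apply: (@le_trans _ _ (\sum_(j < N) C * N%:R^-1 ^+ 2)).
  apply: ler_sum => j _; apply: hG; first by rewrite divr_ge0.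
    by rewrite invr_gt0.
  by rewrite -{2}[N%:R^-1]mul1r -mulrDl natr1 ler_pdivrMr// mul1r ler_nat ltn_ord.
rewrite sumr_const card_ord -[leLHS]mulr_natl.
have -> : N%:R * (C * N%:R^-1 ^+ 2) = C / N%:R by field; rewrite gt_eqF.
rewrite ler_pdivrMr// mulrC -ler_pdivrMr//; apply: ltW.
by have /andP[] := truncn_itv (divr_ge0 C0 (ltW e0)).
Qed.

Variables (Omega : set E) (f : E -> R).
Hypothesis oO : open Omega.
Hypothesis fi : L.-integrable Omega (EFin \o f).
Hypothesis fz : forall i phi, test_function Omega phi -> \int[L]_(x in Omega) (f x * partial i phi x) = 0.
Let mO := @lebesgue_open R n _ oO.

Lemma integral_dirder0 w (phi : E -> R) : bump_alg phi -> test_function Omega phi ->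
  \int[L]_(x in Omega) (f x * dirder phi w x) = 0.
Proof.
move=> ap tp; rewrite /Rintegral.
have -> : (\int[L]_(x in Omega) (f x * dirder phi w x)%:E =
    \int[L]_(x in Omega) \sum_(i < n.+1) (w 0 i)%:E * (f x * partial i phi x)%:E)%E.
  apply: eq_integral => x _; rewrite /dirder mulr_sumr -sumEFin.
  by apply: eq_bigr => i _; rewrite -EFinM; congr EFin; ring.
have ii i := integrable_bump oO fi (bump_partial i ap).
rewrite integral_sum//; last by move=> i; exact: (integrableZl mO _ (ii i)).
rewrite big1// => i _; rewrite (integralZl mO (ii i)).
by rewrite (@integrable_Rintegral R _ Lm L _ _ mO (ii i)) fz// mule0.
Qed.

Lemma dirder_cutoff w k c s x y : dirder (cutoff k (c - y) s) w x = dirder (cutoff k c s) w (x + y).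
Proof.
have i1 : is_derive x w (cutoff k (c - y) s) (dirder (cutoff k (c - y) s) w x).
  apply: C1_is_derive => [i z|i]; first by apply: bump_derivable; exact: cutoff_bump.
  by apply: bump_continuous; apply: bump_partial; exact: cutoff_bump.
have [_ <-] := i1.
have i2 : is_derive (x + y) w (cutoff k c s) (dirder (cutoff k c s) w (x + y)).
  apply: C1_is_derive => [i z|i]; first by apply: bump_derivable; exact: cutoff_bump.
  by apply: bump_continuous; apply: bump_partial; exact: cutoff_bump.
have [_ <-] := i2.
rewrite /derive; apply: (congr1 (fun g : R -> R => lim (g @ (0 : R)^'))); apply/funext => h /=.
by rewrite -!cutoff_translate addrA.
Qed.

(** The derivative of the integral of [f] against a moving test function is minus an
    integral of [f] against a derivative of a test function, so it vanishes;
    [bump_taylor] makes this quantitative and [telescope_const] integrates it. *)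
Lemma cutoff_shift_integral k c s w :
  (forall t : R, 0 <= t -> t <= 1 -> test_function Omega (cutoff k (c - t *: w) s)) ->
  \int[L]_(x in Omega) (f x * cutoff k (c - w) s x) = \int[L]_(x in Omega) (f x * cutoff k c s x).
Proof.
move=> ht; pose psi := cutoff k c s; have ap : bump_alg psi := cutoff_bump k c s.
have [M M0 hM] := bump_taylor w ap.
pose G (t : R) := \int[L]_(x in Omega) (f x * cutoff k (c - t *: w) s x).
suff : G 1 = G 0 by rewrite /G scale1r scale0r subr0.
have ib t := integrable_bump oO fi (cutoff_bump k (c - t *: w) s).
pose I := fine (\int[L]_(x in Omega) `|(f x)%:E|)%E.
have I0 : 0 <= I by apply: fine_ge0; apply: integral_ge0.
apply: (@telescope_const G (M * I)); first exact: mulr_ge0.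
move=> t h t0 h0 th.
have id := integrable_bump oO fi (bump_dirder w (cutoff_bump k (c - t *: w) s)).
have iZ := integrableZl mO h id.
have GE : G (t + h) - G t = \int[L]_(x in Omega) (f x * (cutoff k (c - (t + h) *: w) s x -
    cutoff k (c - t *: w) s x - h * dirder (cutoff k (c - t *: w) s) w x)).
  have z : \int[L]_(x in Omega) (h * (f x * dirder (cutoff k (c - t *: w) s) w x)) = 0.
    rewrite (RintegralZl h mO id) integral_dirder0 ?mulr0//; first exact: cutoff_bump.
    by apply: ht => //; lra.
  rewrite -[LHS]subr0 -[X in _ - X]z /G -(RintegralB mO (ib _) (ib _)) -RintegralB//.
    by apply: eq_Rintegral => x _ /=; ring.
  exact: (integrableB mO (ib _) (ib _)).
have i3 : L.-integrable Omega (EFin \o (fun x => f x * (cutoff k (c - (t + h) *: w) s x -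
    cutoff k (c - t *: w) s x - h * dirder (cutoff k (c - t *: w) s) w x))).
  have := integrableB mO (integrableB mO (ib (t + h)) (ib t)) iZ.
  by apply: eq_integrable => // x _ /=; rewrite -!EFinB; congr EFin; ring.
rewrite GE; apply: le_trans (le_normr_Rintegral mO i3) _.
have ia : L.-integrable Omega (EFin \o (fun x => `|f x|)) := integrable_abse fi.
have -> : M * I * h ^+ 2 = \int[L]_(x in Omega) (M * h ^+ 2 * `|f x|).
  rewrite (RintegralZl (M * h ^+ 2) mO ia).
  by rewrite /I /Rintegral; ring.
apply: le_Rintegral => //.
- exact: (integrable_abse i3).
- exact: (integrableZl mO _ ia).
- move=> x Ox /=; rewrite normrM mulrC ler_wpM2r//.
  have := hM (x + t *: w) h h0.
  have -> : h *: w + (x + t *: w) = x + (t + h) *: w by rewrite scalerDl [t *: w + _]addrC addrCA.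
  rewrite /psi !cutoff_translate -dirder_cutoff.
  by [].
Qed.

Lemma lim_near_eq (u v : nat -> R) (a b : R) : u k @[k --> \oo] --> a -> v k @[k --> \oo] --> b ->
  (\forall k \near \oo, u k = v k) -> a = b.
Proof.
move=> ua vb uv; apply: (cvg_unique _ ua) => //; apply: cvg_trans vb.
by apply: near_eq_cvg; apply: filterS uv => k ->.
Qed.

Lemma grid_sum c s N (g : E -> R) : 0 < s -> L.-integrable (hcube c s) (EFin \o g) ->
  Rint (hcube c s) g = \sum_(z : {ffun 'I_n.+1 -> 'I_N.+1}) Rint (gcube c s z) g.
Proof.
move=> s0 gi.
have mz (z : {ffun 'I_n.+1 -> 'I_N.+1}) : measurable (gcube c s z : set Lm) by exact: hcube_measurable.
have QE : hcube c s = \big[setU/set0]_(z : {ffun 'I_n.+1 -> 'I_N.+1}) gcube c s z.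
  apply/seteqP; split => x; rewrite -(@bigcup_pred _ _ predT).
    by move=> hx; have [z zx] := gcube_cover N s0 hx; exists z.
  by move=> [z _]; exact: gcube_sub.
have iz z := integrableS (hcube_measurable c s) (mz z) (gcube_sub s0) gi.
apply: EFin_inj; rewrite -(@integrable_Rintegral R _ Lm L _ g (hcube_measurable c s) gi) -sumEFin.
have -> : \sum_(z : {ffun 'I_n.+1 -> 'I_N.+1}) (Rint (gcube c s z) g)%:E =
    \sum_(z <- index_enum {ffun 'I_n.+1 -> 'I_N.+1}) (\int[L]_(x in gcube c s z) (g x)%:E)%E.
  by apply: eq_bigr => z _; rewrite (@integrable_Rintegral R _ Lm L _ g (mz z) (iz z)).
rewrite -(@integral_bigsetU_EFin _ Lm R L _ _ g (index_enum {ffun 'I_n.+1 -> 'I_N.+1})).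
- by rewrite -QE.
- exact: mz.
- exact: index_enum_uniq.
- apply/trivIsetP => z z' _ _ /= zz'; apply/seteqP; split => // x [zx z'x].
  by move: zz'; rewrite (gcube_disjoint s0 zx z'x) eqxx.
- by rewrite -QE; exact: measurable_int gi.
Qed.

(** Limit of [cutoff_shift_integral]: cubes of the same size which can be joined
    inside [Omega] carry the same integral of [f]. *)
Lemma hcube_translate_integral c c' s r : 0 < r ->
  (forall t, 0 <= t -> t <= 1 -> forall x : E,
    (forall i, c 0 i + t * (c' 0 i - c 0 i) - r <= x 0 i <= c 0 i + t * (c' 0 i - c 0 i) + s) -> Omega x) ->
  \int[L]_(x in hcube c s) f x = \int[L]_(x in hcube c' s) f x.
Proof.
move=> r0 hr.
have sub0 : hcube c s `<=` Omega.
  move=> x hx; apply: (hr 0) => // i; rewrite mul0r addr0; have /andP[] := hx i; move: r0; lra.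
have sub1 : hcube c' s `<=` Omega.
  move=> x hx; apply: (hr 1) => // i; rewrite mul1r subrKC; have /andP[] := hx i; move: r0; lra.
have cv0 := cutoff_integral_cvg oO fi sub0; have cv1 := cutoff_integral_cvg oO fi sub1.
apply: lim_near_eq cv0 cv1 _; near=> k.
apply/esym; have -> : c' = c - (c - c') by rewrite subKr.
apply: cutoff_shift_integral => t t0 t1; apply: (@cutoff_test _ _ _ _ _ _ r).
  rewrite -[leRHS]invrK lef_pV2 ?posrE ?invr_gt0//; near: k; exact: near_natr.
move=> x hx; apply: (hr t) => // i; have := hx i; rewrite !mxE.
by rewrite (_ : c 0 i - t * (c 0 i - c' 0 i) = c 0 i + t * (c' 0 i - c 0 i))//; ring.
Unshelve. all: by end_near. Qed.

(** All the cells of a grid carry the same integral of [f], hence the integral of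
    [f] minus its mean vanishes on each of them, and [null_of_grid] applies. *)
Lemma constant_on_cube c s r : 0 < s -> 0 < r ->
  (forall x : E, (forall i, c 0 i - r <= x 0 i <= c 0 i + s) -> Omega x) ->
  exists a : R, {ae L, forall x, hcube c s x -> f x = a}.
Proof.
move=> s0 r0 hr.
have mq := hcube_measurable c s.
have sub : hcube c s `<=` Omega.
  by move=> x hx; apply: hr => i; have /andP[] := hx i; move: r0; lra.
have fiq := integrableS mO mq sub fi.
have iq N (z : {ffun 'I_n.+1 -> 'I_N.+1}) : L.-integrable (gcube c s z) (EFin \o f).
  by apply: (integrableS mq (hcube_measurable _ _) (gcube_sub s0) fiq).
have lf (c1 : E) s1 : L (hcube c1 s1) \is a fin_num.
  by rewrite ge0_fin_numE; [exact: hcube_lty|exact: measure_ge0].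
pose a := Rint (hcube c s) f / fine (L (hcube c s)).
have [l0|l0] := eqVneq (fine (L (hcube c s))) 0.
  exists 0; apply: (@ae_null R _ Lm L _ _ mq).
  by have := fineK (lf c s); rewrite l0 => /esym.
exists a.
suff : {ae L, forall x, hcube c s x -> f x - a = 0}.
  by apply: (@ae_imp R _ Lm L) => x h qx; apply/eqP; rewrite -subr_eq0 (h qx).
have ia (D : set E) : measurable (D : set Lm) -> (L D < +oo)%E -> L.-integrable D (EFin \o cst a).
  move=> mD Doo; apply: (measurable_bounded_integrable mD Doo) => //.
  by exists `|a|; split => [|M aM x Dx]; [exact: num_real|exact: ltW].
apply: null_of_grid => //.
  exact: (integrableB mq fiq (ia _ mq (hcube_lty _ _))).
move=> N z; have mz := hcube_measurable (\row_i (c 0 i + s / N.+1%:R * (z i)%:R)) (s / N.+1%:R).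
have zoo := hcube_lty (\row_i (c 0 i + s / N.+1%:R * (z i)%:R)) (s / N.+1%:R).
have l1 (c1 : E) s1 : Rint (hcube c1 s1) (cst 1) = fine (L (hcube c1 s1)).
  by rewrite /Rint Rintegral_cst ?mul1r//; exact: hcube_measurable.
have i1 : L.-integrable (hcube c s) (EFin \o cst 1).
  apply: (measurable_bounded_integrable mq (hcube_lty _ _)) => //.
  by exists 1; split => [|M aM x Dx]; [exact: num_real|rewrite /= normr1 ltW].
have same (z' : {ffun 'I_n.+1 -> 'I_N.+1}) : Rint (gcube c s z') f = Rint (gcube c s z) f.
  apply: (hcube_translate_integral r0) => t t0 t1 x hx; apply: hr => i.
  have := hx i; rewrite !mxE.
  have [p1 p2] := gcorner_bounds c z i s0; have [q1 q2] := gcorner_bounds c z' i s0.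
  move: p1 p2 q1 q2; set p := _ * (z i)%:R; set q := _ * (z' i)%:R; set e := s / _.
  by move=> p1 p2 q1 q2 /andP[h1 h2]; apply/andP; split; nra.
have samel (z' : {ffun 'I_n.+1 -> 'I_N.+1}) : Rint (gcube c s z') (cst 1) = Rint (gcube c s z) (cst 1).
  by rewrite !l1 !hcube_translate.
have := grid_sum N s0 fiq; under eq_bigr do rewrite same; rewrite sumr_const -mulr_natl => SF.
have := grid_sum N s0 i1; under eq_bigr do rewrite samel; rewrite sumr_const -mulr_natl l1 => SL.
have mza : L.-integrable (gcube c s z) (EFin \o cst a) := ia _ mz zoo.
rewrite (@integrable_Rintegral R _ Lm L _ _ mz (integrableB mz (iq N z) mza)).
congr EFin; rewrite (RintegralB mz (iq N z) mza) Rintegral_cst//.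
have := l1 (\row_i (c 0 i + s / N.+1%:R * (z i)%:R)) (s / N.+1%:R); rewrite -/(gcube c s z) => <-.
rewrite -/(Rint _ _) /a SF SL.
move: l0; rewrite SL mulf_eq0 negb_or => /andP[c0 l0].
by field; rewrite c0 l0.
Qed.

Lemma cube_positive s : bounded_set Omega -> L Omega != 0%E -> 0 < s ->
  L (hcube 0 s) != 0%E.
Proof.
move=> bO LO s0; apply: contraNN LO => /eqP L0.
have [s' [sp ss [J [P [c [_ _ cov]]]]]] := interior_cells (closure_compact bO) openT (@subsetT _ _) s0.
have L0' c' : L (hcube c' s') = 0%E.
  rewrite hcube_translate; apply/eqP; rewrite eq_le measure_ge0 andbT -L0.
  apply: (le_outer_measure (lebesgue_outer R n)) => x hx i; have := hx i; lra.
rewrite eq_le measure_ge0 andbT.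
have sub : Omega `<=` \big[setU/set0]_(j | P j) hcube (c j) s'.
  move=> x Ox; rewrite -(@bigcup_pred _ _ P).
  by have [j Pj hj] := cov x (subset_closure Ox); exists j.
apply: le_trans (le_outer_measure (lebesgue_outer R n) _ _ sub) _.
have : (lebesgue_outer R n (\big[setU/set0]_(j | P j) hcube (c j) s') <=
    \sum_(j | P j) lebesgue_outer R n (hcube (c j) s'))%E.
  apply: (@bigsetU_subadditive R _ (lebesgue_outer R n) setT) => // A B _ _.
  exact: outer_measureU2.
by move/le_trans; apply; rewrite big1// => j _; exact: L0'.
Qed.

(** A distribution with zero gradient is constant. The function is constant on every
    small cube, the constants agree on overlapping cubes because cubes have positive
    measure, and connectedness of [Omega] makes the local constant global. *)
Lemma weakly_constant : connected Omega -> bounded_set Omega ->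
  exists a : R, {ae L, forall x, Omega x -> f x = a}.
Proof.
move=> cO bO.
have [LO|LO] := eqVneq (L Omega) 0%E; first by exists 0; exact: (@ae_null R _ Lm L _ _ mO).
have Lpos s : 0 < s -> L (hcube 0 s) != 0%E by exact: cube_positive.
have [Oe|/set0P[x0 Ox0]] := eqVneq Omega set0.
  by move: LO; rewrite Oe measure0 eqxx.
pose A (a : R) := [set x | Omega x /\ exists2 r, 0 < r & {ae L, forall y, ball x r y -> f y = a}].
have loc x : Omega x -> exists a, A a x.
  move=> Ox; have /nbhs_ballP[rho /= rho0 hb] : nbhs x Omega by exact: open_nbhs_nbhs.
  pose s := rho / 4; have s0 : 0 < s by rewrite divr_gt0.
  pose c : E := \row_i (x 0 i - s / 2).
  have qx : hcube c s x by move=> i; rewrite !mxE; apply/andP; split; lra.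
  have marg := small_cube_margin hb s0 _ qx.
  have [a ha] : exists a : R, {ae L, forall x, hcube c s x -> f x = a}.
    apply: (constant_on_cube s0 (_ : 0 < rho / 2)); first by rewrite divr_gt0.
    by apply: marg; rewrite /s; lra.
  exists a; split => //; exists (s / 2); first by rewrite divr_gt0.
  apply: (@ae_imp R _ Lm L) ha => y h /(rV_ballE _ _ (divr_gt0 s0 (ltr0n R 2))) by_.
  apply: h => i; have := by_ i; rewrite !mxE ltr_norml => /andP[? ?]; apply/andP; split; lra.
have uniqA a b x : A a x -> A b x -> a = b.
  move=> [_ [r r0 ha]] [_ [r' r'0 hb]]; apply: contrapT => ab.
  pose s := Num.min r r'; have s0 : 0 < s by rewrite lt_min r0.
  pose c : E := \row_i (x 0 i - s / 2).
  have := Lpos s s0; rewrite -(hcube_translate c) => /eqP; apply.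
  apply: (@ae_false R _ Lm L); first exact: hcube_measurable.
  apply: (@ae_imp2 R _ Lm L) ha hb => y h1 h2 hy.
  have bs : ball x s y.
    apply/rV_ballE => // i; have := hy i; rewrite !mxE ltr_norml => /andP[? ?]; apply/andP; split; lra.
  by apply: ab; rewrite -h1 ?h2//; apply: le_ball bs; rewrite ge_min lexx ?orbT.
have openA a : open (A a).
  rewrite openE => x [Ox [r r0 ha]]; have /nbhs_ballP[rho /= rho0 hb] : nbhs x Omega by exact: open_nbhs_nbhs.
  apply/nbhs_ballP; exists (Num.min rho (r / 2)); first by rewrite /= lt_min rho0 divr_gt0.
  move=> y bxy; split.
    by apply: hb; apply: le_ball bxy; rewrite ge_min lexx.
  exists (r / 2); first by rewrite divr_gt0.
  apply: (@ae_imp R _ Lm L) ha => z h bz; apply: h; rewrite [r]splitr; apply: ball_triangle bz.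
  by apply: le_ball bxy; rewrite ge_min lexx orbT.
have [a Aa] := loc x0 Ox0; exists a.
have AO : A a = Omega.
  apply: cO; first by exists x0.
    by exists (A a) => //; apply/esym/setIidr => x [].
  exists (~` \bigcup_(b in [set b | b != a]) A b).
    by apply: open_closedC; apply: bigcup_open => b _; exact: openA.
  apply/seteqP; split => x.
    move=> Ax; split; first by case: Ax.
    by move=> [b /= /eqP ba Ab]; apply: ba; exact: uniqA Ab Ax.
  move=> [Ox nx]; have [b Ab] := loc x Ox; have [<-//|ba] := eqVneq b a.
  by exfalso; apply: nx; exists b.
apply: ae_local => x; rewrite -{1}AO => -[Ox [r r0 ha]].
exists r => // c s s0 sr hx; apply: (@ae_imp R _ Lm L) ha => y h hy; apply: h.
by apply/rV_ballE => // i; have := hy i; have := hx i; rewrite ltr_norml => /andP[? ?] /andP[? ?]; apply/andP; split; lra.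
Qed.

End Constancy.

(** * The space of square-integrable functions *)

(** The sequences [a_j - 2 C 2^-j] and [a_j + 2 C 2^-j] are monotone and enclose the
    limit. *)
Lemma geometric_limit (R : realType) (a : nat -> R) (C : R) :
  (forall j, `|a j.+1 - a j| <= C * 2 ^- j) ->
  exists2 l, a j @[j --> \oo] --> l & forall j, `|l - a j| <= 2 * C * 2 ^- j.
Proof.
move=> ha.
have C0 : 0 <= C by have := le_trans (normr_ge0 _) (ha 0%N); rewrite expr0 invr1 mulr1.
have half j : (2 : R) ^- j.+1 = 2 ^- j / 2 by rewrite exprS invfM mulrC.
pose u j := a j - 2 * C * 2 ^- j; pose w j := a j + 2 * C * 2 ^- j.
have p0 j : 0 < (2 : R) ^- j by rewrite invr_gt0 exprn_gt0.
have hu j : u j <= u j.+1.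
  by rewrite /u half; have := ha j; rewrite ler_norml => /andP[]; lra.
have hw j : w j.+1 <= w j.
  by rewrite /w half; have := ha j; rewrite ler_norml => /andP[]; lra.
have nu : nondecreasing_seq u by apply/nondecreasing_seqP.
have nw : nonincreasing_seq w by apply/nonincreasing_seqP.
have uw j : u j <= w j by rewrite /u /w; have := mulr_ge0 C0 (ltW (p0 j)); lra.
have bu : has_ubound (range u).
  by exists (w 0%N) => _ [j _ <-]; apply: le_trans (uw j) _; exact: nw.
have cu := nondecreasing_cvgn nu bu; set l := sup (range u) in cu.
have c0 : 2 * C * 2 ^- j @[j --> \oo] --> (0 : R).
  rewrite -[X in _ --> X](mulr0 (2 * C)); apply: cvgM; first exact: cvg_cst.
  rewrite (_ : (fun j => _) = fun j => (1 / 2) ^+ j); last by apply/funext => j; rewrite div1r exprVn.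
  by apply: cvg_expr; rewrite ger0_norm; lra.
have ca : a j @[j --> \oo] --> l.
  rewrite (_ : a = fun j => u j + 2 * C * 2 ^- j); last by apply/funext => j; rewrite /u subrK.
  by rewrite -[X in _ --> X]addr0; apply: cvgD.
have lu j : u j <= l by apply: sup_ubound => //; exists j.
have lw j : l <= w j.
  apply: ge_sup; first by exists (u 0%N); exists 0%N.
  move=> _ [i _ <-]; apply: (@le_trans _ _ (u (maxn i j))); first by apply: nu; exact: leq_maxl.
  by apply: le_trans (uw _) _; apply: nw; exact: leq_maxr.
exists l => // j; have := lu j; have := lw j; rewrite /u /w ler_norml => h1 h2.
by apply/andP; split; lra.
Qed.

Section SquareIntegrable.
Context (R : realType) d (T : measurableType d) (mu : {measure set T -> \bar R}) (D : set T).
Hypothesis mD : measurable D.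
Implicit Types f g w : T -> R.
Local Notation L2 := (square_integrable mu D).

Lemma L2_prod f g : L2 f -> L2 g -> mu.-integrable D (EFin \o (fun x => f x * g x)).
Proof.
move=> [mf if2] [mg ig2].
have := integrableD mD if2 ig2; apply: le_integrable => //.
  by apply/measurable_EFinP; exact: measurable_funM.
move=> x _ /=; rewrite lee_fin [leRHS]ger0_norm; last by rewrite addr_ge0 ?sqr_ge0.
rewrite ler_norml; have := sqr_ge0 (f x - g x); have := sqr_ge0 (f x + g x).
have := sqr_ge0 (f x); have := sqr_ge0 (g x).
by move=> *; apply/andP; split; nra.
Qed.

Lemma L2_comb a b f g : L2 f -> L2 g -> L2 (fun x => a * f x + b * g x).
Proof.
move=> hf hg; have [mf if2] := hf; have [mg ig2] := hg; split.
  by apply: measurable_funD; apply: measurable_funM => //; exact: measurable_cst.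
have ifg := L2_prod hf hg.
have := integrableD mD (integrableD mD (integrableZl mD (a ^+ 2) if2) (integrableZl mD (b ^+ 2) ig2))
  (integrableZl mD (2 * a * b) ifg).
apply: eq_integrable => // x _ /=; rewrite -!EFinD; congr EFin; ring.
Qed.

Lemma L2_weight w f (M : R) : measurable_fun D w -> (forall x, D x -> `|w x| <= M) -> L2 f ->
  L2 (fun x => w x * f x).
Proof.
move=> mw hw [mf if2]; split; first exact: measurable_funM.
have := integrableZl mD (M ^+ 2) if2; apply: le_integrable => //.
  by apply/measurable_EFinP; apply: measurable_funX; exact: measurable_funM.
move=> x Dx /=; rewrite lee_fin ger0_norm ?sqr_ge0// ger0_norm; last by rewrite mulr_ge0 ?sqr_ge0.
rewrite exprMn ler_wpM2r ?sqr_ge0//.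
have /hw := Dx; rewrite ler_norml => /andP[]; nra.
Qed.

Definition ip f g : R := \int[mu]_(x in D) (f x * g x).

Lemma ipC f g : ip f g = ip g f.
Proof. by apply: eq_Rintegral => x _; rewrite mulrC. Qed.

Lemma ip_ge0 f : 0 <= ip f f.
Proof. by apply/fine_ge0/integral_ge0 => x _; rewrite lee_fin -expr2 sqr_ge0. Qed.

Lemma ip_comb a b f g w : L2 f -> L2 g -> L2 w ->
  ip (fun x => a * f x + b * g x) w = a * ip f w + b * ip g w.
Proof.
move=> hf hg hw; have ifw := L2_prod hf hw; have igw := L2_prod hg hw.
rewrite /ip -(RintegralZl a mD ifw) -(RintegralZl b mD igw) -RintegralD//.
- by apply: eq_Rintegral => x _; ring.
- exact: (integrableZl mD a ifw).
- exact: (integrableZl mD b igw).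
Qed.

Lemma ip_ae f f' g : L2 f -> L2 f' -> L2 g -> {ae mu, forall x, D x -> f x = f' x} -> ip f g = ip f' g.
Proof.
move=> hf hf' hg ff'; rewrite /ip /Rintegral; congr fine; apply: ae_eq_integral => //.
- exact: measurable_int (L2_prod hf hg).
- exact: measurable_int (L2_prod hf' hg).
- by apply: ae_imp ff' => x h Dx; rewrite h.
Qed.

Lemma ip_EFin f g : L2 f -> L2 g -> (\int[mu]_(x in D) (f x * g x)%:E = (ip f g)%:E)%E.
Proof. by move=> hf hg; apply: integrable_Rintegral => //; exact: L2_prod. Qed.

Lemma ip_sqr_EFin f : L2 f -> (\int[mu]_(x in D) (f x ^+ 2)%:E = (ip f f)%:E)%E.
Proof. by move=> hf; rewrite -ip_EFin//; apply: eq_integral => x _; rewrite expr2. Qed.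

Lemma ip_null f : L2 f -> ip f f = 0 -> {ae mu, forall x, D x -> f x = 0}.
Proof.
move=> hf f0; have [mf _] := hf.
have : (\int[mu]_(x in D) `|(f x ^+ 2)%:E| = 0)%E.
  rewrite -[RHS](_ : (ip f f)%:E = 0%E); last by rewrite f0.
  by rewrite -(ip_sqr_EFin hf); apply: eq_integral => x _; rewrite /= ger0_norm ?sqr_ge0.
move/ae_eq_integral_abs => h.
have {}h : ae_eq mu D (fun x => (f x ^+ 2)%:E) (cst 0%E).
  by apply: h => //; apply/measurable_EFinP; exact: measurable_funX.
by apply: ae_imp h => x h Dx; have [/eqP] := h Dx; rewrite sqrf_eq0 => /eqP.
Qed.

Lemma L2_bounded f (M : R) : (mu D < +oo)%E -> measurable_fun D f ->
  (forall x, D x -> `|f x| <= M) -> L2 f.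
Proof.
move=> Doo mf hf; split => //; apply: (measurable_bounded_integrable mD Doo).
  by apply: measurable_funX.
exists (M ^+ 2); split => [|N MN x Dx]; first exact: num_real.
rewrite /= normrX; apply: le_trans (ltW MN).
by rewrite lerXn2r ?nnegrE//; [exact: le_trans (normr_ge0 _) (hf x Dx)|exact: hf].
Qed.

Lemma L2_integrable f : (mu D < +oo)%E -> L2 f -> mu.-integrable D (EFin \o f).
Proof.
move=> Doo hf; have h1 : L2 (cst 1).
  by apply: (@L2_bounded _ 1) => // x _; rewrite normr1.
by have := L2_prod hf h1; apply: eq_integrable => // x _ /=; rewrite mulr1.
Qed.

Lemma L2_sub f g : L2 f -> L2 g -> L2 (fun x => f x - g x).
Proof.
move=> hf hg; have := L2_comb 1 (-1) hf hg.
by congr (square_integrable _ _ _); apply/funext => x; ring.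
Qed.

Lemma extract_fast (P : nat -> nat -> nat -> Prop) :
  (forall r, exists N, forall i j, (N <= i)%N -> (N <= j)%N -> P r i j) ->
  exists2 k : nat -> nat, (forall j, (j <= k j)%N) & forall j, P j (k j.+1) (k j).
Proof.
move=> /choice[N hN].
exists (fun j => (j + \sum_(i < j.+1) N i)%N) => [j|j]; first exact: leq_addr.
apply: hN; last by rewrite big_ord_recr/= addnA leq_addl.
by rewrite !big_ord_recr/=; lia.
Qed.

(** Along a subsequence with [ip Delta_j Delta_j <= 8^-j] for the increments
    [Delta_j], the series [G] of the functions [4^j Delta_j^2] is integrable. Hence
    almost everywhere the subsequence converges at the rate [2 sqrt(G) 2^-j], and
    integrating the square of this bound gives convergence in L^2. *)
Lemma riesz_fischer (f : nat -> T -> R) : (forall k, L2 (f k)) ->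
  (forall eps : R, 0 < eps -> exists N, forall i j, (N <= i)%N -> (N <= j)%N ->
     ip (fun x => f i x - f j x) (fun x => f i x - f j x) <= eps) ->
  exists2 g, L2 g & forall eps : R, 0 < eps -> exists N, forall i, (N <= i)%N ->
     ip (fun x => f i x - g x) (fun x => f i x - g x) <= eps.
Proof.
move=> hf hc.
have hc8 r : exists N, forall i j, (N <= i)%N -> (N <= j)%N ->
    ip (fun x => f i x - f j x) (fun x => f i x - f j x) <= 8 ^- r.
  by apply: hc; rewrite invr_gt0 exprn_gt0.
have [k kge hk] := extract_fast hc8.
pose Delta j x := f (k j.+1) x - f (k j) x.
have LD j : L2 (Delta j) by exact: L2_sub.
pose G x := (\sum_(0 <= j <oo) (4 ^+ j * Delta j x ^+ 2)%:E)%E.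
have mDelta j : measurable_fun D (fun x => (4 ^+ j * Delta j x ^+ 2)%:E).
  apply/measurable_EFinP; apply: measurable_funM; first exact: measurable_cst.
  by apply: measurable_funX; have [] := LD j.
have D0 j x : (0 <= (4 ^+ j * Delta j x ^+ 2)%:E)%E by rewrite lee_fin; apply: mulr_ge0; [exact: exprn_ge0|exact: sqr_ge0].
have mG : measurable_fun D G by apply: ge0_emeasurable_sum => //.
have G0 x : (0 <= G x)%E by apply: nneseries_ge0.
have GI : (\int[mu]_(x in D) G x < +oo)%E.
  rewrite integral_nneseries//.
  apply: (@le_lt_trans _ _ (\sum_(0 <= j <oo) ((2 ^- j)%R)%:E)%E).
    apply: lee_nneseries => [j _ _|j _]; first by apply: integral_ge0.
    rewrite (@ge0_integral_scale R _ _ mu D (4 ^+ j) (fun x => Delta j x ^+ 2))//; last 2 first.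
    - by apply: measurable_funX; have [] := LD j.
    - by move=> x _; rewrite sqr_ge0.
    rewrite (ip_sqr_EFin (LD j)) -EFinM lee_fin.
    apply: le_trans (ler_wpM2l _ (hk j)) _; first by rewrite exprn_ge0.
    by rewrite (_ : (8 : R) = 4 * 2) ?exprMn ?invfM ?mulrA ?divff ?mul1r// ?expf_neq0//; lra.
  exact: half_series_lty.
have iG : mu.-integrable D G.
  apply/integrableP; split => //; apply: le_lt_trans GI; rewrite le_eqVlt; apply/orP; left; apply/eqP.
  by apply: eq_integral => x _; rewrite gee0_abs.
pose C x := Num.sqrt (fine (G x)).
have fast : {ae mu, forall x, D x -> G x \is a fin_num /\ forall j, `|f (k j.+1) x - f (k j) x| <= C x * 2 ^- j}.
  apply: ae_imp (integrable_ae mD iG) => x Gf Dx; split; first exact: Gf.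
  move=> j; have : 4 ^+ j * Delta j x ^+ 2 <= fine (G x).
    rewrite -lee_fin fineK ?Gf//.
    apply: le_trans (_ : \sum_(0 <= i < j.+1) (4 ^+ i * Delta i x ^+ 2)%:E <= _)%E.
      by rewrite big_nat_recr//= leeDr// sume_ge0.
    exact: nneseries_lim_ge.
  rewrite (_ : 4 ^+ j * Delta j x ^+ 2 = (2 ^+ j * Delta j x) ^+ 2); last first.
    by rewrite exprMn -exprM mulnC exprM; congr (_ ^+ j * _); ring.
  move=> h; have : `|2 ^+ j * Delta j x| <= C x by rewrite -sqrtr_sqr ler_wsqrtr.
  by rewrite normrM ger0_norm ?exprn_ge0// mulrC ler_pdivlMr ?exprn_gt0.
pose g x := fine (limn_esup (fun j => (f (k j) x)%:E)).
have mg : measurable_fun D g.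
  apply: (@measurableT_comp _ _ _ _ _ _ fine); first exact: fine_measurable.
  apply: (measurable_fun_limn_esup (f := fun j x => (f (k j) x)%:E)) => j.
  by apply/measurable_EFinP; have [] := hf (k j).
have close : {ae mu, forall x, D x -> G x \is a fin_num /\ forall j, `|g x - f (k j) x| <= 2 * C x * 2 ^- j}.
  apply: ae_imp fast => x h Dx; have [Gf hx] := h Dx; split => // j.
  have [l cl hl] := geometric_limit hx.
  have -> : g x = l.
    have cE : (f (k j) x)%:E @[j --> \oo] --> l%:E by apply/fine_cvgP; split; [exact: nearW|exact: cl].
    by rewrite /g (cvg_limn_einf_sup cE).
  exact: hl.
have gI j : (\int[mu]_(x in D) ((f (k j) x - g x) ^+ 2)%:E <= (4 * 4 ^- j)%:E * \int[mu]_(x in D) G x)%E.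
  rewrite -ge0_integralZl//.
  apply: ae_ge0_le_integral => //.
  - by move=> x _; rewrite lee_fin sqr_ge0.
  - by apply/measurable_EFinP; apply: measurable_funX; apply: measurable_funB => //; have [] := hf (k j).
  - by move=> x _; apply: mule_ge0 => //; rewrite lee_fin mulr_ge0// invr_ge0 exprn_ge0.
  - exact: measurable_funeM.
  apply: ae_imp close => x h Dx; have [Gf /(_ j) hx] := h Dx.
  rewrite -(fineK Gf) -EFinM lee_fin -sqrrN opprB -real_normK ?num_real//.
  have G0' : 0 <= fine (G x) by exact: fine_ge0.
  apply: (@le_trans _ _ ((2 * C x * 2 ^- j) ^+ 2)); first by rewrite lerXn2r ?nnegrE// (le_trans _ hx).
  rewrite !exprMn sqr_sqrtr// exprVn -exprM mulnC exprM.
  have -> : (2 : R) ^+ 2 = 4 by ring.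
  by rewrite mulrAC.
have Lfg j : L2 (fun x => f (k j) x - g x).
  split; first by apply: measurable_funB => //; have [] := hf (k j).
  apply/integrableP; split.
    by apply/measurable_EFinP; apply: measurable_funX; apply: measurable_funB => //; have [] := hf (k j).
  rewrite (eq_integral (fun x => ((f (k j) x - g x) ^+ 2)%:E)); last first.
    by move=> x _; rewrite gee0_abs// lee_fin sqr_ge0.
  apply: le_lt_trans (gI j) _; apply: lte_mul_pinfty => //.
exists g.
  have := L2_sub (hf (k 0%N)) (Lfg 0%N).
  by congr (square_integrable _ _ _); apply/funext => x; ring.
move=> eps e0.
have e4 : 0 < eps / 4 by rewrite divr_gt0.
have [N hN] := hc _ e4.
have GE : (\int[mu]_(x in D) G x)%E = (fine (\int[mu]_(x in D) G x))%:E.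
  by rewrite fineK// ge0_fin_numE//; exact: integral_ge0.
set I := fine _ in GE; have I0 : 0 <= I by apply/fine_ge0/integral_ge0.
have [j Nj jI] : exists2 j, (N <= j)%N & 4 * 4 ^- j * I <= eps / 4.
  pose j := (N + Num.truncn (4 * I / (eps / 4))).+1.
  exists j; first by rewrite /j; lia.
  have hj : 4 * I / (eps / 4) <= 4 ^+ j.
    apply: le_trans (_ : j%:R <= _); last by rewrite -natrX ler_nat; apply/ltnW/ltn_expl.
    apply: ltW; apply: lt_le_trans (_ : (Num.truncn (4 * I / (eps / 4))).+1%:R <= _).
      by have /andP[] := truncn_itv (divr_ge0 (mulr_ge0 (ler0n R 4) I0) (ltW e4)).
    by rewrite ler_nat /j; lia.
  by rewrite mulrAC ler_pdivrMr ?exprn_gt0// [leRHS]mulrC -ler_pdivrMr.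
exists N => i Ni.
have Lij := L2_sub (hf i) (hf (k j)).
have LA := Lfg j.
have hi : ip (fun x => f i x - f (k j) x) (fun x => f i x - f (k j) x) <= eps / 4.
  by apply: hN => //; exact: leq_trans Nj (kge j).
have hj : ip (fun x => f (k j) x - g x) (fun x => f (k j) x - g x) <= eps / 4.
  by apply: le_trans jI; rewrite -lee_fin -(ip_sqr_EFin LA) EFinM -GE.
have Lig : L2 (fun x => f i x - g x).
  have := L2_comb 1 1 Lij LA; congr (square_integrable _ _ _); apply/funext => x; ring.
rewrite -lee_fin -(ip_sqr_EFin Lig).
apply: (@le_trans _ _ (\int[mu]_(x in D) ((2 * (f i x - f (k j) x) ^+ 2 + 2 * (f (k j) x - g x) ^+ 2)%:E))%E).
  apply: ge0_integral_mono => x _; first by rewrite lee_fin sqr_ge0.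
  rewrite lee_fin; have := sqr_ge0 ((f i x - f (k j) x) - (f (k j) x - g x)); nra.
under eq_integral do rewrite EFinD.
rewrite ge0_integralD//; last 4 first.
- by move=> x _; rewrite lee_fin mulr_ge0 ?sqr_ge0.
- by apply/measurable_EFinP; apply: measurable_funM => //; apply: measurable_funX; have [] := Lij.
- by move=> x _; rewrite lee_fin mulr_ge0 ?sqr_ge0.
- by apply/measurable_EFinP; apply: measurable_funM => //; apply: measurable_funX; have [] := LA.
rewrite (@ge0_integral_scale R _ _ mu D 2 (fun x => (f i x - f (k j) x) ^+ 2))//; last 2 first.
- by apply: measurable_funX; have [] := Lij.
- by move=> x _; rewrite sqr_ge0.
rewrite (@ge0_integral_scale R _ _ mu D 2 (fun x => (f (k j) x - g x) ^+ 2))//; last 2 first.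
- by apply: measurable_funX; have [] := LA.
- by move=> x _; rewrite sqr_ge0.
rewrite (ip_sqr_EFin Lij) (ip_sqr_EFin LA) -!EFinM -EFinD lee_fin; lra.
Qed.

End SquareIntegrable.

(** * Eigenvectors of compact pairs of forms *)

(** Limits along an ultrafilter extract convergent subsequences of all the relevant
    bounded numerical sequences at the same time. *)
Lemma ultra_limit (R : realType) (U : set_system nat) (x : nat -> R) (M : R) : UltraFilter U ->
  (forall k, `|x k| <= M) -> exists2 l : R, `|l| <= M & forall eps : R, 0 < eps -> U [set k | `|x k - l| <= eps].
Proof.
move=> UU hx.
have all k : `[- M, M]%classic (x k) by rewrite /= in_itv/= -ler_norml; exact: hx.
have xU : U (x @^-1` `[- M, M]%classic) by apply: filterE => k; exact: all.
have [l [Kl xl]] := @segment_compact R (- M) M (x @ U) _ xU.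
exists l; first by move: Kl; rewrite /= in_itv/= -ler_norml.
move=> eps e0; have [//|nU] := in_ultra_setVsetC [set k | `|x k - l| <= eps] UU.
have [y [/= ny ly]] := xl (~` [set y | `|y - l| <= eps]) (ball l eps) nU (nbhsx_ballx _ _ e0).
by exfalso; apply: ny; move: ly; rewrite /= /ball/= distrC => /ltW.
Qed.

Lemma kernel_row (R : fieldType) (m J : nat) (M : 'M[R]_(m, J)) : (J < m)%N ->
  exists2 c : 'rV[R]_m, c != 0 & c *m M = 0.
Proof.
move=> Jm; have k0 : kermx M != 0.
  by rewrite -mxrank_eq0 mxrank_ker subn_eq0 -ltnNge; exact: leq_ltn_trans (rank_leq_col M) Jm.
have [i ri] : exists i, row i (kermx M) != 0.
  apply: contrapT => /forallNP h; move/eqP: k0; apply; apply/row_matrixP => i; rewrite row0.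
  by apply/eqP; apply: contrapT => /negP; exact: h.
exists (row i (kermx M)) => //.
by rewrite -row_mul mulmx_ker row0.
Qed.

Lemma cvg_sqr0 (R : realType) (x : nat -> R) : x k ^+ 2 @[k --> \oo] --> (0 : R) ->
  x k @[k --> \oo] --> (0 : R).
Proof.
move=> h; apply/cvgrPdist_le => e e0; have /cvgrPdist_le := h.
move=> /(_ (e ^+ 2)) -/(_ (exprn_gt0 2 e0)); apply: filterS => k.
rewrite !sub0r !normrN normrX => hk.
by rewrite -(@ler_pXn2r _ 2) ?nnegrE// ltW.
Qed.

Lemma squeeze0 (R : realType) (x y : nat -> R) : (forall k, 0 <= x k <= y k) ->
  y k @[k --> \oo] --> (0 : R) -> x k @[k --> \oo] --> (0 : R).
Proof.
move=> h hy; apply: (@squeeze_cvgr _ _ _ _ (fun=> 0) y) => //; last exact: cvg_cst.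
by apply: nearW => k; exact: h.
Qed.

Section Forms.
Context (R : realType) (V : lmodType R) (h : V -> V -> R).
Hypotheses (hsym : symform h) (hpsd : psd h).

Definition hcvg (x : nat -> V) (y : V) := h (x k - y) (x k - y) @[k --> \oo] --> (0 : R).

Section PsdContinuity.
Variables (b : V -> V -> R) (C : R).
Hypotheses (bsym : symform b) (bpsd : psd b) (bC : forall u, b u u <= C * h u u).

Lemma psd_hcvg x y : hcvg x y -> b (x k - y) (x k - y) @[k --> \oo] --> (0 : R).
Proof.
move=> xy; apply: (@squeeze0 _ _ (fun k => C * h (x k - y) (x k - y))).
  by move=> k; rewrite bpsd bC.
by rewrite -[X in _ --> X](mulr0 C); apply: cvgM => //; exact: cvg_cst.
Qed.

Lemma psd_cvgl x y w : hcvg x y -> b (x k) w @[k --> \oo] --> b y w.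
Proof.
move=> xy; have : b (x k - y) w @[k --> \oo] --> (0 : R).
  apply: cvg_sqr0; apply: (@squeeze0 _ _ (fun k => b (x k - y) (x k - y) * b w w)).
    by move=> k; rewrite sqr_ge0 form_CS.
  by rewrite -[X in _ --> X](mul0r (b w w)); apply: cvgM; [exact: psd_hcvg|exact: cvg_cst].
move=> hd; rewrite (_ : (fun k => _) = fun k => b (x k - y) w + b y w).
  by rewrite -[X in _ --> X]add0r; apply: cvgD => //; exact: cvg_cst.
by apply/funext => k; rewrite -formDl// subrK.
Qed.

Lemma psd_cvg x y z w : hcvg x y -> hcvg z w -> b (x k) (z k) @[k --> \oo] --> b y w.
Proof.
move=> xy zw; have d0 : b (x k - y) (z k - w) @[k --> \oo] --> (0 : R).
  apply: cvg_sqr0; apply: (@squeeze0 _ _ (fun k => b (x k - y) (x k - y) * b (z k - w) (z k - w))).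
    by move=> k; rewrite sqr_ge0 form_CS.
  by rewrite -[X in _ --> X](mulr0 (0 : R)); apply: cvgM; exact: psd_hcvg.
rewrite (_ : (fun k => _) = fun k => b (x k - y) (z k - w) + b (x k) w + b (z k) y - b w y).
  rewrite [X in _ --> X](_ : _ = 0 + b y w + b w y - b w y); last by rewrite add0r addrK.
  apply: cvgB; last exact: cvg_cst.
  apply: cvgD; last exact: psd_cvgl.
  by apply: cvgD => //; exact: psd_cvgl.
apply/funext => k; rewrite formBl// !formBr// [b (z k) y]formC// [b w y]formC//; ring.
Qed.

End PsdContinuity.

Section BoundedContinuity.
Variables (b : V -> V -> R) (M : R).
Hypotheses (bsym : symform b) (bM : forall u, `|b u u| <= M * h u u).

Let b' u v := b u v + M * h u v.

Lemma shifted_symform : symform b'.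
Proof.
split => [u v|a u v w]; first by rewrite /b' (formC bsym) (formC hsym).
by rewrite /b' formDl// formZl// [h (_ + _) _]formDl// formZl//; ring.
Qed.

Let b'psd : psd b'.
Proof. by move=> u; have := bM u; rewrite ler_norml /b' => /andP[]; lra. Qed.

Let b'C u : b' u u <= (2 * M) * h u u.
Proof. by have := bM u; rewrite ler_norml /b' => /andP[]; lra. Qed.

Lemma bounded_cvgl x y w : hcvg x y -> b (x k) w @[k --> \oo] --> b y w.
Proof.
move=> xy; have c1 := @psd_cvgl b' _ shifted_symform b'psd b'C x y w xy.
have hC u : h u u <= 1 * h u u by rewrite mul1r.
have c2 := @psd_cvgl h _ hsym hpsd hC x y w xy.
rewrite (_ : (fun k => _) = fun k => b' (x k) w - M * h (x k) w); last first.
  by apply/funext => k; rewrite /b' addrK.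
rewrite (_ : b y w = b' y w - M * h y w); last by rewrite /b' addrK.
by apply: cvgB => //; apply: cvgM => //; exact: cvg_cst.
Qed.

Lemma bounded_null u v : h u u = 0 -> b u v = 0.
Proof.
move=> h0; have b0 : b' u u = 0 by apply/eqP; rewrite eq_le b'psd andbT; have := b'C u; rewrite h0 mulr0.
have := form_null shifted_symform b'psd v b0; rewrite /b'.
by rewrite (form_null hsym hpsd v h0) mulr0 addr0.
Qed.

Lemma bounded_polar u v : `|b u v| <= M / 2 * (h u u + h v v).
Proof.
have p1 := bM (u + v); have p2 := bM (u - v).
move: p1 p2; rewrite form_sqrD// form_sqrB// [h (u + v) _]form_sqrD// [h (u - v) _]form_sqrB//.
by rewrite !ler_norml => /andP[? ?] /andP[? ?]; apply/andP; split; lra.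
Qed.

End BoundedContinuity.
End Forms.

Section Spectrum.
Context (R : realType) (V : lmodType R) (h s : V -> V -> R) (alpha : R).
Hypotheses (hsym : symform h) (hpsd : psd h) (ssym : symform s) (spsd : psd s).
Hypothesis alpha0 : 0 < alpha.

(** Completeness of the seminormed space defined by [h], with limits that are unique
    only up to the kernel of [h]. *)
Definition complete_form := forall x : nat -> V,
  (forall eps : R, 0 < eps -> exists N, forall i j, (N <= i)%N -> (N <= j)%N ->
     h (x i - x j) (x i - x j) <= eps) ->
  exists y, hcvg h x y.

(** The quadratic form [s] is compact relative to [h]: up to a small multiple of [h]
    it is controlled by finitely many bounded functionals. For the H^1 norm this is
    the form in which the Rellich inequality is available. *)
Definition compact_form := forall eps : R, 0 < eps ->
  exists (J : nat) (l : 'I_J -> V -> R) (K : R),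
  [/\ forall j a u v, l j (a *: u + v) = a * l j u + l j v, 0 <= K,
      forall j u, l j u ^+ 2 <= K * h u u
    & forall u, s u u <= eps * h u u + \sum_j l j u ^+ 2].

Hypotheses (hcomplete : complete_form) (scompact : compact_form).

(** The class of forms in which the perturbation takes place; the common lower bound
    [alpha] makes the estimates on eigenvectors uniform. *)
Record admissible (q : V -> V -> R) : Prop := Admissible {
  adm_sym : symform q;
  adm_low : forall u, alpha * h u u <= q u u;
  adm_up : exists C, forall u, q u u <= C * h u u }.

Definition within (q q' : V -> V -> R) (rho : R) := forall u, `|q' u u - q u u| <= rho * h u u.

Definition eigenvector q (lam : R) e := forall phi, q e phi = lam * s e phi.

Definition orthonormal m (e : 'I_m -> V) := forall i j, s (e i) (e j) = (i == j)%:R.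

(** An eigenvalue at most [N] of multiplicity at least [m]. The negation of
    [eigenfamily 2 N] for all [N] says that all eigenvalues are simple, and the cut-
    off [N] makes this a countable intersection of open conditions. *)
Definition eigenfamily m (N : R) q := exists (lam : R) (e : 'I_m -> V),
  [/\ lam <= N, orthonormal e & forall i, eigenvector q lam (e i)].

Lemma s_bounded : exists2 C, 0 <= C & forall u, s u u <= C * h u u.
Proof.
have [J [l [K [_ K0 lK sl]]]] := scompact ltr01.
exists (1 + J%:R * K) => [|u]; first by rewrite addr_ge0// mulr_ge0.
apply: le_trans (sl u) _; rewrite mulrDl lerD2l.
apply: le_trans (ler_sum _ (fun j _ => lK j u)) _.
by rewrite sumr_const card_ord -[leLHS]mulr_natl mulrA.
Qed.

Lemma adm_psd q : admissible q -> psd q.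
Proof. by move=> aq u; apply: le_trans (adm_low aq u); rewrite mulr_ge0// ltW. Qed.

Lemma eigen_bound m q lam N (e : 'I_m -> V) i : admissible q -> lam <= N -> orthonormal e ->
  (forall i, eigenvector q lam (e i)) -> h (e i) (e i) <= N / alpha /\ 0 <= lam.
Proof.
move=> aq lN oe ee; have := ee i (e i); rewrite oe eqxx mulr1 => qe; split.
  by rewrite ler_pdivlMr// mulrC; apply: le_trans (adm_low aq _) _; rewrite qe.
by rewrite -qe; exact: adm_psd.
Qed.

Lemma linear_sum (l : V -> R) m (c : 'I_m -> R) (e : 'I_m -> V) :
  (forall a u v, l (a *: u + v) = a * l u + l v) ->
  l (\sum_i c i *: e i) = \sum_i c i * l (e i).
Proof.
move=> hl; have l0 : l 0 = 0.
  by have := hl 1 0 0; rewrite scaler0 add0r mul1r => /eqP; rewrite -subr_eq0 opprD addrA subrr add0r oppr_eq0 => /eqP.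
elim: (index_enum _) => [|i r IH]; first by rewrite !big_nil.
by rewrite !big_cons hl IH.
Qed.

Lemma form_diag (b : V -> V -> R) m (c : 'I_m -> R) (e : 'I_m -> V) : symform b ->
  (forall i j, i != j -> b (e i) (e j) = 0) ->
  b (\sum_i c i *: e i) (\sum_i c i *: e i) = \sum_i c i ^+ 2 * b (e i) (e i).
Proof.
move=> bs bd; rewrite form_suml//; apply: eq_bigr => i _.
rewrite form_sumr// (bigD1 i)//= big1 ?addr0; last first.
  by move=> j ji; rewrite formZl// formZr// bd ?mulr0// eq_sym.
by rewrite formZl// formZr//; ring.
Qed.

(** On a combination of the vectors [e i] annihilated by the functionals of
    [compact_form] the form [s] is at most a small multiple of [h], while [q <= N s]
    bounds [s] from below. Such a combination exists if [m] exceeds the number of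
    functionals. *)
Lemma multiplicity_bound (N : R) : exists P, forall q m (e : 'I_m -> V), admissible q ->
  orthonormal e -> (forall i j, i != j -> q (e i) (e j) = 0) -> (forall i, q (e i) (e i) <= N) ->
  (m <= P)%N.
Proof.
have eps0 : 0 < alpha / (2 * (`|N| + 1)) by rewrite divr_gt0// mulr_gt0// ltr_wpDl.
have [J [l [K [ll _ _ sl]]]] := scompact eps0; set eps := alpha / _ in eps0 sl.
exists J => q m e aq oe qe qN; rewrite leqNgt; apply/negP => Jm.
have [c c0 cM] := kernel_row (\matrix_(i < m, j < J) l j (e i)) Jm.
pose u := \sum_i c 0 i *: e i.
have lu j : l j u = 0.
  rewrite (linear_sum _ _ (ll j)); have := congr1 (fun M : 'rV_J => M 0 j) cM.
  by rewrite !mxE => {2}<-; apply: eq_bigr => i _; rewrite mxE.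
pose S := \sum_i c 0 i ^+ 2.
have su : s u u = S.
  rewrite (form_diag _ ssym) => [|i j ij]; last by rewrite oe (negbTE ij).
  by apply: eq_bigr => i _; rewrite oe eqxx mulr1.
have S0 : 0 <= S by apply: sumr_ge0 => i _; exact: sqr_ge0.
have qu : q u u <= `|N| * S.
  rewrite (form_diag _ (adm_sym aq) qe) mulr_sumr; apply: ler_sum => i _.
  by rewrite mulrC ler_wpM2r ?sqr_ge0//; apply: le_trans (qN i) (ler_norm N).
have hu : alpha * h u u <= `|N| * S := le_trans (adm_low aq u) qu.
have := sl u; rewrite big1 => [|j _]; last by rewrite lu expr0n.
rewrite addr0 su => Sle.
have : S <= S / 2.
  apply: le_trans Sle _; rewrite /eps invfM mulrA mulrAC ler_pdivrMr; last by rewrite ltr_wpDl.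
  have N0 := normr_ge0 N.
  by move: hu; set H := h u u; lra.
move=> S2; have Sz : S = 0 by lra.
move/eqP: c0; apply; apply/rowP => i; rewrite mxE.
apply/eqP; rewrite -sqrf_eq0 eq_le sqr_ge0 andbT -Sz /S (bigD1 i)//= lerDl.
by apply: sumr_ge0 => k _; exact: sqr_ge0.
Qed.

Lemma eigenfamilyS m N q : eigenfamily m.+1 N q -> eigenfamily m N q.
Proof.
move=> [lam [e [lN oe ee]]]; exists lam, (fun i => e (lift ord0 i)); split => //.
Qed.

Lemma eigenfamily_le m m' N q : (m <= m')%N -> eigenfamily m' N q -> eigenfamily m N q.
Proof.
elim: m' => [|m' IH]; first by rewrite leqn0 => /eqP->.
rewrite leq_eqVlt => /orP[/eqP-> //|]; rewrite ltnS => mm' /eigenfamilyS; exact: IH.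
Qed.

Lemma no_large_family (N : R) : exists P, forall q, admissible q -> ~ eigenfamily P N q.
Proof.
have [P hP] := multiplicity_bound N; exists P.+1 => q aq [lam [e [lN oe ee]]].
suff : (P.+1 <= P)%N by rewrite ltnn.
apply: (hP q P.+1 e aq oe) => [i j ij|i].
  by rewrite ee oe (negbTE ij) mulr0.
by rewrite ee oe eqxx mulr1.
Qed.

(** The eigenvalue equations for [e1] and [e2] are tested with [e1 - e2]: the
    difference is small in [h] as soon as it is small for [s], the eigenvalues are
    close and both forms are close to [q]. *)
Lemma eigen_cauchy_bound q q1 q2 (lam1 lam2 N H rho1 rho2 eps delta : R) e1 e2 J (l : 'I_J -> V -> R) :
  admissible q -> symform q1 -> symform q2 -> within q q1 rho1 -> within q q2 rho2 ->
  eigenvector q1 lam1 e1 -> eigenvector q2 lam2 e2 -> s e1 e1 = 1 -> s e2 e2 = 1 ->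
  h e1 e1 <= H -> h e2 e2 <= H -> 0 <= lam2 -> lam2 <= N -> 0 <= rho1 -> 0 <= rho2 ->
  `|lam1 - lam2| <= delta ->
  s (e1 - e2) (e1 - e2) <= eps * h (e1 - e2) (e1 - e2) + \sum_j l j (e1 - e2) ^+ 2 -> 0 <= eps ->
  alpha * h (e1 - e2) (e1 - e2) <=
    N * (eps * (4 * H) + \sum_j l j (e1 - e2) ^+ 2) + 2 * delta + 3 * H * (rho1 + rho2).
Proof.
move=> aq s1 s2 w1 w2 ev1 ev2 n1 n2 h1 h2 lam0 lamN r1 r2 ld sle eps0.
set d := e1 - e2 in sle *.
have hd : h d d <= 4 * H by have := form_sqrB_le hsym hpsd e1 e2; rewrite -/d; lra.
have sd : s d d <= 4 by have := form_sqrB_le ssym spsd e1 e2; rewrite -/d n1 n2; lra.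
have sd0 := spsd d.
have s1d : `|s e1 d| <= 2.
  have := form_CS ssym spsd e1 d; rewrite n1 mul1r => le.
  have : s e1 d ^+ 2 <= 4 by apply: le_trans le sd.
  by rewrite ler_norml => le'; apply/andP; split; nra.
have polar q' rho e : symform q' -> within q q' rho -> 0 <= rho -> h e e <= H ->
    `|q' e d - q e d| <= rho * (5 / 2 * H).
  move=> sq wq r0 he.
  have sdq : symform (fun u v => q' u v - q u v).
    split=> [u v|a u v w]; first by rewrite (formC sq) (formC (adm_sym aq)).
    by rewrite (formDl sq) (formDl (adm_sym aq)) (formZl sq) (formZl (adm_sym aq)); ring.
  apply: le_trans (bounded_polar hsym sdq wq e d) _.
  rewrite -mulrA ler_wpM2l//; lra.
have p1 := polar q1 rho1 e1 s1 w1 r1 h1; have p2 := polar q2 rho2 e2 s2 w2 r2 h2.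
have H0 : 0 <= H := le_trans (hpsd e1) h1.
apply: le_trans (adm_low aq d) _.
have qE : q d d = q e1 d - q e2 d by rewrite {1}/d (formBl (adm_sym aq)).
have sE : s d d = s e1 d - s e2 d by rewrite {1}/d (formBl ssym).
rewrite ev1 in p1; rewrite ev2 in p2.
have t1 : (lam1 - lam2) * s e1 d <= delta * 2.
  by apply: le_trans (ler_norm _) _; rewrite normrM ler_pM.
have t2 : lam2 * s d d <= N * (eps * (4 * H) + \sum_j l j d ^+ 2).
  apply: (@le_trans _ _ (N * s d d)); first by rewrite ler_wpM2r.
  rewrite ler_wpM2l//; first exact: le_trans lam0 lamN.
  by apply: le_trans sle _; rewrite lerD2r ler_wpM2l.
move: p1 p2; rewrite !ler_norml => /andP[p1 _] /andP[_ p2].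
have r1H : 0 <= rho1 * H by exact: mulr_ge0.
have r2H : 0 <= rho2 * H by exact: mulr_ge0.
have e12 : lam1 * s e1 d - lam2 * s e2 d = lam2 * s d d + (lam1 - lam2) * s e1 d by rewrite sE; ring.
rewrite qE; move: t2; set X := N * _ => t2.
have -> : 3 * H * (rho1 + rho2) = 3 * (rho1 * H) + 3 * (rho2 * H) by ring.
lra.
Qed.

(** Along an ultrafilter the eigenvalues and the values of the functionals of
    [compact_form] converge; by [eigen_cauchy_bound] the eigenvectors then form a
    Cauchy sequence along sets of the ultrafilter, from which a subsequence is
    picked diagonally. *)
Lemma eigen_compactness m N q (qk : nat -> V -> V -> R) (rho lam : nat -> R) (e : nat -> 'I_m.+1 -> V) :
  admissible q -> (forall k, admissible (qk k)) -> (forall k, within q (qk k) (rho k)) ->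
  (forall k, 0 <= rho k) -> rho k @[k --> \oo] --> (0 : R) ->
  (forall k, lam k <= N) -> (forall k, orthonormal (e k)) ->
  (forall k i, eigenvector (qk k) (lam k) (e k i)) ->
  exists (kap : nat -> nat) (lam' : R) (e' : 'I_m.+1 -> V),
  [/\ forall j, (j <= kap j)%N, lam (kap j) @[j --> \oo] --> lam' &
      forall i, hcvg h (fun j => e (kap j) i) (e' i)].
Proof.
move=> aq aqk wk rho0 crho lamN oe ee.
have eb k i := eigen_bound i (aqk k) (lamN k) (oe k) (ee k).
pose H := N / alpha; have hH k i : h (e k i) (e k i) <= H by have [] := eb k i.
have lam0 k : 0 <= lam k by have [] := eb k ord0.
have N0 : 0 <= N := le_trans (lam0 0%N) (lamN 0%N).
have H0 : 0 <= H by rewrite divr_ge0// ltW.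
have [U [UU ooU]] := ultraFilterLemma (@eventually_filter).
have nearU (A : set nat) : (\forall k \near \oo, A k) -> U A by move=> h'; exact: ooU.
have [lam' _ hlam] : exists2 l : R, `|l| <= N & forall eps : R, 0 < eps -> U [set k | `|lam k - l| <= eps].
  by apply: (ultra_limit UU) => k; rewrite ger0_norm.
have small (eta : R) : 0 < eta -> exists2 A, U A & forall k k' i, A k -> A k' ->
    h (e k i - e k' i) (e k i - e k' i) <= eta.
  move=> eta0; pose ae := alpha * eta; have ae0 : 0 < ae by exact: mulr_gt0.
  pose eps := ae / (4 * (4 * N * H + 1)).
  have NH0 : 0 <= 4 * N * H by apply: mulr_ge0 => //; exact: mulr_ge0.
  have eps0 : 0 < eps by rewrite divr_gt0// mulr_gt0// ltr_wpDl.
  have [J [l [K [ll K0 lK sl]]]] := scompact eps0.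
  pose tau := Num.min 1 (ae / (16 * (N * J%:R + 1))).
  have NJ0 : 0 <= N * J%:R by rewrite mulr_ge0.
  have tau0 : 0 < tau by rewrite lt_min ltr01 divr_gt0// mulr_gt0// ltr_wpDl.
  have tau1 : tau <= 1 by rewrite ge_min lexx.
  have tauJ : 16 * (N * J%:R) * tau <= ae.
    have : tau <= ae / (16 * (N * J%:R + 1)) by rewrite ge_min lexx orbT.
    by rewrite ler_pdivlMr; [nra|rewrite mulr_gt0// ltr_wpDl].
  pose M := Num.sqrt (K * H).
  have lM j k i : `|l j (e k i)| <= M.
    rewrite -sqrtr_sqr ler_wsqrtr//; apply: le_trans (lK j _) _.
    by rewrite ler_wpM2l.
  have /choice[L hL] : forall z : 'I_J * 'I_m.+1, exists t : R, forall eps : R, 0 < eps ->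
      U [set k | `|l z.1 (e k z.2) - t| <= eps].
    by move=> z; have [t _ ht] := ultra_limit UU (fun k => lM z.1 k z.2); exists t.
  pose A1 := [set k | forall z : 'I_J * 'I_m.+1, `|l z.1 (e k z.2) - L z| <= tau / 2].
  have UA1 : U A1.
    by apply: filter_forall => z; apply: hL; exact: divr_gt0.
  pose A2 := [set k | `|lam k - lam'| <= ae / 32].
  have UA2 : U A2 by apply: hlam; rewrite divr_gt0.
  pose A3 := [set k | rho k <= ae / (24 * (H + 1))].
  have HH : 0 < 24 * (H + 1) by rewrite mulr_gt0// ltr_wpDl.
  have UA3 : U A3.
    apply: nearU; have /cvgrPdist_le/(_ (ae / (24 * (H + 1)))) := crho.
    rewrite divr_gt0// => /(_ isT); apply: filterS => k; rewrite sub0r normrN.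
    exact: le_trans (ler_norm _).
  exists (A1 `&` (A2 `&` A3)) => [|k k' i [a1 [a2 a3]] [b1 [b2 b3]]]; first by do ![apply: filterI].
  have nk : s (e k i) (e k i) = 1 by rewrite oe eqxx.
  have nk' : s (e k' i) (e k' i) = 1 by rewrite oe eqxx.
  have ld : `|lam k - lam k'| <= ae / 16.
    have := ler_normB (lam k - lam') (lam k' - lam'); rewrite opprB addrA subrK.
    by move: a2 b2; rewrite /A2 /=; lra.
  have := eigen_cauchy_bound aq (adm_sym (aqk k)) (adm_sym (aqk k')) (wk k) (wk k') (ee k i) (ee k' i)
    nk nk' (hH k i) (hH k' i) (lam0 k') (lamN k') (rho0 k) (rho0 k') ld (sl _) (ltW eps0).
  set d := e k i - e k' i => hd.
  have lsum : \sum_j l j d ^+ 2 <= J%:R * tau.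
    apply: (@le_trans _ _ (\sum_(j < J) tau)); last by rewrite sumr_const card_ord mulr_natl.
    apply: ler_sum => j _.
    have lB : l j d = l j (e k i) - l j (e k' i).
      by rewrite /d -[e k i - _]addrC -scaleN1r ll mulN1r addrC.
    have : `|l j d| <= tau.
      rewrite lB; have := ler_normB (l j (e k i) - L (j, i)) (l j (e k' i) - L (j, i)).
      rewrite opprB addrA subrK; have := a1 (j, i); have := b1 (j, i) => /=; lra.
    by rewrite ler_norml => /andP[x1 x2]; nra.
  have t1 : N * (eps * (4 * H)) <= ae / 4.
    have eE : eps * (4 * (4 * N * H + 1)) = ae by rewrite /eps divfK// gt_eqF// mulr_gt0// ltr_wpDl.
    by move: (eps) eps0 eE => ep ep0 eE; lra.
  have t2 : N * \sum_j l j d ^+ 2 <= ae / 16.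
    apply: le_trans (ler_wpM2l N0 lsum) _; lra.
  have t3 : 3 * H * (rho k + rho k') <= ae / 4.
    move: a3 b3; rewrite /A3 /=; set r := ae / (24 * (H + 1)) => a3 b3.
    have rH : r * (24 * (H + 1)) = ae by rewrite /r divfK// gt_eqF.
    have r0 : 0 <= r by rewrite divr_ge0// ltW.
    by have := mulr_ge0 H0 (rho0 k); nra.
  rewrite -(ler_pM2l alpha0) -/ae; apply: le_trans hd _; rewrite mulrDr; lra.
have [A UA hA] : exists2 A : nat -> set nat, (forall r, U (A r)) & forall r k k' i, A r k -> A r k' ->
    h (e k i - e k' i) (e k i - e k' i) <= r.+1%:R^-1 /\ `|lam k - lam'| <= r.+1%:R^-1.
  have /choice[A hA] : forall r : nat, exists A : set nat, U A /\ forall k k' i, A k -> A k' ->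
      h (e k i - e k' i) (e k i - e k' i) <= r.+1%:R^-1 /\ `|lam k - lam'| <= r.+1%:R^-1.
    move=> r; have r0 : 0 < r.+1%:R^-1 :> R by rewrite invr_gt0.
    have [A UA hA] := small _ r0.
    exists (A `&` [set k | `|lam k - lam'| <= r.+1%:R^-1]); split; first by apply: filterI => //; exact: hlam.
    by move=> k k' i [Ak Bk] [Ak' _]; split => //; exact: hA.
  by exists A => [r|r]; have [] := hA r.
have /choice[kap hkap] : forall r : nat, exists k, (r <= k)%N /\ forall i : 'I_r.+1, A i k.
  move=> r; have UB : U ([set k | (r <= k)%N] `&` [set k | forall i : 'I_r.+1, A i k]).
    apply: filterI; first by apply: nearU; exists r.
    by apply: filter_forall => i; exact: UA.
  by have [k [rk Ak]] := filter_ex UB; exists k.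
have hkr r r' i : (r <= r')%N -> h (e (kap r') i - e (kap r) i) (e (kap r') i - e (kap r) i) <= r.+1%:R^-1.
  move=> rr'; have [_ /(_ ord_max) a1] := hkap r; have [_ a2] := hkap r'.
  have rr2 : (r < r'.+1)%N by rewrite ltnS.
  by have [] := hA r _ _ i (a2 (Ordinal rr2)) a1.
have /choice[e' he'] : forall i, exists y, hcvg h (fun j => e (kap j) i) y.
  move=> i; apply: hcomplete => eps eps0.
  have [N1 _ hN1] := near_natr (eps^-1).
  have N1e : N1.+1%:R^-1 <= eps by rewrite -[leRHS]invrK lef_pV2 ?posrE ?invr_gt0//; exact: (hN1 N1 (leqnn N1)).
  have inv_le r : (N1 <= r)%N -> r.+1%:R^-1 <= eps.
    by move=> Nr; apply: le_trans N1e; rewrite lef_pV2 ?posrE// ler_nat.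
  exists N1 => j j' Nj Nj'; have [jj'|/ltnW jj'] := leqP j' j.
    exact: le_trans (hkr j' j i jj') (inv_le _ Nj').
  apply: le_trans (inv_le _ Nj); apply: le_trans (hkr j j' i jj').
  by rewrite -[e (kap j) i - _]opprB (formNl hsym) (formNr hsym) opprK.
exists kap, lam', e'; split => // [j|].
  by have [] := hkap j.
apply/cvgrPdist_le => eps eps0; have [N1 _ hN1] := near_natr (eps^-1).
exists N1 => // j /= Nj; rewrite distrC; have [_ /(_ ord_max) a1] := hkap j.
have [_ /le_trans] := hA j _ _ ord0 a1 a1; apply.
by rewrite -[leRHS]invrK lef_pV2 ?posrE ?invr_gt0//; exact: (hN1 j Nj).
Qed.

Lemma within_cvg0 q (qk : nat -> V -> V -> R) (rho : nat -> R) (x : nat -> V) w (H : R) :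
  symform q -> (forall k, symform (qk k)) -> (forall k, within q (qk k) (rho k)) ->
  (forall k, 0 <= rho k) -> rho k @[k --> \oo] --> (0 : R) -> (forall k, h (x k) (x k) <= H) ->
  qk k (x k) w - q (x k) w @[k --> \oo] --> (0 : R).
Proof.
move=> sq sqk wk r0 cr hx; apply/norm_cvg0P.
apply: (@squeeze0 _ _ (fun k => rho k * (2^-1 * (H + h w w)))).
  move=> k; rewrite normr_ge0/=.
  have sd : symform (fun u v => qk k u v - q u v).
    split=> [u v|a u v z]; first by rewrite (formC sq) (formC (sqk k)).
    by rewrite (formDl sq) (formDl (sqk k)) (formZl sq) (formZl (sqk k)); ring.
  apply: le_trans (bounded_polar hsym sd (wk k) (x k) w) _.
  by rewrite -mulrA ler_wpM2l// ler_wpM2l ?invr_ge0// lerD2r.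
by rewrite -[X in _ --> X](mul0r (2^-1 * (H + h w w))); apply: cvgM => //; exact: cvg_cst.
Qed.

Lemma eigen_limit m N q (qk : nat -> V -> V -> R) (rho lam : nat -> R) (e : nat -> 'I_m.+1 -> V)
    (kap : nat -> nat) (lam' : R) (e' : 'I_m.+1 -> V) :
  admissible q -> (forall k, admissible (qk k)) -> (forall k, within q (qk k) (rho k)) ->
  (forall k, 0 <= rho k) -> rho k @[k --> \oo] --> (0 : R) ->
  (forall k, lam k <= N) -> (forall k, orthonormal (e k)) ->
  (forall k i, eigenvector (qk k) (lam k) (e k i)) ->
  (forall j, (j <= kap j)%N) -> lam (kap j) @[j --> \oo] --> lam' ->
  (forall i, hcvg h (fun j => e (kap j) i) (e' i)) ->
  [/\ lam' <= N, orthonormal e' & forall i, eigenvector q lam' (e' i)].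
Proof.
move=> aq aqk wk r0 cr lamN oe ee kapj clam ce.
have [Cs Cs0 sC] := s_bounded; have [Cq qC] := adm_up aq.
have ckap : kap j @[j --> \oo] --> \oo.
  by apply/cvgnyPge => A; exists A => // j /= Aj; exact: leq_trans Aj (kapj j).
split.
- rewrite -(cvg_lim _ clam)//; apply: limr_le; first by apply: cvgP clam.
  by apply: nearW => j; exact: lamN.
- move=> i j; have c1 := psd_cvg ssym spsd sC (ce i) (ce j).
  apply: (lim_near_eq c1 (@cvg_cst _ _ _ _ _)).
  by apply: nearW => k; exact: oe.
- move=> i w.
  have c1 : q (e (kap k) i) w @[k --> \oo] --> q (e' i) w := psd_cvgl (adm_sym aq) (adm_psd aq) qC (ce i).
  have c2 : s (e (kap k) i) w @[k --> \oo] --> s (e' i) w := psd_cvgl ssym spsd sC (ce i).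
  have c3 : lam (kap j) * s (e (kap j) i) w @[j --> \oo] --> lam' * s (e' i) w by exact: cvgM.
  have hb k : h (e k i) (e k i) <= N / alpha.
    by have [] := eigen_bound i (aqk k) (lamN k) (oe k) (ee k).
  have c4 := within_cvg0 w (adm_sym aq) (fun k => adm_sym (aqk k)) wk r0 cr hb.
  have c5 := cvg_comp _ _ ckap c4.
  have c6 : (qk (kap j) (e (kap j) i) w - q (e (kap j) i) w) + q (e (kap j) i) w @[j --> \oo] -->
      0 + q (e' i) w by apply: cvgD => //; exact: c5.
  rewrite add0r in c6.
  apply: (lim_near_eq c6 c3); apply: nearW => j /=.
  by rewrite subrK ee.
Qed.

(** Otherwise there are forms converging to [q] with [m.+1] independent eigenvectors
    below [N], and their limits contradict the assumption. *)
Lemma no_family_open m N q : admissible q -> ~ eigenfamily m.+1 N q ->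
  exists2 rho, 0 < rho & forall q', admissible q' -> within q q' rho -> ~ eigenfamily m.+1 N q'.
Proof.
move=> aq nq; apply: contrapT => hn.
have /choice[qk hqk] : forall k : nat, exists q', [/\ admissible q', within q q' k.+1%:R^-1 & eigenfamily m.+1 N q'].
  move=> k; apply: contrapT => hk; apply: hn; exists k.+1%:R^-1; first by rewrite invr_gt0.
  by move=> q' aq' wq' fq'; apply: hk; exists q'.
have /choice[lam hlam] : forall k, exists l, exists e : 'I_m.+1 -> V,
    [/\ l <= N, orthonormal e & forall i, eigenvector (qk k) l (e i)] by move=> k; have [] := hqk k.
have /choice[e he] := hlam.
have aqk k : admissible (qk k) by have [] := hqk k.
have wk k : within q (qk k) k.+1%:R^-1 by have [] := hqk k.
have r0 k : 0 <= k.+1%:R^-1 :> R by rewrite invr_ge0.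
have cr : k.+1%:R^-1 @[k --> \oo] --> (0 : R) by exact: cvg_harmonic.
have lN k : lam k <= N by have [] := he k.
have oe k : orthonormal (e k) by have [] := he k.
have ee k i : eigenvector (qk k) (lam k) (e k i) by have [] := he k.
have [kap [lam' [e' [kj cl ce]]]] := eigen_compactness aq aqk wk r0 cr lN oe ee.
have [l1 l2 l3] := eigen_limit aq aqk wk r0 cr lN oe ee kj cl ce.
by apply: nq; exists lam', e'.
Qed.

End Spectrum.

(** * Generic simplicity for families of forms *)

Section Perturbation.
Context (R : realType) (V W : lmodType R) (h s : V -> V -> R) (alpha : R).
Hypotheses (hsym : symform h) (hpsd : psd h) (ssym : symform s) (spsd : psd s).
Hypothesis alpha0 : 0 < alpha.
Hypotheses (hcomplete : complete_form h) (scompact : compact_form h s).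
Variables (P : W -> Prop) (b : W -> V -> V -> R) (small : W -> R -> Prop).
Hypotheses (P0 : P 0) (Pcomb : forall a B C, P B -> P C -> P (a *: B + C)).
Hypothesis bsym : forall B, P B -> symform (b B).
Hypothesis bcomb : forall a B C u v, P B -> P C -> b (a *: B + C) u v = a * b B u v + b C u v.
Hypothesis small_bound : forall B delta u, P B -> small B delta -> `|b B u u| <= delta * h u u.
Hypothesis small_ex : forall B, P B -> exists2 M, 0 <= M & small B M.
Hypothesis small0 : small 0 0.
Hypothesis small_comb : forall a B C M N, P B -> P C -> small B M -> small C N -> small (a *: B + C) (`|a| * M + N).
Hypothesis small_le : forall B M N, small B M -> M <= N -> small B N.
Hypothesis nondegenerate : forall e f, s e f = 0 -> s e e = 1 -> s f f = 1 ->
  exists2 B, P B & ~ (b B e f = 0 /\ b B e e = b B f f).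

Local Notation adm := (admissible h alpha).
Definition perturb (q : V -> V -> R) B u v := q u v + b B u v.

Lemma b0 u v : b 0 u v = 0.
Proof.
have := bcomb 1 u v P0 P0; rewrite scaler0 addr0 mul1r => /eqP.
by rewrite -subr_eq0 opprD addrA subrr add0r oppr_eq0 => /eqP.
Qed.

Lemma perturb_sym q B : symform q -> P B -> symform (perturb q B).
Proof.
move=> sq PB; have sb := bsym PB; split => [u v|a u v w].
  by rewrite /perturb (formC sq) (formC sb).
by rewrite /perturb (formDl sq) (formZl sq) (formDl sb) (formZl sb); ring.
Qed.

Lemma perturb_adm q B delta : symform q -> (forall u, (alpha + delta) * h u u <= q u u) ->
  (exists C, forall u, q u u <= C * h u u) -> P B -> small B delta -> adm (perturb q B).
Proof.
move=> sq ql [C qC] PB sB; split.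
- exact: perturb_sym.
- move=> u; have := ql u; have := small_bound u PB sB; rewrite /perturb ler_norml => /andP[]; lra.
- exists (C + delta) => u; have := qC u; have := small_bound u PB sB.
  by rewrite /perturb ler_norml => /andP[]; lra.
Qed.

(** To first order in [t], the eigenvalue [lam] of [q] does not split under the
    perturbation [t B]. *)
Definition scalar_on q lam B := exists mu : R, forall e f,
  eigenvector s q lam e -> eigenvector s q lam f -> b B e f = mu * s e f.

Lemma eigenvector_comb q lam e f (a : R) : symform q -> eigenvector s q lam e -> eigenvector s q lam f ->
  eigenvector s q lam (a *: e + f).
Proof.
move=> sq he hf w; rewrite (formDl sq) (formZl sq) (formDl ssym) (formZl ssym) he hf; ring.
Qed.

Lemma eigenvector_sum q lam m (c : 'I_m -> R) (e : 'I_m -> V) : symform q ->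
  (forall i, eigenvector s q lam (e i)) -> eigenvector s q lam (\sum_i c i *: e i).
Proof.
move=> sq he; elim: (index_enum _) => [|i r IH].
  by rewrite big_nil => w; rewrite (form0l sq) (form0l ssym) mulr0.
by rewrite big_cons; exact: eigenvector_comb.
Qed.

(** The component of [f] orthogonal to the family is an eigenvector; if it were not
    null it could be normalised and would enlarge the family. *)
Lemma eigenspace_expansion m N q lam (e : 'I_m -> V) f : adm q -> ~ eigenfamily s m.+1 N q ->
  lam <= N -> orthonormal s e -> (forall i, eigenvector s q lam (e i)) -> eigenvector s q lam f ->
  let g := f - \sum_i s f (e i) *: e i in h g g = 0.
Proof.
move=> aq nf lN oe ee ef g.
have sq := adm_sym aq.
have eg : eigenvector s q lam g.
  rewrite /g -scaleN1r addrC; apply: eigenvector_comb => //; exact: eigenvector_sum.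
have ge i : s g (e i) = 0.
  rewrite /g (formBl ssym) (form_suml ssym) (bigD1 i)//= big1 ?addr0.
    by rewrite (formZl ssym) oe eqxx mulr1 subrr.
  by move=> j ji; rewrite (formZl ssym) oe (negbTE ji) mulr0.
have sg : s g g = 0.
  apply: contrapT => /eqP sg0; apply: nf.
  have sgp : 0 < s g g by rewrite lt_neqAle eq_sym sg0 spsd.
  pose g' := (Num.sqrt (s g g))^-1 *: g.
  pose e' (i : 'I_m.+1) := if unlift ord0 i is Some j then e j else g'.
  have eg' : eigenvector s q lam g' by move=> w; rewrite (formZl sq) (formZl ssym) eg; ring.
  have g'g' : s g' g' = 1.
    by rewrite /g' (form_sqrZ ssym) exprVn sqr_sqrtr ?spsd// mulVf.
  have g'e i : s g' (e i) = 0 by rewrite /g' (formZl ssym) ge mulr0.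
  exists lam, e'; split => // [i j|i]; rewrite /e'.
    case: (unliftP ord0 i) => [i'|] ->; case: (unliftP ord0 j) => [j'|] ->.
    - by rewrite oe (inj_eq (@lift_inj _ _)).
    - by rewrite (formC ssym) g'e.
    - by rewrite g'e.
    - by rewrite g'g' eqxx.
  by case: (unlift _ _).
apply/eqP; rewrite eq_le hpsd andbT -(ler_pM2l alpha0) mulr0.
by apply: le_trans (adm_low aq g) _; rewrite eg sg mulr0.
Qed.

(** Let [t] tend to zero along a sequence. The eigenvectors of [perturb q (t B)]
    converge to eigenvectors of [q], and testing their equation with an eigenvector
    [f] of [q] gives [b B e_t f = nu_t * s e_t f] with the same slope [nu_t] of the
    eigenvalue for the whole family. In the limit [B] is scalar on the eigenspace,
    the limit family exhausting it because [q] has no family of size [m + 2]. *)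
Lemma persistent_scalar m N q B : adm q -> P B -> ~ eigenfamily s m.+2 N q ->
  (exists2 tau, 0 < tau & forall t, 0 < t -> t <= tau ->
     adm (perturb q (t *: B)) /\ eigenfamily s m.+1 N (perturb q (t *: B))) ->
  exists lam, [/\ lam <= N, exists e : 'I_m.+1 -> V, orthonormal s e /\ forall i, eigenvector s q lam (e i)
    & scalar_on q lam B].
Proof.
move=> aq PB nf [tau tau0 htau]; have sq := adm_sym aq; have sb := bsym PB.
pose t (k : nat) := tau / k.+1%:R.
have t0 k : 0 < t k by rewrite divr_gt0.
have tt k : t k <= tau by rewrite ler_pdivrMr// -[leLHS]mulr1 ler_pM2l// ler1n.
have PtB (x : R) : P (x *: B) by have := Pcomb x PB P0; rewrite addr0.
have btB (x : R) u v : b (x *: B) u v = x * b B u v.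
  by have := bcomb x u v PB P0; rewrite addr0 b0 addr0.
pose qk k := perturb q (t k *: B).
have aqk k : adm (qk k) by have [] := htau (t k) (t0 k) (tt k).
have /choice[lam hlam] : forall k, exists l, exists e : 'I_m.+1 -> V,
    [/\ l <= N, orthonormal s e & forall i, eigenvector s (qk k) l (e i)].
  by move=> k; have [] := htau (t k) (t0 k) (tt k).
have /choice[e he] := hlam.
have lN k : lam k <= N by have [] := he k.
have oe k : orthonormal s (e k) by have [] := he k.
have ee k i : eigenvector s (qk k) (lam k) (e k i) by have [] := he k.
have [M M0 sM] := small_ex PB.
have bM u : `|b B u u| <= M * h u u by exact: small_bound.
have wk k : within h q (qk k) (t k * M).
  move=> u; rewrite /qk /perturb addrAC subrr add0r btB normrM (gtr0_norm (t0 k)) -[leRHS]mulrA.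
  by apply: ler_wpM2l => //; exact: ltW.
have r0 k : 0 <= t k * M by rewrite mulr_ge0// ltW.
have cr : t k * M @[k --> \oo] --> (0 : R).
  rewrite -[X in _ --> X](mul0r M); apply: cvgM; last exact: cvg_cst.
  by rewrite -[X in _ --> X](mulr0 tau); apply: cvgM; [exact: cvg_cst|exact: cvg_harmonic].
have [kap [lam' [e' [kj cl ce]]]] := eigen_compactness hsym hpsd ssym spsd alpha0 hcomplete scompact aq aqk wk r0 cr lN oe ee.
have [l1 l2 l3] := eigen_limit hsym hpsd ssym spsd alpha0 scompact aq aqk wk r0 cr lN oe ee kj cl ce.
exists lam'; split => //; first by exists e'.
have [Cs Cs0 sC] := s_bounded scompact.
(* the slope of the eigenvalue between [q] and [perturb q (t k *: B)] *)
pose nu k := (lam k - lam') / t k.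
have key k i f : eigenvector s q lam' f -> b B (e k i) f = nu k * s (e k i) f.
  move=> ef; have := ee k i f; rewrite /qk /perturb btB (formC sq) ef (formC ssym) => h1.
  have tn0 : t k != 0 by rewrite gt_eqF.
  apply: (mulfI tn0); rewrite /nu; have -> : t k * ((lam k - lam') / t k * s (e k i) f) =
    (lam k - lam') * s (e k i) f by field.
  by move: h1; lra.
pose i0 : 'I_m.+1 := ord0.
have cb i f : b B (e (kap j) i) f @[j --> \oo] --> b B (e' i) f := bounded_cvgl hsym hpsd sb bM (ce i).
have cs i f : s (e (kap j) i) f @[j --> \oo] --> s (e' i) f := psd_cvgl ssym spsd sC (ce i).
pose mu := b B (e' i0) (e' i0).
have cnu : nu (kap j) @[j --> \oo] --> mu.
  have s1 : s (e' i0) (e' i0) = 1 by rewrite l2 eqxx.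
  have c1 : b B (e (kap j) i0) (e' i0) / s (e (kap j) i0) (e' i0) @[j --> \oo] --> mu / 1.
    apply: cvgM; first exact: cb.
    by rewrite -s1; apply: cvgV; [rewrite s1 oner_eq0|exact: cs].
  rewrite divr1 in c1; apply: cvg_trans c1; apply: near_eq_cvg.
  have := cs i0 (e' i0); rewrite s1 => /cvgrPdist_lt/(_ 1 ltr01); apply: filterS => j hj.
  have sn0 : s (e (kap j) i0) (e' i0) != 0.
    by apply: contraTneq hj => ->; rewrite subr0 normr1 ltxx.
  by rewrite (key _ _ _ (l3 i0)) mulfK.
exists mu => f g ef eg.
have base i w : eigenvector s q lam' w -> b B (e' i) w = mu * s (e' i) w.
  move=> ew; have c2 : nu (kap j) * s (e (kap j) i) w @[j --> \oo] --> mu * s (e' i) w.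
    by apply: cvgM => //; exact: cs.
  by apply: (lim_near_eq (cb i w) c2); apply: nearW => j; exact: key.
have hz := eigenspace_expansion aq nf l1 l2 l3 ef; set p := \sum_i _ in hz; cbv zeta in hz.
have bz : b B (f - p) g = 0 by exact: (bounded_null hsym hpsd sb bM).
have sz : s (f - p) g = 0.
  apply: (form_null ssym spsd); apply/eqP; rewrite eq_le spsd andbT.
  by apply: le_trans (sC _) _; rewrite hz mulr0.
move: bz sz; rewrite (formBl sb) (formBl ssym) => /eqP; rewrite subr_eq0 => /eqP-> /eqP.
rewrite subr_eq0 => /eqP->; rewrite /p (form_suml sb) (form_suml ssym) mulr_sumr.
by apply: eq_bigr => i _; rewrite (formZl sb) (formZl ssym) base//; ring.
Qed.

Lemma scalar_on_line q lam B C (t1 t2 : R) : P B -> P C -> t1 != t2 ->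
  scalar_on q lam (t1 *: C + B) -> scalar_on q lam (t2 *: C + B) ->
  scalar_on q lam C /\ scalar_on q lam B.
Proof.
move=> PB PC t12 [m1 h1] [m2 h2].
have d0 : t1 - t2 != 0 by rewrite subr_eq0.
have hC e f : eigenvector s q lam e -> eigenvector s q lam f -> b C e f = (m1 - m2) / (t1 - t2) * s e f.
  move=> ee ef; have := h1 e f ee ef; have := h2 e f ee ef; rewrite !bcomb// => e2 e1.
  by apply: (mulfI d0); rewrite mulrA [_ * (_ / _)]mulrC divfK//; lra.
split; first by exists ((m1 - m2) / (t1 - t2)).
exists (m1 - t1 * ((m1 - m2) / (t1 - t2))) => e f ee ef.
have := h1 e f ee ef; rewrite bcomb// hC//; lra.
Qed.

(** Being scalar is an affine condition on lines, so it holds for at most one point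
    [t C + B] of a line whose direction is not scalar; among [size ls + 2] points
    one avoids all the eigenvalues. *)
Lemma avoiding_direction q (ls : seq R) : (forall lam, lam \in ls -> exists2 C, P C & ~ scalar_on q lam C) ->
  exists2 B, P B & forall lam, lam \in ls -> ~ scalar_on q lam B.
Proof.
elim: ls => [|lam ls IH] hls; first by exists 0.
have [|B PB hB] := IH; first by move=> l ll; apply: hls; rewrite inE ll orbT.
have [C PC nC] := hls lam (mem_head _ _).
have [nt|nt] := pselect (exists t : 'I_(size ls).+2, forall l, l \in lam :: ls -> ~ scalar_on q l ((t%:R : R) *: C + B)).
  by have [t ht] := nt; exists ((t%:R : R) *: C + B) => //; exact: Pcomb.
have /choice[g hg] : forall t : 'I_(size ls).+2, exists j : 'I_(size ls).+1,
    scalar_on q (nth 0 (lam :: ls) j) ((t%:R : R) *: C + B).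
  move=> t; apply: contrapT => hn; apply: nt; exists t => l ll sl; apply: hn.
  have jl : (index l (lam :: ls) < (size ls).+1)%N by rewrite -[X in (_ < X)%N]/(size (lam :: ls)) index_mem.
  by exists (Ordinal jl); rewrite nth_index.
have gi : injective g.
  move=> t1 t2 gt; apply/eqP; apply: contrapT => /negP t12.
  have t12R : (t1%:R : R) != t2%:R by rewrite eqr_nat.
  have s1 := hg t1; have s2 := hg t2; rewrite gt in s1.
  have [sC sB] := scalar_on_line PB PC t12R s1 s2.
  have : nth 0 (lam :: ls) (g t2) \in lam :: ls by apply: mem_nth.
  rewrite inE => /orP[/eqP le|ll]; first by apply: nC; rewrite -le.
  exact: hB ll sB.
by have := leq_card g gi; rewrite !card_ord ltnn.
Qed.

(** Eigenvectors for different eigenvalues are orthogonal, so [multiplicity_bound]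
    applies. *)
Lemma finitely_many_eigenvalues q N : adm q -> exists K, forall ls : seq R, uniq ls ->
  (forall lam, lam \in ls -> lam <= N /\ exists e, s e e = 1 /\ eigenvector s q lam e) -> (size ls <= K)%N.
Proof.
move=> aq; have [K hK] := multiplicity_bound ssym alpha0 scompact N.
exists K => ls uls hls.
have /choice[e he] : forall i : 'I_(size ls), exists e, s e e = 1 /\ eigenvector s q (nth 0 ls i) e.
  by move=> i; have [_] := hls _ (mem_nth 0 (ltn_ord i)).
have orth i j : i != j -> s (e i) (e j) = 0.
  move=> ij; have [_ ei] := he i; have [_ ej] := he j.
  have : (nth 0 ls i - nth 0 ls j) * s (e i) (e j) = 0.
    by rewrite mulrBl -ei [s (e i) _](formC ssym) -ej (formC (adm_sym aq)) subrr.
  move/eqP; rewrite mulf_eq0 subr_eq0 nth_uniq// => /orP[/eqP/val_inj ijE|/eqP//].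
  by rewrite ijE eqxx in ij.
apply: (hK q (size ls) e aq).
- move=> i j; have [->|ij] := eqVneq i j; first by have [] := he j.
  exact: orth.
- by move=> i j ij; have [_ ->] := he i; rewrite orth// mulr0.
- by move=> i; have [s1 ->] := he i; rewrite s1 mulr1; have [] := hls _ (mem_nth 0 (ltn_ord i)).
Qed.

(** Otherwise [persistent_scalar] makes every [B] scalar on the eigenspace of some
    eigenvalue below [N], whereas [avoiding_direction] produces a [B] which is
    scalar on none of these. *)
Lemma splitting_direction m N q : adm q -> ~ eigenfamily s m.+3 N q ->
  exists2 B, P B & forall tau, 0 < tau -> exists2 t, 0 < t /\ t <= tau &
     adm (perturb q (t *: B)) -> ~ eigenfamily s m.+2 N (perturb q (t *: B)).
Proof.
move=> aq nf; apply: contrapT => hn.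
have all B : P B -> exists lam, [/\ lam <= N,
    exists e : 'I_m.+2 -> V, orthonormal s e /\ forall i, eigenvector s q lam (e i) & scalar_on q lam B].
  move=> PB; apply: (persistent_scalar aq PB nf).
  have [tau /not_implyP[tau0 ht]] : exists tau, ~ (0 < tau -> exists2 t, 0 < t /\ t <= tau &
     adm (perturb q (t *: B)) -> ~ eigenfamily s m.+2 N (perturb q (t *: B))).
    by apply/existsNP => h'; apply: hn; exists B.
  exists tau => // t t0 tt; apply: contrapT => /not_andP hna; apply: ht; exists t => // aqt fqt.
  by case: hna.
have [K hK] := finitely_many_eigenvalues N aq.
pose good lam := lam <= N /\ exists e : 'I_m.+2 -> V, orthonormal s e /\ forall i, eigenvector s q lam (e i).
have nd lam : good lam -> exists2 C, P C & ~ scalar_on q lam C.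
  move=> [_ [e [oe ee]]]; pose j : 'I_m.+2 := lift ord0 ord0.
  have [||| C PC nC] := @nondegenerate (e ord0) (e j).
  - by rewrite oe.
  - by rewrite oe eqxx.
  - by rewrite oe eqxx.
  by exists C => // -[mu hmu]; apply: nC; rewrite !hmu// !oe !eqxx /= mulr0.
have many r : exists ls : seq R, [/\ size ls = r, uniq ls & forall lam, lam \in ls -> good lam].
  elim: r => [|r [ls [sl ul gl]]]; first by exists [::].
  have [B PB hB] := @avoiding_direction q ls (fun lam ll => nd lam (gl lam ll)).
  have [lam [lN le ls']] := all B PB.
  exists (lam :: ls); split => /=; first by rewrite sl.
    by rewrite ul andbT; apply/negP => ll; exact: hB ll ls'.
  by move=> l; rewrite inE => /orP[/eqP->|/gl].
have [ls [sl ul gl]] := many K.+1.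
have := hK ls ul; rewrite sl ltnn => hF.
suff : false by []. apply: hF => lam /gl[lN [e [oe ee]]]; split => //.
by exists (e ord0); rewrite oe eqxx.
Qed.

(** Minimise the largest multiplicity over the perturbations of size less than
    [delta]; a minimum above one is lowered by [splitting_direction]. *)
Lemma simple_dense N q delta : symform q -> 0 < delta -> (forall u, (alpha + delta) * h u u <= q u u) ->
  (exists C, forall u, q u u <= C * h u u) ->
  exists2 B, P B /\ small B delta & ~ eigenfamily s 2 N (perturb q B).
Proof.
move=> sq d0 ql qC.
pose Q p := exists B, P B /\ (exists2 d, d < delta & small B d) /\ ~ eigenfamily s p N (perturb q B).
have pa B d : P B -> d < delta -> small B d -> adm (perturb q B).
  by move=> PB dd sB; apply: (perturb_adm sq ql qC PB); exact: small_le sB (ltW dd).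
have [K hK] := no_large_family ssym alpha0 scompact N.
have QK : Q K.
  by exists 0; split => //; split; [exists 0|apply: hK; exact: (pa 0 0)].
have exQ : exists p, `[< Q p >] by exists K; exact/asboolP.
case: (ex_minnP exQ) => p /asboolP Qp minp.
have [B1 [PB1 [[d1 d1d sB1] nf1]]] := Qp.
have [p2|p2] := leqP p 2.
  exists B1; first by split => //; exact: small_le sB1 (ltW d1d).
  by move=> f2; apply: nf1; exact: eigenfamily_le f2.
case: p p2 Qp minp nf1 => [|[|[|m]]]// _ _ minp nf1.
have aq1 := pa B1 d1 PB1 d1d sB1.
have [C PC hC] := splitting_direction aq1 nf1.
have [M M0 sC] := small_ex PC.
have dd : 0 < delta - d1 by rewrite subr_gt0.
have tau0 : 0 < (delta - d1) / (2 * (M + 1)) by rewrite divr_gt0// mulr_gt0// ltr_wpDl.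
have [t [t0 tt] ht] := hC _ tau0.
have tM : t * M + d1 < delta.
  move: tt; rewrite ler_pdivlMr; last by rewrite mulr_gt0// ltr_wpDl.
  nra.
have sB2 : small (t *: C + B1) (t * M + d1) by have := small_comb t PC PB1 sC sB1; rewrite gtr0_norm.
have PB2 : P (t *: C + B1) by exact: Pcomb.
have E2 : perturb (perturb q B1) (t *: C) = perturb q (t *: C + B1).
  apply/funext => u; apply/funext => v; rewrite /perturb bcomb//.
  have -> : b (t *: C) u v = t * b C u v by have := bcomb t u v PC P0; rewrite addr0 b0 addr0.
  ring.
have Q2 : Q m.+2.
  exists (t *: C + B1); split => //; split; first by exists (t * M + d1).
  by move: ht; rewrite E2; apply; exact: pa sB2.
by have := minp m.+2; rewrite ltnn => /(_ (asboolT Q2)).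
Qed.

(** Baire's argument along an explicit sequence. The stage [k] adds [C k] of size at
    most [r k] to make the eigenvalues below [k] simple, and then chooses the radius
    [r k.+1] so that simplicity survives in the ball of radius [2 r k.+1], which
    contains all the later stages and their limit. *)
Theorem generic_simplicity q0 delta : symform q0 -> 0 < delta ->
  (forall u, (alpha + delta) * h u u <= q0 u u) -> (exists C, forall u, q0 u u <= C * h u u) ->
  exists (C : nat -> W) (r : nat -> R),
  [/\ forall k, [/\ P (C k), small (C k) (r k) & 0 < r k], forall k, r k.+1 <= r k / 2, r 0%N <= delta &
    forall q', adm q' -> (forall K, within h (perturb q0 (\sum_(k < K) C k)) q' (2 * r K)) ->
      forall N : nat, ~ eigenfamily s 2 N%:R q'].
Proof.
move=> sq d0 ql [Cq qC].
pose valid (z : W * R) := [/\ P z.1, 0 < z.2 & exists2 sig, small z.1 sig & sig + 2 * z.2 <= delta].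
have /choice[f hf] : forall x : nat * (W * R), exists y : W * R, valid x.2 ->
    [/\ P y.1, small y.1 x.2.2, 0 < y.2, y.2 <= x.2.2 / 2 &
      forall q', adm q' -> within h (perturb q0 (x.2.1 + y.1)) q' (2 * y.2) -> ~ eigenfamily s 2 x.1%:R q'].
  move=> [N [B rho]] /=; have [vz|nv] := pselect (valid (B, rho)); last by exists (0, 0).
  have [/= PB rho0 [sig sB sd]] := vz.
  have sq1 : symform (perturb q0 B) by exact: perturb_sym.
  have ql1 u : (alpha + rho) * h u u <= perturb q0 B u u.
    have := ql u; have := small_bound u PB sB; rewrite /perturb ler_norml => /andP[x1 _] x2.
    have := mulr_ge0 (_ : 0 <= delta - sig - rho) (hpsd u); rewrite -[(_ <= _ * h u u)]/(_) => x3.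
    have {}x3 : 0 <= (delta - sig - rho) * h u u by apply: x3; lra.
    by move: x1 x2 x3; lra.
  have qC1 : exists C, forall u, perturb q0 B u u <= C * h u u.
    exists (Cq + sig) => u; have := qC u; have := small_bound u PB sB.
    by rewrite /perturb ler_norml => /andP[]; lra.
  have [C [PC sC] nfC] := simple_dense N%:R sq1 rho0 ql1 qC1.
  have E : perturb (perturb q0 B) C = perturb q0 (B + C).
    apply/funext => u; apply/funext => v; rewrite /perturb -[B in RHS]scale1r bcomb// mul1r.
    by rewrite addrA.
  have aBC := perturb_adm sq1 ql1 qC1 PC sC; rewrite E in aBC nfC.
  have [rho1 rho10 hrho1] := no_family_open hsym hpsd ssym spsd alpha0 hcomplete scompact aBC nfC.
  exists (C, Num.min (rho / 2) (rho1 / 2)) => _; split => //=.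
  - by rewrite lt_min !divr_gt0.
  - by rewrite ge_min lexx.
  move=> q' aq' wq'; apply: hrho1 => // u; apply: le_trans (wq' u) _; rewrite ler_wpM2r//.
  have : Num.min (rho / 2) (rho1 / 2) <= rho1 / 2 by rewrite ge_min lexx orbT.
  lra.
(* A stage is the sum of the corrections made so far and the radius still available. *)
pose st := fix st k : W * R := if k is j.+1 then ((st j).1 + (f (j, st j)).1, (f (j, st j)).2) else (0, delta / 2).
have vst k : valid (st k).
  elim: k => [|k [Pk rk [sig sk sd]]].
    by split => //=; [exact: divr_gt0|exists 0 => //; lra].
  have [y1 y2 y3 y4 _] := hf (k, st k) (And3 Pk rk (ex_intro2 _ _ sig sk sd)).
  split => //=; first by rewrite -[(st k).1]scale1r; exact: Pcomb.
  exists (sig + (st k).2); last by move: y4 => /=; lra.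
  by rewrite -[(st k).1]scale1r; have := small_comb 1 Pk y1 sk y2; rewrite normr1 mul1r.
have stS K : (st K).1 = \sum_(k < K) (f (nat_of_ord k, st k)).1.
  by elim: K => [|K IH]; [rewrite big_ord0|rewrite big_ord_recr/= -IH].
exists (fun k => (f (k, st k)).1), (fun k => (st k).2); split.
- by move=> k; have [y1 y2 _ _ _] := hf (k, st k) (vst k); have [_ rk _] := vst k.
- by move=> k; have [_ _ _ y4 _] := hf (k, st k) (vst k).
- by rewrite /=; lra.
- move=> q' aq' wq' N; have [_ _ _ _ hN] := hf (N, st N) (vst N).
  apply: hN => //; have := wq' N.+1; by rewrite -stS.
Qed.

End Perturbation.

(** * The space H^1 *)

(** The geometric hypotheses on [Omega] are bundled, so that the space H^1 can be a
    type depending on one argument. *)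
Record domain (R : realType) (n : nat) := Domain {
  dset :> set 'rV[R]_n.+1;
  dom_open : open dset;
  dom_bounded : bounded_set dset;
  dom_connected : connected dset;
  dom_C11 : C11_boundary dset }.

Section AbstractL2.
Context (R : realType) d (T : measurableType d) (mu : {measure set T -> \bar R}) (D : set T).
Hypothesis mD : measurable D.
Local Notation L2 := (square_integrable mu D).
Local Notation ip := (ip mu D).

Lemma L2_0 : L2 (fun=> 0).
Proof.
split; first exact: measurable_cst.
by rewrite (_ : (fun x => _) = cst 0%E); [exact: integrable0|apply/funext => x; rewrite expr0n].
Qed.

(** The discriminant criterion, stated so as to include the degenerate case [a = 0]. *)
Lemma quadratic_disc (a b c : R) : 0 <= a -> (forall t : R, 0 <= t ^+ 2 * a + 2 * t * b + c) -> b ^+ 2 <= a * c.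
Proof.
rewrite le_eqVlt => /orP[/eqP a0|a0] h; last first.
  have := h (- b / a); have an : a != 0 by rewrite gt_eqF.
  have -> : (- b / a) ^+ 2 * a + 2 * (- b / a) * b + c = (a * c - b ^+ 2) / a by field.
  by rewrite pmulr_lge0 ?invr_gt0// subr_ge0.
rewrite -a0 mul0r; have [->|b0] := eqVneq b 0; first by rewrite expr0n.
have := h (- (c + 1) / (2 * b)); rewrite -a0 mulr0 add0r.
have -> : 2 * (- (c + 1) / (2 * b)) * b = - (c + 1) by field.
lra.
Qed.

Lemma ip_CS f g : L2 f -> L2 g -> ip f g ^+ 2 <= ip f f * ip g g.
Proof.
move=> hf hg; apply: quadratic_disc => [|t]; first exact: ip_ge0.
have hc := L2_comb mD t 1 hf hg.
have := ip_ge0 mu D (fun x => t * f x + 1 * g x).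
rewrite (ip_comb mD) // [ip f _]ipC [ip g _]ipC !(ip_comb mD) // [ip g f]ipC; lra.
Qed.

Lemma ip_cvg (f : nat -> T -> R) g u : (forall k, L2 (f k)) -> L2 g -> L2 u ->
  ip (fun x => f k x - g x) (fun x => f k x - g x) @[k --> \oo] --> (0 : R) ->
  ip (f k) u @[k --> \oo] --> ip g u.
Proof.
move=> hf hg hu h0.
have : ip (fun x => f k x - g x) u @[k --> \oo] --> (0 : R).
  apply: cvg_sqr0; apply: (@squeeze0 _ _ (fun k => ip (fun x => f k x - g x) (fun x => f k x - g x) * ip u u)).
    by move=> k; rewrite sqr_ge0 ip_CS//; exact: L2_sub.
  by rewrite -[X in _ --> X](mul0r (ip u u)); apply: cvgM => //; exact: cvg_cst.
move=> hd; rewrite (_ : (fun k => _) = fun k => ip (fun x => f k x - g x) u + ip g u).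
  by rewrite -[X in _ --> X]add0r; apply: cvgD => //; exact: cvg_cst.
apply/funext => k; rewrite -[ip _ u + _]mul1r mulrDr -(ip_comb mD)//; last exact: L2_sub.
by rewrite (_ : (fun x => _ + _) = f k)//; apply/funext => x; ring.
Qed.

End AbstractL2.

Section H1Space.
Context (R : realType) (n : nat) (D : domain R n).
Local Notation E := 'rV[R]_n.+1.
Local Notation L := (lebesgue R n).
Local Notation Lm := (lebesgue_space R n).
Local Notation L2 := (square_integrable L D).

Lemma dom_measurable : measurable (D : set Lm).
Proof. by apply: lebesgue_open; exact: dom_open. Qed.

Lemma dom_lty : (L D < +oo)%E.
Proof. by apply: lebesgue_bounded_lty; exact: dom_bounded. Qed.

Lemma L2_continuous (f : E -> R) : continuous f -> L2 f.
Proof.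
move=> cf; have [M hM] := continuous_bounded_on (dom_bounded D) cf.
exact: (L2_bounded dom_measurable dom_lty (lebesgue_continuous cf) hM).
Qed.

Lemma L2_test phi i : test_function D phi -> L2 phi /\ L2 (partial i phi).
Proof.
move=> [sp _]; split; apply: L2_continuous; first exact: smooth_continuous.
exact: smooth_partial_continuous.
Qed.

Lemma weak_partial_ip u i v : is_weak_partial D u i v <->
  forall phi, test_function D phi -> ip L D u (partial i phi) = - ip L D v phi.
Proof. by []. Qed.

Lemma weak_partial_comb u u' i v v' (a : R) : L2 u -> L2 u' -> L2 v -> L2 v' ->
  is_weak_partial D u i v -> is_weak_partial D u' i v' ->
  is_weak_partial D (fun x => a * u x + 1 * u' x) i (fun x => a * v x + 1 * v' x).
Proof.
move=> hu hu' hv hv' wv wv'; apply/weak_partial_ip => phi tp.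
have [t1 t2] := L2_test i tp; have mD := dom_measurable.
rewrite (ip_comb mD)// (ip_comb mD)//.
rewrite (proj1 (weak_partial_ip u i v) wv phi tp) (proj1 (weak_partial_ip u' i v') wv' phi tp); ring.
Qed.

(** The difference of two weak derivatives is orthogonal to all test functions. *)
Lemma weak_partial_unique (u : E -> R) i (v v' : E -> R) : L2 v -> L2 v' -> is_weak_partial D u i v -> is_weak_partial D u i v' ->
  {ae L, forall x, dset D x -> v x = v' x}.
Proof.
move=> hv hv' wv wv'; have mD := dom_measurable.
suff : {ae L, forall x, dset D x -> 1 * v x + (-1) * v' x = 0}.
  by apply: (@ae_imp R _ Lm L) => x h Dx; have := h Dx; lra.
have fi := L2_integrable mD dom_lty (L2_comb mD 1 (-1) hv hv').
have fl := @null_of_test_integrals R n (dset D) (fun x : E => 1 * v x + -1 * v' x) (@dom_open _ _ D) fi.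
apply fl => phi _ tp; have [t1 t2] := L2_test i tp.
have := ip_comb mD 1 (-1) hv hv' t1; rewrite /ip => ->.
have := wv _ tp; have := wv' _ tp; rewrite -/(ip L D v phi) -/(ip L D v' phi) => -> /oppr_inj->; ring.
Qed.

Lemma weak_partialP u i : H1 D u -> L2 (weak_partial D u i) /\ is_weak_partial D u i (weak_partial D u i).
Proof.
move=> [_ /(_ i)[v hv]].
exact: (@xgetPex _ (fun=> 0) [set v | L2 v /\ is_weak_partial D u i v] (ex_intro _ v hv)).
Qed.

Lemma H1_comb (a : R) u v : H1 D u -> H1 D v -> H1 D (fun x => a * u x + 1 * v x).
Proof.
move=> hu hv; have mD := dom_measurable; split.
  by apply: (L2_comb mD); [case: hu|case: hv].
move=> i; have [u1 u2] := weak_partialP i hu; have [v1 v2] := weak_partialP i hv.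
exists (fun x => a * weak_partial D u i x + 1 * weak_partial D v i x); split; first exact: L2_comb.
by apply: weak_partial_comb => //; [case: hu|case: hv].
Qed.

Lemma H1_zero : H1 D (fun=> 0).
Proof.
split; first exact: L2_0.
move=> i; exists (fun=> 0); split; first exact: L2_0.
move=> phi _; rewrite /Rintegral !integral0_eq ?oppr0//= => x _; by rewrite mul0r.
Qed.

Definition H1_pred : {pred E -> R} := fun u => `[< H1 D u >].

Lemma H1_submod : submod_closed H1_pred.
Proof.
split; first by apply/asboolP; exact: H1_zero.
move=> a u v /asboolP hu /asboolP hv; apply/asboolP.
have := H1_comb a hu hv; congr (H1 _ _); apply/funext => x.
by rewrite mul1r.
Qed.

HB.instance Definition _ := GRing.isSubmodClosed.Build R (E -> R) H1_pred H1_submod.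

(** H^1 as a module of functions rather than of classes: functions equal almost
    everywhere remain distinct, which is why all statements below speak of
    semidefinite forms. *)
Record H1space := H1Space { h1val :> E -> R; h1P : h1val \in H1_pred }.
HB.instance Definition _ := [isSub for h1val].
HB.instance Definition _ := [Choice of H1space by <:].
HB.instance Definition _ := [SubChoice_isSubLmodule of H1space by <:].

Local Notation V := H1space.
Implicit Types u v w : V.

Definition wd u i : E -> R := weak_partial D u i.

Lemma H1val u : H1 D u. Proof. exact/asboolP/h1P. Qed.

Lemma h1_L2 u : L2 u. Proof. by case: (H1val u). Qed.

Lemma wd_L2 u i : L2 (wd u i). Proof. by case: (weak_partialP i (H1val u)). Qed.

Lemma h1_lin (a : R) u v : h1val (a *: u + v) = fun x => a * h1val u x + h1val v x.
Proof. by []. Qed.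

Lemma wd_lin (a : R) u v i :
  {ae L, forall x, dset D x -> wd (a *: u + v) i x = a * wd u i x + 1 * wd v i x}.
Proof.
have [l1 w1] := weak_partialP i (H1val (a *: u + v)).
have [lu wu] := weak_partialP i (H1val u); have [lv wv] := weak_partialP i (H1val v).
have w2 := weak_partial_comb a (h1_L2 u) (h1_L2 v) lu lv wu wv.
have l2 := L2_comb dom_measurable a 1 lu lv.
apply: (weak_partial_unique l1 l2 w1).
by rewrite h1_lin; move: w2; congr (is_weak_partial _ _ _ _); apply/funext => x; rewrite mul1r.
Qed.

Lemma wd_ip_lin (a : R) u v i g : L2 g ->
  ip L D (wd (a *: u + v) i) g = a * ip L D (wd u i) g + ip L D (wd v i) g.
Proof.
move=> hg; have mD := dom_measurable.
rewrite (ip_ae mD (wd_L2 _ _) (L2_comb mD a 1 (wd_L2 u i) (wd_L2 v i)) hg (wd_lin a u v i)).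
by rewrite (ip_comb mD)// ?mul1r//; exact: wd_L2.
Qed.

Definition mass u v := ip L D u v.
Definition dirichlet u v := \sum_(i < n.+1) ip L D (wd u i) (wd v i).
Definition h1form u v := mass u v + dirichlet u v.

Lemma massB u v : mass (u - v) (u - v) = ip L D (fun x => h1val u x - h1val v x) (fun x => h1val u x - h1val v x).
Proof. by []. Qed.

Lemma mass_sym : symform mass.
Proof.
split=> [u v|a u v w]; first exact: ipC.
rewrite /mass h1_lin (_ : (fun x => _) = fun x => a * u x + 1 * v x).
  by rewrite (ip_comb dom_measurable)// ?mul1r//; exact: h1_L2.
by apply/funext => x; rewrite mul1r.
Qed.

Lemma dirichlet_sym : symform dirichlet.
Proof.
split=> [u v|a u v w]; first by apply: eq_bigr => i _; exact: ipC.
rewrite /dirichlet mulr_sumr -big_split/=; apply: eq_bigr => i _.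
by rewrite wd_ip_lin//; exact: wd_L2.
Qed.

Lemma sum_form_sym (b c : V -> V -> R) : symform b -> symform c -> symform (fun u v => b u v + c u v).
Proof.
move=> sb sc; split=> [u v|a u v w]; first by rewrite (formC sb) (formC sc).
by rewrite (formDl sb) (formDl sc) (formZl sb) (formZl sc); ring.
Qed.

Lemma h1form_sym : symform h1form.
Proof. exact: sum_form_sym mass_sym dirichlet_sym. Qed.

Lemma mass_psd : psd mass. Proof. by move=> u; exact: ip_ge0. Qed.

Lemma dirichlet_psd : psd dirichlet.
Proof. by move=> u; apply: sumr_ge0 => i _; exact: ip_ge0. Qed.

Lemma h1form_psd : psd h1form.
Proof. by move=> u; apply: addr_ge0; [exact: mass_psd|exact: dirichlet_psd]. Qed.

Lemma wd_sub u v i : {ae L, forall x, dset D x -> wd (u - v) i x = wd u i x - wd v i x}.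
Proof.
have := wd_lin (-1) v u i; rewrite scaleN1r addrC; apply: (@ae_imp R _ Lm L) => x h Dx.
by rewrite h//; ring.
Qed.

Lemma ip_wd_sub u v i : ip L D (wd (u - v) i) (wd (u - v) i) =
  ip L D (fun x => wd u i x - wd v i x) (fun x => wd u i x - wd v i x).
Proof.
have mD := dom_measurable; have ls := L2_sub mD (wd_L2 u i) (wd_L2 v i).
rewrite (ip_ae mD (wd_L2 _ _) ls (wd_L2 _ _) (wd_sub u v i)) ipC.
by rewrite (ip_ae mD (wd_L2 _ _) ls ls (wd_sub u v i)).
Qed.

Lemma sum_cvg0 (J : finType) (F : J -> nat -> R) : (forall i, F i k @[k --> \oo] --> (0 : R)) ->
  \sum_i F i k @[k --> \oo] --> (0 : R).
Proof.
move=> hF; elim: (index_enum J) => [|i l IH].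
  by rewrite (_ : (fun k => _) = fun=> 0); [exact: cvg_cst|apply/funext => k; rewrite big_nil].
rewrite (_ : (fun k => _) = fun k => F i k + \sum_(i <- l) F i k); last first.
  by apply/funext => k; rewrite big_cons.
by rewrite -[X in _ --> X]addr0; apply: cvgD.
Qed.

Lemma small_cvg0 (x : nat -> R) : (forall eps : R, 0 < eps -> exists N, forall i, (N <= i)%N -> x i <= eps) ->
  (forall i, 0 <= x i) -> x k @[k --> \oo] --> (0 : R).
Proof.
move=> hx x0; apply/cvgrPdist_le => e e0; have [N hN] := hx e e0.
by exists N => // i /= Ni; rewrite sub0r normrN ger0_norm//; exact: hN.
Qed.

Lemma weak_partial_limit (u : nat -> E -> R) (v : nat -> E -> R) (u' v' : E -> R) i :
  (forall k, L2 (u k)) -> (forall k, L2 (v k)) -> L2 u' -> L2 v' ->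
  (forall k, is_weak_partial D (u k) i (v k)) ->
  ip L D (fun x => u k x - u' x) (fun x => u k x - u' x) @[k --> \oo] --> (0 : R) ->
  ip L D (fun x => v k x - v' x) (fun x => v k x - v' x) @[k --> \oo] --> (0 : R) ->
  is_weak_partial D u' i v'.
Proof.
move=> lu lv lu' lv' w cu cv; apply/weak_partial_ip => phi tp; have [t1 t2] := L2_test i tp.
have mD := dom_measurable.
have c1 := ip_cvg mD lu lu' t2 cu; have c2 := ip_cvg mD lv lv' t1 cv.
apply: (lim_near_eq c1 (cvgN c2)); apply: nearW => k.
by have := w k phi tp.
Qed.

(** The functions and their weak derivatives converge in L^2 by [riesz_fischer], and
    the relation between them passes to the limit. *)
Lemma h1form_complete : complete_form h1form.
Proof.
move=> x hx; have mD := dom_measurable.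
have m_le u : mass u u <= h1form u u by rewrite lerDl dirichlet_psd.
have d_le u i : ip L D (wd u i) (wd u i) <= h1form u u.
  apply: (@le_trans _ _ (dirichlet u u)); last by rewrite lerDr mass_psd.
  by rewrite /dirichlet (bigD1 i)//= lerDl; apply: sumr_ge0 => j _; exact: ip_ge0.
have [u' lu' hu'] : exists2 u' : E -> R, L2 u' & forall eps : R, 0 < eps -> exists N, forall i, (N <= i)%N ->
    ip L D (fun y => h1val (x i) y - u' y) (fun y => h1val (x i) y - u' y) <= eps.
  apply: (@riesz_fischer R _ Lm L D mD (fun k => h1val (x k))) => [k|eps e0]; first exact: h1_L2.
  have [N hN] := hx eps e0; exists N => i j Ni Nj; rewrite -massB.
  exact: le_trans (m_le _) (hN i j Ni Nj).
have /choice[v' hv'] : forall i, exists v' : E -> R, L2 v' /\ forall eps : R, 0 < eps -> exists N, forall k, (N <= k)%N ->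
    ip L D (fun y => wd (x k) i y - v' y) (fun y => wd (x k) i y - v' y) <= eps.
  move=> i; have [||g lg hg] := @riesz_fischer R _ Lm L D mD (fun k => wd (x k) i).
  - by move=> k; exact: wd_L2.
  - move=> eps e0; have [N hN] := hx eps e0; exists N => k j Nk Nj; rewrite -ip_wd_sub.
    exact: le_trans (d_le _ _) (hN k j Nk Nj).
  by exists g.
have lv' i : L2 (v' i) by have [] := hv' i.
have cu := small_cvg0 hu' (fun i => ip_ge0 _ _ _).
have cv i : ip L D (fun y => wd (x k) i y - v' i y) (fun y => wd (x k) i y - v' i y) @[k --> \oo] --> (0 : R).
  by apply: small_cvg0 => [|k]; [have [] := hv' i|exact: ip_ge0].
have wv i : is_weak_partial D u' i (v' i).
  apply: (@weak_partial_limit (fun k => h1val (x k)) (fun k => wd (x k) i)) => //.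
  - by move=> k; exact: h1_L2.
  - by move=> k; exact: wd_L2.
  - by move=> k; have [] := weak_partialP i (H1val (x k)).
have H1u : u' \in H1_pred by apply/asboolP; split => // i; exists (v' i).
pose y := H1Space H1u; exists y.
have yv i : {ae L, forall z, dset D z -> wd y i z = v' i z}.
  by apply: weak_partial_unique (wv i) => //; [exact: (wd_L2 y i)|have [] := weak_partialP i (H1val y)].
rewrite /hcvg /h1form -[X in _ --> X]addr0; apply: cvgD; first exact: cu.
apply: sum_cvg0 => i; rewrite (_ : (fun k => _) = fun k => ip L D (fun z => wd (x k) i z - v' i z) (fun z => wd (x k) i z - v' i z)).
  exact: cv.
apply/funext => k; rewrite ip_wd_sub.
have l1 := L2_sub mD (wd_L2 (x k) i) (wd_L2 y i); have l2 := L2_sub mD (wd_L2 (x k) i) (lv' i).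
have ae1 : {ae L, forall z, dset D z -> wd (x k) i z - wd y i z = wd (x k) i z - v' i z}.
  by apply: (@ae_imp R _ Lm L) (yv i) => z h Dz; rewrite h.
by rewrite (ip_ae mD l1 l2 l1 ae1) ipC (ip_ae mD l1 l2 l2 ae1).
Qed.

End H1Space.

(** * Energy forms *)

Section MoreL2.
Context (R : realType) d (T : measurableType d) (mu : {measure set T -> \bar R}) (D : set T).
Hypothesis mD : measurable D.
Local Notation L2 := (square_integrable mu D).
Local Notation ip := (ip mu D).

Lemma Rintegral_sum (J : Type) (r : seq J) (P : pred J) (F : J -> T -> R) :
  (forall j, mu.-integrable D (EFin \o F j)) ->
  \int[mu]_(x in D) (\sum_(j <- r | P j) F j x) = \sum_(j <- r | P j) \int[mu]_(x in D) F j x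
  /\ mu.-integrable D (EFin \o (fun x => \sum_(j <- r | P j) F j x)).
Proof.
move=> hF; elim: r => [|j r [IH1 IH2]].
  rewrite big_nil; under eq_Rintegral do rewrite big_nil.
  rewrite Rintegral_cst// mul0r; split => //.
  rewrite (_ : _ \o _ = cst 0%E); first exact: integrable0.
  by apply/funext => x; rewrite /= big_nil.
have E1 x : \sum_(j <- j :: r | P j) F j x = (if P j then F j x else 0) + \sum_(j <- r | P j) F j x.
  by rewrite big_cons; case: ifP => // _; rewrite add0r.
have i1 : mu.-integrable D (EFin \o (fun x => if P j then F j x else 0)).
  case: (P j); first exact: hF.
  by rewrite (_ : _ \o _ = cst 0%E); first exact: integrable0.
split.
  under eq_Rintegral do rewrite E1.
  rewrite RintegralD// IH1 big_cons; case: (P j) => //.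
  by rewrite Rintegral_cst// mul0r add0r.
rewrite (_ : _ \o _ = EFin \o (fun x => (if P j then F j x else 0) + \sum_(j <- r | P j) F j x)).
  have := integrableD mD i1 IH2; apply: eq_integrable => //.
by apply/funext => x /=; rewrite E1.
Qed.

Lemma ip_cvg_norm (f : nat -> T -> R) g : (forall k, L2 (f k)) -> L2 g ->
  ip (fun x => f k x - g x) (fun x => f k x - g x) @[k --> \oo] --> (0 : R) ->
  ip (f k) (f k) @[k --> \oo] --> ip g g.
Proof.
move=> hf hg h0; have c1 := ip_cvg mD hf hg hg h0.
have E k : ip (f k) (f k) = ip (fun x => f k x - g x) (fun x => f k x - g x) + 2 * ip (f k) g - ip g g.
  have := ip_comb mD 1 (-1) (hf k) hg (L2_sub mD (hf k) hg).
  have := ip_comb mD 1 (-1) (hf k) hg (hf k); have := ip_comb mD 1 (-1) (hf k) hg hg.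
  have -> : (fun x => 1 * f k x + -1 * g x) = fun x => f k x - g x by apply/funext => x; ring.
  have := ipC mu D (f k) (fun x => f k x - g x); have := ipC mu D g (fun x => f k x - g x).
  have := ipC mu D g (f k); lra.
rewrite (_ : (fun k => _) = fun k => ip (fun x => f k x - g x) (fun x => f k x - g x) + 2 * ip (f k) g - ip g g).
  rewrite [X in _ --> X](_ : _ = 0 + 2 * ip g g - ip g g); last by ring.
  apply: cvgB; last exact: cvg_cst.
  by apply: cvgD => //; apply: cvgM => //; exact: cvg_cst.
by apply/funext => k; exact: E.
Qed.

Lemma ip_cvg_EFin (f : nat -> T -> R) g : (forall k, L2 (f k)) -> L2 g ->
  (\int[mu]_(x in D) ((f k x - g x) ^+ 2)%:E)%E @[k --> \oo] --> 0%E ->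
  ip (fun x => f k x - g x) (fun x => f k x - g x) @[k --> \oo] --> (0 : R).
Proof.
move=> hf hg; rewrite (_ : (fun k => _) = fun k => (ip (fun x => f k x - g x) (fun x => f k x - g x))%:E).
  by move/fine_cvgP => [_].
by apply/funext => k; rewrite (ip_sqr_EFin mD)//; exact: L2_sub.
Qed.

End MoreL2.

Section QuadraticForms.
Context (R : realType) (n : nat) (D : domain R n).
Local Notation E := 'rV[R]_n.+1.
Local Notation L := (lebesgue R n).
Local Notation Lm := (lebesgue_space R n).
Local Notation L2 := (square_integrable L D).
Local Notation V := (H1space D).
Let mD := dom_measurable D.
Implicit Types (u v w : V) (M : E -> 'M[R]_n.+1).

(** The properties of a matrix by which its energy is a bounded symmetric form on
    H^1. *)
Record coefficient_field M : Prop := CoefficientField {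
  coef_measurable : forall i j, measurable_fun (dset D : set Lm) (fun x : Lm => M x i j);
  coef_bounded : exists c, forall i j x, dset D x -> `|M x i j| <= c;
  coef_symmetric : symmetric_on D M }.

Definition energy M u v : R := \int[L]_(x in D) (\sum_(i < n.+1) \sum_(j < n.+1)
  M x i j * wd u i x * wd v j x).

Lemma coef_L2 M v i j : coefficient_field M -> L2 (fun x => M x i j * wd v j x).
Proof.
by move=> [mM [c hc] _]; exact: (L2_weight mD (mM i j) (hc i j) (wd_L2 v j)).
Qed.

Lemma coef_integrable M u v i j : coefficient_field M ->
  L.-integrable D (EFin \o (fun x => M x i j * wd u i x * wd v j x)).
Proof.
move=> cM; have := L2_prod mD (wd_L2 u i) (coef_L2 v i j cM).
apply: eq_integrable => // x _ /=; by rewrite mulrCA mulrA.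
Qed.

Lemma energy_integrable M u v : coefficient_field M ->
  L.-integrable D (EFin \o (fun x => \sum_(i < n.+1) \sum_(j < n.+1) M x i j * wd u i x * wd v j x)).
Proof.
move=> cM; have [_] := @Rintegral_sum _ _ Lm L D mD _ (index_enum 'I_n.+1) xpredT
  (fun i x => \sum_(j < n.+1) M x i j * wd u i x * wd v j x)
  (fun i => (@Rintegral_sum _ _ Lm L D mD _ (index_enum 'I_n.+1) xpredT _
     (fun j => coef_integrable u v i j cM)).2).
exact.
Qed.

Lemma energyE M u v : coefficient_field M ->
  energy M u v = \sum_(i < n.+1) \sum_(j < n.+1) ip L D (wd u i) (fun x => M x i j * wd v j x).
Proof.
move=> cM; rewrite /energy.
have [-> _] := @Rintegral_sum _ _ Lm L D mD _ (index_enum 'I_n.+1) xpredT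
  (fun i x => \sum_(j < n.+1) M x i j * wd u i x * wd v j x)
  (fun i => (@Rintegral_sum _ _ Lm L D mD _ (index_enum 'I_n.+1) xpredT _
     (fun j => coef_integrable u v i j cM)).2).
apply: eq_bigr => i _.
have [-> _] := @Rintegral_sum _ _ Lm L D mD _ (index_enum 'I_n.+1) xpredT _ (fun j => coef_integrable u v i j cM).
by apply: eq_bigr => j _; apply: eq_Rintegral => x _; rewrite [RHS]mulrCA mulrA.
Qed.

Lemma energy_sym M : coefficient_field M -> symform (energy M).
Proof.
move=> cM; split=> [u v|a u v w].
  apply: eq_Rintegral => x /set_mem Dx; rewrite exchange_big/=.
  apply: eq_bigr => i _; apply: eq_bigr => j _.
  have := coef_symmetric cM Dx; move/matrixP => /(_ i j); rewrite mxE => ->; exact: mulrAC.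
rewrite !energyE// mulr_sumr -big_split/=; apply: eq_bigr => i _.
rewrite mulr_sumr -big_split/=; apply: eq_bigr => j _.
exact: (wd_ip_lin a u v i (coef_L2 w i j cM)).
Qed.

Lemma dirichletE u : dirichlet u u = \int[L]_(x in D) (\sum_(i < n.+1) wd u i x ^+ 2) /\
  L.-integrable D (EFin \o (fun x => \sum_(i < n.+1) wd u i x ^+ 2)).
Proof.
have ii i : L.-integrable D (EFin \o (fun x => wd u i x ^+ 2)) by have [_] := wd_L2 u i.
have [-> i2] := @Rintegral_sum _ _ Lm L D mD _ (index_enum 'I_n.+1) xpredT _ ii.
by split.
Qed.

Lemma quadratic_abs_le (m : nat) (A : 'M[R]_m) (p : 'I_m -> R) (c : R) : (forall i j, `|A i j| <= c) ->
  `|\sum_i \sum_j A i j * p i * p j| <= c * m%:R * \sum_i p i ^+ 2.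
Proof.
move=> hA; apply: le_trans (ler_norm_sum _ _ _) _.
apply: (@le_trans _ _ (\sum_(i < m) \sum_(j < m) (c / 2 * p i ^+ 2 + c / 2 * p j ^+ 2))).
  apply: ler_sum => i _; apply: le_trans (ler_norm_sum _ _ _) _; apply: ler_sum => j _.
  rewrite -mulrA normrM; have c0 : 0 <= c := le_trans (normr_ge0 _) (hA i j).
  apply: le_trans (ler_wpM2r (normr_ge0 _) (hA i j)) _.
  rewrite -mulrDr -[c / 2 * _]mulrA ler_wpM2l// normrM.
  have := sqr_ge0 (`|p i| - `|p j|); rewrite -[p i ^+ 2]real_normK ?num_real// -[p j ^+ 2]real_normK ?num_real//.
  nra.
under eq_bigr do rewrite big_split/= sumr_const card_ord -mulr_sumr.
rewrite big_split/= sumrMnl sumr_const card_ord -mulr_sumr.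
by set S := \sum_i _; rewrite -mulrnDl -[leLHS]mulr_natr le_eqVlt; apply/orP; left; apply/eqP; field.
Qed.

Lemma energy_bound M u (c : R) : coefficient_field M -> (forall i j x, dset D x -> `|M x i j| <= c) ->
  `|energy M u u| <= c * n.+1%:R * dirichlet u u.
Proof.
move=> cM hc; have [dE di] := dirichletE u; have ei := energy_integrable u u cM.
rewrite dE -(RintegralZl _ mD di); apply: le_trans (le_normr_Rintegral mD ei) _.
apply: le_Rintegral => //.
- exact: (integrable_abse ei).
- exact: (integrableZl mD _ di).
- by move=> x Dx; apply: quadratic_abs_le => i j; exact: hc.
Qed.

Lemma energy_low M u (c : R) : coefficient_field M ->
  (forall x (xi : 'rV[R]_n.+1), dset D x ->
    c * enorm xi ^+ 2 <= \sum_(i < n.+1) \sum_(j < n.+1) M x i j * xi 0 i * xi 0 j) ->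
  c * dirichlet u u <= energy M u u.
Proof.
move=> cM hc; have [dE di] := dirichletE u; have ei := energy_integrable u u cM.
rewrite dE -(RintegralZl _ mD di); apply: le_Rintegral => //.
  exact: (integrableZl mD _ di).
move=> x Dx; have := hc x (\row_i wd u i x) Dx; rewrite enorm_sqr.
under eq_bigr do rewrite mxE.
by move/le_trans; apply; rewrite le_eqVlt; apply/orP; left; apply/eqP;
   apply: eq_bigr => i _; apply: eq_bigr => j _; rewrite !mxE.
Qed.

Lemma energy_comb (a : R) M N u v : coefficient_field M -> coefficient_field N ->
  energy (fun x => a *: M x + N x) u v = a * energy M u v + energy N u v.
Proof.
move=> cM cN; have i1 := energy_integrable u v cM; have i2 := energy_integrable u v cN.
rewrite /energy -(RintegralZl a mD i1) -RintegralD//; last exact: (integrableZl mD a i1).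
apply: eq_Rintegral => x _; rewrite mulr_sumr -big_split/=; apply: eq_bigr => i _.
by rewrite mulr_sumr -big_split/=; apply: eq_bigr => j _; rewrite !mxE !mulrDl !mulrA.
Qed.

End QuadraticForms.

(** * Traces *)

Section ValueForms.
Context (R : realType) d (T : measurableType d) (mu : {measure set T -> \bar R}) (A : set T).
Hypothesis mA : measurable A.
Local Notation L2 := (square_integrable mu A).
Local Notation ip := (ip mu A).

Lemma ip_comb_sqr_le (f g : T -> R) (a : R) : L2 f -> L2 g ->
  ip (fun x => a * f x + 1 * g x) (fun x => a * f x + 1 * g x) <=
    2 * (a ^+ 2 * ip f f + ip g g).
Proof.
move=> hf hg.
have s1 := L2_comb mA a 1 hf hg; have s2 := L2_comb mA a (-1) hf hg.
have := ip_ge0 mu A (fun x => a * f x + (-1) * g x).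
have E (c : R) (s : L2 (fun x => a * f x + c * g x)) :
    ip (fun x => a * f x + c * g x) (fun x => a * f x + c * g x) =
    a ^+ 2 * ip f f + 2 * a * c * ip f g + c ^+ 2 * ip g g.
  rewrite (ip_comb mA a c hf hg s) (ipC _ _ f) (ipC _ _ g) (ip_comb mA a c hf hg hf) (ip_comb mA a c hf hg hg).
  by rewrite (ipC _ _ g f); ring.
rewrite !E//; lra.
Qed.

Lemma ip_comb_cvg0 (f f' : nat -> T -> R) (g g' : T -> R) (a : R) :
  (forall k, L2 (f k)) -> (forall k, L2 (f' k)) ->
  L2 g -> L2 g' ->
  ip (fun x => f k x - g x) (fun x => f k x - g x) @[k --> \oo] --> (0 : R) ->
  ip (fun x => f' k x - g' x) (fun x => f' k x - g' x) @[k --> \oo] --> (0 : R) ->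
  ip (fun x => (a * f k x + 1 * f' k x) - (a * g x + 1 * g' x))
          (fun x => (a * f k x + 1 * f' k x) - (a * g x + 1 * g' x)) @[k --> \oo] --> (0 : R).
Proof.
move=> hf hf' hg hg' c1 c2.
have ld k := L2_sub mA (hf k) hg; have ld' k := L2_sub mA (hf' k) hg'.
set F := fun k x => f k x - g x in c1 ld *; set F' := fun k x => f' k x - g' x in c2 ld' *.
have E k : (fun x => (a * f k x + 1 * f' k x) - (a * g x + 1 * g' x)) = fun x => a * F k x + 1 * F' k x.
  by apply/funext => x; rewrite /F /F' !mulrBr opprD addrACA.
rewrite (_ : (fun k => _) = fun k => ip (fun x => a * F k x + 1 * F' k x) (fun x => a * F k x + 1 * F' k x)).
  apply: (@squeeze0 _ _ (fun k => 2 * (a ^+ 2 * ip (F k) (F k) + ip (F' k) (F' k)))).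
    move=> k; rewrite ip_ge0/=.
    exact: (ip_comb_sqr_le a (ld k) (ld' k)).
  rewrite [X in _ --> X](_ : _ = 2 * (a ^+ 2 * 0 + 0)); last by ring.
  by apply: cvgM; [exact: cvg_cst|apply: cvgD => //; apply: cvgM => //; exact: cvg_cst].
by apply/funext => k; rewrite E.
Qed.

Lemma ip_cvg_EFinr (f : nat -> T -> R) g : (forall k, L2 (f k)) -> L2 g ->
  ip (fun x => f k x - g x) (fun x => f k x - g x) @[k --> \oo] --> (0 : R) ->
  (\int[mu]_(x in A) ((f k x - g x) ^+ 2)%:E)%E @[k --> \oo] --> 0%E.
Proof.
move=> hf hg h; rewrite (_ : (fun k => _) = fun k => (ip (fun x => f k x - g x) (fun x => f k x - g x))%:E).
  by apply/fine_cvgP; split => //; exact: nearW.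
by apply/funext => k; rewrite (ip_sqr_EFin mA)//; exact: L2_sub.
Qed.

Lemma indic_ip (q : set T) (f : T -> R) : measurable q -> q `<=` A ->
  \int[mu]_(x in q) f x = ip f (\1_q).
Proof.
move=> mq qA; rewrite -[in LHS](setIidr qA) Rintegral_mkcondr; apply: eq_Rintegral => x _.
by rewrite patchE indicE; case: (x \in q); rewrite ?mulr1 ?mulr0.
Qed.

Lemma L2_indic (q : set T) (f : T -> R) : measurable q -> L2 f -> L2 (fun x => \1_q x * f x).
Proof.
move=> mq; apply: (@L2_weight _ _ _ _ _ mA _ _ 1) => [|x _]; first exact: measurable_indic.
by rewrite indicE ger0_norm ?ler0n// lern1; case: (_ \in _).
Qed.

Variables (V : lmodType R) (tr : V -> T -> R).
Hypothesis tr_L2 : forall u, L2 (tr u).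
Hypothesis tr_lin : forall a u v, {ae mu, forall x, A x -> tr (a *: u + v) x = a * tr u x + 1 * tr v x}.

Lemma value_ip_lin (a : R) u v g : L2 g -> ip (tr (a *: u + v)) g = a * ip (tr u) g + ip (tr v) g.
Proof.
move=> hg.
rewrite (ip_ae mA (tr_L2 _) (L2_comb mA a 1 (tr_L2 u) (tr_L2 v)) hg (tr_lin a u v)).
by rewrite (ip_comb mA a 1 (tr_L2 u) (tr_L2 v) hg) mul1r.
Qed.

Lemma value_form_sym : symform (fun u v => ip (tr u) (tr v)).
Proof. by split=> [u v|a u v w]; [exact: ipC|exact: value_ip_lin]. Qed.

Variable (S : set T).
Hypothesis mS : measurable S.

Definition indic_form u v := \int[mu]_(x in A) (\1_S x * tr u x * tr v x).

Lemma indic_formE u v : indic_form u v = ip (tr u) (fun x => \1_S x * tr v x).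
Proof. by apply: eq_Rintegral => x _; rewrite mulrAC mulrC. Qed.

Lemma indic_form_sym : symform indic_form.
Proof.
split=> [u v|a u v w]; first by apply: eq_Rintegral => x _; rewrite mulrAC.
by rewrite !indic_formE value_ip_lin//; exact: L2_indic.
Qed.

Lemma indic_form_sqr u : indic_form u u = ip (fun x => \1_S x * tr u x) (fun x => \1_S x * tr u x).
Proof.
by apply: eq_Rintegral => x _; rewrite indicE; case: (_ \in _); rewrite ?mul1r// !mul0r.
Qed.

Lemma indic_form_psd : psd indic_form.
Proof. by move=> u; rewrite indic_form_sqr; exact: ip_ge0. Qed.

Lemma indic_form_le u : indic_form u u <= ip (tr u) (tr u).
Proof.
have li := L2_indic mS (tr_L2 u).
rewrite indic_form_sqr -lee_fin -(ip_sqr_EFin mA li) -(ip_sqr_EFin mA (tr_L2 u)).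
apply: ge0_le_integral => //.
- by move=> x _; rewrite lee_fin sqr_ge0.
- by apply/measurable_EFinP/measurable_funX; have [] := li.
- by apply/measurable_EFinP/measurable_funX; have [] := tr_L2 u.
- by move=> x _; rewrite lee_fin indicE; case: (_ \in _); rewrite ?mul1r// mul0r expr0n sqr_ge0.
Qed.

End ValueForms.

Section Traces.
Context (R : realType) (n : nat) (D : domain R n).
Local Notation E := 'rV[R]_n.+1.
Local Notation L := (lebesgue R n).
Local Notation Lm := (lebesgue_space R n).
Local Notation sg := (surface R n).
Local Notation Sm := (surface_space R n).
Local Notation Bd := (boundary (dset D)).
Local Notation V := (H1space D).
Let mD := dom_measurable D.
Implicit Types (u v w : V).

Lemma boundary_measurable : measurable (Bd : set Sm).
Proof.
apply: surface_closed; apply: compact_closed; first exact: norm_hausdorff.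
exact: (boundary_compact (dom_bounded D)).
Qed.
Let mB := boundary_measurable.

Lemma boundary_lty : (sg Bd < +oo)%E.
Proof. exact: (boundary_surface_lty (@dom_open _ _ D) (dom_bounded D) (@dom_C11 _ _ D)). Qed.

Lemma boundary_L2_continuous (f : E -> R) : continuous f -> square_integrable sg Bd f.
Proof.
move=> cf.
have bB : bounded_set Bd by apply: compact_bounded; exact: (boundary_compact (dom_bounded D)).
have [M hM] := continuous_bounded_on bB cf.
exact: (L2_bounded mB boundary_lty (surface_continuous cf) hM).
Qed.

Lemma smooth_mass (v : E -> R) : Rint D (fun x => v x ^+ 2) = ip L D v v.
Proof. by apply: eq_Rintegral => x _; rewrite expr2. Qed.

Lemma smooth_dirichlet (v : E -> R) : smooth v ->
  Rint D (gradsq v) = \sum_(i < n.+1) ip L D (partial i v) (partial i v).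
Proof.
move=> sv; rewrite /Rint /gradsq.
have ii i : L.-integrable D (EFin \o (fun x => partial i v x ^+ 2)).
  by have [_ ?] := L2_continuous D (smooth_partial_continuous (i := i) sv).
have [-> _] := @Rintegral_sum _ _ Lm L D mD _ (index_enum 'I_n.+1) xpredT _ ii.
by apply: eq_bigr => i _; apply: eq_Rintegral => x _; rewrite expr2.
Qed.

(** The convergences of [is_trace] in terms of real-valued inner products, which are
    easier to add and to pass to the limit. *)
Definition approximates (v : nat -> E -> R) (u g : E -> R) :=
  [/\ forall k, smooth (v k),
      ip L D (fun x => v k x - u x) (fun x => v k x - u x) @[k --> \oo] --> (0 : R),
      forall i, ip L D (fun x => partial i (v k) x - weak_partial D u i x)
        (fun x => partial i (v k) x - weak_partial D u i x) @[k --> \oo] --> (0 : R)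
    & ip sg Bd (fun x => v k x - g x) (fun x => v k x - g x) @[k --> \oo] --> (0 : R)].

Lemma is_traceP (u g : E -> R) : H1 D u -> is_trace D u g ->
  square_integrable sg Bd g /\ exists v : nat -> E -> R, approximates v u g.
Proof.
move=> hu [lg [v [sv c1 c2 c3]]]; split => //; exists v; split => //.
- have lv k : square_integrable L D (v k) by apply: L2_continuous; exact: smooth_continuous.
  by apply: (ip_cvg_EFin mD lv) c1; case: hu.
- move=> i; have lv k : square_integrable L D (partial i (v k)).
    by apply: L2_continuous; exact: smooth_partial_continuous.
  by apply: (ip_cvg_EFin mD lv) (c2 i); have [] := weak_partialP i hu.
- have lv k : square_integrable sg Bd (v k) by apply: boundary_L2_continuous; exact: smooth_continuous.
  exact: (ip_cvg_EFin mB lv lg c3).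
Qed.

Lemma smooth_trace_le (eps : R) : 0 < eps -> exists2 K, 0 <= K & forall v : E -> R, smooth v ->
  ip sg Bd v v <= eps * (\sum_(i < n.+1) ip L D (partial i v) (partial i v)) + K * ip L D v v.
Proof.
move=> e0; have [K K0 hK] := trace_inequality (@dom_open _ _ D) (dom_bounded D) (@dom_C11 _ _ D) e0.
exists K => // v sv; have := hK v sv.
rewrite (ip_sqr_EFin mB (boundary_L2_continuous (smooth_continuous sv))) lee_fin.
by rewrite smooth_mass smooth_dirichlet.
Qed.

Lemma approximates_comb (a : R) (v v' : nat -> E -> R) (u u' : V) (g g' : E -> R) :
  square_integrable sg Bd g -> square_integrable sg Bd g' ->
  approximates v u g -> approximates v' u' g' ->
  approximates (fun k x => a * v k x + 1 * v' k x) (a *: u + u') (fun x => a * g x + 1 * g' x).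
Proof.
move=> lg lg' [sv m1 d1 t1] [sv' m2 d2 t2].
have cv k := smooth_continuous (sv k); have cv' k := smooth_continuous (sv' k).
have cp i k := smooth_partial_continuous (i := i) (sv k).
have cp' i k := smooth_partial_continuous (i := i) (sv' k).
split.
- by move=> k; exact: smooth_comb.
- rewrite h1_lin (_ : (fun k => _) = fun k => ip L D
      (fun x => (a * v k x + 1 * v' k x) - (a * h1val u x + 1 * h1val u' x))
      (fun x => (a * v k x + 1 * v' k x) - (a * h1val u x + 1 * h1val u' x))); last first.
    by apply/funext => k; congr ip; apply/funext => x; rewrite [in RHS](mul1r (h1val u' x)).
  exact: (ip_comb_cvg0 mD a (fun k => L2_continuous D (cv k)) (fun k => L2_continuous D (cv' k)) (h1_L2 u) (h1_L2 u') m1 m2).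
- move=> i; rewrite (_ : (fun k => _) = fun k => ip L D
      (fun x => (a * partial i (v k) x + 1 * partial i (v' k) x) - (a * wd u i x + 1 * wd u' i x))
      (fun x => (a * partial i (v k) x + 1 * partial i (v' k) x) - (a * wd u i x + 1 * wd u' i x))).
    apply: (ip_comb_cvg0 mD a (fun k => L2_continuous D (cp i k)) (fun k => L2_continuous D (cp' i k))
      (wd_L2 u i) (wd_L2 u' i) (d1 i) (d2 i)).
  apply/funext => k.
  have -> : partial i (fun x => a * v k x + 1 * v' k x) = fun x => a * partial i (v k) x + 1 * partial i (v' k) x.
    by apply/funext => x; apply: partial_comb.
  have lk := L2_comb mD a 1 (L2_continuous D (cp i k)) (L2_continuous D (cp' i k)).
  have lu := L2_comb mD a 1 (wd_L2 u i) (wd_L2 u' i).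
  have l1 := L2_sub mD lk (wd_L2 (a *: u + u') i); have l2 := L2_sub mD lk lu.
  have ae1 : {ae L, forall x, dset D x -> (a * partial i (v k) x + 1 * partial i (v' k) x) - wd (a *: u + u') i x =
     (a * partial i (v k) x + 1 * partial i (v' k) x) - (a * wd u i x + 1 * wd u' i x)}.
    by apply: (@ae_imp R _ Lm L) (wd_lin a u u' i) => x h Dx; rewrite h.
  by rewrite -/(wd _ _) (ip_ae mD l1 l2 l1 ae1) ipC (ip_ae mD l1 l2 l2 ae1).
- exact: (ip_comb_cvg0 mB a (fun k => boundary_L2_continuous (cv k)) (fun k => boundary_L2_continuous (cv' k)) lg lg' t1 t2).
Qed.

Lemma sum_cvg (J : finType) (F : J -> nat -> R) (l : J -> R) : (forall i, F i k @[k --> \oo] --> l i) ->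
  \sum_i F i k @[k --> \oo] --> \sum_i l i.
Proof.
move=> hF; elim: (index_enum J) => [|i r IH].
  by rewrite (_ : (fun k => _) = fun=> 0) ?big_nil; [exact: cvg_cst|apply/funext => k; rewrite big_nil].
rewrite big_cons (_ : (fun k => _) = fun k => F i k + \sum_(i <- r) F i k); last first.
  by apply/funext => k; rewrite big_cons.
exact: cvgD.
Qed.

(** Both sides of the inequality for smooth functions converge along the
    approximating sequence. *)
Lemma approximates_le (eps K : R) (v : nat -> E -> R) (u : V) (g : E -> R) :
  (forall v : E -> R, smooth v ->
    ip sg Bd v v <= eps * (\sum_(i < n.+1) ip L D (partial i v) (partial i v)) + K * ip L D v v) ->
  square_integrable sg Bd g -> approximates v u g ->
  ip sg Bd g g <= eps * dirichlet u u + K * mass u u.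
Proof.
move=> hK lg [sv m1 d1 t1].
have cv k := smooth_continuous (sv k); have cp i k := smooth_partial_continuous (i := i) (sv k).
have c1 := ip_cvg_norm mB (fun k => boundary_L2_continuous (cv k)) lg t1.
have c2 := ip_cvg_norm mD (fun k => L2_continuous D (cv k)) (h1_L2 u) m1.
have c3 i := ip_cvg_norm mD (fun k => L2_continuous D (cp i k)) (wd_L2 u i) (d1 i).
have c4 : \sum_(i < n.+1) ip L D (partial i (v k)) (partial i (v k)) @[k --> \oo] --> dirichlet u u.
  by rewrite /dirichlet; exact: sum_cvg.
apply: (ler_cvg_to c1 (cvgD (cvgM (cvg_cst eps) c4) (cvgM (cvg_cst K) c2))).
by apply: nearW => k; exact: hK.
Qed.

Hypothesis traces : forall u : V, exists g : E -> R, is_trace D u g.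

Definition tr u : E -> R := trace D u.

Lemma tr_is_trace u : is_trace D u (tr u).
Proof. by have [g hg] := traces u; exact: (@xgetPex _ (fun=> 0) [set g | is_trace D u g] (ex_intro _ g hg)). Qed.

Lemma tr_L2 u : square_integrable sg Bd (tr u).
Proof. by have [] := is_traceP (H1val u) (tr_is_trace u). Qed.

(** The difference of two approximating sequences approximates the zero function,
    whose trace is null by the trace inequality. *)
Lemma trace_unique u (g g' : E -> R) : is_trace D u g -> is_trace D u g' ->
  {ae sg, forall x, Bd x -> g x = g' x}.
Proof.
move=> /(is_traceP (H1val u))[lg [v hv]] /(is_traceP (H1val u))[lg' [v' hv']].
have h := approximates_comb (-1) lg lg' hv hv'; have ld := L2_comb mB (-1) 1 lg lg'.
have [K K0 hK] := smooth_trace_le ltr01.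
have := approximates_le hK ld h; rewrite scaleN1r addNr.
rewrite (form0l (dirichlet_sym D)) (form0l (mass_sym D)) !mulr0 addr0 => i0.
have /(ip_null mB ld) : ip sg Bd (fun x => -1 * g x + 1 * g' x) (fun x => -1 * g x + 1 * g' x) = 0.
  by apply/eqP; rewrite eq_le i0 ip_ge0.
by apply: (@ae_imp R _ Sm sg) => x hx Bx; have := hx Bx; lra.
Qed.

Lemma is_trace_comb (a : R) u u' (g g' : E -> R) : is_trace D u g -> is_trace D u' g' ->
  is_trace D (a *: u + u') (fun x => a * g x + 1 * g' x).
Proof.
move=> /(is_traceP (H1val u))[lg [v hv]] /(is_traceP (H1val u'))[lg' [v' hv']].
have [sv m1 d1 t1] := approximates_comb a lg lg' hv hv'.
split; first exact: L2_comb.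
have cp i k := smooth_partial_continuous (i := i) (sv k).
exists (fun k x => a * v k x + 1 * v' k x); split => //.
- exact: (ip_cvg_EFinr mD (fun k => L2_continuous D (smooth_continuous (sv k))) (h1_L2 _) m1).
- move=> i; exact: (ip_cvg_EFinr mD (fun k => L2_continuous D (cp i k)) (wd_L2 (a *: u + u') i) (d1 i)).
- exact: (ip_cvg_EFinr mB (fun k => boundary_L2_continuous (smooth_continuous (sv k))) (L2_comb mB a 1 lg lg') t1).
Qed.

Lemma tr_lin (a : R) u u' : {ae sg, forall x, Bd x -> tr (a *: u + u') x = a * tr u x + 1 * tr u' x}.
Proof. exact: (trace_unique (tr_is_trace _) (is_trace_comb a (tr_is_trace u) (tr_is_trace u'))). Qed.

Definition tform u v := ip sg Bd (tr u) (tr v).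

Lemma tform_sym : symform tform.
Proof. exact: (value_form_sym mB tr_L2 tr_lin). Qed.

Lemma tform_psd : psd tform. Proof. by move=> u; exact: ip_ge0. Qed.

(** The trace inequality on H^1. *)
Lemma tform_le (eps : R) : 0 < eps -> exists2 K, 0 <= K &
  forall u, tform u u <= eps * dirichlet u u + K * mass u u.
Proof.
move=> e0; have [K K0 hK] := smooth_trace_le e0; exists K => // u.
have [lg [v hv]] := is_traceP (H1val u) (tr_is_trace u); exact: (approximates_le hK lg hv).
Qed.

Variable (S : set E).
Hypothesis mS : measurable (S : set Sm).

Definition sform u v := \int[sg]_(x in Bd) (\1_S x * tr u x * tr v x).

Lemma sform_sym : symform sform.
Proof. exact: (indic_form_sym mB tr_L2 tr_lin mS). Qed.

Lemma sform_psd : psd sform.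
Proof. exact: (@indic_form_psd R _ Sm sg Bd V tr S). Qed.

Lemma sform_le u : sform u u <= tform u u.
Proof. by have h := indic_form_le mB tr_L2 mS u; exact h. Qed.

(** The Rellich inequality passes to H^1 along smooth approximations; the
    functionals are multiples of the means over the cubes. *)
Lemma mass_compact : compact_form (@h1form R n D) (@mass R n D).
Proof.
move=> eps e0.
have [J [P [q [K [mq qD K0 hK]]]]] := rellich (@dom_open _ _ D) (dom_bounded D) (@dom_C11 _ _ D) e0.
pose Q := [set: {j : J | P j}]%SET.
pose p (j : 'I_#|{: {j : J | P j}}|) : set E := q (val (enum_val j)).
have mp j : measurable (p j : set Lm) by exact: mq.
have pD j : p j `<=` D by apply: qD; exact: (valP (enum_val j)).
have L2p j : square_integrable L D (\1_(p j)).
  have := L2_indic mD (mp j) (L2_continuous D (@cst_continuous _ _ (1 : R))).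
  by congr (square_integrable _ _ _); apply/funext => x; rewrite mulr1.
exists #|{: {j : J | P j}}|, (fun j u => Num.sqrt K * ip L D u (\1_(p j))).
pose K1 := \sum_j K * ip L D (\1_(p j)) (\1_(p j)).
have K10 j : 0 <= K * ip L D (\1_(p j)) (\1_(p j)) by rewrite mulr_ge0// ip_ge0.
exists K1; split.
- move=> j a u v; have -> : ip L D (a *: u + v) (\1_(p j)) = a * ip L D u (\1_(p j)) + 1 * ip L D v (\1_(p j)).
    rewrite -(ip_comb mD a 1 (h1_L2 u) (h1_L2 v) (L2p j)); congr ip; apply/funext => x.
    by rewrite [in RHS](mul1r (h1val v x)).
  by rewrite mul1r mulrDr mulrCA.
- exact: sumr_ge0.
- move=> j u; rewrite exprMn sqr_sqrtr//.
  apply: (@le_trans _ _ (K * (ip L D u u * ip L D (\1_(p j)) (\1_(p j))))).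
    by rewrite ler_wpM2l// (ip_CS mD (h1_L2 u) (L2p j)).
  rewrite mulrCA mulrC; apply: ler_pM; rewrite ?ip_ge0//.
    by rewrite /K1 (bigD1 j)//= lerDl sumr_ge0.
  by rewrite /h1form lerDl dirichlet_psd.
- move=> u; have [_ [v [sv m1 d1 t1]]] := is_traceP (H1val u) (tr_is_trace u).
  have cv k := smooth_continuous (sv k); have cp i k := smooth_partial_continuous (i := i) (sv k).
  have c2 := ip_cvg_norm mD (fun k => L2_continuous D (cv k)) (h1_L2 u) m1.
  have c3 i := ip_cvg_norm mD (fun k => L2_continuous D (cp i k)) (wd_L2 u i) (d1 i).
  have c4 := sum_cvg c3.
  have c5 j := ip_cvg mD (fun k => L2_continuous D (cv k)) (h1_L2 u) (L2p j) m1.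
  have c6 := sum_cvg (fun j => cvgM (c5 j) (c5 j)).
  apply: (@le_trans _ _ (eps * h1form u u + K * \sum_j ip L D u (\1_(p j)) * ip L D u (\1_(p j)))); last first.
    by rewrite lerD2l mulr_sumr; apply: ler_sum => j _; rewrite exprMn sqr_sqrtr// expr2.
  apply: (ler_cvg_to c2 (cvgD (cvgM (cvg_cst eps) (cvgD c2 c4)) (cvgM (cvg_cst K) (c6 _)))).
  apply: nearW => k; have := hK _ (sv k); rewrite smooth_mass (smooth_dirichlet (sv k)).
  move/le_trans; apply; rewrite lerD2l; apply: ler_wpM2l => //.
  rewrite le_eqVlt; apply/orP; left; apply/eqP.
  rewrite [LHS](_ : _ = \sum_(j : {j : J | P j}) Rint (q (val j)) (v k) ^+ 2); last first.
    by rewrite (@big_sub _ _ _ J P)/=.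
  rewrite (reindex (fun j : 'I_#|{: {j : J | P j}}| => enum_val j))/=; last by apply: onW_bij; exact: enum_val_bij.
  by apply: eq_bigr => j _; have := indic_ip L (v k) (mp j) (pD j); rewrite -/(Rint (p j) (v k)) expr2 /p => ->.
Qed.

(** By the trace inequality [s] is at most a small multiple of the energy plus a
    multiple of the mass, and the mass is compact. *)
Lemma sform_compact : compact_form (@h1form R n D) sform.
Proof.
move=> eps e0; have e1 : 0 < eps / 2 by rewrite divr_gt0.
have [K K0 hK] := tform_le e1.
have e2 : 0 < eps / (2 * (K + 1)) by rewrite divr_gt0// mulr_gt0// ltr_wpDl.
have [J [l [C [hl C0 lC lm]]]] := mass_compact e2.
exists J, (fun j u => Num.sqrt K * l j u), (K * C); split.
- by move=> j a u v; rewrite hl mulrDr mulrCA.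
- exact: mulr_ge0.
- by move=> j u; rewrite exprMn sqr_sqrtr// -mulrA ler_wpM2l.
- move=> u; apply: le_trans (sform_le u) _; apply: le_trans (hK u) _.
  under eq_bigr do rewrite exprMn sqr_sqrtr//.
  rewrite -mulr_sumr.
  have h1 := lm u; have h2 : dirichlet u u <= h1form u u by rewrite lerDr mass_psd.
  have h0 := @h1form_psd _ _ D u.
  have h3 : K * mass u u <= K * (eps / (2 * (K + 1)) * h1form u u + \sum_j l j u ^+ 2) by rewrite ler_wpM2l.
  have h4 : K * (eps / (2 * (K + 1))) <= eps / 2.
    rewrite -subr_ge0 [X in 0 <= X](_ : _ = eps / (2 * (K + 1))) ?(ltW e2)//; field.
    by rewrite gt_eqF// ltr_wpDl.
  have h5 := ler_wpM2r h0 h4; have h6 := ler_wpM2l (ltW e1) h2.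
  have h7 : K * (eps / (2 * (K + 1)) * h1form u u + \sum_j l j u ^+ 2) =
      K * (eps / (2 * (K + 1))) * h1form u u + K * \sum_j l j u ^+ 2 by rewrite mulrDr mulrA.
  move: h3 h5 h6; rewrite h7.
  set a := K * mass u u; set b := K * (_ / _) * _; set c := K * \sum_i _; set d := eps / 2 * _.
  by move=> *; rewrite [eps]splitr mulrDl; lra.
Qed.

End Traces.

(** * Coercivity of the Robin form *)

Section Coercivity.
Context (R : realType) (V : lmodType R) (h m p : V -> V -> R) (C : R).
Hypotheses (hsym : symform h) (hpsd : psd h) (psym : symform p) (ppsd : psd p).
Hypotheses (hcomplete : complete_form h) (mcompact : compact_form h m).
Hypotheses (pC : forall u, p u u <= C * h u u) (hmp : forall u, h u u <= m u u + p u u).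
Hypothesis kernel : forall u, p u u = 0 -> h u u = 0.

(** If there were no such constant, a sequence with [h (u k) (u k) = 1] and [p (u k)
    (u k)] tending to zero would exist. As [m] is compact and [h <= m + p], a
    subsequence is Cauchy for [h]; its limit has norm one and lies in the kernel of
    [p]. *)
Lemma coercive_of_kernel : exists2 c, 0 < c & forall u, c * h u u <= p u u.
Proof.
apply: contrapT => hn.
have /choice[u hu] : forall k : nat, exists u, h u u = 1 /\ p u u <= k.+1%:R^-1.
  move=> k; apply: contrapT => hk; apply: hn; exists k.+1%:R^-1; first by rewrite invr_gt0.
  move=> v; have := hpsd v; rewrite le_eqVlt => /orP[/eqP<-|h0]; first by rewrite mulr0 ppsd.
  rewrite leNgt; apply/negP => hv; apply: hk.
  have sE (b : V -> V -> R) : symform b -> b ((Num.sqrt (h v v))^-1 *: v) ((Num.sqrt (h v v))^-1 *: v) = b v v / h v v.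
    by move=> bs; rewrite (form_sqrZ bs) exprVn sqr_sqrtr ?hpsd// mulrC.
  exists ((Num.sqrt (h v v))^-1 *: v); rewrite !sE// divff ?gt_eqF//; split => //.
  by rewrite ler_pdivrMr// ltW.
have hu1 k : h (u k) (u k) = 1 by case: (hu k).
have pu k : p (u k) (u k) <= k.+1%:R^-1 by case: (hu k).
have [U [UU ooU]] := ultraFilterLemma (@eventually_filter).
have nearU (A : set nat) : (\forall k \near \oo, A k) -> U A by move=> h'; exact: ooU.
have inv_near (e : R) : 0 < e -> \forall k \near \oo, k.+1%:R^-1 <= e.
  move=> e0; have [N _ hN] := near_natr e^-1; exists N => // k /= Nk.
  by rewrite -[leRHS]invrK lef_pV2 ?posrE ?invr_gt0//; exact: (hN k Nk).
have small (e : R) : 0 < e -> exists2 A, U A & forall k k', A k -> A k' ->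
    h (u k - u k') (u k - u k') <= e.
  move=> e0; have e4 : 0 < e / 16 by rewrite divr_gt0.
  have [J [l [K [ll K0 lK sl]]]] := mcompact e4.
  pose tau := Num.min 1 (e / (4 * (J%:R + 1))).
  have J1 : 0 < 4 * (J%:R + 1) :> R by rewrite mulr_gt0// ltr_wpDl.
  have tau0 : 0 < tau by rewrite lt_min ltr01 divr_gt0.
  have tau1 : tau <= 1 by rewrite ge_min lexx.
  have tauJ : J%:R * tau <= e / 4.
    have : tau <= e / (4 * (J%:R + 1)) by rewrite ge_min lexx orbT.
    by rewrite ler_pdivlMr// => ht; nra.
  have lM j k : `|l j (u k)| <= Num.sqrt K.
    by rewrite -sqrtr_sqr ler_wsqrtr//; apply: le_trans (lK j _) _; rewrite hu1 mulr1.
  have /choice[L hL] : forall j, exists t : R, forall e : R, 0 < e -> U [set k | `|l j (u k) - t| <= e].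
    by move=> j; have [t _ ht] := ultra_limit UU (lM j); exists t.
  pose A1 := [set k | forall j, `|l j (u k) - L j| <= tau / 2].
  have UA1 : U A1 by apply: filter_forall => j; apply: hL; exact: divr_gt0.
  pose A2 := [set k : nat | k.+1%:R^-1 <= e / 16].
  have UA2 : U A2 by apply: nearU; exact: inv_near.
  exists (A1 `&` A2) => [|k k' [a1 a2] [b1 b2]]; first exact: filterI.
  set d := u k - u k'.
  have lsum : \sum_j l j d ^+ 2 <= J%:R * tau.
    apply: (@le_trans _ _ (\sum_(j < J) tau)); last by rewrite sumr_const card_ord mulr_natl.
    apply: ler_sum => j _.
    have lB : l j d = l j (u k) - l j (u k') by rewrite /d addrC -scaleN1r ll mulN1r addrC.
    have : `|l j d| <= tau.
      rewrite lB; have := ler_normB (l j (u k) - L j) (l j (u k') - L j).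
      rewrite opprB addrA subrK; have := a1 j; have := b1 j => /=; lra.
    by rewrite ler_norml => /andP[x1 x2]; nra.
  have par (b : V -> V -> R) : symform b -> psd b -> b d d <= 2 * (b (u k) (u k) + b (u k') (u k')).
    move=> bs bp; have := bp (u k + u k'); rewrite /d (form_sqrD bs) (form_sqrB bs); lra.
  have h4 := par h hsym hpsd; have p4 := par p psym ppsd; rewrite !hu1 in h4.
  have h5 : e / 16 * h d d <= e / 16 * 4 by rewrite (ler_wpM2l (ltW e4))//; apply: le_trans h4 _; lra.
  have h6 := le_trans (pu k) a2; have h7 := le_trans (pu k') b2.
  have := hmp d; have := sl d; rewrite -/d; move: h5; set x := e / 16 * h d d; set y := \sum_j _ in lsum *.
  clearbody x y => *; lra.
have /choice[A hA] : forall r : nat, exists A : set nat, U A /\ forall k k', A k -> A k' ->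
    h (u k - u k') (u k - u k') <= r.+1%:R^-1.
  move=> r; have r0 : 0 < r.+1%:R^-1 :> R by rewrite invr_gt0.
  by have [A UA hA] := small _ r0; exists A.
have /choice[kap hkap] : forall r : nat, exists k, (r <= k)%N /\ forall i : 'I_r.+1, A i k.
  move=> r; have UB : U ([set k | (r <= k)%N] `&` [set k | forall i : 'I_r.+1, A i k]).
    apply: filterI; first by apply: nearU; exists r.
    by apply: filter_forall => i; have [] := hA i.
  by have [k [rk Ak]] := filter_ex UB; exists k.
have hkr r r' r'' : (r <= r')%N -> (r <= r'')%N ->
    h (u (kap r') - u (kap r'')) (u (kap r') - u (kap r'')) <= r.+1%:R^-1.
  move=> rr' rr''; have [_ a1] := hkap r'; have [_ a2] := hkap r''.
  have r1 : (r < r'.+1)%N by rewrite ltnS.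
  have r2 : (r < r''.+1)%N by rewrite ltnS.
  by have [_ /(_ _ _ (a1 (Ordinal r1)) (a2 (Ordinal r2)))] := hA r.
have [y hy] : exists y, hcvg h (fun j => u (kap j)) y.
  apply: hcomplete => e e0; have [N _ hN] := inv_near e e0.
  by exists N => i j Ni Nj; apply: le_trans (hkr N i j Ni Nj) (hN N (leqnn N)).
have hC v : h v v <= 1 * h v v by rewrite mul1r.
have cy := psd_cvg hsym hpsd hC hy hy; have cp := psd_cvg psym ppsd pC hy hy.
have h1 : h y y = 1.
  apply: (cvg_unique _ cy) => //; rewrite (_ : (fun k => _) = fun=> 1); first exact: cvg_cst.
  by apply/funext => k; rewrite hu1.
suff p0 : p y y = 0 by have := kernel p0; rewrite h1 => /eqP; rewrite oner_eq0.
apply: (cvg_unique _ cp) => //; apply: (@squeeze0 _ _ (fun k => k.+1%:R^-1)); last exact: cvg_harmonic.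
move=> k; rewrite ppsd/=; apply: le_trans (pu _) _; have [kk _] := hkap k.
by rewrite lef_pV2 ?posrE// ler_nat.
Qed.

End Coercivity.

Section Kernel.
Context (R : realType) (n : nat) (D : domain R n).
Local Notation E := 'rV[R]_n.+1.
Local Notation L := (lebesgue R n).
Local Notation Lm := (lebesgue_space R n).
Local Notation sg := (surface R n).
Local Notation Sm := (surface_space R n).
Local Notation Bd := (boundary (dset D)).
Local Notation V := (H1space D).
Let mD := dom_measurable D.
Let mB := boundary_measurable D.
Implicit Types (u v w : V).

Lemma ip_null_ae d (T : measurableType d) (mu : {measure set T -> \bar R}) (A : set T) (f g : T -> R) :
  measurable A -> square_integrable mu A f -> square_integrable mu A g ->
  {ae mu, forall x, A x -> f x = 0} -> ip mu A f g = 0.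
Proof.
move=> mA lf lg h; rewrite (ip_ae mA lf (L2_0 mu A) lg h).
by rewrite /ip /Rintegral integral0_eq// => x _; rewrite mul0r.
Qed.

Lemma gradient_null u : dirichlet u u = 0 -> forall i, {ae L, forall x, dset D x -> wd u i x = 0}.
Proof.
move=> d0 i; apply: (ip_null mD (wd_L2 u i)); apply/eqP; rewrite eq_le ip_ge0 andbT -[leRHS]d0.
by rewrite /dirichlet (bigD1 i)//= lerDl; apply: sumr_ge0 => j _; exact: ip_ge0.
Qed.

Lemma constant_of_gradient u : (forall i, {ae L, forall x, dset D x -> wd u i x = 0}) ->
  exists a : R, {ae L, forall x, dset D x -> u x = a}.
Proof.
move=> g0.
have fi := L2_integrable mD (dom_lty D) (h1_L2 u).
have fz i phi : test_function D phi -> \int[L]_(x in D) (u x * partial i phi x) = 0; last first.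
  exact: (weakly_constant (@dom_open _ _ D) fi fz (@dom_connected _ _ D) (dom_bounded D)).
move=> tp.
have [_ w] := weak_partialP i (H1val u); have [t1 t2] := L2_test i tp.
have := w phi tp; rewrite -/(wd u i) => ->.
have := ip_null_ae mD (wd_L2 u i) t1 (g0 i); rewrite /ip => ->; exact: oppr0.
Qed.

(** A constant sequence of smooth functions approximates a function which is almost
    everywhere constant. *)
Lemma trace_constant u (a : R) : {ae L, forall x, dset D x -> u x = a} ->
  (forall i, {ae L, forall x, dset D x -> wd u i x = 0}) -> is_trace D u (fun=> a).
Proof.
move=> ua g0.
have sc : smooth (fun _ : E => a) by apply: bump_smooth; exact: bump_cst.
have lc := boundary_L2_continuous D (smooth_continuous sc).
have p0 i : partial i (fun _ : E => a) = fun=> 0 by apply/funext => x; exact: derive_cst.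
have lD := L2_continuous D (smooth_continuous sc).
split => //; exists (fun _ _ => a); split => //.
- apply: (ip_cvg_EFinr mD (fun=> lD) (h1_L2 u)).
  rewrite (_ : (fun k => _) = fun=> 0); first exact: cvg_cst.
  apply/funext => k; have l1 := L2_sub mD lD (h1_L2 u).
  by apply: (ip_null_ae mD l1 l1); apply: (@ae_imp R _ Lm L) ua => x h Dx; rewrite h// subrr.
- move=> i; rewrite p0; apply: (ip_cvg_EFinr mD (fun=> L2_0 L D) (wd_L2 u i)).
  rewrite (_ : (fun k => _) = fun=> 0); first exact: cvg_cst.
  apply/funext => k; have l1 := L2_sub mD (L2_0 L D) (wd_L2 u i).
  by apply: (ip_null_ae mD l1 l1); apply: (@ae_imp R _ Lm L) (g0 i) => x h Dx; rewrite h// subrr.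
- apply: (ip_cvg_EFinr mB (fun=> lc) lc).
  rewrite (_ : (fun k => _) = fun=> 0); first exact: cvg_cst.
  by apply/funext => k; rewrite /ip /Rintegral integral0_eq// => x _; rewrite subrr mul0r.
Qed.

Hypothesis traces : forall u, exists g : E -> R, is_trace D u g.
Hypothesis Bd_pos : sg Bd != 0%E.

Definition robin u v := dirichlet u v + tform u v.

(** Zero energy makes [u] constant, and the trace of a constant vanishes only if the
    constant does, as the boundary has positive measure. *)
Lemma robin_kernel u : robin u u = 0 -> h1form u u = 0.
Proof.
rewrite /robin => r0; have d0 := @dirichlet_psd _ _ D u; have t0 := @tform_psd _ _ D u.
have dz : dirichlet u u = 0 by lra.
have tz : tform u u = 0 by lra.
have g0 := gradient_null dz; have [a ua] := constant_of_gradient g0.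
have tra := trace_unique (tr_is_trace traces u) (trace_constant ua g0).
have lc := boundary_L2_continuous D (@cst_continuous E _ a).
have tae := ip_null mB (tr_L2 traces u) tz.
have a0 : a = 0.
  apply: contrapT => an; move/eqP: Bd_pos; apply; apply: (ae_false mB).
  apply: (@ae_imp2 R _ Sm sg _ _ _ _ tra tae) => x h1 h2 Bx.
  by apply: an; rewrite -h1// h2.
rewrite /h1form dz addr0 /mass; apply: (ip_null_ae mD (h1_L2 u) (h1_L2 u)).
by apply: (@ae_imp R _ Lm L) ua => x h Dx; rewrite h.
Qed.

(** Friedrichs' inequality. *)
Lemma robin_coercive : exists2 c, 0 < c & forall u, c * h1form u u <= robin u u.
Proof.
have ds := @dirichlet_sym _ _ D; have dp := @dirichlet_psd _ _ D; have tp := @tform_psd _ _ D.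
have [K K0 hK] := tform_le traces ltr01.
apply: (@coercive_of_kernel R (H1space D) (@h1form _ _ D) (@mass _ _ D) robin (2 + K)).
- exact: h1form_sym.
- exact: h1form_psd.
- exact: (sum_form_sym ds (tform_sym traces)).
- by move=> u; apply: addr_ge0; [exact: dp|exact: tp].
- exact: h1form_complete.
- exact: (mass_compact traces).
- move=> u; have := hK u; have := @mass_psd _ _ D u; have := dp u; rewrite /robin /h1form.
  move=> d0 m0 h; have := mulr_ge0 K0 d0; lra.
- by move=> u; rewrite /robin /h1form addrA lerDl tp.
- exact: robin_kernel.
Qed.

End Kernel.

(** * Perturbing matrices *)

Section Coefficients.
Context (R : realType) (n : nat) (D : domain R n).
Local Notation E := 'rV[R]_n.+1.
Local Notation L := (lebesgue R n).
Local Notation Lm := (lebesgue_space R n).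
Local Notation V := (H1space D).
Local Notation W := (E -> 'M[R]_n.+1).
Let mD := dom_measurable D.
Implicit Types (B C : W).

Definition bump_mx B := (forall i j, bump_alg (entry B i j)) /\ forall x, (B x)^T = B x.

(** A bound for the C^1 size, normalised by the dimension so that the energy of [B]
    is at most [d] times the energy of the gradient, as [small_mx_bound] asserts. *)
Definition small_mx B (d : R) := forall i j x,
  `|entry B i j x| <= d / n.+1%:R /\ forall k, `|partial k (entry B i j) x| <= d / n.+1%:R.

Lemma entry_comb (a : R) B C i j : entry (a *: B + C) i j = fun x => a * entry B i j x + 1 * entry C i j x.
Proof. by apply/funext => x; rewrite /entry mul1r; rewrite /GRing.add/= /GRing.scale/= !mxE. Qed.

Lemma entry0 i j : entry (0 : W) i j = fun=> 0.
Proof. by apply/funext => x; rewrite /entry /GRing.zero/= mxE. Qed.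

Lemma bump_mx0 : bump_mx 0.
Proof.
split=> [i j|x]; first by rewrite entry0; exact: bump_cst.
by apply/matrixP => i j; rewrite mxE -[LHS]/(entry 0 j i x) -[RHS]/(entry 0 i j x) !entry0.
Qed.

Lemma bump_mx_comb (a : R) B C : bump_mx B -> bump_mx C -> bump_mx (a *: B + C).
Proof.
move=> [eB sB] [eC sC]; split=> [i j|x].
  rewrite entry_comb; apply: bump_add; apply: bump_mul => //; exact: bump_cst.
rewrite -[(a *: B + C) x]/(a *: B x + C x).
by apply/matrixP => i j; have := sB x => /matrixP/(_ i j); have := sC x => /matrixP/(_ i j); rewrite !mxE => -> ->.
Qed.

Lemma bump_mx_coef B : bump_mx B -> coefficient_field D B.
Proof.
move=> [eB sB]; split=> [i j||x _]; last exact: sB.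
  exact: lebesgue_continuous (bump_continuous (eB i j)).
have /choice[c hc] : forall z : 'I_n.+1 * 'I_n.+1, exists M, 0 <= M /\ forall x, `|B x z.1 z.2| <= M.
  by move=> [i j]; have [M M0 hM] := bump_bounded (eB i j); exists M.
exists (\sum_z c z) => i j x _; have [c0 /(_ x)/le_trans] := hc (i, j); apply.
by rewrite (bigD1 (i, j))//= lerDl; apply: sumr_ge0 => z _; have [] := hc z.
Qed.

Lemma small_mx_bound B (d : R) (u : V) : bump_mx B -> small_mx B d -> `|energy B u u| <= d * h1form u u.
Proof.
move=> pB sB; have cB := bump_mx_coef pB.
apply: (@le_trans _ _ (d / n.+1%:R * n.+1%:R * dirichlet u u)).
  by apply: (energy_bound _ cB) => i j x _; have [] := sB i j x.
have d0 : 0 <= d.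
  have [] := sB ord0 ord0 0; move=> /(le_trans (normr_ge0 _)) + _.
  by rewrite pmulr_lge0// invr_gt0.
by rewrite divfK// ler_wpM2l// /h1form lerDr mass_psd.
Qed.

Lemma small_mx_ex B : bump_mx B -> exists2 M, 0 <= M & small_mx B M.
Proof.
move=> [eB sB].
have /choice[c hc] : forall z : 'I_n.+1 * 'I_n.+1, exists M, 0 <= M /\ forall x, `|entry B z.1 z.2 x| <= M.
  by move=> [i j]; have [M M0 hM] := bump_bounded (eB i j); exists M.
have /choice[d hd] : forall z : 'I_n.+1 * 'I_n.+1 * 'I_n.+1, exists M, 0 <= M /\
    forall x, `|partial z.2 (entry B z.1.1 z.1.2) x| <= M.
  by move=> [[i j] k]; have [M M0 hM] := bump_bounded (bump_partial k (eB i j)); exists M.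
pose M := \sum_z c z + \sum_z d z.
have sc0 : 0 <= \sum_z c z by apply: sumr_ge0 => z _; have [] := hc z.
have sd0 : 0 <= \sum_z d z by apply: sumr_ge0 => z _; have [] := hd z.
exists (M * n.+1%:R); first by rewrite mulr_ge0// addr_ge0.
move=> i j x; rewrite mulfK//; split => [|k].
  have [c0 /(_ x)/le_trans] := hc (i, j); apply.
  rewrite /M (bigD1 (i, j))//= -addrA lerDl; apply: addr_ge0 => //.
  by apply: sumr_ge0 => z _; have [] := hc z.
have [d0 /(_ x)/le_trans] := hd (i, j, k); apply.
rewrite /M addrC (bigD1 (i, j, k))//= -addrA lerDl; apply: addr_ge0 => //.
by apply: sumr_ge0 => z _; have [] := hd z.
Qed.

Lemma small_mx0 : small_mx 0 0.
Proof.
move=> i j x; rewrite entry0 mul0r normr0; split => // k.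
by rewrite (_ : partial k _ x = 0) ?normr0//; exact: derive_cst.
Qed.

Lemma small_mx_comb (a : R) B C (M N : R) : bump_mx B -> bump_mx C -> small_mx B M -> small_mx C N ->
  small_mx (a *: B + C) (`|a| * M + N).
Proof.
move=> [eB _] [eC _] hB hC i j x; rewrite entry_comb mulrDl -mulrA.
have key (y z : R) : `|y| <= M / n.+1%:R -> `|z| <= N / n.+1%:R -> `|a * y + 1 * z| <= `|a| * (M / n.+1%:R) + N / n.+1%:R.
  move=> hy hz; apply: le_trans (ler_normD _ _) _; rewrite mul1r normrM lerD// ler_wpM2l//.
have [b1 b2] := hB i j x; have [c1 c2] := hC i j x.
split=> [|k]; first exact: key.
by rewrite (partial_comb _ _ _ _ (bump_smooth (eB i j)) (bump_smooth (eC i j))); exact: key.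
Qed.

Lemma small_mx_le B (M N : R) : small_mx B M -> M <= N -> small_mx B N.
Proof.
move=> hB MN i j x; have [b1 b2] := hB i j x.
have h : M / n.+1%:R <= N / n.+1%:R by rewrite ler_wpM2r.
by split => [|k]; apply: le_trans h.
Qed.

(** The matrix [psi E_ii], whose energy form sees the [i]-th partial derivatives
    only. *)
Definition diag_bump (psi : E -> R) (i : 'I_n.+1) : W := fun x => psi x *: delta_mx i i.

Lemma diag_bump_mx psi i : bump_alg psi -> bump_mx (diag_bump psi i).
Proof.
move=> bp; split=> [k l|x]; last by rewrite /diag_bump linearZ/= trmx_delta.
rewrite (_ : entry _ k l = fun x => psi x * ((k == i) && (l == i))%:R).
  by apply: bump_mul => //; exact: bump_cst.
by apply/funext => x; rewrite /entry /diag_bump !mxE.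
Qed.

Lemma diag_bump_energy psi i (u v : V) : energy (diag_bump psi i) u v = \int[L]_(x in D) (wd u i x * wd v i x * psi x).
Proof.
apply: eq_Rintegral => x _; rewrite (bigD1 i)//= [X in _ + X]big1 ?addr0; last first.
  by move=> j ji; apply: big1 => k _; rewrite !mxE (negbTE ji) mulr0 !mul0r.
rewrite (bigD1 i)//= [X in _ + X]big1 ?addr0; last first.
  by move=> j ji; rewrite !mxE (negbTE ji) andbF mulr0 !mul0r.
by rewrite !mxE !eqxx mulr1 -mulrA mulrC.
Qed.

(** The fundamental lemma gives [d_i u * d_i v = 0] and [(d_i u)^2 = (d_i v)^2]
    almost everywhere. *)
Lemma energy_diff_null (u v : V) i :
  (forall psi, bump_alg psi -> energy (diag_bump psi i) u v = 0) ->
  (forall psi, bump_alg psi -> energy (diag_bump psi i) u u = energy (diag_bump psi i) v v) ->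
  {ae L, forall x, dset D x -> wd u i x = 0 /\ wd v i x = 0}.
Proof.
move=> h1 h2; have lu := wd_L2 u i; have lv := wd_L2 v i.
have iuv := L2_prod mD lu lv; have iuu := L2_prod mD lu lu; have ivv := L2_prod mD lv lv.
have a1 := @null_of_test_integrals R n (dset D) (fun x : E => wd u i x * wd v i x) (@dom_open _ _ D) iuv
  (fun psi bp _ => etrans (esym (diag_bump_energy psi i u v)) (h1 psi bp)).
have idf : L.-integrable D (EFin \o (fun x => wd u i x * wd u i x - wd v i x * wd v i x)).
  by have := integrableB mD iuu ivv; apply: eq_integrable.
have z psi : bump_alg psi -> test_function D psi ->
    \int[L]_(x in D) ((wd u i x * wd u i x - wd v i x * wd v i x) * psi x) = 0.
  move=> bp tp; have [M _ hM] := bump_bounded bp.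
  have mp : measurable_fun (dset D : set Lm) (psi : Lm -> R) := lebesgue_continuous (bump_continuous bp).
  have lpu := L2_weight mD mp (fun x _ => hM x) lu; have lpv := L2_weight mD mp (fun x _ => hM x) lv.
  have i1 := L2_prod mD lu lpu; have i2 := L2_prod mD lv lpv.
  have := h2 psi bp; rewrite !diag_bump_energy => /eqP; rewrite -subr_eq0 => /eqP <-.
  rewrite -RintegralB//.
  - by apply: eq_Rintegral => x _; rewrite mulrBl.
  - by apply: eq_integrable i1 => // x _ /=; rewrite mulrCA mulrC.
  - by apply: eq_integrable i2 => // x _ /=; rewrite mulrCA mulrC.
have a2 := @null_of_test_integrals R n (dset D) _ (@dom_open _ _ D) idf z.
apply: (@ae_imp2 R _ Lm L _ _ _ _ a1 a2) => x k1 k2 Dx; have {}k1 := k1 Dx; have {}k2 := k2 Dx.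
have s0 : wd u i x ^+ 2 = wd v i x ^+ 2 by apply/eqP; rewrite -subr_eq0 !expr2 k2.
move/eqP: k1; rewrite mulf_eq0 => /orP[/eqP h|/eqP h]; split => //; apply/eqP; rewrite -sqrf_eq0.
  by rewrite -s0 h expr0n.
by rewrite s0 h expr0n.
Qed.

End Coefficients.

(** * Genericity for the Robin problem *)

Lemma form_comb2 (R : realType) (V : lmodType R) (b : V -> V -> R) (a c : R) u v w : symform b ->
  b (a *: u + c *: v) w = a * b u w + c * b v w.
Proof. by move=> sb; rewrite (formDl sb) !(formZl sb). Qed.

Section Robin.
Context (R : realType) (n : nat) (D : domain R n).
Local Notation E := 'rV[R]_n.+1.
Local Notation L := (lebesgue R n).
Local Notation Lm := (lebesgue_space R n).
Local Notation sg := (surface R n).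
Local Notation Sm := (surface_space R n).
Local Notation Bd := (boundary (dset D)).
Local Notation V := (H1space D).
Local Notation W := (E -> 'M[R]_n.+1).
Let mD := dom_measurable D.
Variables (S : set E) (A : W) (a0 : R).
Hypothesis mS : measurable (S : set Sm).
Hypothesis traces : forall u : V, exists g : E -> R, is_trace D u g.
Hypothesis Bd_pos : sg Bd != 0%E.
Hypothesis cA : coefficient_field D A.
Hypothesis a00 : 0 < a0.
Hypothesis A_low : forall x (xi : E), dset D x ->
  a0 * enorm xi ^+ 2 <= \sum_(i < n.+1) \sum_(j < n.+1) A x i j * xi 0 i * xi 0 j.
Local Notation h := (@h1form R n D).
Local Notation s := (@sform R n D S).

Lemma sform_null (u : V) : h u u = 0 -> forall v, s u v = 0.
Proof.
move=> h0 v; have [C _ sC] := s_bounded (sform_compact traces mS).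
apply: (form_null (sform_sym traces mS) (sform_psd S)).
by apply/eqP; rewrite eq_le sform_psd andbT; have := sC u; rewrite h0 mulr0.
Qed.

(** If no [diag_bump psi i] separates [e] and [f], both have zero gradient by
    [energy_diff_null] and equal constants [a] and [b]. Then [z = b e - a f] is
    null, so [0 = s z e = b]; hence [f] is null, against [s f f = 1]. *)
Lemma separating_perturbation (e f : V) : s e f = 0 -> s e e = 1 -> s f f = 1 ->
  exists2 B, bump_mx B & ~ (energy B e f = 0 /\ energy B e e = energy B f f).
Proof.
move=> sef see sff; apply: contrapT => hn.
have hB B : bump_mx B -> energy B e f = 0 /\ energy B e e = energy B f f.
  by move=> bB; apply: contrapT => hb; apply: hn; exists B.
have g0 i : {ae L, forall x, dset D x -> wd e i x = 0 /\ wd f i x = 0}.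
  by apply: energy_diff_null => psi bp; have [] := hB _ (diag_bump_mx i bp).
have ge i : {ae L, forall x, dset D x -> wd e i x = 0}.
  by apply: (@ae_imp R _ Lm L) (g0 i) => x hx Dx; have [] := hx Dx.
have gf i : {ae L, forall x, dset D x -> wd f i x = 0}.
  by apply: (@ae_imp R _ Lm L) (g0 i) => x hx Dx; have [] := hx Dx.
have dnull (u : V) : (forall i, {ae L, forall x, dset D x -> wd u i x = 0}) -> dirichlet u u = 0.
  by move=> gu; rewrite /dirichlet big1// => i _; exact: (ip_null_ae mD (wd_L2 u i) (wd_L2 u i) (gu i)).
have mnull (u : V) : {ae L, forall x, dset D x -> u x = 0} -> mass u u = 0.
  by move=> u0; exact: (ip_null_ae mD (h1_L2 u) (h1_L2 u) u0).
have [a ea] := constant_of_gradient ge; have [b fb] := constant_of_gradient gf.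
have de := dnull e ge; have df := dnull f gf.
have sd := dirichlet_sym D; have pd := dirichlet_psd (D := D).
(* [z] vanishes almost everywhere as [e = a] and [f = b]. *)
pose z : V := b *: e + (- a) *: f.
have hz : h z z = 0.
  rewrite /h1form [dirichlet z z](_ : _ = 0) ?addr0; last first.
    by rewrite (form_comb2 b (- a) e f z sd) (form_null sd pd _ de) (form_null sd pd _ df) !mulr0 addr0.
  apply: mnull; apply: (@ae_imp2 R _ Lm L _ _ _ _ ea fb) => x h1 h2 Dx.
  rewrite -[z x]/(b * e x + (- a) * f x) h1// h2//; ring.
have ss := sform_sym traces mS.
have b0 : b = 0.
  have := sform_null hz e; rewrite (form_comb2 b (- a) e f e ss) (formC ss f e) sef see mulr1 mulr0 addr0.
  exact.
have hf : h f f = 0.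
  by rewrite /h1form df addr0; apply: mnull; apply: (@ae_imp R _ Lm L) fb => x + Dx => ->//; rewrite b0.
by have := sform_null hf f; rewrite sff => /eqP; rewrite oner_eq0.
Qed.

Definition robin_form (M : W) (u v : V) := energy M u v + tform u v.

Lemma robin_form_coercive : exists2 c, 0 < c & forall u, c * h u u <= robin_form A u u.
Proof.
have [c c0 hc] := robin_coercive traces Bd_pos.
have m0 : 0 < Num.min a0 1 by rewrite lt_min a00 ltr01.
exists (Num.min a0 1 * c); first exact: mulr_gt0.
move=> u; rewrite -mulrA; apply: le_trans (ler_wpM2l (ltW m0) (hc u)) _.
rewrite /robin mulrDr /robin_form; apply: lerD.
  apply: le_trans (energy_low u cA A_low); rewrite ler_wpM2r ?dirichlet_psd//.
  by rewrite ge_min lexx.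
by rewrite -[leRHS]mul1r ler_wpM2r ?tform_psd// ge_min lexx orbT.
Qed.

Lemma robin_form_sym (M : W) : coefficient_field D M -> symform (robin_form M).
Proof. by move=> cM; exact: (sum_form_sym (energy_sym cM) (tform_sym traces)). Qed.

Lemma robin_form_upper (M : W) : coefficient_field D M -> exists C, forall u, robin_form M u u <= C * h u u.
Proof.
move=> cM; have [_ [c hc] _] := cM; have [K K0 hK] := tform_le traces ltr01.
exists (`|c| * n.+1%:R + 1 + K) => u; have := hK u.
have hc' i j x : dset D x -> `|M x i j| <= `|c| by move=> Dx; apply: le_trans (ler_norm c); exact: hc.
have := energy_bound u cM hc'; rewrite ler_norml => /andP[_].
have d0 := dirichlet_psd u; have m0 := mass_psd u.
have x1 : 0 <= K * dirichlet u u by exact: mulr_ge0.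
have x2 : 0 <= `|c| * n.+1%:R * mass u u by rewrite !mulr_ge0.
rewrite /robin_form /h1form !mulrDl !mulrDr !mul1r.
set e := `|c| * _ * dirichlet u u; set e' := `|c| * _ * mass u u in x2 *.
by set k := K * mass u u; set k' := K * dirichlet u u in x1 *; lra.
Qed.

(** The abstract theorem applied to H^1. Coercivity with the constant [2 * alpha]
    leaves room for perturbations which keep the forms above [alpha h]. *)
Lemma robin_generic (eps : R) : 0 < eps ->
  exists (C : nat -> W) (r : nat -> R) (alpha : R),
  [/\ 0 < alpha, forall k, [/\ bump_mx (C k), small_mx (C k) (r k) & 0 < r k],
      forall k, r k.+1 <= r k / 2, r 0%N <= Num.min eps (alpha / 2)
    & (forall u, (2 * alpha) * h u u <= robin_form A u u) /\
      forall q', admissible h alpha q' ->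
       (forall K, within h (perturb (@energy R n D) (robin_form A) (\sum_(k < K) C k)) q' (2 * r K)) ->
      forall N : nat, ~ eigenfamily s 2 N%:R q'].
Proof.
move=> e0; have [c c0 hc] := robin_form_coercive.
pose alpha := c / 2; have al0 : 0 < alpha by rewrite divr_gt0.
have al2 : 0 < alpha / 2 by rewrite divr_gt0.
have d0 : 0 < Num.min eps (alpha / 2) by rewrite lt_min e0.
have low u : (alpha + Num.min eps (alpha / 2)) * h u u <= robin_form A u u.
  apply: le_trans (hc u); rewrite ler_wpM2r ?h1form_psd// [leRHS]splitr lerD2l.
  by rewrite ge_min [X in _ || X](_ : _ = true) ?orbT// [leRHS]splitr lerDl ltW.
have bB B : bump_mx B -> symform (@energy R n D B) by move/(bump_mx_coef D)/energy_sym.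
have [C [r [h1 h2 h3 h4]]] := @generic_simplicity R V W h s alpha (h1form_sym D) (@h1form_psd _ _ D)
  (sform_sym traces mS) (sform_psd S) al0 (@h1form_complete _ _ D) (sform_compact traces mS)
  (@bump_mx R n) (@energy R n D) (@small_mx R n) (@bump_mx0 R n) (@bump_mx_comb R n) bB
  (fun a B C u v pB pC => energy_comb a u v (bump_mx_coef D pB) (bump_mx_coef D pC))
  (fun B d u pB sB => small_mx_bound u pB sB) (@small_mx_ex R n) (@small_mx0 R n)
  (fun a B C M N pB pC => small_mx_comb a pB pC (M:=M) (N:=N)) (@small_mx_le R n) separating_perturbation
  (robin_form A) _ (robin_form_sym cA) d0 low (robin_form_upper cA).
exists C, r, alpha; split => //; split => // u.
have -> : 2 * alpha = c by rewrite /alpha mulrC divfK.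
exact: hc.
Qed.

End Robin.

(** * Limits of series of bump functions *)

Lemma dirder_basis (R : realType) (n : nat) (f : 'rV[R]_n.+1 -> R) i x :
  dirder f (basis_vec R i) x = partial i f x.
Proof.
rewrite /dirder (bigD1 i)//= [X in _ + X]big1 ?addr0; first by rewrite mxE !eqxx mul1r.
by move=> j ji; rewrite mxE (negbTE ji) andbF mul0r.
Qed.

Section FadingSequences.
Context (R : realType) (r : nat -> R).
Hypotheses (r_pos : forall k, 0 < r k) (r_half : forall k, r k.+1 <= r k / 2).

Lemma fading_small (e : R) : 0 < e -> exists K, r K < e.
Proof.
move=> e0.
have rK K : r K <= r 0%N * 2 ^- K.
  elim: K => [|K IH]; first by rewrite expr0 invr1 mulr1.
  apply: le_trans (r_half K) _; rewrite exprS invfM mulrCA mulrC ler_wpM2l//.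
have [K _ hK] := near_natr (r 0%N / e); exists K.+1.
apply: le_lt_trans (rK K.+1) _; rewrite ltr_pdivrMr ?exprn_gt0// mulrC -ltr_pdivrMr//.
apply: le_lt_trans (hK K (leqnn K)) _.
by rewrite -natrX ltr_nat; exact: ltn_expl.
Qed.

(** [geometric_limit] at every index [K], the sequence starting at [K] having
    increments at most [r K * 2^-j]. *)
Lemma fading_limit (a : nat -> R) : (forall k, `|a k.+1 - a k| <= r k) ->
  exists2 l, a k @[k --> \oo] --> l & forall K, `|l - a K| <= 2 * r K.
Proof.
move=> ha.
have rK K j : r (K + j)%N <= r K * 2 ^- j.
  elim: j => [|j IH]; first by rewrite addn0 expr0 invr1 mulr1.
  rewrite addnS; apply: le_trans (r_half _) _; rewrite exprS invfM mulrCA mulrC ler_wpM2l//.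
have lim K : exists2 l, a (K + j)%N @[j --> \oo] --> l & `|l - a K| <= 2 * r K.
  have [|l cl hl] := @geometric_limit R (fun j => a (K + j)%N) (r K).
    by move=> j; rewrite addnS; apply: le_trans (ha _) (rK K j).
  by exists l => //; have := hl 0%N; rewrite addn0 expr0 invr1 mulr1.
have [l cl _] := lim 0%N; exists l => // K; have [l' cl' hl'] := lim K.
suff -> : l = l' by [].
have cl0 : a j @[j --> \oo] --> (l : R) := cl.
have cs : a (j + K)%N @[j --> \oo] --> (l : R) by apply: cvg_comp cl0; exact: cvg_addnr.
apply: (cvg_unique _ cs) => //.
by rewrite (_ : (fun j => a (j + K)%N) = fun j => a (K + j)%N)//; apply/funext => j; rewrite addnC.
Qed.

Lemma fading_function (T : Type) (f : nat -> T -> R) : (forall k x, `|f k.+1 x - f k x| <= r k) ->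
  exists g : T -> R, forall K x, `|g x - f K x| <= 2 * r K.
Proof.
move=> hf; have /choice[g hg] : forall x, exists l, forall K, `|l - f K x| <= 2 * r K.
  by move=> x; have [l _ hl] := @fading_limit (fun k => f k x) (fun k => hf k x); exists l.
by exists g => K x; exact: hg.
Qed.

Section Rows.
Variable (n : nat).
Local Notation E := 'rV[R]_n.+1.

Lemma uniform_continuous_limit (f : nat -> E -> R) g : (forall k, continuous (f k)) ->
  (forall K x, `|g x - f K x| <= 2 * r K) -> continuous g.
Proof.
move=> cf hg x; apply/(@cvgrPdist_lt _ _ _ (nbhs x)) => e e0.
have e6 : 0 < e / 6 by rewrite divr_gt0.
have [K rK] := fading_small e6.
have e3 : 0 < e / 3 by rewrite divr_gt0.
have /cvgrPdist_lt/(_ _ e3) := cf K x; apply: filterS => y hy.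
have := hg K x; have := hg K y; rewrite ler_norml => /andP[a1 a2]; rewrite ler_norml => /andP[b1 b2].
move: hy; rewrite !ltr_norml => /andP[c1 c2]; apply/andP; split; lra.
Qed.

Lemma bump_lipschitz (psi : E -> R) i (c : R) : bump_alg psi -> (forall x, `|partial i psi x| <= c) ->
  forall x t, `|psi (t *: basis_vec R i + x) - psi x| <= c * `|t|.
Proof.
move=> bp hc.
have pos x t : 0 < t -> `|psi (t *: basis_vec R i + x) - psi x| <= c * t.
  move=> t0; have [u _ ->] := bump_increment (basis_vec R i) x bp t0.
  by rewrite normrM dirder_basis (gtr0_norm t0) mulrC ler_wpM2r ?(ltW t0).
move=> x t; have [->|t0] := eqVneq t 0; first by rewrite scale0r add0r subrr !normr0 mulr0.
have [tp|tn] := ltP 0 t; first by rewrite (gtr0_norm tp) pos.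
have tn' : 0 < - t by rewrite oppr_gt0 lt_neqAle t0.
have := pos (t *: basis_vec R i + x) _ tn'.
by rewrite scaleNr addKr distrC (ler0_norm tn).
Qed.

(** Differentiation of a series whose derivatives converge uniformly. By
    [bump_lipschitz] the difference quotients of [f (K + m) - f K] are at most [2 r
    K], uniformly in [m]; so the difference quotients of the limit are within [2 r
    K] of those of [f K]. *)
Lemma uniform_derivative_limit (f : nat -> E -> R) (g g' : E -> R) i :
  (forall k, bump_alg (f k)) ->
  (forall K x, `|g x - f K x| <= 2 * r K) ->
  (forall k x, `|partial i (f k.+1) x - partial i (f k) x| <= r k) ->
  (forall K x, `|g' x - partial i (f K) x| <= 2 * r K) ->
  forall x, derivable g x (basis_vec R i) /\ partial i g x = g' x.
Proof.
move=> bf hg hd hg' x.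
suff h : (fun t : R => t^-1 *: ((g \o shift x) (t *: basis_vec R i) - g x)) @ (0 : R)^' --> g' x.
  by split; [exact: (cvgP _ h)|exact: (cvg_lim _ h)].
have gap K m y : `|partial i (f (K + m)%N) y - partial i (f K) y| <= 2 * r K.
  elim: m K => [|m IH] K; first by rewrite addn0 subrr normr0 mulr_ge0// ltW.
  rewrite addnS -addSn; have := IH K.+1; have := hd K y; have := r_half K.
  rewrite !ler_norml => h1 /andP[a1 a2] /andP[b1 b2]; apply/andP; split; lra.
have lip K m t : `|(f (K + m)%N (t *: basis_vec R i + x) - f K (t *: basis_vec R i + x)) -
    (f (K + m)%N x - f K x)| <= 2 * r K * `|t|.
  have bd : bump_alg (fun y => 1 * f (K + m)%N y + (-1) * f K y).
    by apply: bump_add; apply: bump_mul => //; exact: bump_cst.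
  have hb y : `|partial i (fun y => 1 * f (K + m)%N y + (-1) * f K y) y| <= 2 * r K.
    rewrite (partial_comb _ _ _ _ (bump_smooth (bf _)) (bump_smooth (bf _))).
    by rewrite mul1r mulN1r; exact: gap.
  by have := bump_lipschitz bd hb x t; rewrite !mul1r !mulN1r.
have glip K t : `|(g (t *: basis_vec R i + x) - f K (t *: basis_vec R i + x)) - (g x - f K x)| <= 2 * r K * `|t|.
  apply/ler_addgt0Pr => e e0; have e4 : 0 < e / 4 by rewrite divr_gt0.
  have [M rM] := fading_small e4.
  have mono a b : r (a + b)%N <= r a.
    elim: b => [|b IH]; first by rewrite addn0.
    by rewrite addnS; have := r_half (a + b); have := r_pos (a + b); lra.
  have rKM : r (K + M)%N < e / 4 by rewrite addnC; apply: le_lt_trans (mono M K) rM.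
  have := lip K M t; have := hg (K + M)%N x; have := hg (K + M)%N (t *: basis_vec R i + x).
  move: (2 * r K * `|t|) => z.
  rewrite !ler_norml => /andP[a1 a2] /andP[b1 b2] /andP[c1 c2]; apply/andP; split; lra.
apply/cvgrPdist_lt => e e0; have e8 : 0 < e / 8 by rewrite divr_gt0.
have [K rK] := fading_small e8.
have /cvgrPdist_lt/(_ (e / 4)) : (fun t : R => t^-1 *: ((f K \o shift x) (t *: basis_vec R i) - f K x)) @ (0 : R)^' --> partial i (f K) x.
  exact: (@bump_derivable R n (f K) i x (bf K)).
rewrite divr_gt0// => /(_ isT) hK.
near=> t; have t0 : t != 0 by near: t; exact: nbhs_dnbhs_neq.
have h1 : `|partial i (f K) x - t^-1 * (f K (t *: basis_vec R i + x) - f K x)| < e / 4 by near: t.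
have h2 : `|t^-1 * (g (t *: basis_vec R i + x) - g x) - t^-1 * (f K (t *: basis_vec R i + x) - f K x)| <= 2 * r K.
  rewrite -mulrBr normrM normfV mulrC ler_pdivrMr ?normr_gt0//.
  have -> : g (t *: basis_vec R i + x) - g x - (f K (t *: basis_vec R i + x) - f K x) =
    (g (t *: basis_vec R i + x) - f K (t *: basis_vec R i + x)) - (g x - f K x).
    by rewrite !opprB !addrA [in RHS]addrAC; ring.
  exact: glip.
rewrite -[t^-1 *: _]/(t^-1 * (g (t *: basis_vec R i + x) - g x)).
have := hg' K x; move: h1 h2.
set p := t^-1 * _; set q := t^-1 * _.
rewrite !ltr_norml !ler_norml => /andP[a1 a2] /andP[b1 b2] /andP[c1 c2]; apply/andP; split; lra.
Unshelve. all: by end_near.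
Qed.

End Rows.
End FadingSequences.

Lemma C1_closure_of_continuous (R : realType) (n : nat) (Omega : set 'rV[R]_n.+1) (f : 'rV[R]_n.+1 -> R) :
  continuous f -> (forall i x, derivable f x (basis_vec R i)) -> (forall i, continuous (partial i f)) ->
  C1_closure Omega f.
Proof.
move=> cf df cp; split=> [i x _||i]; first exact: df.
  by exists f; split => //; exact: continuous_subspaceT.
by exists (partial i f); split => //; exact: continuous_subspaceT.
Qed.

Lemma C1_norm_mx_le (R : realType) (n : nat) (Omega : set 'rV[R]_n.+1) (M : 'rV[R]_n.+1 -> 'M[R]_n.+1) (c : R) :
  0 <= c -> (forall i j x, `|entry M i j x| <= c /\ forall k, `|partial k (entry M i j) x| <= c) ->
  (C1_norm_mx Omega M <= (n.+1%:R * n.+1%:R * (c + n.+1%:R * c))%:E)%E.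
Proof.
move=> c0 hM.
have sup (f : 'rV[R]_n.+1 -> R) : (forall x, `|f x| <= c) -> (sup_norm Omega f <= c%:E)%E.
  by move=> hf; apply: ge_ereal_sup => _ [x _ <-]; rewrite lee_fin.
have const (d : R) : (\sum_(i < n.+1) d%:E = (n.+1%:R * d)%:E)%E.
  by rewrite sumEFin sumr_const card_ord mulr_natl.
rewrite /C1_norm_mx -mulrA -const; apply: lee_sum => i _; rewrite -const; apply: lee_sum => j _.
rewrite EFinD; apply: leeD; first by apply: sup => x; have [] := hM i j x.
by rewrite -const; apply: lee_sum => k _; apply: sup => x; have [_ /(_ k)] := hM i j x.
Qed.

Section LimitMatrix.
Context (R : realType) (n : nat).
Local Notation E := 'rV[R]_n.+1.
Local Notation W := (E -> 'M[R]_n.+1).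
Variables (C : nat -> W) (r : nat -> R).
Hypotheses (bC : forall k, bump_mx (C k)) (sC : forall k, small_mx (C k) (r k)).
Hypotheses (r_pos : forall k, 0 < r k) (r_half : forall k, r k.+1 <= r k / 2).

Lemma bump_mx_sum K : bump_mx (\sum_(k < K) C k).
Proof.
elim: K => [|K IH]; first by rewrite big_ord0; exact: bump_mx0.
by rewrite big_ord_recr/= addrC -[C K]scale1r; exact: bump_mx_comb.
Qed.

(** The sum of the series of corrections. The entries converge uniformly together
    with their first derivatives, and the remainder after [K] terms is at most [2 r
    K], up to the normalisation by the dimension. *)
Lemma limit_matrix : exists B : W, [/\ forall Omega, C1_closure_mx Omega B, forall x, (B x)^T = B x,
  forall i j, continuous (entry B i j),
  forall K i j x, `|entry B i j x - entry (\sum_(k < K) C k) i j x| <= 2 * (r K / n.+1%:R) &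
  forall i j x, `|entry B i j x| <= 2 * (r 0%N / n.+1%:R) /\
    forall k, `|partial k (entry B i j) x| <= 2 * (r 0%N / n.+1%:R)].
Proof.
pose f K i j := entry (\sum_(k < K) C k) i j.
have fS K i j : f K.+1 i j = fun x => 1 * entry (C K) i j x + 1 * f K i j x.
  by rewrite /f big_ord_recr/= addrC -[C K in LHS]scale1r entry_comb.
have bf K i j : bump_alg (f K i j) by have [b _] := bump_mx_sum K; exact: b.
have bE K i j : bump_alg (entry (C K) i j) by have [b _] := bC K; exact: b.
pose rk K := r K / n.+1%:R.
have rk_pos K : 0 < rk K by rewrite divr_gt0.
have rk_half K : rk K.+1 <= rk K / 2 by rewrite /rk mulrAC ler_wpM2r.
have df i j K x : `|f K.+1 i j x - f K i j x| <= rk K.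
  by rewrite fS !mul1r addrK; have [] := sC K i j x.
have dp i j k K x : `|partial k (f K.+1 i j) x - partial k (f K i j) x| <= rk K.
  rewrite fS (partial_comb _ _ _ _ (bump_smooth (bE K i j)) (bump_smooth (bf K i j))) !mul1r addrK.
  by have [_] := sC K i j x; exact.
have /choice[g hg] : forall z : 'I_n.+1 * 'I_n.+1, exists g : E -> R,
    forall K x, `|g x - f K z.1 z.2 x| <= 2 * rk K.
  move=> [i j]; have [g hg] := @fading_function R rk rk_half E (fun K => f K i j) (df i j); exists g; exact: hg.
have /choice[g' hg'] : forall z : 'I_n.+1 * 'I_n.+1 * 'I_n.+1, exists g : E -> R,
    forall K x, `|g x - partial z.2 (f K z.1.1 z.1.2) x| <= 2 * rk K.
  move=> [[i j] k]; have [g' hg'] := @fading_function R rk rk_half E (fun K => partial k (f K i j)) (dp i j k); exists g'; exact: hg'.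
pose B : W := fun x => \matrix_(i, j) g (i, j) x.
have BE i j : entry B i j = g (i, j) by apply/funext => x; rewrite /entry mxE.
have der i j k x : derivable (g (i, j)) x (basis_vec R k) /\ partial k (g (i, j)) x = g' (i, j, k) x.
  exact: (@uniform_derivative_limit R rk rk_pos rk_half n (fun K => f K i j) _ _ k (fun K => bf K i j) (hg (i, j)) (dp i j k) (hg' (i, j, k))).
have pE i j k : partial k (g (i, j)) = g' (i, j, k) by apply/funext => x; have [] := der i j k x.
have cg i j : continuous (g (i, j)).
  exact: (@uniform_continuous_limit R rk rk_half n (fun K => f K i j) _ (fun K => bump_continuous (bf K i j)) (hg (i, j))).
have cg' i j k : continuous (g' (i, j, k)).
  exact: (@uniform_continuous_limit R rk rk_half n (fun K => partial k (f K i j)) _ (fun K => bump_continuous (bump_partial k (bf K i j))) (hg' (i, j, k))).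
have f0 i j : f 0%N i j = fun=> 0 by rewrite /f big_ord0 entry0.
exists B; split.
- move=> Omega i j; rewrite BE; apply: C1_closure_of_continuous => // [k x|k]; first by have [] := der i j k x.
  by rewrite pE.
- move=> x; apply/matrixP => i j; rewrite !mxE.
  have fsym K : f K i j x = f K j i x.
    by have [_ /(_ x)/matrixP/(_ i j)] := bump_mx_sum K; rewrite mxE => h; rewrite /f /entry h.
  apply/eqP; rewrite -subr_eq0 -normr_le0; apply/ler_addgt0Pr => e e0; rewrite add0r.
  have e4 : 0 < e / 4 by rewrite divr_gt0.
  have [K rK] := fading_small rk_half e4.
  have := hg (i, j) K x; have := hg (j, i) K x => /=; rewrite fsym.
  rewrite !ler_norml => /andP[a1 a2] /andP[b1 b2]; apply/andP; split; lra.
- by move=> i j; rewrite BE.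
- by move=> K i j x; rewrite BE; exact: (hg (i, j) K x).
- move=> i j x; rewrite BE; split=> [|k].
    by have := hg (i, j) 0%N x; rewrite /= f0 subr0.
  rewrite pE; have := hg' (i, j, k) 0%N x; rewrite /= f0.
  by rewrite (_ : partial k _ x = 0) ?subr0//; exact: derive_cst.
Qed.

End LimitMatrix.

(** * From forms back to eigenfunctions *)

Lemma measurable_fun_comb (R : realType) d (T : measurableType d) (A : set T) (f g : T -> R) (a : R) :
  measurable_fun A f -> measurable_fun A g -> measurable_fun A (fun x => a * f x + g x).
Proof. by move=> mf mg; apply: measurable_funD => //; apply: measurable_funM => //; exact: measurable_cst. Qed.

Lemma continuous_within_measurable (R : realType) (n : nat) (U : set 'rV[R]_n.+1) (g : 'rV[R]_n.+1 -> R) :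
  open U -> {within closure U, continuous g} ->
  measurable_fun (U : set (lebesgue_space R n)) (g : lebesgue_space R n -> R).
Proof.
move=> oU /(continuous_subspaceW (@subset_closure _ U)) cg.
apply: (measurability _ (RGenOpens.measurableE R)) => _ [_ [a [b ->] <-]].
apply: lebesgue_open; rewrite continuous_open_subspace// continuous_inP// in cg.
by apply: cg; exact: interval_open.
Qed.

Lemma form_add_null (R : realType) (V : lmodType R) (b : V -> V -> R) (e w : V) : symform b ->
  b e ((-1) *: e + w) = 0 -> b e w = 0 -> b e e = 0.
Proof. by move=> sb h1 h2; move: h1; rewrite (formC sb) (formDl sb) (formZl sb) (formC sb w) h2; lra. Qed.

Section Coefficients.
Context (R : realType) (n : nat) (D : domain R n).
Local Notation E := 'rV[R]_n.+1.
Local Notation Lm := (lebesgue_space R n).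
Local Notation W := (E -> 'M[R]_n.+1).

Lemma coefficient_of_continuous (B : W) : (forall i j, continuous (entry B i j)) ->
  (forall x, (B x)^T = B x) -> coefficient_field D B.
Proof.
move=> cB sB; split=> [i j||x _]; last exact: sB.
  exact: lebesgue_continuous (cB i j).
have /choice[c hc] : forall z : 'I_n.+1 * 'I_n.+1, exists M, forall x, dset D x -> `|B x z.1 z.2| <= M.
  by move=> [i j]; exact: (continuous_bounded_on (dom_bounded D) (cB i j)).
exists (\sum_z `|c z|) => i j x Dx; apply: (le_trans (hc (i, j) x Dx)).
by apply: (le_trans (ler_norm _)); rewrite (bigD1 (i, j))//= lerDl sumr_ge0.
Qed.

Lemma coefficient_comb (a : R) (M N : W) : coefficient_field D M -> coefficient_field D N ->
  coefficient_field D (fun x => a *: M x + N x).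
Proof.
move=> [mM [c hc] sM] [mN [c' hc'] sN]; split.
- move=> i j; rewrite (_ : (fun x => _) = fun x => a * M x i j + N x i j); last by apply/funext => x; rewrite !mxE.
  exact: (measurable_fun_comb a (mM i j) (mN i j)).
- exists (`|a| * c + c') => i j x Dx; rewrite !mxE; apply: le_trans (ler_normD _ _) _.
  by rewrite normrM lerD ?hc'// ler_wpM2l// hc.
- move=> x Dx; apply/matrixP => i j; have /matrixP/(_ i j) := sM x Dx; have /matrixP/(_ i j) := sN x Dx.
  by rewrite !mxE => -> ->.
Qed.

(** Entries of class C^1 on the closure are bounded, as they extend continuously to
    a compact set. *)
Lemma coefficient_of_C1 (M : W) : C1_closure_mx D M -> symmetric_on D M -> coefficient_field D M.
Proof.
move=> cM sM.
have /choice[g hg] : forall z : 'I_n.+1 * 'I_n.+1, exists g : E -> R,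
    {within closure D, continuous g} /\ forall x, dset D x -> g x = M x z.1 z.2.
  by move=> [i j]; have [_ [g hg] _] := cM i j; exists g.
have cK : compact (closure (dset D)) by exact: (closure_compact (dom_bounded D)).
have /choice[c hc] : forall z : 'I_n.+1 * 'I_n.+1, exists c : R, forall x, dset D x -> `|g z x| <= c.
  move=> z; have [cg _] := hg z.
  have /compact_bounded[c [_ hc]] := continuous_compact cg cK.
  exists (c + 1) => x Dx; apply: (hc (c + 1)); first by rewrite ltrDl.
  by exists x => //; exact: subset_closure.
split; last exact: sM.
  move=> i j; have [cg gM] := hg (i, j).
  have mg := continuous_within_measurable (@dom_open _ _ D) cg.
  apply: (@eq_measurable_fun _ _ Lm R (dset D) (g (i, j)) _ _ mg) => x /set_mem Dx; exact: gM.
exists (\sum_z `|c z|) => i j x Dx; have [_ gM] := hg (i, j); rewrite -[M x i j]/(M x (i, j).1 (i, j).2) -gM//.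
apply: (le_trans (hc (i, j) x Dx)).
by apply: (le_trans (ler_norm _)); rewrite (bigD1 (i, j))//= lerDl sumr_ge0.
Qed.

End Coefficients.

Section Main.
Context (R : realType) (n : nat) (D : domain R n).
Local Notation E := 'rV[R]_n.+1.
Local Notation L := (lebesgue R n).
Local Notation Lm := (lebesgue_space R n).
Local Notation sg := (surface R n).
Local Notation Sm := (surface_space R n).
Local Notation Bd := (boundary (dset D)).
Local Notation V := (H1space D).
Local Notation W := (E -> 'M[R]_n.+1).
Let mD := dom_measurable D.
Let mB := boundary_measurable D.
Variables (S : set E) (A : W) (a0 : R).
Hypothesis mS : measurable (S : set Sm).
Hypothesis cA : coefficient_field D A.
Hypothesis a00 : 0 < a0.
Hypothesis A_low : forall x (xi : E), dset D x ->
  a0 * enorm xi ^+ 2 <= \sum_(i < n.+1) \sum_(j < n.+1) A x i j * xi 0 i * xi 0 j.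
Local Notation h := (@h1form R n D).
Local Notation s := (@sform R n D S).

Definition to_H1 (e : E -> R) (he : H1 D e) : V := H1Space (asboolT he : e \in @H1_pred R n D).

Lemma nonzero_mass (e : V) : nonzero_on D e -> 0 < mass e e.
Proof.
move=> e0; rewrite lt_neqAle mass_psd andbT eq_sym; apply/eqP => m0.
exact: (e0 (ip_null mD (h1_L2 e) m0)).
Qed.

Lemma h1form_null_ae (u : V) : h u u = 0 -> {ae L, forall x, dset D x -> u x = 0}.
Proof.
rewrite /h1form => h0; have m0 := mass_psd u; have d0 := dirichlet_psd u.
by apply: (ip_null mD (h1_L2 u)); rewrite -/(mass u u); lra.
Qed.

(** Coercivity gives [s e e > 0] for an eigenfunction [e], which can thus be
    normalised; by [eigenspace_expansion] with a family of one vector, any other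
    eigenfunction is a multiple of [e] up to a null function. *)
Lemma simple_of_no_family (M : W) (alpha : R) : 0 < alpha ->
  (forall u : V, exists g : E -> R, is_trace D u g) ->
  admissible h alpha (robin_form M) -> (forall N : nat, ~ eigenfamily s 2 N%:R (robin_form M)) ->
  forall lam, is_eigenvalue D S M lam -> simple_eigenvalue D S M lam.
Proof.
move=> al0 traces aq nf lam [e [[He eqe] e0]].
pose u := to_H1 He.
have eu : eigenvector s (robin_form M) lam u by move=> v; exact: (eqe v (H1val v)).
have m0 : 0 < mass u u by exact: nonzero_mass.
have h0 : 0 < h u u by rewrite /h1form ltr_wpDr// dirichlet_psd.
have q0 : 0 < robin_form M u u by apply: lt_le_trans (adm_low aq u); exact: mulr_gt0.
have s0 : 0 < s u u.
  rewrite lt_neqAle sform_psd andbT eq_sym; apply/eqP => s0.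
  by move: q0; rewrite eu s0 mulr0 ltxx.
exists e; split => // e' [He' eqe'].
pose u' := to_H1 He'.
have eu' : eigenvector s (robin_form M) lam u' by move=> v; exact: (eqe' v (H1val v)).
have ss := sform_sym traces mS; have sq := adm_sym aq.
pose k := (Num.sqrt (s u u))^-1.
have ku : eigenvector s (robin_form M) lam (k *: u).
  by move=> w; rewrite (formZl sq) (formZl ss) eu mulrCA.
have oe : orthonormal s (fun _ : 'I_1 => k *: u).
  by move=> i j; rewrite !ord1 eqxx (form_sqrZ ss) exprVn sqr_sqrtr ?sform_psd// mulVf// gt_eqF.
have [N _ hN] := near_natr lam.
have := @eigenspace_expansion R V h s alpha (@h1form_psd _ _ D) ss (sform_psd S) al0
  1 N.+1%:R (robin_form M) lam (fun=> k *: u) u' aq (nf N.+1) (hN N (leqnn N)) oe (fun=> ku) eu'.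
rewrite big_ord1 => /h1form_null_ae hz.
exists (s u' (k *: u) * k); apply: (@ae_imp R _ Lm L) hz => x hx Dx; have := hx Dx.
move=> hz'; have {}hz' : e' x - s u' (k *: u) * (k * e x) = 0 := hz'.
by rewrite -mulrA; exact: subr0_eq.
Qed.

(** Constants form a space of dimension one. *)
Lemma simple_of_constants (M : W) : 
  (forall e : V, forall lam, eigenspace_mem D S M lam e -> dirichlet e e = 0) ->
  forall lam, is_eigenvalue D S M lam -> simple_eigenvalue D S M lam.
Proof.
move=> hc lam [e [he e0]].
have const (f : E -> R) : eigenspace_mem D S M lam f -> exists a, {ae L, forall x, dset D x -> f x = a}.
  move=> [Hf hf]; exact: (constant_of_gradient (gradient_null (hc (to_H1 Hf) lam (conj Hf hf)))).
have [a ea] := const e he.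
exists e; split => // e' /const[b eb].
have a_0 : a != 0.
  by apply/eqP => az; apply: e0; apply: (@ae_imp R _ Lm L) ea => x hx Dx; rewrite hx.
exists (b / a); apply: (@ae_imp2 R _ Lm L _ _ _ _ ea eb) => x h1 h2 Dx.
by rewrite h1// h2// divfK.
Qed.

Lemma energy_null (e : V) : energy A e e = 0 -> dirichlet e e = 0.
Proof.
move=> e0; have := energy_low e cA A_low; have := dirichlet_psd e; rewrite e0 => d0.
by rewrite pmulr_rle0// => d1; apply/eqP; rewrite eq_le d1.
Qed.

(** Without boundary terms, testing the equation with [e] itself gives zero energy. *)
Lemma simple_null_boundary : (forall u : V, exists g : E -> R, is_trace D u g) -> sg Bd = 0%E ->
  forall lam, is_eigenvalue D S A lam -> simple_eigenvalue D S A lam.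
Proof.
move=> traces B0; apply: simple_of_constants => e lam [_ he]; apply: energy_null.
have tr0 : {ae sg, forall x, Bd x -> tr e x = 0} by exact: (@ae_null R _ Sm sg _ _ mB).
have te : tform e e = 0 by exact: (ip_null_ae mB (tr_L2 traces e) (tr_L2 traces e) tr0).
have se : s e e = 0 by apply/eqP; rewrite eq_le sform_psd andbT -te sform_le.
have he' : energy A e e + tform e e = lam * s e e := he e (H1val e).
by move: he'; rewrite te se mulr0 addr0.
Qed.

Lemma untraceable (phi : V) : (forall g : E -> R, ~ is_trace D phi g) -> trace D phi = fun=> 0.
Proof. by move=> hn; apply: xgetPN => g; exact: hn. Qed.

(** By definition the trace of a function without trace is zero, so the weak
    equation tested with such a function has no boundary terms. If [e] has a trace,
    [phi] and [phi - e] have none, and subtracting the two equations gives zero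
    energy for [e]. *)
Lemma simple_without_trace (phi : V) : (forall g : E -> R, ~ is_trace D phi g) ->
  forall lam, is_eigenvalue D S A lam -> simple_eigenvalue D S A lam.
Proof.
move=> hn; apply: simple_of_constants => e lam [_ he]; apply: energy_null.
have zero (w : V) : (forall g : E -> R, ~ is_trace D w g) -> energy A e w = 0.
  move=> /untraceable hw; have := he w (H1val w); rewrite -/(energy A e w) hw.
  rewrite /Rintegral !integral0_eq ?mulr0 ?addr0// => x _; by rewrite mulr0.
have [[g hg]|ne] := pselect (exists g : E -> R, is_trace D e g); last first.
  by apply: zero => g hg; apply: ne; exists g.
have sA := energy_sym cA.
have z1 : energy A e phi = 0 by exact: zero.
apply: (@form_add_null R V (energy A) e phi sA _ z1); apply: zero => g' hg'.
apply: (hn (fun x => 1 * g x + 1 * g' x)).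
by have := is_trace_comb 1 hg hg'; rewrite scale1r scaleN1r addrA subrr add0r.
Qed.

End Main.

(** * The perturbation of the coefficients *)

Section Genericity.
Context (R : realType) (n : nat) (D : domain R n).
Local Notation E := 'rV[R]_n.+1.
Local Notation sg := (surface R n).
Local Notation Sm := (surface_space R n).
Local Notation Bd := (boundary (dset D)).
Local Notation V := (H1space D).
Local Notation W := (E -> 'M[R]_n.+1).
Variables (S : set E) (A : W) (a0 : R).
Hypothesis mS : measurable (S : set Sm).
Hypothesis cA : coefficient_field D A.
Hypothesis a00 : 0 < a0.
Hypothesis A_low : forall x (xi : E), dset D x ->
  a0 * enorm xi ^+ 2 <= \sum_(i < n.+1) \sum_(j < n.+1) A x i j * xi 0 i * xi 0 j.
Local Notation h := (@h1form R n D).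

Lemma entry_bound_energy (T : W) (c : R) (u : V) : coefficient_field D T ->
  (forall i j x, `|entry T i j x| <= 2 * (c / n.+1%:R)) -> `|energy T u u| <= 2 * c * h u u.
Proof.
move=> cT hT; apply: le_trans (energy_bound u cT (fun i j x _ => hT i j x)) _.
have -> : 2 * (c / n.+1%:R) * n.+1%:R = 2 * c by rewrite mulrA divfK.
have c0 : 0 <= 2 * c.
  have := le_trans (normr_ge0 _) (hT ord0 ord0 0); rewrite mulrA pmulr_lge0// invr_gt0//.
by rewrite ler_wpM2l// /h1form lerDr mass_psd.
Qed.

(** The series of corrections of [robin_generic] is summed by [limit_matrix]. The
    remainder bounds of the latter are what [generic_simplicity] requires of the
    limit form. *)
Lemma simple_perturbation (eps : R) : 0 < eps ->
  (forall u : V, exists g : E -> R, is_trace D u g) -> sg Bd != 0%E ->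
  exists B : W, [/\ C1_closure_mx D B, symmetric_on D B, (C1_norm_mx D B < eps%:E)%E &
    forall lam, is_eigenvalue D S (fun x => A x + B x) lam -> simple_eigenvalue D S (fun x => A x + B x) lam].
Proof.
move=> e0 traces Bpos.
pose kap : R := n.+1%:R; have kap0 : 0 < kap by rewrite ltr0n.
(* The C^1 norm of the sum of the series is at most [2 * kap * (1 + kap) * r 0]. *)
pose eta := eps / (4 * kap ^+ 2 * (1 + kap)).
have k2 : 0 < 4 * kap ^+ 2 * (1 + kap) by rewrite !mulr_gt0// ?exprn_gt0// ltr_wpDl// ltW.
have eta0 : 0 < eta by rewrite divr_gt0.
have [C [r [alpha [al0 hC hr r0 [low gen]]]]] := robin_generic mS traces Bpos cA a00 A_low eta0.
have bC k : bump_mx (C k) by have [] := hC k.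
have sC k : small_mx (C k) (r k) by have [] := hC k.
have rp k : 0 < r k by have [] := hC k.
have [B [C1B symB cB gapB bB]] := limit_matrix bC sC rp hr.
have kB : coefficient_field D B by exact: coefficient_of_continuous.
have cM : coefficient_field D (fun x => A x + B x).
  have := coefficient_comb 1 kB cA; congr coefficient_field.
  by apply/funext => x; rewrite scale1r addrC.
have EM (u : V) : energy (fun x => A x + B x) u u = energy A u u + energy B u u :> R.
  rewrite (_ : (fun x => _) = fun x => 1 *: A x + B x).
    by rewrite (energy_comb 1 u u cA kB) mul1r.
  by apply/funext => x; rewrite scale1r.
have r_eta : r 0%N <= eta by apply: le_trans r0 _; rewrite ge_min lexx.
have r_alpha : 2 * r 0%N <= alpha.
  have : r 0%N <= alpha / 2 by apply: le_trans r0 _; rewrite ge_min lexx orbT.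
  by rewrite ler_pdivlMr// mulrC.
have aq : admissible h alpha (@robin_form R n D (fun x => A x + B x)).
  split.
  - exact: robin_form_sym.
  - move=> u; have := low u; have := entry_bound_energy u kB (fun i j x => proj1 (bB i j x)).
    have := ler_wpM2r (h1form_psd u) r_alpha.
    rewrite /robin_form EM ler_norml => h1 /andP[h2 _].
    by rewrite -mulrA; move: h1 h2; set x := 2 * r 0%N * h u u; set y := alpha * h u u; lra.
  - exact: robin_form_upper.
exists B; split.
- exact: C1B.
- by move=> x _; exact: symB.
- have c0 : 0 <= 2 * (r 0%N / kap) by apply: mulr_ge0 => //; apply: ltW; exact: divr_gt0.
  have hn := C1_norm_mx_le (dset D) c0 bB; apply: (le_lt_trans hn); rewrite lte_fin -/kap.
  have -> : kap * kap * (2 * (r 0%N / kap) + kap * (2 * (r 0%N / kap))) = 2 * kap * (1 + kap) * r 0%N.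
    by field; rewrite gt_eqF.
  apply: (@le_lt_trans _ _ (2 * kap * (1 + kap) * eta)).
    by rewrite ler_pM2l// !mulr_gt0// ltr_wpDl// ltW.
  rewrite /eta (_ : _ * _ = eps / (2 * kap)); last by field; rewrite !gt_eqF// ltr_wpDl// ltW.
  rewrite ltr_pdivrMr ?mulr_gt0// ltr_pMr//.
  have : 1 <= kap by rewrite ler1n.
  lra.
- apply: (simple_of_no_family mS al0 traces aq); apply: gen aq _ => K u.
  have bS := bump_mx_sum bC K; have kS := bump_mx_coef D bS.
  pose T := fun x => (-1) *: (\sum_(k < K) C k) x + B x.
  have kT : coefficient_field D T by exact: coefficient_comb.
  have ET : energy T u u = energy B u u - energy (\sum_(k < K) C k) u u.
    by rewrite (energy_comb (-1) u u kS kB) mulN1r addrC.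
  have := @entry_bound_energy T (r K) u kT; rewrite ET /perturb /robin_form EM => hT.
  rewrite (_ : _ - _ = energy B u u - energy (\sum_(k < K) C k) u u); last first.
    by set a := energy A u u; set b := energy B u u; set c := energy _ u u; set t := tform u u; lra.
  apply: hT => i j x; have := gapB K i j x; rewrite /entry /T !mxE mulN1r [- _ + _]addrC; exact.
Qed.

Lemma generic_perturbation (eps : R) : 0 < eps ->
  exists B : W, [/\ C1_closure_mx D B, symmetric_on D B, (C1_norm_mx D B < eps%:E)%E &
    forall lam, is_eigenvalue D S (fun x => A x + B x) lam -> simple_eigenvalue D S (fun x => A x + B x) lam].
Proof.
move=> e0.
have trivial : (forall lam, is_eigenvalue D S A lam -> simple_eigenvalue D S A lam) ->
  exists B : W, [/\ C1_closure_mx D B, symmetric_on D B, (C1_norm_mx D B < eps%:E)%E &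
    forall lam, is_eigenvalue D S (fun x => A x + B x) lam -> simple_eigenvalue D S (fun x => A x + B x) lam].
  move=> hA; exists (fun=> 0); rewrite (_ : (fun x => A x + 0) = A); last by apply/funext => x; rewrite addr0.
  have en i j : entry (fun _ : E => 0 : 'M[R]_n.+1) i j = fun=> 0 by apply/funext => x; rewrite /entry mxE.
  have pz k x : partial k (fun _ : E => 0 : R) x = 0 by exact: derive_cst.
  split => //.
  - move=> i j; rewrite en; apply: C1_closure_of_continuous => [|i' x|k].
    + exact: cst_continuous.
    + exact: derivable_cst.
    + by rewrite (_ : partial k _ = fun=> 0); [exact: cst_continuous|apply/funext].
  - by move=> x _; rewrite trmx0.
  - apply: (@le_lt_trans _ _ (n.+1%:R * n.+1%:R * (0 + n.+1%:R * 0))%:E).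
      by apply: C1_norm_mx_le => // i j x; rewrite en normr0; split => // k; rewrite pz normr0.
    by rewrite mulr0 addr0 mulr0 lte_fin.
have [traces|] := pselect (forall u : V, exists g : E -> R, is_trace D u g); last first.
  move=> /existsNP[phi /forallNP hphi]; apply: trivial.
  exact: (@simple_without_trace R n D S A a0 cA a00 A_low phi hphi).
have [B0|Bpos] := eqVneq (sg Bd) 0%E; last exact: simple_perturbation.
by apply: trivial; exact: (@simple_null_boundary R n D S A a0 mS cA a00 A_low traces B0).
Qed.

End Genericity.

Unset Implicit Arguments.

Theorem theorem4 (R : realType) (n : nat)
    (Omega S W : set 'rV[R]_n.+1) (A : 'rV[R]_n.+1 -> 'M[R]_n.+1)
    (Omega_open : open Omega) (Omega_connected : connected Omega)
    (Omega_bounded : bounded_set Omega) (Omega_C11 : C11_boundary Omega)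
    (boundary_SW : boundary Omega = S `|` W)
    (S_connected : connected S) (W_connected : connected W)
    (S_interior : relative_interior (boundary Omega) S !=set0)
    (W_interior : relative_interior (boundary Omega) W !=set0)
    (SW_interior : relative_interior (boundary Omega) S `&`
                   relative_interior (boundary Omega) W = set0)
    (S_measurable : measurable (S : set (surface_space R n)))
    (A_C1 : C1_closure_mx Omega A) (A_sym : symmetric_on Omega A)
    (A_posdef : uniformly_posdef Omega A)
    (eps : R) (eps_gt0 : 0 < eps) :
  exists B : 'rV[R]_n.+1 -> 'M[R]_n.+1,
    [/\ C1_closure_mx Omega B, symmetric_on Omega B,
        (C1_norm_mx Omega B < eps%:E)%E
      & forall lambda : R,
          is_eigenvalue Omega S (fun x => A x + B x) lambda ->
          simple_eigenvalue Omega S (fun x => A x + B x) lambda].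
Proof.
have [a a0 hA] := A_posdef.
pose D := Domain Omega_open Omega_bounded Omega_connected Omega_C11.
have cA := @coefficient_of_C1 R n D A A_C1 A_sym.
exact: (@generic_perturbation R n D S A a S_measurable cA a0 hA eps eps_gt0).
Qed.
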